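(* Let $c(n)$, $n\ge 0$, be the Fourier coefficients of the modular invariant $j$. Then the sequence $\{\sqrt[n]{c(n)}\}_{n\ge 1}$ is ratio log-concave.
   Context: The modular invariant $j$ is defined for $\tau$ in the upper half-plane, with $q=e^{2\pi i\tau}$, by $$j(\tau)=\frac{\left(1+240\sum_{n\ge 1}\sigma_3(n)q^n\right)^3}{q\prod_{n\ge 1}(1-q^n)^{24}}=q^{-1}+\sum_{n\ge 0}c(n)q^n=q^{-1}+744+196884q+21493760q^2+\cdots,$$ where $\sigma_3(n)=\sum_{d\mid n}d^3$. This defines the integers $c(n)$, $n\ge 0$. A sequence $\{a_n\}_{n\ge n_0}$ is log-concave if $a_na_{n+2}-a_{n+1}^2\le 0$ for all $n\ge n_0$. A sequence $\{a_n\}_{n\ge n_0}$ is ratio log-concave if the sequence $\{a_{n+1}/a_n\}_{n\ge n_0}$ is log-concave. *)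

(* Defs.v *)
From Stdlib Require Import Reals ZArith Arith List.
From Coquelicot Require Import Coquelicot.

Local Open Scope C_scope.

Definition Cexp (z : C) : C :=
  (exp (Re z) * cos (Im z), exp (Re z) * sin (Im z))%R.

(* Limit of a convergent complex sequence, taken componentwise; like [Lim_seq],
   the value carries no information when the sequence diverges. *)
Definition CLim_seq (u : nat -> C) : C :=
  (real (Lim_seq (fun n => Re (u n))), real (Lim_seq (fun n => Im (u n)))).

Definition CSeries (a : nat -> C) : C := CLim_seq (sum_n a).

Fixpoint Cprod (a : nat -> C) (N : nat) : C :=
  match N with
  | O => 1
  | S N' => Cprod a N' * a N'
  end.

Definition CProduct (a : nat -> C) : C := CLim_seq (Cprod a).

Definition divisor_sum (k n : nat) : nat :=
  list_sum (map (fun d => Nat.pow d k)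
                (filter (fun d => Nat.eqb (Nat.modulo n d) 0) (seq 1 n))).

Definition q_of (tau : C) : C := Cexp (2 * PI * Ci * tau).

(* Coquelicot's series start at 0, so the sums and products over n >= 1 are
   reindexed through [S n]. *)
Definition j_invariant (tau : C) : C :=
  let q := q_of tau in
  (1 + 240 * CSeries (fun n => INR (divisor_sum 3 (S n)) * q ^ S n)) ^ 3
  / (q * CProduct (fun n => (1 - q ^ S n) ^ 24)).

Definition j_fourier_coefficients (c : nat -> Z) : Prop :=
  forall tau : C, (0 < Im tau)%R ->
    is_series (V := C_NormedModule)
      (fun n => IZR (c n) * q_of tau ^ n) (j_invariant tau - / q_of tau).

Local Open Scope R_scope.

Definition log_concave (n0 : nat) (a : nat -> R) : Prop :=
  forall n : nat, (n0 <= n)%nat -> a n * a (n + 2)%nat - a (n + 1)%nat ^ 2 <= 0.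

Definition ratio_log_concave (n0 : nat) (a : nat -> R) : Prop :=
  log_concave n0 (fun n => a (n + 1)%nat / a n).

(* The positive n-th root, for n >= 1 and x > 0 (every c(n) is positive). *)
Definition nth_root (n : nat) (x : R) : R := Rpower x (/ INR n).

(* Main.v *)
(* Put z = -i tau, so that the upper half-plane becomes Re z > 0.  Summing the
   Lipschitz formula (from the partial fractions of coth) over the lattice in
   either order gives E4(1/z) = z^4 E4(z) and, with a telescoping correction for
   the conditional convergence, E2(1/z) = -z^2 E2(z) + 6z/pi; the latter is the
   logarithmic derivative of Delta(1/z) = z^12 Delta(z), so j(1/z) = j(z).

   Let b(n) = 2 pi n^(-1/2) I_1(4 pi sqrt n).  By the Lipschitz formula again,
   sum b(n) q^n is, up to elementary terms, the sum over m in Z of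
   exp(2 pi/(z+im)) - 1 - 2 pi/(z+im), which contains the dominant part
   exp(2 pi/z) of j near z = 0.  Moving z to the fundamental domain bounds the
   difference of the two series on Re z = 1/sqrt n by about exp(pi sqrt n / 2),
   and Cauchy's estimate yields |c(n) - b(n)| <= C exp(5 pi sqrt n / 2), which is
   exponentially smaller than b(n).

   Riccati barriers for I_1'/I_1 make the third derivative of log b(x) / x
   negative of order x^(-7/2), so the third difference of log c(n) / n is
   negative for n >= 64, which is ratio log-concavity of the n-th roots.  The
   indices below 64 follow from exact values of c(n) and integer bounds for their
   binary logarithms. *)

Require Import Defs.
From Stdlib Require Import Reals ZArith Lra Lia List Machin.
From Coquelicot Require Import Coquelicot.
Import ListNotations.
Local Open Scope R_scope.

(** * Absolutely convergent complex series *)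

(** Ratio log-concavity of the roots says that the third difference of [ln c(n) / n] is nonpositive.
    That difference is only of order n^(-7/2), so the elementary asymptotics of [c(n)], with a
    relative error of order n^(-1/2), are too coarse: the full Bessel function is needed, with an
    error bound explicit enough to start at a computable index. The line [Re z = 1 / sqrt n] passes
    through the saddle point of [exp (2 pi / z + 2 pi n z)]. On it every modular image of [z] that
    competes with [1 / z] has real part at most [sqrt n / 4], the bound for a lattice vector
    [p z + i q] with [|p| = 2]; hence the exponent [pi sqrt n / 2], to which Cauchy's estimate adds
    [2 pi sqrt n]. No contour integral or uniform limit occurs: infinite sums are exchanged under
    explicit dominating arrays, complex derivatives are quadratic remainder estimates, and
    identities between analytic functions come from a vanishing derivative on the convex half-plane
    or from comparing power series. *)

Definition Csum (a : nat -> C) : C :=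
  (Series (fun n => Re (a n)), Series (fun n => Im (a n))).

Definition Csummable (a : nat -> C) : Prop := ex_series (fun n => Cmod (a n)).

(** Indices run below [N], one term fewer than in [sum_n a N], so that [Cpsum a 0] is the empty
    sum. *)
Fixpoint Cpsum (a : nat -> C) (N : nat) : C :=
  match N with O => RtoC 0 | S N' => (Cpsum a N' + a N')%C end.

(** Phrased through the real sequence of distances, so that squeezing and subsequences are available
    from the real theory. *)
Definition Clim (u : nat -> C) (x : C) : Prop :=
  is_lim_seq (fun n => Cmod (u n - x)) 0.

Lemma im_le_Cmod (z : C) : Rabs (Im z) <= Cmod z.
Proof.
  pose proof (Cmod2_alt z). pose proof (Cmod_ge_0 z).
  apply Rabs_le. assert (Im z ^ 2 <= Cmod z ^ 2) by nra. nra.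
Qed.

Lemma C_eq (x y : C) : Re x = Re y -> Im x = Im y -> x = y.
Proof. destruct x, y; simpl; intros; subst; reflexivity. Qed.

Lemma Cmod_minus_sym (x y : C) : Cmod (x - y) = Cmod (y - x).
Proof. rewrite <- Cmod_opp. f_equal. ring. Qed.

Lemma Cmod_triangle_minus (x y : C) : Cmod (x - y) <= Cmod x + Cmod y.
Proof.
  unfold Cminus. eapply Rle_trans; [apply Cmod_triangle|]. rewrite Cmod_opp. lra.
Qed.

Lemma Cmod_triangle_dist (x y z : C) : Cmod (x - z) <= Cmod (x - y) + Cmod (y - z).
Proof.
  replace (x - z)%C with ((x - y) + (y - z))%C by ring. apply Cmod_triangle.
Qed.

Lemma Cmod_triangle_rev (x y : C) : Cmod x - Cmod y <= Cmod (x - y).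
Proof.
  pose proof (Cmod_triangle (x - y) y). replace (x - y + y)%C with x in H by ring. lra.
Qed.

Lemma Csummable_Re a : Csummable a -> ex_series (fun n => Re (a n)).
Proof.
  intros H. apply ex_series_Rabs. eapply @ex_series_le; [|exact H].
  intros n. simpl. unfold norm; simpl. unfold abs; simpl. rewrite Rabs_Rabsolu. apply re_le_Cmod.
Qed.

Lemma Csummable_Im a : Csummable a -> ex_series (fun n => Im (a n)).
Proof.
  intros H. apply ex_series_Rabs. eapply @ex_series_le; [|exact H].
  intros n. simpl. unfold norm; simpl. unfold abs; simpl. rewrite Rabs_Rabsolu. apply im_le_Cmod.
Qed.

Lemma ex_series_dominated (a b : nat -> R) :
  (forall n, 0 <= a n <= b n) -> ex_series b -> ex_series a.
Proof.
  intros H Hb. eapply @ex_series_le; [|exact Hb].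
  intros n. unfold norm; simpl; unfold abs; simpl. rewrite Rabs_pos_eq; apply H.
Qed.

Lemma Csummable_le (a : nat -> C) (b : nat -> R) :
  (forall n, Cmod (a n) <= b n) -> ex_series b -> Csummable a.
Proof.
  intros H Hb. eapply ex_series_dominated; [|exact Hb].
  intros n; split; [apply Cmod_ge_0 | apply H].
Qed.

Lemma Csum_ext a b : (forall n, a n = b n) -> Csum a = Csum b.
Proof. intros H. unfold Csum. f_equal; apply Series_ext; intros n; rewrite H; reflexivity. Qed.

Lemma Csummable_ext a b : (forall n, a n = b n) -> Csummable a -> Csummable b.
Proof. intros H. apply ex_series_ext. intros n; rewrite H; reflexivity. Qed.

Lemma Csummable_plus a b : Csummable a -> Csummable b -> Csummable (fun n => (a n + b n)%C).
Proof.
  intros Ha Hb. apply (Csummable_le _ (fun n => Cmod (a n) + Cmod (b n))).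
  - intros; apply Cmod_triangle.
  - apply (ex_series_plus _ _ Ha Hb).
Qed.

Lemma Csummable_scal c a : Csummable a -> Csummable (fun n => (c * a n)%C).
Proof.
  intros Ha. apply (Csummable_le _ (fun n => Cmod c * Cmod (a n))).
  - intros; rewrite Cmod_mult; lra.
  - apply (ex_series_scal_l (Cmod c) _ Ha).
Qed.

Lemma Csummable_minus a b : Csummable a -> Csummable b -> Csummable (fun n => (a n - b n)%C).
Proof.
  intros Ha Hb. apply (Csummable_le _ (fun n => Cmod (a n) + Cmod (b n))).
  - intros; apply Cmod_triangle_minus.
  - apply (ex_series_plus _ _ Ha Hb).
Qed.

Lemma Csum_plus a b : Csummable a -> Csummable b ->
  Csum (fun n => (a n + b n)%C) = (Csum a + Csum b)%C.
Proof.
  intros Ha Hb. unfold Csum. apply C_eq; simpl.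
  - rewrite <- Series_plus; auto using Csummable_Re.
  - rewrite <- Series_plus; auto using Csummable_Im.
Qed.

Lemma Csum_scal c a : Csummable a -> Csum (fun n => (c * a n)%C) = (c * Csum a)%C.
Proof.
  intros Ha. pose proof (Csummable_Re _ Ha) as Hr. pose proof (Csummable_Im _ Ha) as Hi.
  unfold Csum. apply C_eq; simpl.
  - rewrite <- 2!Series_scal_l, <- Series_minus;
      [reflexivity | apply (ex_series_scal_l (fst c) _ Hr) | apply (ex_series_scal_l (snd c) _ Hi)].
  - rewrite <- 2!Series_scal_l, <- Series_plus;
      [reflexivity | apply (ex_series_scal_l (fst c) _ Hi) | apply (ex_series_scal_l (snd c) _ Hr)].
Qed.

Lemma Csum_scal_r c a : Csummable a -> Csum (fun n => (a n * c)%C) = (Csum a * c)%C.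
Proof.
  intros Ha. rewrite Cmult_comm, <- Csum_scal by exact Ha. apply Csum_ext; intros; ring.
Qed.

Lemma Csum_minus a b : Csummable a -> Csummable b ->
  Csum (fun n => (a n - b n)%C) = (Csum a - Csum b)%C.
Proof.
  intros Ha Hb. unfold Csum. apply C_eq; simpl.
  - rewrite (Series_ext _ (fun n => fst (a n) - fst (b n))) by reflexivity.
    rewrite Series_minus; [reflexivity | apply (Csummable_Re _ Ha) | apply (Csummable_Re _ Hb)].
  - rewrite (Series_ext _ (fun n => snd (a n) - snd (b n))) by reflexivity.
    rewrite Series_minus; [reflexivity | apply (Csummable_Im _ Ha) | apply (Csummable_Im _ Hb)].
Qed.

Lemma Csummable_S a : Csummable a <-> Csummable (fun n => a (S n)).
Proof. unfold Csummable. apply (ex_series_incr_1 (fun n => Cmod (a n))). Qed.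

Lemma Csum_S a : Csummable a -> Csum a = (a O + Csum (fun n => a (S n)))%C.
Proof.
  intros Ha. unfold Csum. apply C_eq; simpl.
  - rewrite (Series_incr_1 _ (Csummable_Re _ Ha)). reflexivity.
  - rewrite (Series_incr_1 _ (Csummable_Im _ Ha)). reflexivity.
Qed.

Lemma Csummable_shift a N : Csummable a -> Csummable (fun n => a (N + n)%nat).
Proof.
  induction N as [|N IH]; intros Ha; [exact Ha|].
  specialize (IH Ha). rewrite Csummable_S in IH.
  eapply Csummable_ext; [|exact IH]. intros n. simpl. f_equal. lia.
Qed.

Lemma Csum_split a N : Csummable a ->
  Csum a = (Cpsum a N + Csum (fun n => a (N + n)%nat))%C.
Proof.
  intros Ha. induction N as [|N IH].
  - simpl. rewrite Cplus_0_l. reflexivity.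
  - rewrite IH, (Csum_S _ (Csummable_shift a N Ha)). simpl.
    rewrite Nat.add_0_r, Cplus_assoc. f_equal. apply Csum_ext. intros n. f_equal. lia.
Qed.

Lemma Series_nonneg (a : nat -> R) : (forall n, 0 <= a n) -> ex_series a -> 0 <= Series a.
Proof.
  intros H Ha. replace 0 with (Series (fun n => 0 * a n)) by (rewrite Series_scal_l; lra).
  apply Series_le; [|exact Ha]. intros n; specialize (H n); lra.
Qed.

Lemma Series_monotone (a b : nat -> R) :
  (forall n, a n <= b n) -> ex_series a -> ex_series b -> Series a <= Series b.
Proof.
  intros H Ha Hb. enough (0 <= Series (fun n => b n - a n)) by (rewrite Series_minus in H0; auto; lra).
  apply Series_nonneg; [intros n; specialize (H n); lra | apply (ex_series_minus _ _ Hb Ha)].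
Qed.

(** The sum is defined componentwise, so the inequality is reduced to real parts: multiplying by the
    unit [u] turns the sum into its own modulus. *)
Lemma Cmod_Csum_le a : Csummable a -> Cmod (Csum a) <= Series (fun n => Cmod (a n)).
Proof.
  intros Ha. destruct (Ceq_dec (Csum a) 0) as [E|E].
  - rewrite E, Cmod_0. apply Series_nonneg; [intros; apply Cmod_ge_0 | exact Ha].
  - set (s := Csum a) in *. pose proof (proj1 (Cmod_gt_0 s) E) as Hs.
    set (u := (Cconj s / Cmod s)%C).
    assert (Hu : Cmod u = 1).
    { unfold u. rewrite Cmod_div.
      - rewrite Cmod_conj, Cmod_R, Rabs_pos_eq by lra. field; lra.
      - intros H. apply RtoC_inj in H. lra. }
    assert (Hus : Cmod s = Re (u * s)).
    { assert ((u * s)%C = RtoC (Cmod s)) as ->; [|reflexivity].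
      unfold u. replace (Cconj s / Cmod s * s)%C with (s * Cconj s / Cmod s)%C.
      - rewrite <- Cmod2_conj, RtoC_pow. field. intros H. apply RtoC_inj in H. lra.
      - field. intros H. apply RtoC_inj in H. lra. }
    rewrite Hus. unfold s. rewrite <- Csum_scal by exact Ha. simpl.
    apply Series_monotone.
    + intros n. eapply Rle_trans; [apply Rle_abs|]. eapply Rle_trans.
      * apply (re_le_Cmod (u * a n)).
      * rewrite Cmod_mult, Hu. lra.
    + apply (Csummable_Re (fun n => (u * a n)%C)), Csummable_scal, Ha.
    + exact Ha.
Qed.

Lemma ex_series_bounded (a : nat -> R) (B : R) :
  (forall n, 0 <= a n) -> (forall n, sum_n a n <= B) -> ex_series a.
Proof.
  intros Ha HB.
  assert (H : ex_finite_lim_seq (sum_n a)).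
  { apply (ex_finite_lim_seq_incr _ B); [|exact HB].
    intros n. rewrite sum_Sn. unfold plus; simpl. specialize (Ha (S n)). lra. }
  destruct H as [l Hl]. exists l. exact Hl.
Qed.

Lemma Series_le_bounded (a : nat -> R) (B : R) :
  ex_series a -> (forall n, sum_n a n <= B) -> Series a <= B.
Proof.
  intros Ha HB. pose proof (Series_correct _ Ha) as H.
  apply (is_lim_seq_le (sum_n a) (fun _ => B) (Series a) B HB H (is_lim_seq_const B)).
Qed.

Lemma sum_n_le_Series (a : nat -> R) n :
  (forall n, 0 <= a n) -> ex_series a -> sum_n a n <= Series a.
Proof.
  intros Ha Hs. pose proof (Series_correct _ Hs) as H.
  apply (is_lim_seq_incr_compare (sum_n a) (Series a) H).
  intros k. rewrite sum_Sn. unfold plus; simpl. specialize (Ha (S k)). lra.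
Qed.

Lemma term_le_Series (a : nat -> R) n :
  (forall n, 0 <= a n) -> ex_series a -> a n <= Series a.
Proof.
  intros Ha Hs. eapply Rle_trans; [|apply (sum_n_le_Series a n Ha Hs)].
  destruct n; [rewrite sum_O; lra|]. rewrite sum_Sn. unfold plus; simpl.
  enough (0 <= sum_n a n) by lra.
  clear Hs. induction n; [rewrite sum_O; apply Ha | rewrite sum_Sn; unfold plus; simpl; specialize (Ha (S n)); lra].
Qed.

(** * Interchange of double sums *)

Lemma ex_series_sum_n (a : nat -> nat -> R) N :
  (forall j, ex_series (a j)) -> ex_series (fun i => sum_n (fun j => a j i) N).
Proof.
  intros H. induction N as [|N IH].
  - apply (ex_series_ext (a O)); [intros; rewrite sum_O; reflexivity | apply H].
  - apply (ex_series_ext (fun i => plus (sum_n (fun j => a j i) N) (a (S N) i))).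
    + intros; rewrite sum_Sn; reflexivity.
    + apply (ex_series_plus _ _ IH (H (S N))).
Qed.

Lemma Series_sum_n (a : nat -> nat -> R) N :
  (forall j, ex_series (a j)) ->
  Series (fun i => sum_n (fun j => a j i) N) = sum_n (fun j => Series (a j)) N.
Proof.
  intros H. induction N as [|N IH].
  - rewrite sum_O. apply Series_ext. intros; rewrite sum_O; reflexivity.
  - rewrite sum_Sn, <- IH. unfold plus; simpl. rewrite <- Series_plus.
    + apply Series_ext. intros; rewrite sum_Sn; reflexivity.
    + apply ex_series_sum_n, H.
    + apply H.
Qed.

(** Finitely many columns can be summed inside the row sums, which bounds every partial sum of the
    column sums. One inequality is enough here, since the transposed array supplies the other. *)
Lemma Series_fubini_nonneg_aux (a : nat -> nat -> R) :
  (forall i j, 0 <= a i j) -> (forall i, ex_series (a i)) ->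
  ex_series (fun i => Series (a i)) ->
  (forall j, ex_series (fun i => a i j)) /\
  ex_series (fun j => Series (fun i => a i j)) /\
  Series (fun j => Series (fun i => a i j)) <= Series (fun i => Series (a i)).
Proof.
  intros Hp Hr Hs.
  assert (Hc : forall j, ex_series (fun i => a i j)).
  { intros j. eapply ex_series_dominated; [|exact Hs]. intros i; split; [apply Hp|].
    apply term_le_Series; auto. }
  assert (HB : forall N, sum_n (fun j => Series (fun i => a i j)) N <= Series (fun i => Series (a i))).
  { intros N. rewrite <- (Series_sum_n (fun j i => a i j)) by exact Hc.
    apply Series_monotone; [|apply (ex_series_sum_n (fun j i => a i j)); exact Hc|exact Hs].
    intros i. apply sum_n_le_Series; auto. }
  assert (Hcs : ex_series (fun j => Series (fun i => a i j))).
  { eapply ex_series_bounded; [|exact HB]. intros j. apply Series_nonneg; auto. }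
  auto using Series_le_bounded.
Qed.

Lemma Series_fubini_nonneg (a : nat -> nat -> R) :
  (forall i j, 0 <= a i j) -> (forall i, ex_series (a i)) ->
  ex_series (fun i => Series (a i)) ->
  Series (fun j => Series (fun i => a i j)) = Series (fun i => Series (a i)).
Proof.
  intros Hp Hr Hs. destruct (Series_fubini_nonneg_aux a Hp Hr Hs) as (Hc & Hcs & Hle).
  destruct (Series_fubini_nonneg_aux (fun i j => a j i)) as (_ & _ & Hge); auto.
  apply Rle_antisym; assumption.
Qed.

(** Write [a = b - d]: both [b] and [d = b - a] are nonnegative and [d <= 2 b], so the nonnegative
    case applies to each. *)
Lemma Series_fubini_dominated (a b : nat -> nat -> R) :
  (forall i j, Rabs (a i j) <= b i j) -> (forall i, ex_series (b i)) ->
  ex_series (fun i => Series (b i)) ->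
  Series (fun j => Series (fun i => a i j)) = Series (fun i => Series (a i)).
Proof.
  intros Hab Hr Hs.
  assert (Hp : forall i j, 0 <= b i j) by (intros i j; eapply Rle_trans; [apply Rabs_pos | apply Hab]).
  destruct (Series_fubini_nonneg_aux b Hp Hr Hs) as (Hc & Hcs & _).
  pose (d := fun i j => b i j - a i j).
  assert (Hd : forall i j, 0 <= d i j <= 2 * b i j).
  { intros i j. unfold d. specialize (Hab i j). apply Rabs_le_between in Hab. lra. }
  assert (Hdr : forall i, ex_series (d i)).
  { intros i. eapply ex_series_dominated; [intros j; apply Hd|]. apply (ex_series_scal_l 2 _ (Hr i)). }
  assert (Hdc : forall j, ex_series (fun i => d i j)).
  { intros j. eapply ex_series_dominated; [intros i; apply Hd|]. apply (ex_series_scal_l 2 _ (Hc j)). }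
  assert (Hds : ex_series (fun i => Series (d i))).
  { apply (ex_series_dominated _ (fun i => 2 * Series (b i))).
    - intros i; split; [apply Series_nonneg; [intros; apply Hd | apply Hdr]|].
      rewrite <- Series_scal_l. apply Series_monotone; [intros; apply Hd | apply Hdr |].
      apply (ex_series_scal_l 2 _ (Hr i)).
    - apply (ex_series_scal_l 2 _ Hs). }
  destruct (Series_fubini_nonneg_aux d (fun i j => proj1 (Hd i j)) Hdr Hds) as (_ & Hdcs & _).
  pose proof (Series_fubini_nonneg d (fun i j => proj1 (Hd i j)) Hdr Hds) as F1.
  pose proof (Series_fubini_nonneg b Hp Hr Hs) as F2.
  rewrite (Series_ext (fun j => Series (fun i => a i j))
    (fun j => Series (fun i => b i j) - Series (fun i => d i j))).
  2:{ intros j. rewrite <- Series_minus by auto. apply Series_ext. intros; unfold d; lra. }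
  rewrite (Series_ext (fun i => Series (a i)) (fun i => Series (b i) - Series (d i))).
  2:{ intros i. rewrite <- Series_minus by auto. apply Series_ext. intros; unfold d; lra. }
  rewrite 2!Series_minus by assumption. lra.
Qed.

Section Fubini.

Variables (a : nat -> nat -> C) (b : nat -> nat -> R).
Hypothesis Hab : forall i j, Cmod (a i j) <= b i j.
Hypothesis Hr : forall i, ex_series (b i).
Hypothesis Hs : ex_series (fun i => Series (b i)).

Lemma Csum_fubini : Csum (fun i => Csum (a i)) = Csum (fun j => Csum (fun i => a i j)).
Proof.
  unfold Csum at 1 3. apply C_eq; simpl; symmetry.
  - apply (Series_fubini_dominated (fun i j => fst (a i j)) b); auto.
    intros i j. eapply Rle_trans; [apply re_le_Cmod | apply Hab].
  - apply (Series_fubini_dominated (fun i j => snd (a i j)) b); auto.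
    intros i j. eapply Rle_trans; [apply im_le_Cmod | apply Hab].
Qed.

Lemma Csummable_row i : Csummable (a i).
Proof. apply (Csummable_le _ (b i)); auto. Qed.

Lemma Csummable_rows : Csummable (fun i => Csum (a i)).
Proof.
  apply (Csummable_le _ (fun i => Series (b i))); auto.
  intros i. eapply Rle_trans; [apply Cmod_Csum_le, Csummable_row|].
  apply Series_le; auto. intros n; split; [apply Cmod_ge_0 | apply Hab].
Qed.

Lemma dominating_columns :
  (forall j, ex_series (fun i => b i j)) /\ ex_series (fun j => Series (fun i => b i j)).
Proof.
  destruct (Series_fubini_nonneg_aux b) as (H1 & H2 & _); auto.
  intros i j. eapply Rle_trans; [apply Cmod_ge_0 | apply Hab].
Qed.

End Fubini.

Lemma Csummable_col a b :
  (forall i j, Cmod (a i j) <= b i j) -> (forall i, ex_series (b i)) ->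
  ex_series (fun i => Series (b i)) -> forall j, Csummable (fun i => a i j).
Proof.
  intros Hab Hr Hs j. destruct (dominating_columns a b Hab Hr Hs) as [H1 H2].
  apply (Csummable_row (fun j i => a i j) (fun j i => b i j)); auto.
Qed.

Lemma Csummable_cols a b :
  (forall i j, Cmod (a i j) <= b i j) -> (forall i, ex_series (b i)) ->
  ex_series (fun i => Series (b i)) -> Csummable (fun j => Csum (fun i => a i j)).
Proof.
  intros Hab Hr Hs. destruct (dominating_columns a b Hab Hr Hs) as [H1 H2].
  apply (Csummable_rows (fun j i => a i j) (fun j i => b i j)); auto.
Qed.

(** * Limits of complex sequences *)

Lemma Clim_unique u x y : Clim u x -> Clim u y -> x = y.
Proof.
  intros Hx Hy. pose proof (is_lim_seq_plus' _ _ _ _ Hx Hy) as H. simpl in H.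
  assert (Cmod (x - y) <= 0 + 0).
  { apply (is_lim_seq_le (fun _ => Cmod (x - y)) _ (Cmod (x - y)) (0 + 0)) with (2 := is_lim_seq_const _) (3 := H).
    intros n. rewrite (Cmod_minus_sym (u n) x). apply Cmod_triangle_dist. }
  apply Ceq_minus, Cmod_eq_0. pose proof (Cmod_ge_0 (x - y)). lra.
Qed.

Lemma Clim_bound u x (e : nat -> R) :
  (forall n, Cmod (u n - x) <= e n) -> is_lim_seq e 0 -> Clim u x.
Proof.
  intros H He. apply (is_lim_seq_le_le (fun _ => 0) _ e 0); [|apply is_lim_seq_const|exact He].
  intros n; split; [apply Cmod_ge_0 | apply H].
Qed.

Lemma Clim_bound_eventually u x (e : nat -> R) N :
  (forall n, (N <= n)%nat -> Cmod (u n - x) <= e n) -> is_lim_seq e 0 -> Clim u x.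
Proof.
  intros H He. apply (is_lim_seq_le_le_loc (fun _ => 0) _ e 0); [|apply is_lim_seq_const|exact He].
  exists N. intros n Hn; split; [apply Cmod_ge_0 | apply H, Hn].
Qed.

Lemma Clim_ext u v x : (forall n, u n = v n) -> Clim u x -> Clim v x.
Proof. intros H. apply is_lim_seq_ext. intros n; rewrite H; reflexivity. Qed.

Lemma Clim_const x : Clim (fun _ => x) x.
Proof.
  eapply is_lim_seq_ext; [|apply (is_lim_seq_const 0)].
  intros n. simpl. replace (x - x)%C with (RtoC 0) by ring. rewrite Cmod_0. reflexivity.
Qed.

Lemma Clim_plus u v x y : Clim u x -> Clim v y -> Clim (fun n => (u n + v n)%C) (x + y).
Proof.
  intros Hu Hv. apply (Clim_bound _ _ (fun n => Cmod (u n - x) + Cmod (v n - y))).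
  - intros n. replace (u n + v n - (x + y))%C with ((u n - x) + (v n - y))%C by ring. apply Cmod_triangle.
  - replace 0 with (0 + 0) by ring. apply is_lim_seq_plus'; assumption.
Qed.

Lemma Clim_scal c u x : Clim u x -> Clim (fun n => (c * u n)%C) (c * x).
Proof.
  intros Hu. apply (Clim_bound _ _ (fun n => Cmod c * Cmod (u n - x))).
  - intros n. replace (c * u n - c * x)%C with (c * (u n - x))%C by ring. rewrite Cmod_mult. lra.
  - replace 0 with (Cmod c * 0) by ring. apply (is_lim_seq_scal_l _ (Cmod c) 0 Hu).
Qed.

Lemma Series_tail_lim (a : nat -> R) :
  ex_series a -> is_lim_seq (fun N => Series (fun n => a (N + n)%nat)) 0.
Proof.
  intros Ha. apply is_lim_seq_incr_1.
  apply (is_lim_seq_ext (fun N => Series a - sum_n a N)).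
  - intros N. rewrite (Series_incr_n a (S N)) by (auto; lia). simpl.
    rewrite sum_n_Reals. ring.
  - replace 0 with (Series a - Series a) by ring.
    apply is_lim_seq_minus'; [apply is_lim_seq_const | apply (Series_correct _ Ha)].
Qed.

Lemma Clim_Cpsum a : Csummable a -> Clim (Cpsum a) (Csum a).
Proof.
  intros Ha. eapply Clim_bound; [|apply (Series_tail_lim _ Ha)].
  intros N. rewrite (Csum_split a N Ha).
  replace (Cpsum a N - (Cpsum a N + Csum (fun n => a (N + n)%nat)))%C
    with (- Csum (fun n => a (N + n)%nat))%C by ring.
  rewrite Cmod_opp. apply (Cmod_Csum_le (fun n => a (N + n)%nat)), Csummable_shift, Ha.
Qed.

Lemma Csum_unique a l : Csummable a -> Clim (Cpsum a) l -> Csum a = l.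
Proof. intros Ha Hl. eapply Clim_unique; [apply Clim_Cpsum, Ha | exact Hl]. Qed.

Lemma Cpsum_ext a b N : (forall n, (n < N)%nat -> a n = b n) -> Cpsum a N = Cpsum b N.
Proof.
  induction N as [|N IH]; intros H; [reflexivity|]. simpl. rewrite IH, H by (auto; lia). reflexivity.
Qed.

Lemma Cpsum_plus a b N : Cpsum (fun n => (a n + b n)%C) N = (Cpsum a N + Cpsum b N)%C.
Proof. induction N as [|N IH]; simpl; [ring | rewrite IH; ring]. Qed.

Lemma Cpsum_scal c a N : Cpsum (fun n => (c * a n)%C) N = (c * Cpsum a N)%C.
Proof. induction N as [|N IH]; simpl; [ring | rewrite IH; ring]. Qed.

Lemma Cmod_Cpsum_le a (B : R) N :
  (forall n, (n < N)%nat -> Cmod (a n) <= B) -> Cmod (Cpsum a N) <= INR N * B.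
Proof.
  induction N as [|N IH]; intros H.
  - simpl. rewrite Cmod_0. lra.
  - rewrite S_INR. simpl. eapply Rle_trans; [apply Cmod_triangle|].
    specialize (IH (fun n Hn => H n (Nat.lt_lt_succ_r _ _ Hn))).
    specialize (H N (Nat.lt_succ_diag_r N)). lra.
Qed.

Lemma Clim_shift u x : Clim u x -> Clim (fun n => u (S n)) x.
Proof. intros H. apply (is_lim_seq_incr_1 (fun n => Cmod (u n - x))) in H. exact H. Qed.

(** * The complex exponential *)

(** From the identity [pi / 4 = 2 atan (1/3) + atan (1/7)], with the alternating series stopped at
    the terms of index 4 and 5. *)
Lemma PI_bounds : (3.1415 < PI < 3.1416)%R.
Proof.
  pose proof (PI_2_3_7_ineq 2) as H.
  unfold tg_alt, PI_2_3_7_tg, Ratan_seq in H. cbn [sum_f_R0 Nat.mul Nat.add pow INR] in H. lra.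
Qed.

Lemma Cexp_0 : Cexp 0 = 1.
Proof. unfold Cexp; simpl. rewrite exp_0, cos_0, sin_0. apply C_eq; simpl; ring. Qed.

Lemma Cexp_plus x y : Cexp (x + y) = (Cexp x * Cexp y)%C.
Proof.
  unfold Cexp. rewrite re_plus, im_plus, exp_plus, cos_plus, sin_plus. apply C_eq; simpl; ring.
Qed.

Lemma Cmod_Cexp z : Cmod (Cexp z) = exp (Re z).
Proof.
  unfold Cmod, Cexp; simpl. pose proof (sin2_cos2 (Im z)) as H. unfold Rsqr in H.
  replace (_ + _) with ((exp (Re z)) ^ 2).
  - apply sqrt_pow2, Rlt_le, exp_pos.
  - simpl. unfold Im in *. nra.
Qed.

Lemma Cexp_neq_0 z : Cexp z <> 0.
Proof. apply Cmod_gt_0. rewrite Cmod_Cexp. apply exp_pos. Qed.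

Lemma Cexp_opp z : Cexp (- z) = (/ Cexp z)%C.
Proof.
  assert (H : (Cexp (- z) * Cexp z)%C = 1).
  { rewrite <- Cexp_plus. replace (- z + z)%C with (RtoC 0) by ring. apply Cexp_0. }
  pose proof (Cexp_neq_0 z).
  replace (Cexp (- z)) with ((Cexp (- z) * Cexp z) / Cexp z)%C by (field; assumption).
  rewrite H. field; assumption.
Qed.

Lemma Cexp_minus x y : Cexp (x - y) = (Cexp x / Cexp y)%C.
Proof. unfold Cminus, Cdiv. rewrite Cexp_plus, Cexp_opp. reflexivity. Qed.

Lemma Cexp_pow z n : (Cexp z ^ n)%C = Cexp (INR n * z).
Proof.
  induction n as [|n IH].
  - simpl. replace (0 * z)%C with (RtoC 0) by ring. rewrite Cexp_0. reflexivity.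
  - rewrite Cpow_S, IH, S_INR, RtoC_plus, <- Cexp_plus. f_equal; ring.
Qed.

Lemma Cexp_real x : Cexp (RtoC x) = RtoC (exp x).
Proof. unfold Cexp; simpl. rewrite cos_0, sin_0. apply C_eq; simpl; ring. Qed.

Lemma Cexp_2PI_i : Cexp (2 * PI * Ci) = 1.
Proof.
  unfold Cexp. assert (Hc : (2 * PI * Ci)%C = (0, 2 * PI)%R) by (apply C_eq; simpl; ring). rewrite Hc.
  simpl. rewrite cos_2PI, sin_2PI, exp_0. apply C_eq; simpl; ring.
Qed.

(** * The exponential series *)

Lemma CV_disk_radius (a : nat -> R) r : CV_disk a r -> Rbar_le r (CV_radius a).
Proof. intros H. apply (proj1 (Lub_Rbar_correct (CV_disk a))), H. Qed.

Lemma CV_radius_infinite (a : nat -> R) : (forall r, 0 <= r -> CV_disk a r) -> CV_radius a = p_infty.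
Proof.
  intros H. destruct (CV_radius a) as [r| |] eqn:E; [|reflexivity|].
  - assert (H0 := CV_disk_radius a (Rabs r + 1)). rewrite E in H0. simpl in H0.
    pose proof (Rle_abs r). pose proof (Rabs_pos r).
    assert (Rabs r + 1 <= r) by (apply H0, H; lra). lra.
  - assert (H0 := CV_disk_radius a 0). rewrite E in H0. exfalso. apply H0, H. lra.
Qed.

Lemma ex_series_exp x : ex_series (fun k => x ^ k / INR (fact k)).
Proof.
  exists (exp x). eapply is_series_ext; [|apply (is_exp_Reals x)].
  intros n. simpl. unfold scal; simpl; unfold mult; simpl. rewrite pow_n_pow. unfold Rdiv. reflexivity.
Qed.

Lemma Series_exp x : Series (fun k => x ^ k / INR (fact k)) = exp x.
Proof.
  apply is_series_unique. eapply is_series_ext; [|apply (is_exp_Reals x)].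
  intros n. simpl. unfold scal; simpl; unfold mult; simpl. rewrite pow_n_pow. unfold Rdiv. reflexivity.
Qed.

Lemma INR_fact_C_neq_0 n : RtoC (INR (fact n)) <> 0.
Proof. intros H. apply RtoC_inj in H. apply (INR_fact_neq_0 n H). Qed.

Lemma Cmod_pow_fact v j k : Cmod (v ^ k / INR (fact (j + k)))%C = Cmod v ^ k / INR (fact (j + k)).
Proof.
  rewrite Cmod_div by apply INR_fact_C_neq_0. rewrite Cmod_pow, Cmod_R, Rabs_pos_eq; [reflexivity|].
  apply Rlt_le, INR_fact_lt_0.
Qed.

(* The Taylor tails: [v ^ j * exp_tail j v] is the exponential series without its first [j] terms. *)
Definition exp_tail (j : nat) (v : C) : C := Csum (fun k => v ^ k / INR (fact (j + k)))%C.

Lemma fact_shift_le j k : / INR (fact (j + k)) <= / INR (fact k).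
Proof.
  apply Rinv_le_contravar; [apply INR_fact_lt_0|]. apply le_INR, fact_le. lia.
Qed.

Lemma exp_tail_bound_term j v k : Cmod (v ^ k / INR (fact (j + k)))%C <= Cmod v ^ k / INR (fact k).
Proof.
  rewrite Cmod_pow_fact. apply Rmult_le_compat_l; [apply pow_le, Cmod_ge_0 | apply fact_shift_le].
Qed.

Lemma exp_tail_summable j v : Csummable (fun k => v ^ k / INR (fact (j + k)))%C.
Proof. eapply Csummable_le; [apply exp_tail_bound_term | apply ex_series_exp]. Qed.

Lemma exp_tail_bound j v : Cmod (exp_tail j v) <= exp (Cmod v).
Proof.
  eapply Rle_trans; [apply Cmod_Csum_le, exp_tail_summable|]. rewrite <- Series_exp.
  apply Series_le; [|apply ex_series_exp].
  intros n; split; [apply Cmod_ge_0 | apply exp_tail_bound_term].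
Qed.

(** The tails of index 1 and 2 are the entire functions [(e^v - 1) / v] and [(e^v - 1 - v) / v^2];
    this recursion relates them without dividing by [v]. *)
Lemma exp_tail_S j v : exp_tail j v = (/ INR (fact j) + v * exp_tail (S j) v)%C.
Proof.
  unfold exp_tail. rewrite (Csum_S _ (exp_tail_summable j v)).
  rewrite <- Csum_scal by apply exp_tail_summable. f_equal.
  - rewrite Nat.add_0_r. simpl. field. apply INR_fact_C_neq_0.
  - apply Csum_ext. intros k. replace (j + S k)%nat with (S j + k)%nat by lia.
    rewrite Cpow_S. field. apply INR_fact_C_neq_0.
Qed.

Lemma pow_diff_bound (x y : C) (r : R) k : Cmod x <= r -> Cmod y <= r ->
  Cmod (x ^ S k - y ^ S k) <= INR (S k) * r ^ k * Cmod (x - y).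
Proof.
  intros Hx Hy. pose proof (Cmod_ge_0 x). pose proof (Cmod_ge_0 (x - y)).
  induction k as [|k IH].
  - simpl. replace (x * 1 - y * 1)%C with (x - y)%C by ring. lra.
  - replace (x ^ S (S k) - y ^ S (S k))%C with (x * (x ^ S k - y ^ S k) + y ^ S k * (x - y))%C
      by (simpl; ring).
    eapply Rle_trans; [apply Cmod_triangle|]. rewrite 2!Cmod_mult, Cmod_pow.
    replace (INR (S (S k)) * r ^ S k * Cmod (x - y))
      with (r * (INR (S k) * r ^ k * Cmod (x - y)) + r ^ S k * Cmod (x - y))
      by (rewrite (S_INR (S k)); simpl; ring).
    apply Rplus_le_compat.
    + apply Rmult_le_compat; auto. apply Cmod_ge_0.
    + apply Rmult_le_compat_r; [lra|]. apply pow_incr. split; [apply Cmod_ge_0 | exact Hy].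
Qed.

(** Termwise: the factor [k + 1] in the bound for [x^(k+1) - y^(k+1)] is absorbed by the factorial,
    which leaves the series of [exp r]. *)
Lemma exp_tail_lipschitz j x y r : Cmod x <= r -> Cmod y <= r ->
  Cmod (exp_tail j x - exp_tail j y) <= exp r * Cmod (x - y).
Proof.
  intros Hx Hy. unfold exp_tail.
  pose proof (exp_tail_summable j x) as Sx. pose proof (exp_tail_summable j y) as Sy.
  rewrite <- Csum_minus by assumption.
  rewrite (Csum_S _ (Csummable_minus _ _ Sx Sy)). simpl (x ^ 0)%C. simpl (y ^ 0)%C.
  replace (_ - _ + _)%C with (Csum (fun n => x ^ S n / INR (fact (j + S n)) - y ^ S n / INR (fact (j + S n))))%C
    by ring.
  assert (B : forall n, Cmod (x ^ S n / INR (fact (j + S n)) - y ^ S n / INR (fact (j + S n)))%C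
    <= r ^ n / INR (fact n) * Cmod (x - y)).
  { intros n.
    replace (x ^ S n / INR (fact (j + S n)) - y ^ S n / INR (fact (j + S n)))%C
      with ((x ^ S n - y ^ S n) / INR (fact (j + S n)))%C by (field; apply INR_fact_C_neq_0).
    rewrite Cmod_div by apply INR_fact_C_neq_0. rewrite Cmod_R, (Rabs_pos_eq (INR _)) by apply pos_INR.
    pose proof (pow_diff_bound x y r n Hx Hy) as P.
    pose proof (INR_fact_lt_0 (j + S n)). pose proof (fact_shift_le j (S n)) as F.
    assert (0 <= r) by (pose proof (Cmod_ge_0 x); lra).
    assert (0 <= r ^ n) by (apply pow_le; assumption). pose proof (Cmod_ge_0 (x - y)).
    eapply Rle_trans; [apply Rmult_le_compat_r; [apply Rlt_le, Rinv_0_lt_compat; assumption | exact P]|].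
    eapply Rle_trans; [apply Rmult_le_compat_l; [|exact F]|].
    - repeat apply Rmult_le_pos; auto. apply pos_INR.
    - rewrite fact_simpl, mult_INR. apply Req_le. field. split; [apply INR_fact_neq_0 | apply not_0_INR; lia]. }
  eapply Rle_trans.
  - apply Cmod_Csum_le. eapply Csummable_le; [exact B|]. apply ex_series_scal_r, ex_series_exp.
  - rewrite <- Series_exp, <- Series_scal_r. apply Series_le; [|apply ex_series_scal_r, ex_series_exp].
    intros n; split; [apply Cmod_ge_0 | apply B].
Qed.

Section ExpSeries.

Variable v : C.

(** [cr] and [ci] are the Taylor coefficients, in a real variable [t], of the real and imaginary
    parts of the series for [exp (t v)]. A linear system of differential equations in [t] identifies
    them with the cosine and sine form of [Cexp]. *)
Let cr (k : nat) : R := Re (v ^ k)%C / INR (fact k).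
Let ci (k : nat) : R := Im (v ^ k)%C / INR (fact k).

Lemma exp_comp_disk (f : C -> R) (Hf : forall z, Rabs (f z) <= Cmod z) r : 0 <= r ->
  CV_disk (fun k => f (v ^ k)%C / INR (fact k)) r.
Proof.
  intros Hr. apply (ex_series_dominated _ (fun k => (Cmod v * r) ^ k / INR (fact k))); [|apply ex_series_exp].
  intros n; split; [apply Rabs_pos|]. unfold Rdiv.
  rewrite 2!Rabs_mult, (Rabs_pos_eq (r ^ n)) by (apply pow_le; lra).
  rewrite (Rabs_pos_eq (/ _)) by (apply Rlt_le, Rinv_0_lt_compat, INR_fact_lt_0).
  rewrite Rpow_mult_distr, <- Cmod_pow.
  replace (Cmod (v ^ n) * r ^ n * / INR (fact n)) with (Cmod (v ^ n) * / INR (fact n) * r ^ n) by ring.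
  apply Rmult_le_compat_r; [apply pow_le; lra|].
  apply Rmult_le_compat_r; [apply Rlt_le, Rinv_0_lt_compat, INR_fact_lt_0 | apply Hf].
Qed.

Lemma cr_radius : CV_radius cr = p_infty.
Proof. apply CV_radius_infinite. intros r Hr. apply (exp_comp_disk Re re_le_Cmod r Hr). Qed.

Lemma ci_radius : CV_radius ci = p_infty.
Proof. apply CV_radius_infinite. intros r Hr. apply (exp_comp_disk Im im_le_Cmod r Hr). Qed.

Lemma cr_derive t : is_derive (PSeries cr) t (Re v * PSeries cr t - Im v * PSeries ci t).
Proof.
  evar_last; [apply is_derive_PSeries; rewrite cr_radius; exact I|].
  rewrite <- 2!PSeries_scal, <- PSeries_minus.
  - apply PSeries_ext. intros n. unfold PS_derive, PS_minus, PS_plus, PS_opp, PS_scal, cr, ci.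
    unfold plus, opp, scal; simpl; unfold mult; simpl.
    rewrite plus_INR, mult_INR. change (match n with O => 1 | S _ => INR n + 1 end) with (INR (S n)).
    assert (INR (S n) <> 0) by (apply not_0_INR; lia). rewrite S_INR in *.
    unfold Re, Im. pose proof (INR_fact_lt_0 n). pose proof (pos_INR n).
    field. repeat split; try lra; apply Rgt_not_eq; nra.
  - apply ex_pseries_scal; [apply Rmult_comm|]. apply CV_radius_inside. rewrite cr_radius. exact I.
  - apply ex_pseries_scal; [apply Rmult_comm|]. apply CV_radius_inside. rewrite ci_radius. exact I.
Qed.

Lemma ci_derive t : is_derive (PSeries ci) t (Im v * PSeries cr t + Re v * PSeries ci t).
Proof.
  evar_last; [apply is_derive_PSeries; rewrite ci_radius; exact I|].
  rewrite <- 2!PSeries_scal, <- PSeries_plus.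
  - apply PSeries_ext. intros n. unfold PS_derive, PS_plus, PS_scal, cr, ci.
    unfold plus, scal; simpl; unfold mult; simpl.
    rewrite plus_INR, mult_INR. change (match n with O => 1 | S _ => INR n + 1 end) with (INR (S n)).
    assert (INR (S n) <> 0) by (apply not_0_INR; lia). rewrite S_INR in *.
    unfold Re, Im. pose proof (INR_fact_lt_0 n). pose proof (pos_INR n).
    field. repeat split; try lra; apply Rgt_not_eq; nra.
  - apply ex_pseries_scal; [apply Rmult_comm|]. apply CV_radius_inside. rewrite cr_radius. exact I.
  - apply ex_pseries_scal; [apply Rmult_comm|]. apply CV_radius_inside. rewrite ci_radius. exact I.
Qed.

(* Both rotated combinations [e^{-at} (cr cos + ci sin)] and [e^{-at} (ci cos - cr sin)] have zero derivative. *)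
Lemma exp_series_components :
  PSeries cr 1 = exp (Re v) * cos (Im v) /\ PSeries ci 1 = exp (Re v) * sin (Im v).
Proof.
  pose (f t := exp (- (Re v * t)) * (PSeries cr t * cos (Im v * t) + PSeries ci t * sin (Im v * t))).
  pose (g t := exp (- (Re v * t)) * (PSeries ci t * cos (Im v * t) - PSeries cr t * sin (Im v * t))).
  assert (Hf : forall t, is_derive f t 0).
  { intros t. unfold f. pose proof (cr_derive t) as Hr. pose proof (ci_derive t) as Hi.
    evar_last; [auto_derive; [repeat split; eexists; eassumption | reflexivity]|].
    rewrite (is_derive_unique (fun x : R => PSeries cr x) t _ Hr), (is_derive_unique (fun x : R => PSeries ci x) t _ Hi). ring. }
  assert (Hg : forall t, is_derive g t 0).
  { intros t. unfold g. pose proof (cr_derive t) as Hr. pose proof (ci_derive t) as Hi.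
    evar_last; [auto_derive; [repeat split; eexists; eassumption | reflexivity]|].
    rewrite (is_derive_unique (fun x : R => PSeries cr x) t _ Hr), (is_derive_unique (fun x : R => PSeries ci x) t _ Hi). ring. }
  assert (H0r : PSeries cr 0 = 1) by (rewrite PSeries_0; unfold cr; simpl; field).
  assert (H0i : PSeries ci 0 = 0) by (rewrite PSeries_0; unfold ci; simpl; field).
  assert (Ef : f 1 = 1).
  { transitivity (f 0).
    - symmetry. apply (eq_is_derive f 0 1); [intros; apply Hf | lra].
    - unfold f. rewrite H0r, H0i, !Rmult_0_r, Ropp_0, exp_0, cos_0, sin_0. ring. }
  assert (Eg : g 1 = 0).
  { transitivity (g 0).
    - symmetry. apply (eq_is_derive g 0 1); [intros; apply Hg | lra].
    - unfold g. rewrite H0r, H0i, !Rmult_0_r, Ropp_0, exp_0, cos_0, sin_0. ring. }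
  unfold f, g in Ef, Eg. rewrite !Rmult_1_r in Ef, Eg.
  pose proof (sin2_cos2 (Im v)) as SC. unfold Rsqr in SC.
  rewrite exp_Ropp in Ef, Eg. pose proof (exp_pos (Re v)) as Hp.
  set (P := PSeries cr 1) in *. set (Q := PSeries ci 1) in *.
  set (c := cos (Im v)) in *. set (s := sin (Im v)) in *. set (e := exp (Re v)) in *.
  assert (E1 : P * c + Q * s = e) by (apply (Rmult_eq_reg_l (/ e)); [rewrite Ef; field; lra | apply Rinv_neq_0_compat; lra]).
  assert (E2 : Q * c - P * s = 0) by (apply (Rmult_eq_reg_l (/ e)); [rewrite Eg; field; lra | apply Rinv_neq_0_compat; lra]).
  split.
  - replace P with (P * (s * s + c * c)) by (rewrite SC; ring).
    replace (P * (s * s + c * c)) with (c * (P * c + Q * s) - s * (Q * c - P * s)) by ring.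
    rewrite E1, E2. ring.
  - replace Q with (Q * (s * s + c * c)) by (rewrite SC; ring).
    replace (Q * (s * s + c * c)) with (s * (P * c + Q * s) + c * (Q * c - P * s)) by ring.
    rewrite E1, E2. ring.
Qed.

End ExpSeries.

Lemma Re_div_R (x : C) (r : R) : r <> 0 -> Re (x / r) = Re x / r.
Proof.
  intros H. unfold Cdiv. rewrite <- RtoC_inv by exact H. rewrite re_scal_r. reflexivity.
Qed.

Lemma Im_div_R (x : C) (r : R) : r <> 0 -> Im (x / r) = Im x / r.
Proof.
  intros H. unfold Cdiv. rewrite <- RtoC_inv by exact H. rewrite im_scal_r. reflexivity.
Qed.

Lemma Cexp_exp_tail v : Cexp v = exp_tail 0 v.
Proof.
  destruct (exp_series_components v) as [Hr Hi].
  unfold Cexp, exp_tail, Csum. rewrite <- Hr, <- Hi. unfold PSeries.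
  apply C_eq; simpl; apply Series_ext; intros k; rewrite pow1, Rmult_1_r.
  - symmetry; apply (Re_div_R (v ^ k)%C (INR (fact k)) (INR_fact_neq_0 k)).
  - symmetry; apply (Im_div_R (v ^ k)%C (INR (fact k)) (INR_fact_neq_0 k)).
Qed.

Lemma Cexp_expand1 v : Cexp v = (1 + v * exp_tail 1 v)%C.
Proof. rewrite Cexp_exp_tail, exp_tail_S. simpl. f_equal. field. Qed.

Lemma Cexp_expand2 v : Cexp v = (1 + v + v * v * exp_tail 2 v)%C.
Proof. rewrite Cexp_expand1, exp_tail_S. simpl. field. Qed.

Lemma Cexp_sub1_bound v : Cmod (Cexp v - 1) <= Cmod v * exp (Cmod v).
Proof.
  rewrite Cexp_expand1. replace (1 + v * exp_tail 1 v - 1)%C with (v * exp_tail 1 v)%C by ring.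
  rewrite Cmod_mult. apply Rmult_le_compat_l; [apply Cmod_ge_0 | apply exp_tail_bound].
Qed.

Lemma Cexp_sub2_bound v : Cmod (Cexp v - 1 - v) <= Cmod v ^ 2 * exp (Cmod v).
Proof.
  rewrite Cexp_expand2. replace (_ - 1 - v)%C with (v * v * exp_tail 2 v)%C by ring.
  rewrite 2!Cmod_mult. replace (Cmod v ^ 2) with (Cmod v * Cmod v) by ring.
  apply Rmult_le_compat_l; [apply Rmult_le_pos; apply Cmod_ge_0 | apply exp_tail_bound].
Qed.

(** Telescoping comparison with [1 / ((n + 1) (n + 2))]. *)
Lemma sum_n_inv_sq n : sum_n (fun k => / (INR k + 1) ^ 2) n <= 2 - / (INR n + 1).
Proof.
  induction n as [|n IH].
  - rewrite sum_O. simpl. lra.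
  - rewrite sum_Sn. unfold plus; simpl. change (match n with O => 1 | S _ => INR n + 1 end) with (INR (S n)).
    rewrite S_INR. simpl in IH. pose proof (pos_INR n).
    enough (/ ((INR n + 1 + 1) * ((INR n + 1 + 1) * 1)) <= / (INR n + 1) - / (INR n + 1 + 1)) by lra.
    replace (/ (INR n + 1) - / (INR n + 1 + 1)) with (/ ((INR n + 1) * (INR n + 1 + 1))) by (field; lra).
    apply Rinv_le_contravar; nra.
Qed.

Lemma ex_series_inv_sq : ex_series (fun k => / (INR k + 1) ^ 2).
Proof.
  apply (ex_series_bounded _ 2).
  - intros n. apply Rlt_le, Rinv_0_lt_compat, pow_lt. pose proof (pos_INR n); lra.
  - intros n. pose proof (sum_n_inv_sq n). pose proof (pos_INR n).
    assert (0 < / (INR n + 1)) by (apply Rinv_0_lt_compat; lra). lra.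
Qed.

Lemma Series_inv_sq_le : Series (fun k => / (INR k + 1) ^ 2) <= 2.
Proof.
  apply Series_le_bounded; [apply ex_series_inv_sq|].
  intros n. pose proof (sum_n_inv_sq n). pose proof (pos_INR n).
  assert (0 < / (INR n + 1)) by (apply Rinv_0_lt_compat; lra). lra.
Qed.

Lemma Re_le_Cmod (z : C) : Re z <= Cmod z.
Proof. eapply Rle_trans; [apply Rle_abs | apply re_le_Cmod]. Qed.

Lemma Re_pos_neq_0 (z : C) : 0 < Re z -> z <> 0.
Proof. intros H E. rewrite E in H. simpl in H. lra. Qed.

(** * Partial fractions of the hyperbolic cotangent *)

(** The constant of norm equivalence on the lattice generated by [z] and [i]; all dominating arrays
    for lattice sums are expressed with it. *)
Definition lattice_const (z : C) : R := / (1 + (Cmod z + 1) / Re z).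

Lemma lattice_const_pos z : 0 < Re z -> 0 < lattice_const z.
Proof.
  intros H. apply Rinv_0_lt_compat. pose proof (Cmod_ge_0 z).
  assert (0 < (Cmod z + 1) / Re z) by (apply Rdiv_lt_0_compat; lra). lra.
Qed.

Lemma Cmod_Ci : Cmod Ci = 1.
Proof. unfold Cmod; simpl. match goal with |- sqrt ?t = _ => replace t with 1 by ring end. apply sqrt_1. Qed.

(** With [X] the modulus on the right, [l Re z <= X] and [|m| - l |z| <= X]; add [(|z| + 1) / Re z]
    times the first to the second. *)
Lemma lattice_lower_bound z l m : 0 < Re z -> 0 <= l ->
  lattice_const z * (l + Rabs m) <= Cmod (l * z + m * Ci).
Proof.
  intros Hz Hl. unfold lattice_const. set (X := Cmod (l * z + m * Ci)).
  assert (H1 : l * Re z <= X).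
  { eapply Rle_trans; [|apply Re_le_Cmod]. apply Req_le. unfold Re. simpl. ring. }
  assert (H2 : Rabs m - l * Cmod z <= X).
  { unfold X. replace (Rabs m) with (Cmod (m * Ci)).
    - replace (l * Cmod z) with (Cmod (- (l * z))%C) by (rewrite Cmod_opp, Cmod_mult, Cmod_R, Rabs_pos_eq; auto).
      replace (l * z + m * Ci)%C with (m * Ci - (- (l * z)))%C by ring. apply Cmod_triangle_rev.
    - rewrite Cmod_mult, Cmod_R, Cmod_Ci. ring. }
  pose proof (Cmod_ge_0 z).
  assert (0 < (Cmod z + 1) / Re z) by (apply Rdiv_lt_0_compat; lra).
  apply (Rmult_le_reg_l (1 + (Cmod z + 1) / Re z)); [lra|].
  rewrite <- Rmult_assoc, Rinv_r, Rmult_1_l by lra.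
  assert (l * (Cmod z + 1) <= (Cmod z + 1) / Re z * X).
  { replace (l * (Cmod z + 1)) with ((Cmod z + 1) / Re z * (l * Re z)) by (field; lra).
    apply Rmult_le_compat_l; lra. }
  lra.
Qed.

(** This is [pi coth (pi w)], written with a single exponential. *)
Definition pi_coth (w : C) : C := (PI + 2 * PI / (Cexp (2 * PI * w) - 1))%C.

Lemma Cexp_sub_1_neq_0_of_re v : 0 < Re v -> (Cexp v - 1)%C <> 0.
Proof.
  intros H E. apply Ceq_minus in E. apply (f_equal Cmod) in E.
  rewrite Cmod_Cexp, Cmod_1, <- exp_0 in E. apply exp_inv in E. lra.
Qed.

Lemma Re_2PI_mult w : Re (2 * PI * w) = 2 * PI * Re w.
Proof. unfold Re; simpl; ring. Qed.

Lemma Im_2PI_mult w : Im (2 * PI * w) = 2 * PI * Im w.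
Proof. unfold Im; simpl; ring. Qed.

Lemma pi_coth_den w : 0 < Re w -> (Cexp (2 * PI * w) - 1)%C <> 0.
Proof.
  intros H. apply Cexp_sub_1_neq_0_of_re. rewrite Re_2PI_mult. pose proof PI_RGT_0. nra.
Qed.

Definition omega3 : C := Cexp (2 * PI * (Ci / 3)).

Lemma C3_neq_0 : RtoC 3 <> 0.
Proof. intros H. apply RtoC_inj in H. lra. Qed.

Lemma omega3_cube : (omega3 * omega3 * omega3)%C = 1.
Proof.
  unfold omega3. rewrite <- 2!Cexp_plus, <- Cexp_2PI_i. f_equal. field; try apply C3_neq_0.
Qed.

Lemma omega3_neq_1 : omega3 <> 1.
Proof.
  intros H. apply (f_equal Im) in H. unfold omega3, Cexp in H. simpl in H.
  pose proof PI_RGT_0.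
  match type of H with (_ * sin ?t = 0) => replace t with (2 * PI / 3) in H by (simpl; field) end.
  apply Rmult_integral in H. destruct H as [H|H].
  - revert H. apply Rgt_not_eq, exp_pos.
  - revert H. apply Rgt_not_eq, sin_gt_0; lra.
Qed.

Lemma omega3_quadratic : (1 + omega3 + omega3 * omega3)%C = 0.
Proof.
  destruct (Ceq_dec (1 + omega3 + omega3 * omega3)%C 0) as [H|H]; [exact H|].
  exfalso. assert (E : ((omega3 - 1) * (1 + omega3 + omega3 * omega3))%C = 0).
  { transitivity (omega3 * omega3 * omega3 - 1)%C; [ring | rewrite omega3_cube; ring]. }
  revert E. apply Cmult_neq_0; [|exact H]. intros E. apply omega3_neq_1, Ceq_minus, E.
Qed.

(** With [E] the exponential at [w / 3], the denominator [E^3 - 1] factors over the cube roots of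
    unity and its reciprocal splits into partial fractions. Three pieces, unlike two, keep the
    evaluation points symmetric around [w]. *)
Lemma pi_coth_tripling w : 0 < Re w ->
  (3 * pi_coth w)%C = (pi_coth (w / 3) + pi_coth ((w + Ci) / 3) + pi_coth ((w - Ci) / 3))%C.
Proof.
  intros Hw. unfold pi_coth. pose proof omega3_cube as W3. pose proof omega3_quadratic as W2.
  set (E := Cexp (2 * PI * (w / 3))).
  assert (E0 : Cexp (2 * PI * w) = (E * E * E)%C).
  { unfold E. rewrite <- 2!Cexp_plus. f_equal. field; try apply C3_neq_0. }
  assert (E1 : Cexp (2 * PI * ((w + Ci) / 3)) = (E * omega3)%C).
  { unfold E, omega3. rewrite <- Cexp_plus. f_equal. field; try apply C3_neq_0. }
  assert (E2 : Cexp (2 * PI * ((w - Ci) / 3)) = (E * (omega3 * omega3))%C).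
  { transitivity (E * Cexp (- (2 * PI * (Ci / 3))))%C.
    - unfold E. rewrite <- Cexp_plus. f_equal. field; try apply C3_neq_0.
    - f_equal. rewrite Cexp_opp. fold omega3.
      assert (omega3 <> 0) by apply Cexp_neq_0.
      replace (/ omega3)%C with (omega3 * omega3 * omega3 / omega3)%C by (rewrite W3; field; assumption).
      field; assumption. }
  pose proof (pi_coth_den w Hw) as D. rewrite E0, E1, E2 in *. clear E0 E1 E2.
  set (o := omega3) in *. clearbody o E.
  assert (F : (E * E * E - 1)%C = ((E - 1) * (E * o - 1) * (E * (o * o) - 1))%C).
  { transitivity (E * E * E * (o * o * o) - E * E * o * (1 + o + o * o) + E * (1 + o + o * o) - 1)%C; [rewrite W3, W2; ring | ].
    ring. }
  assert (D1 : (E - 1)%C <> 0) by (intros H; apply D; rewrite F, H; ring).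
  assert (D2 : (E * o - 1)%C <> 0) by (intros H; apply D; rewrite F, H; ring).
  assert (D3 : (E * (o * o) - 1)%C <> 0) by (intros H; apply D; rewrite F, H; ring).
  assert (G : (3 / (E * E * E - 1))%C = (/ (E - 1) + / (E * o - 1) + / (E * (o * o) - 1))%C).
  { rewrite F.
    replace (/ (E - 1) + / (E * o - 1) + / (E * (o * o) - 1))%C with
      ((E * E * (o * (1 + o + o * o)) - 2 * E * (1 + o + o * o) + 3) / ((E - 1) * (E * o - 1) * (E * (o * o) - 1)))%C.
    - rewrite W2. f_equal. ring.
    - field. repeat split; assumption. }
  unfold Cdiv in *.
  transitivity (3 * PI + 2 * PI * (3 * / (E * E * E - 1)))%C; [ring|]. rewrite G. ring.
Qed.

Definition Zsum (F : Z -> C) (a : Z) (n : nat) : C := Cpsum (fun k => F (a + Z.of_nat k)%Z) n.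

Lemma Cpsum_app a m n : Cpsum a (m + n) = (Cpsum a m + Cpsum (fun k => a (m + k)%nat) n)%C.
Proof.
  induction n as [|n IH].
  - rewrite Nat.add_0_r. simpl. ring.
  - rewrite Nat.add_succ_r. simpl. rewrite IH. ring.
Qed.

Lemma Zsum_app F a m n : Zsum F a (m + n) = (Zsum F a m + Zsum F (a + Z.of_nat m) n)%C.
Proof.
  unfold Zsum. rewrite Cpsum_app. f_equal. apply Cpsum_ext. intros k _. f_equal. lia.
Qed.

Lemma Zsum_shift F a b n : Zsum F (a + b) n = Zsum (fun m => F (m + b)%Z) a n.
Proof. apply Cpsum_ext. intros k _. f_equal. lia. Qed.

Lemma Zsum_symmetric F M :
  Zsum F (- Z.of_nat M) (2 * M + 1) =
  (F 0%Z + Cpsum (fun k => F (Z.of_nat (S k)) + F (- Z.of_nat (S k))%Z) M)%C.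
Proof.
  induction M as [|M IH].
  - unfold Zsum; simpl. ring.
  - replace (2 * S M + 1)%nat with (1 + ((2 * M + 1) + 1))%nat by lia.
    rewrite Zsum_app, Zsum_app.
    replace (- Z.of_nat (S M) + Z.of_nat 1)%Z with (- Z.of_nat M)%Z by lia.
    rewrite IH. replace (- Z.of_nat M + Z.of_nat (2 * M + 1))%Z with (Z.of_nat (S M)) by lia.
    unfold Zsum. cbn [Cpsum]. change (Z.of_nat 0) with 0%Z. rewrite !Z.add_0_r. ring.
Qed.

(** The range from [-(3 M + 1)] to [3 M + 1] consists of the central range of length [2 M + 1] and
    its two translates by that length. *)
Lemma Zsum_triple F M :
  Zsum F (- Z.of_nat (3 * M + 1)) (2 * (3 * M + 1) + 1) =
  Zsum (fun m => F m + F (m + (2 * Z.of_nat M + 1))%Z + F (m - (2 * Z.of_nat M + 1))%Z)%C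
    (- Z.of_nat M) (2 * M + 1).
Proof.
  replace (2 * (3 * M + 1) + 1)%nat with ((2 * M + 1) + ((2 * M + 1) + (2 * M + 1)))%nat by lia.
  rewrite (Zsum_app F _ (2 * M + 1) (2 * M + 1 + (2 * M + 1))), (Zsum_app F _ (2 * M + 1) (2 * M + 1)).
  replace (- Z.of_nat (3 * M + 1))%Z with (- Z.of_nat M + - (2 * Z.of_nat M + 1))%Z by lia.
  rewrite Zsum_shift.
  replace (- Z.of_nat M + - (2 * Z.of_nat M + 1) + Z.of_nat (2 * M + 1))%Z with (- Z.of_nat M)%Z by lia.
  replace (- Z.of_nat M + Z.of_nat (2 * M + 1))%Z with (- Z.of_nat M + (2 * Z.of_nat M + 1))%Z by lia.
  rewrite Zsum_shift. unfold Zsum. rewrite Cplus_assoc, <- !Cpsum_plus. apply Cpsum_ext. intros k _.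
  replace (- Z.of_nat M + Z.of_nat k + - (2 * Z.of_nat M + 1))%Z with
    (- Z.of_nat M + Z.of_nat k - (2 * Z.of_nat M + 1))%Z by lia. ring.
Qed.

(** [half3 p] is [(3^p - 1) / 2]: exactly [3^p] integers have absolute value at most [half3 p]. *)
Fixpoint half3 (p : nat) : nat := match p with O => O | S p' => 3 * half3 p' + 1 end.

Lemma half3_pow p : INR (2 * half3 p + 1) = 3 ^ p.
Proof.
  induction p as [|p IH]; [simpl; lra|].
  change (half3 (S p)) with (3 * half3 p + 1)%nat. rewrite <- tech_pow_Rmult, <- IH.
  rewrite !plus_INR, !mult_INR, plus_INR, mult_INR. simpl. ring.
Qed.

Lemma half3_ge p : (p <= half3 p)%nat.
Proof. induction p as [|p IH]; [reflexivity|]. change (half3 (S p)) with (3 * half3 p + 1)%nat. lia. Qed.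

Lemma pow3_neq_0 p : RtoC (3 ^ p) <> 0.
Proof. intros H. apply RtoC_inj in H. revert H. apply pow_nonzero. lra. Qed.

Definition cpt (w : C) (p : nat) (m : Z) : C := ((w + IZR m * Ci) / (3 ^ p)%R)%C.

Lemma Re_cpt w p m : Re (cpt w p m) = Re w / 3 ^ p.
Proof.
  unfold cpt. rewrite Re_div_R by (apply pow_nonzero; lra). f_equal. unfold Re; simpl; ring.
Qed.

Lemma Im_cpt w p m : Im (cpt w p m) = (Im w + IZR m) / 3 ^ p.
Proof.
  unfold cpt. rewrite Im_div_R by (apply pow_nonzero; lra). f_equal. unfold Im; simpl; ring.
Qed.

Lemma Re_cpt_pos w p m : 0 < Re w -> 0 < Re (cpt w p m).
Proof. intros H. rewrite Re_cpt. apply Rdiv_lt_0_compat; [exact H | apply pow_lt; lra]. Qed.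

(* Iterating the tripling formula: the terms are [pi_coth] near 0, so replacing
   [pi_coth] by [1 / u] plus a Lipschitz error gives the partial fractions as
   [p] tends to infinity. *)
Lemma pi_coth_average w p : 0 < Re w ->
  ((3 ^ p)%R * pi_coth w)%C = Zsum (fun m => pi_coth (cpt w p m)) (- Z.of_nat (half3 p)) (2 * half3 p + 1).
Proof.
  intros Hw. induction p as [|p IH].
  - unfold Zsum; simpl. replace (cpt w 0 0) with w; [ring|].
    unfold cpt; simpl. field.
  - change (half3 (S p)) with (3 * half3 p + 1)%nat. rewrite Zsum_triple.
    replace ((3 ^ S p)%R * pi_coth w)%C with (3 * ((3 ^ p)%R * pi_coth w))%C
      by (rewrite <- tech_pow_Rmult, RtoC_mult; ring).
    rewrite IH. unfold Zsum. rewrite <- Cpsum_scal. apply Cpsum_ext. intros k _.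
    set (m := (- Z.of_nat (half3 p) + Z.of_nat k)%Z).
    rewrite (pi_coth_tripling _ (Re_cpt_pos w p m Hw)).
    assert (HN : IZR (2 * Z.of_nat (half3 p) + 1) = 3 ^ p).
    { rewrite <- half3_pow, plus_IZR, mult_IZR, <- INR_IZR_INZ, plus_INR, mult_INR. simpl. ring. }
    pose proof (pow3_neq_0 p). pose proof C3_neq_0.
    assert (H3 : RtoC (3 ^ S p) = (3 * (3 ^ p)%R)%C) by (rewrite <- tech_pow_Rmult, RtoC_mult; reflexivity).
    f_equal; [f_equal|]; f_equal; unfold cpt; rewrite H3.
    + field; auto.
    + rewrite plus_IZR, HN, RtoC_plus. field; auto.
    + rewrite minus_IZR, HN, RtoC_minus. field; auto.
Qed.

(** [pi_coth] without its pole at 0. Its remaining singularities are the nonzero integer multiples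
    of [Ci], which explains the strips [|Im u| <= 3 / 4] below. *)
Definition coth_reg (u : C) : C := (pi_coth u - / u)%C.

(** Slope 1/2 holds up to [PI / 2]; beyond it [PI - s >= s / 3], because [s <= 3 PI / 4], and slope
    1/6 is left. *)
Lemma Rabs_sin_lower t : Rabs t <= 3 * PI / 4 -> Rabs t / 6 <= Rabs (sin t).
Proof.
  assert (B : forall t, 0 <= t <= PI / 2 -> t / 2 <= sin t).
  { intros x Hx. pose proof PI_bounds. assert (x <= 4) by lra. destruct (pre_sin_bound x 0 (proj1 Hx)) as [H1 _]; [lra|].
    unfold sin_approx, sin_term in H1. simpl in H1. eapply Rle_trans; [|exact H1].
    replace (1 * (x * 1 / 1) + -1 * 1 * (x * (x * (x * 1)) / (1 + 1 + 1 + 1 + 1 + 1))) with (x * (1 - x ^ 2 / 6)) by field.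
    assert (x ^ 2 <= 3); [|nra].
    nra. }
  intros H. assert (G : forall s, 0 <= s <= 3 * PI / 4 -> s / 6 <= sin s).
  { intros s Hs. destruct (Rle_dec s (PI / 2)) as [Hs2|Hs2].
    - specialize (B s). lra.
    - rewrite <- sin_PI_x. specialize (B (PI - s)). lra. }
  destruct (Rle_dec 0 t) as [Ht|Ht].
  - rewrite (Rabs_pos_eq t) in * by assumption. eapply Rle_trans; [|apply Rle_abs]. apply G. lra.
  - rewrite <- (Rabs_Ropp (sin t)), <- sin_neg, <- (Rabs_Ropp t). rewrite <- Rabs_Ropp in H.
    rewrite (Rabs_pos_eq (- t)) in * by lra. eapply Rle_trans; [|apply Rle_abs]. apply G. lra.
Qed.

(** For [v = a + i b], [|e^v - 1|^2 = (e^a - 1)^2 + 4 e^a sin^2 (b / 2)]. The bound [3 pi / 2] on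
    [|b|] keeps away from the next zeros at [2 pi i] and [-2 pi i]. *)
Lemma Cexp_sub1_lower v r : Rabs (Im v) <= 3 * PI / 2 -> Cmod v <= r ->
  exp (- r) / 6 * Cmod v <= Cmod (Cexp v - 1).
Proof.
  intros Hi Hr. set (a := Re v). set (b := Im v) in *.
  assert (Ha : Rabs a <= r) by (eapply Rle_trans; [apply re_le_Cmod | exact Hr]).
  assert (Hr0 : 0 <= r) by (eapply Rle_trans; [apply Rabs_pos | exact Ha]).
  set (E := exp (- r)). assert (HE : 0 < E) by apply exp_pos.
  assert (HE1 : E <= 1).
  { unfold E. rewrite <- exp_0. destruct (Req_dec r 0) as [->|]; [rewrite Ropp_0; lra|].
    apply Rlt_le, exp_increasing. lra. }
  apply Rabs_le_between in Ha.
  assert (Hea : E <= exp a).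
  { unfold E. destruct (Req_dec a (- r)) as [->|]; [lra|]. apply Rlt_le, exp_increasing. lra. }
  assert (H1 : E * Rabs a <= Rabs (exp a - 1)).
  { destruct (Rle_dec 0 a) as [Ha0|Ha0].
    - rewrite (Rabs_pos_eq a) by assumption. eapply Rle_trans; [|apply Rle_abs].
      pose proof (exp_ineq1_le a). nra.
    - rewrite (Rabs_left a), Rabs_left1 by (try lra; rewrite <- exp_0; apply Rlt_le, Rlt_minus, exp_increasing; lra).
      pose proof (exp_ineq1_le (- a)) as H. pose proof (exp_Ropp a) as H'.
      assert (exp a * exp (- a) = 1) by (rewrite H'; field; apply Rgt_not_eq, exp_pos).
      pose proof (exp_pos a). nra. }
  assert (H2 : Rabs b / 12 <= Rabs (sin (b / 2))).
  { pose proof (Rabs_sin_lower (b / 2)) as H.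
    assert (Hb : Rabs (b / 2) = Rabs b / 2) by (unfold Rdiv; rewrite Rabs_mult, (Rabs_pos_eq (/ 2)); lra).
    rewrite Hb in H. assert (Rabs b / 2 <= 3 * PI / 4) by lra. specialize (H H0). lra. }
  assert (N1 : Cmod (Cexp v - 1) ^ 2 = (exp a - 1) ^ 2 + 4 * exp a * sin (b / 2) ^ 2).
  { rewrite Cmod2_alt. unfold Cexp. simpl. fold a b.
    pose proof (sin2_cos2 b) as SC. unfold Rsqr in SC.
    assert (CB : cos b = 1 - 2 * sin (b / 2) * sin (b / 2)).
    { replace b with (2 * (b / 2)) at 1 by field. apply cos_2a_sin. }
    replace ((exp a * cos b + - (1)) * ((exp a * cos b + - (1)) * 1) + (exp a * sin b + - 0) * ((exp a * sin b + - 0) * 1))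
      with (exp a * exp a * (sin b * sin b + cos b * cos b) - 2 * exp a * cos b + 1) by ring.
    rewrite SC, CB. ring. }
  assert (N2 : Cmod v ^ 2 = a ^ 2 + b ^ 2) by apply Cmod2_alt.
  pose proof (Cmod_ge_0 v). pose proof (Cmod_ge_0 (Cexp v - 1)).
  apply Rsqr_incr_0_var; [|assumption]. unfold Rsqr.
  assert (G1 : E ^ 2 * a ^ 2 <= (exp a - 1) ^ 2).
  { rewrite <- (pow2_abs a), <- (pow2_abs (exp a - 1)), <- Rpow_mult_distr. apply pow_incr.
    split; [|exact H1]. pose proof (Rabs_pos a). nra. }
  assert (G2 : b ^ 2 / 144 <= sin (b / 2) ^ 2).
  { rewrite <- (pow2_abs b), <- (pow2_abs (sin _)). pose proof (Rabs_pos b). nra. }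
  assert (G3 : E * E * (b ^ 2 / 144) <= exp a * sin (b / 2) ^ 2).
  { pose proof (pow2_ge_0 b). apply Rmult_le_compat; nra. }
  simpl in *. nra.
Qed.

(** With [v = 2 pi u], [coth_reg u] is [pi - 2 pi exp_tail 2 v / exp_tail 1 v], a quotient of entire
    functions whose denominator is bounded below by [Cexp_sub1_lower]. The two points lie on
    opposite sides of the imaginary axis because the bound is applied to a sample point and the
    opposite of its mirror image, where oddness turns the difference into a sum. *)
Lemma coth_reg_lipschitz (r : R) (u u' : C) :
  0 < Re u -> Re u' < 0 -> Rabs (Im u) <= 3 / 4 -> Rabs (Im u') <= 3 / 4 ->
  Cmod u <= r -> Cmod u' <= r ->
  Cmod (coth_reg u - coth_reg u') <=
    2 * PI * (72 * exp (4 * (2 * PI * r)) * (2 * PI)) * Cmod (u - u').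
Proof.
  intros Hu Hu' Hi Hi' Hr Hr'. pose proof PI_RGT_0 as HPI.
  set (v := (2 * PI * u)%C). set (v' := (2 * PI * u')%C). set (r2 := 2 * PI * r).
  assert (Hmod : forall x : C, Cmod (2 * PI * x)%C = 2 * PI * Cmod x).
  { intros x. rewrite <- RtoC_mult, Cmod_mult, Cmod_R, Rabs_pos_eq by lra. reflexivity. }
  assert (D : forall x, Re x <> 0 -> Cmod x <= r -> Rabs (Im x) <= 3 / 4 ->
    coth_reg x = (PI - 2 * PI * (exp_tail 2 (2 * PI * x) / exp_tail 1 (2 * PI * x)))%C /\
    exp (- r2) / 6 <= Cmod (exp_tail 1 (2 * PI * x))).
  { intros x Hx Hxr Hxi.
    assert (x0 : x <> 0) by (intros E; rewrite E in Hx; simpl in Hx; lra).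
    set (y := (2 * PI * x)%C).
    assert (y0 : y <> 0).
    { apply Cmod_gt_0. unfold y. rewrite Hmod. apply Cmod_gt_0 in x0. nra. }
    assert (L : exp (- r2) / 6 <= Cmod (exp_tail 1 y)).
    { pose proof (Cexp_sub1_lower y r2) as B. rewrite Cexp_expand1 in B.
      replace (1 + y * exp_tail 1 y - 1)%C with (y * exp_tail 1 y)%C in B by ring.
      rewrite Cmod_mult in B. apply (Rmult_le_reg_l (Cmod y)); [apply Cmod_gt_0, y0|].
      rewrite (Rmult_comm (Cmod y) (_ / 6)). apply B.
      - unfold y. rewrite Im_2PI_mult, Rabs_mult, (Rabs_pos_eq (2 * PI)) by lra. nra.
      - unfold y. rewrite Hmod. unfold r2. nra. }
    split; [|exact L].
    assert (P0 : exp_tail 1 y <> 0).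
    { apply Cmod_gt_0. pose proof (exp_pos (- r2)). lra. }
    unfold coth_reg, pi_coth. fold y. rewrite Cexp_expand1.
    replace (1 + y * exp_tail 1 y - 1)%C with (y * exp_tail 1 y)%C by ring.
    assert (T1 : exp_tail 1 y = (1 + y * exp_tail 2 y)%C).
    { rewrite exp_tail_S. simpl. f_equal. field. }
    replace (/ x)%C with (2 * PI / y)%C.
    2:{ unfold y. field. repeat split; auto; intros E; apply RtoC_inj in E; lra. }
    rewrite T1 in P0 |- *. field. split; assumption. }
  destruct (D u) as [E L]; [lra | assumption | assumption |].
  destruct (D u') as [E' L']; [lra | assumption | assumption |].
  rewrite E, E'. fold v v' in E, E', L, L' |- *. clear D.
  pose proof (exp_pos (- r2)) as Hep.
  assert (P0 : exp_tail 1 v <> 0) by (apply Cmod_gt_0; lra).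
  assert (P0' : exp_tail 1 v' <> 0) by (apply Cmod_gt_0; lra).
  assert (Hv : Cmod v <= r2) by (unfold v; rewrite Hmod; unfold r2; nra).
  assert (Hv' : Cmod v' <= r2) by (unfold v'; rewrite Hmod; unfold r2; nra).
  replace (_ - _)%C with
    (2 * PI * ((exp_tail 2 v' * (exp_tail 1 v - exp_tail 1 v') - exp_tail 1 v' * (exp_tail 2 v - exp_tail 2 v'))
       / (exp_tail 1 v * exp_tail 1 v')))%C by (field; split; assumption).
  rewrite Hmod, Cmod_div by (apply Cmult_neq_0; assumption).
  replace (2 * PI * (72 * exp (4 * r2) * (2 * PI)) * Cmod (u - u'))
    with (2 * PI * (72 * exp (4 * r2) * (2 * PI * Cmod (u - u')))) by ring.
  apply Rmult_le_compat_l; [lra|]. rewrite <- Hmod.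
  replace (2 * PI * (u - u'))%C with (v - v')%C by (unfold v, v'; ring).
  set (X := Cmod (v - v')). pose proof (Cmod_ge_0 (v - v')) as HX. fold X in HX.
  assert (EV : forall j x, Cmod x <= r2 -> Cmod (exp_tail j x) <= exp r2).
  { intros j x Hx. eapply Rle_trans; [apply exp_tail_bound|].
    destruct Hx as [Hx|Hx]; [apply Rlt_le, exp_increasing, Hx | rewrite Hx; lra]. }
  assert (Num : Cmod (exp_tail 2 v' * (exp_tail 1 v - exp_tail 1 v') - exp_tail 1 v' * (exp_tail 2 v - exp_tail 2 v'))%C
    <= 2 * exp r2 * exp r2 * X).
  { eapply Rle_trans; [apply Cmod_triangle_minus|]. rewrite 2!Cmod_mult.
    pose proof (exp_tail_lipschitz 1 v v' r2 Hv Hv'). pose proof (exp_tail_lipschitz 2 v v' r2 Hv Hv').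
    replace (2 * exp r2 * exp r2 * X) with (exp r2 * (exp r2 * X) + exp r2 * (exp r2 * X)) by ring.
    apply Rplus_le_compat; apply Rmult_le_compat; auto using Cmod_ge_0. }
  rewrite (Cmod_mult (exp_tail 1 v)).
  set (A := Cmod (exp_tail 1 v)) in *. set (B := Cmod (exp_tail 1 v')) in *.
  assert (HAB : (exp (- r2) / 6) * (exp (- r2) / 6) <= A * B) by (apply Rmult_le_compat; lra).
  assert (0 < A * B) by nra.
  apply (Rmult_le_reg_r (A * B)); [assumption|]. unfold Rdiv at 1.
  rewrite (Rmult_assoc _ (/ (A * B))), Rinv_l, Rmult_1_r by lra.
  eapply Rle_trans; [exact Num|].
  assert (Hee : exp r2 * exp (- r2) = 1) by (rewrite exp_Ropp; field; apply Rgt_not_eq, exp_pos).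
  replace (exp (4 * r2)) with (exp r2 * exp r2 * (exp r2 * exp r2)) by (rewrite <- !exp_plus; f_equal; ring).
  set (e := exp r2) in *. set (f := exp (- r2)) in *. assert (0 < e) by apply exp_pos.
  (* 72 is twice the square of 6: two Lipschitz terms in the numerator, two lower bounds
     [exp (- r2) / 6] in the denominator. *)
  assert (G : 2 <= 72 * (e * e) * (A * B)).
  { apply Rle_trans with (72 * (e * e) * (f / 6 * (f / 6))).
    - replace (72 * (e * e) * (f / 6 * (f / 6))) with (2 * (e * f) * (e * f)) by field. rewrite Hee. lra.
    - apply Rmult_le_compat_l; nra. }
  replace (72 * (e * e * (e * e)) * X * (A * B)) with ((e * e * X) * (72 * (e * e) * (A * B))) by ring.
  replace (2 * e * e * X) with ((e * e * X) * 2) by ring.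
  apply Rmult_le_compat_l; [|exact G]. apply Rmult_le_pos; nra.
Qed.

(** Opposite integers are paired: each term alone is of order [1 / k], the pair is of order
    [1 / k^2]. *)
Definition coth_pair (w : C) (k : nat) : C :=
  (/ (w + INR (S k) * Ci) + / (w - INR (S k) * Ci))%C.

Lemma lattice_neq_0 z (l m : R) : 0 < Re z -> 0 <= l -> 0 < l + Rabs m -> (l * z + m * Ci)%C <> 0.
Proof.
  intros Hz Hl Hm. apply Cmod_gt_0. eapply Rlt_le_trans; [|apply lattice_lower_bound; assumption].
  apply Rmult_lt_0_compat; [apply lattice_const_pos, Hz | exact Hm].
Qed.

Lemma Re_shift w (t : R) : Re (w + t * Ci) = Re w.
Proof. rewrite re_plus, re_mult_Ci. simpl. ring. Qed.

Lemma shift_plus_neq_0 w (t : R) : 0 < Re w -> (w + t * Ci)%C <> 0.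
Proof. intros H. apply Re_pos_neq_0. rewrite Re_shift; exact H. Qed.

Lemma shift_minus_neq_0 w (t : R) : 0 < Re w -> (w - t * Ci)%C <> 0.
Proof. intros H. apply Re_pos_neq_0. replace (w - t * Ci)%C with (w + (- t)%R * Ci)%C by (rewrite RtoC_opp; ring). rewrite Re_shift; exact H. Qed.

Lemma shift_plus_lower w (t : R) : 0 < Re w -> lattice_const w * (1 + Rabs t) <= Cmod (w + t * Ci).
Proof.
  intros H. replace (w + t * Ci)%C with (1%R * w + t * Ci)%C by ring.
  apply lattice_lower_bound; [exact H | lra].
Qed.

Lemma shift_minus_lower w (t : R) : 0 < Re w -> lattice_const w * (1 + Rabs t) <= Cmod (w - t * Ci).
Proof.
  intros H. replace (w - t * Ci)%C with (w + (- t)%R * Ci)%C by (rewrite RtoC_opp; ring).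
  rewrite <- Rabs_Ropp. apply shift_plus_lower, H.
Qed.

Lemma coth_pair_bound w k : 0 < Re w ->
  Cmod (coth_pair w k) <= 2 * Cmod w * / lattice_const w ^ 2 * / (INR k + 1) ^ 2.
Proof.
  intros H. pose proof (shift_plus_neq_0 w (INR (S k)) H) as N1.
  pose proof (shift_minus_neq_0 w (INR (S k)) H) as N2.
  unfold coth_pair.
  replace (_ + _)%C with (2 * w / ((w + INR (S k) * Ci) * (w - INR (S k) * Ci)))%C
    by (field; split; assumption).
  rewrite Cmod_div by (apply Cmult_neq_0; assumption).
  rewrite 2!Cmod_mult, Cmod_R, Rabs_pos_eq by lra. unfold Rdiv. rewrite (Rmult_assoc (2 * Cmod w)).
  pose proof (Cmod_ge_0 w). apply Rmult_le_compat_l; [lra|].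
  pose proof (lattice_const_pos w H) as Hk. pose proof (pos_INR k).
  rewrite <- Rinv_mult, <- Rpow_mult_distr. apply Rinv_le_contravar; [apply pow_lt; nra|].
  replace ((lattice_const w * (INR k + 1)) ^ 2)
    with ((lattice_const w * (INR k + 1)) * (lattice_const w * (INR k + 1))) by ring.
  pose proof (shift_plus_lower w (INR (S k)) H) as B1. pose proof (shift_minus_lower w (INR (S k)) H) as B2.
  rewrite S_INR, Rabs_pos_eq in B1, B2 by lra. rewrite S_INR.
  apply Rmult_le_compat; nra.
Qed.

Lemma coth_pair_summable w : 0 < Re w -> Csummable (coth_pair w).
Proof.
  intros H. eapply Csummable_le; [intros k; apply coth_pair_bound, H|].
  apply (ex_series_scal_l (2 * Cmod w * / lattice_const w ^ 2) _ ex_series_inv_sq).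
Qed.

Lemma Cexp_neg_2PI (u : C) : Cexp (2 * PI * - u) = (/ Cexp (2 * PI * u))%C.
Proof. rewrite <- Cexp_opp. f_equal. ring. Qed.

Lemma coth_reg_odd u : 0 < Re u -> coth_reg (- u) = (- coth_reg u)%C.
Proof.
  intros H. unfold coth_reg, pi_coth. rewrite Cexp_neg_2PI.
  pose proof (pi_coth_den u H). pose proof (Cexp_neq_0 (2 * PI * u)).
  pose proof (Re_pos_neq_0 u H). set (e := Cexp (2 * PI * u)) in *.
  assert (1 - e <> 0)%C.
  { intros E. apply H0. replace (e - 1)%C with (- (1 - e))%C by ring. rewrite E. ring. }
  field. repeat split; auto.
Qed.

Lemma coth_partial_fractions w : 0 < Re w -> pi_coth w = (/ w + Csum (coth_pair w))%C.
Proof.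
  intros Hw. pose proof (Cmod_ge_0 w) as Hw0. pose proof (Re_pos_neq_0 w Hw) as wn0.
  set (r := Cmod w + 1).
  set (K := 2 * PI * (72 * exp (4 * (2 * PI * r)) * (2 * PI))).
  assert (HK : 0 <= K).
  { unfold K. pose proof PI_RGT_0. pose proof (exp_pos (4 * (2 * PI * r))).
    replace (2 * PI * (72 * exp (4 * (2 * PI * r)) * (2 * PI))) with (288 * (PI * PI * exp (4 * (2 * PI * r)))) by ring.
    apply Rmult_le_pos; [lra|]. apply Rmult_le_pos; nra. }
  assert (L1 : Clim (fun p => Cpsum (coth_pair w) (half3 p)) (Csum (coth_pair w))).
  { pose proof (Clim_Cpsum _ (coth_pair_summable w Hw)) as L. unfold Clim in L |- *.
    apply (is_lim_seq_subseq _ _ half3) in L; [exact L|].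
    apply eventually_subseq_loc. exists O. intros n _. change (half3 (S n)) with (3 * half3 n + 1)%nat. lia. }
  assert (L2 : Clim (fun p => Cpsum (coth_pair w) (half3 p)) (pi_coth w - / w)%C).
  (* From [p0] on, [|Im w| <= half3 p / 4], which keeps all sample points in the strip
     [|Im| <= 3 / 4] of the Lipschitz bound. *)
  { destruct (INR_unbounded (4 * Rabs (Im w))) as [p0 Hp0].
    apply (Clim_bound_eventually _ _ (fun p => K * Cmod w * (/ 3) ^ p) p0).
    2:{ replace 0 with (K * Cmod w * 0) by ring. apply (is_lim_seq_scal_l _ (K * Cmod w) 0).
        apply is_lim_seq_geom. rewrite Rabs_pos_eq; lra. }
    intros p Hp. set (N := 3 ^ p). set (M := half3 p).
    assert (HN : N = 2 * INR M + 1).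
    { unfold N. rewrite <- half3_pow, plus_INR, mult_INR. simpl. reflexivity. }
    assert (HMp : 4 * Rabs (Im w) <= INR M).
    { apply Rlt_le. eapply Rlt_le_trans; [exact Hp0|]. apply le_INR. unfold M. pose proof (half3_ge p). lia. }
    pose proof (Rabs_pos (Im w)). assert (HN1 : 1 <= N) by lra.
    assert (N0 : RtoC N <> 0) by (intros E; apply RtoC_inj in E; lra).
    set (up := fun m => cpt w p m).
    assert (Hup : forall m, up m = ((w + IZR m * Ci) / N)%C) by reflexivity.
    assert (Hn0 : forall m, (w + IZR m * Ci)%C <> 0) by (intros; apply shift_plus_neq_0, Hw).
    assert (Bim : forall m, Rabs (IZR m) <= INR M -> Rabs (Im (up m)) <= 3 / 4).
    { intros m Hm. unfold up. rewrite Im_cpt. fold N. unfold Rdiv. rewrite Rabs_mult, (Rabs_pos_eq (/ N)).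
      - apply (Rmult_le_reg_r N); [lra|]. rewrite Rmult_assoc, Rinv_l, Rmult_1_r by lra.
        eapply Rle_trans; [apply Rabs_triang|]. lra.
      - apply Rlt_le, Rinv_0_lt_compat. lra. }
    assert (Bmod : forall m, Rabs (IZR m) <= INR M -> Cmod (up m) <= r).
    { intros m Hm. rewrite Hup, Cmod_div, Cmod_R, (Rabs_pos_eq N) by (auto; lra).
      apply (Rmult_le_reg_r N); [lra|]. unfold Rdiv. rewrite Rmult_assoc, Rinv_l, Rmult_1_r by lra.
      eapply Rle_trans; [apply Cmod_triangle|]. rewrite Cmod_mult, Cmod_Ci, Cmod_R. unfold r. nra. }
    pose proof (pi_coth_average w p Hw) as Avg. rewrite Zsum_symmetric in Avg.
    fold N M in Avg.
    change (fun m => pi_coth (cpt w p m)) with (fun m => pi_coth (up m)) in Avg. cbv beta in Avg.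
    set (Er := fun k : nat => (coth_reg (up (Z.of_nat (S k))) + coth_reg (up (- Z.of_nat (S k))%Z))%C).
    assert (Split : Cpsum (fun k => pi_coth (cpt w p (Z.of_nat (S k))) + pi_coth (cpt w p (- Z.of_nat (S k))))%C M
       = (N * Cpsum (coth_pair w) M + Cpsum Er M)%C).
    { rewrite <- Cpsum_scal, <- Cpsum_plus. apply Cpsum_ext. intros k _.
      unfold Er, coth_reg, coth_pair. fold (up (Z.of_nat (S k))) (up (- Z.of_nat (S k))%Z).
      rewrite 2!Hup. rewrite opp_IZR, <- INR_IZR_INZ, RtoC_opp.
      pose proof (shift_plus_neq_0 w (INR (S k)) Hw). pose proof (shift_minus_neq_0 w (INR (S k)) Hw).
      replace (w + - INR (S k) * Ci)%C with (w - INR (S k) * Ci)%C by ring.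
      field. repeat split; assumption. }
    rewrite Split in Avg.
    assert (H00 : pi_coth (cpt w p 0) = (N / w + coth_reg (up 0%Z))%C).
    { unfold coth_reg. fold (up 0%Z). rewrite Hup.
      replace (w + 0 * Ci)%C with w by ring. field. split; assumption. }
    rewrite H00 in Avg.
    assert (Eq : (Cpsum (coth_pair w) M - (pi_coth w - / w))%C = (- ((coth_reg (up 0%Z) + Cpsum Er M) / N))%C).
    { replace (pi_coth w) with ((N * pi_coth w) / N)%C by (field; assumption). rewrite Avg.
      field. split; assumption. }
    rewrite Eq, Cmod_opp, Cmod_div, Cmod_R, (Rabs_pos_eq N) by (auto; lra).
    (* Mirror points add up to [2 w / N], so by oddness a pair is a Lipschitz difference of size
       [2 K |w| / N]. The [half3 p] pairs, divided by [N], are again of order [1 / N]. *)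
    assert (BE : forall m, Rabs (IZR m) <= INR M -> Cmod (coth_reg (up m) + coth_reg (up (- m)%Z)) <= K * (2 * Cmod w / N)).
    { intros m Hm. pose proof (coth_reg_lipschitz r (up m) (- up (- m)%Z)) as Lip.
      rewrite coth_reg_odd in Lip by (apply Re_cpt_pos, Hw).
      replace (coth_reg (up m) - - coth_reg (up (- m)%Z))%C with (coth_reg (up m) + coth_reg (up (- m)%Z))%C in Lip by ring.
      replace (2 * Cmod w / N) with (Cmod (up m - - up (- m)%Z)).
      - assert (Hm' : Rabs (IZR (- m)) <= INR M) by (rewrite opp_IZR, Rabs_Ropp; exact Hm).
        apply Lip; auto.
        + apply Re_cpt_pos, Hw.
        + rewrite re_opp. pose proof (Re_cpt_pos w p (- m) Hw). unfold up. lra.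
        + rewrite im_opp, Rabs_Ropp. auto.
        + rewrite Cmod_opp. auto.
      - rewrite 2!Hup, opp_IZR, RtoC_opp.
        replace (_ - _)%C with (2%R * w / N)%C by (field; assumption).
        rewrite Cmod_div, Cmod_mult, 2!Cmod_R, 2!Rabs_pos_eq by (auto; lra). reflexivity. }
    assert (B0 : Cmod (coth_reg (up 0%Z)) <= K * (Cmod w / N)).
    { specialize (BE 0%Z). rewrite Rabs_R0 in BE. specialize (BE (pos_INR M)).
      change (- 0)%Z with 0%Z in BE.
      replace (coth_reg (up 0%Z) + coth_reg (up 0%Z))%C with (2%R * coth_reg (up 0%Z))%C in BE by ring.
      rewrite Cmod_mult, Cmod_R, Rabs_pos_eq in BE by lra. unfold Rdiv in *. lra. }
    assert (BS : Cmod (Cpsum Er M) <= INR M * (K * (2 * Cmod w / N))).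
    { apply Cmod_Cpsum_le. intros k Hk. apply (BE (Z.of_nat (S k))). rewrite <- INR_IZR_INZ, Rabs_pos_eq by apply pos_INR.
      apply le_INR. lia. }
    apply (Rmult_le_reg_r N); [lra|]. unfold Rdiv at 1. rewrite Rmult_assoc, Rinv_l, Rmult_1_r by lra.
    eapply Rle_trans; [apply Cmod_triangle|].
    eapply Rle_trans; [apply Rplus_le_compat; [exact B0 | exact BS]|].
    replace (K * Cmod w * (/ 3) ^ p * N) with (K * Cmod w).
    - apply Req_le. rewrite HN. field. lra.
    - unfold N. rewrite Rmult_assoc, <- Rpow_mult_distr. replace (/ 3 * 3) with 1 by field. rewrite pow1. ring. }
  pose proof (Clim_unique _ _ _ L1 L2) as E. rewrite E. ring.
Qed.

(** * Geometric series and uniqueness of power series coefficients *)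

Lemma Series_zero : Series (fun _ => 0) = 0.
Proof. rewrite (Series_ext _ (fun _ => 0 * 0)), Series_scal_l; [|intros]; ring. Qed.

Lemma Csum_0 : Csum (fun _ => RtoC 0) = 0.
Proof. apply C_eq; simpl; apply Series_zero. Qed.

Lemma Csummable_geom x : Cmod x < 1 -> Csummable (fun n => (x ^ n)%C).
Proof.
  intros H. apply (ex_series_ext (fun n => Cmod x ^ n)).
  - intros n. symmetry. apply Cmod_pow.
  - apply ex_series_geom. rewrite Rabs_pos_eq; [exact H | apply Cmod_ge_0].
Qed.

Lemma Csum_geom x : Cmod x < 1 -> Csum (fun n => (x ^ n)%C) = (/ (1 - x))%C.
Proof.
  intros H. pose proof (Csummable_geom x H) as Sx. pose proof (Csum_S _ Sx) as E.
  cbv beta in E. change (x ^ 0)%C with (RtoC 1) in E.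
  rewrite (Csum_ext (fun n => x ^ S n)%C (fun n => x * x ^ n)%C) in E by (intros; apply Cpow_S).
  rewrite Csum_scal in E by exact Sx.
  assert (D : (1 - x)%C <> 0).
  { intros H0. apply Ceq_minus in H0. rewrite <- H0, Cmod_1 in H. lra. }
  set (s := Csum _) in *.
  assert (E2 : (s * (1 - x))%C = 1) by (transitivity (s - x * s)%C; [ring | rewrite E at 1; ring]).
  replace s with ((s * (1 - x)) / (1 - x))%C by (field; exact D). rewrite E2. field; exact D.
Qed.

(** Agreement at real arguments suffices: the real and imaginary parts of the coefficients form real
    power series, to which the real identity theorem applies. *)
Lemma Cpower_series_unique (a b : nat -> C) (r : R) : 0 < r ->
  Csummable (fun j => ((r ^ j)%R * a j)%C) -> Csummable (fun j => ((r ^ j)%R * b j)%C) ->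
  (forall s : R, Rabs s <= r -> Csum (fun j => ((s ^ j)%R * a j)%C) = Csum (fun j => ((s ^ j)%R * b j)%C)) ->
  forall j, a j = b j.
Proof.
  intros Hr Ha Hb Hab.
  assert (G : forall (f : C -> R), (forall z, Rabs (f z) <= Cmod z) -> forall c : nat -> C,
    Csummable (fun j => ((r ^ j)%R * c j)%C) -> Rbar_lt 0 (CV_radius (fun j => f (c j)))).
  { intros f Hf c Hc. apply Rbar_lt_le_trans with r; [exact Hr|]. apply CV_disk_radius.
    eapply ex_series_dominated; [|exact Hc]. intros n; split; [apply Rabs_pos|].
    rewrite Rabs_mult, Cmod_mult, Cmod_R, Rmult_comm.
    apply Rmult_le_compat_l; [apply Rabs_pos | apply Hf]. }
  assert (Pa : forall s c, PSeries (fun j => Re (c j)) s = Re (Csum (fun j => ((s ^ j)%R * c j)%C))).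
  { intros s c. unfold PSeries, Csum. simpl. apply Series_ext. intros j. unfold Re. ring. }
  assert (Pb : forall s c, PSeries (fun j => Im (c j)) s = Im (Csum (fun j => ((s ^ j)%R * c j)%C))).
  { intros s c. unfold PSeries, Csum. simpl. apply Series_ext. intros j. unfold Im. ring. }
  intros j. apply C_eq.
  - apply (PSeries_ext_recip (fun j => Re (a j)) (fun j => Re (b j)));
      [apply (G Re re_le_Cmod); assumption | apply (G Re re_le_Cmod); assumption|].
    exists (mkposreal r Hr). intros s Hs. rewrite 2!Pa, Hab; [reflexivity|].
    unfold ball in Hs; simpl in Hs; unfold AbsRing_ball, abs, minus, plus, opp in Hs; simpl in Hs.
    rewrite Ropp_0, Rplus_0_r in Hs. apply Rlt_le, Hs.
  - apply (PSeries_ext_recip (fun j => Im (a j)) (fun j => Im (b j)));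
      [apply (G Im im_le_Cmod); assumption | apply (G Im im_le_Cmod); assumption|].
    exists (mkposreal r Hr). intros s Hs. rewrite 2!Pb, Hab; [reflexivity|].
    unfold ball in Hs; simpl in Hs; unfold AbsRing_ball, abs, minus, plus, opp in Hs; simpl in Hs.
    rewrite Ropp_0, Rplus_0_r in Hs. apply Rlt_le, Hs.
Qed.

(** * The Lipschitz formula *)

(** The exponent is [S j] because [(/ a) ^ S j] is the coefficient of [s^j] in [1 / (a - s)];
    [j = 0] gives back [coth_pair]. *)
Definition power_pair (w : C) (j k : nat) : C :=
  ((/ (w + INR (S k) * Ci)) ^ S j + (/ (w - INR (S k) * Ci)) ^ S j)%C.

Lemma resolvent_expansion (a : C) (s : R) : 0 < Re a -> Rabs s < Re a ->
  Csummable (fun j => ((s ^ j)%R * (/ a) ^ S j)%C) /\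
  Csum (fun j => ((s ^ j)%R * (/ a) ^ S j)%C) = (/ (a - s))%C.
Proof.
  intros Ha Hs. pose proof (Re_pos_neq_0 a Ha) as a0.
  assert (Hx : Cmod (s / a) < 1).
  { rewrite Cmod_div, Cmod_R by exact a0. apply Cmod_gt_0 in a0 as a1.
    apply (Rmult_lt_reg_r (Cmod a)); [exact a1|]. unfold Rdiv. rewrite Rmult_assoc, Rinv_l by lra.
    pose proof (Re_le_Cmod a). lra. }
  assert (E : forall j, (/ a * (s / a) ^ j)%C = ((s ^ j)%R * (/ a) ^ S j)%C).
  { intros j. unfold Cdiv. rewrite Cpow_mult_l, RtoC_pow, Cpow_S. ring. }
  pose proof (Csummable_geom _ Hx) as Sx. split.
  - eapply Csummable_ext; [exact E|]. apply Csummable_scal, Sx.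
  - rewrite <- (Csum_ext _ _ E), Csum_scal, Csum_geom by assumption.
    assert (a - s <> 0)%C.
    { apply Re_pos_neq_0. unfold Cminus. rewrite re_plus, re_opp. simpl. pose proof (Rle_abs s). lra. }
    field. split; assumption.
Qed.

Section Lipschitz.

Variable w : C.
Hypothesis Hw : 0 < Re w.
Let a := Re w.
Let kap := lattice_const w.
Let D := 4 * Cmod w * / kap ^ 2.

Lemma shift_inv_bounds (t : R) : Cmod (/ (w + t * Ci)) <= / a /\
  (forall k, Rabs t = INR (S k) -> Cmod (/ (w + t * Ci)) <= / kap * / (INR k + 1)).
Proof.
  pose proof (shift_plus_neq_0 w t Hw) as N. pose proof (lattice_const_pos w Hw) as Kp. fold kap in Kp.
  split.
  - rewrite Cmod_inv by exact N. apply Rinv_le_contravar; [exact Hw|].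
    eapply Rle_trans; [|apply Re_le_Cmod]. rewrite Re_shift. apply Rle_refl.
  - intros k Hk. rewrite Cmod_inv by exact N. rewrite <- Rinv_mult. pose proof (pos_INR k).
    apply Rinv_le_contravar; [nra|]. eapply Rle_trans; [|apply shift_plus_lower, Hw].
    rewrite Hk, S_INR. fold kap. nra.
Qed.

Lemma power_bound (t : R) k j : Rabs t = INR (S k) ->
  Cmod ((/ (w + t * Ci)) ^ S (S j)) <= / a ^ j * (/ kap ^ 2 * / (INR k + 1) ^ 2).
Proof.
  intros Ht. destruct (shift_inv_bounds t) as [B1 B2]. specialize (B2 k Ht).
  replace (S (S j)) with (j + 2)%nat by lia. rewrite Cpow_add_r, Cmod_mult, 2!Cmod_pow.
  pose proof (Cmod_ge_0 (/ (w + t * Ci))). rewrite <- pow_inv.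
  apply Rmult_le_compat; try (apply pow_le; assumption).
  - apply pow_incr; split; assumption.
  - rewrite <- 2!pow_inv, <- Rpow_mult_distr. apply pow_incr; split; assumption.
Qed.

(** For [j = 0] the decay in [k] comes from the pairing; for larger [j] two of the factors provide
    it and each other one is at most [1 / a]. Together with [|s| <= a / 2] this makes the bound
    geometric in [j]. *)
Lemma power_pair_term_bound (s : R) j k : Rabs s <= a / 2 ->
  Cmod ((s ^ j)%R * power_pair w j k) <= / (INR k + 1) ^ 2 * (D * (/ 2) ^ j).
Proof.
  intros Hs. pose proof (lattice_const_pos w Hw) as Kp. fold kap in Kp.
  pose proof (pos_INR k) as Pk. pose proof (Re_le_Cmod w) as Ra. fold a in Ra.
  assert (Ha : 0 < a) by exact Hw.
  assert (I1 : 0 < / (INR k + 1) ^ 2) by (apply Rinv_0_lt_compat, pow_lt; lra).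
  assert (I2 : 0 < / kap ^ 2) by (apply Rinv_0_lt_compat, pow_lt; lra).
  destruct j as [|j].
  - unfold power_pair. rewrite 2!Cpow_1_r. change (/ (w + _) + _)%C with (coth_pair w k).
    simpl (s ^ 0). rewrite Cmult_1_l. eapply Rle_trans; [apply coth_pair_bound, Hw|]. fold kap.
    unfold D. simpl (_ ^ 0). apply Rle_trans with (/ (INR k + 1) ^ 2 * (2 * Cmod w * / kap ^ 2)); [apply Req_le; ring|].
    apply Rmult_le_compat_l; [lra|]. nra.
  - rewrite Cmod_mult, Cmod_R, <- RPow_abs.
    assert (P : Cmod (power_pair w (S j) k) <= 2 * (/ a ^ j * (/ kap ^ 2 * / (INR k + 1) ^ 2))).
    { unfold power_pair. eapply Rle_trans; [apply Cmod_triangle|].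
      pose proof (power_bound (INR (S k)) k j (Rabs_pos_eq _ (pos_INR _))) as Q1.
      pose proof (power_bound (- INR (S k)) k j) as Q2. rewrite Rabs_Ropp in Q2.
      specialize (Q2 (Rabs_pos_eq _ (pos_INR _))).
      replace (w + (- INR (S k))%R * Ci)%C with (w - INR (S k) * Ci)%C in Q2 by (rewrite RtoC_opp; ring).
      lra. }
    assert (Ps : Rabs s ^ S j <= (a / 2) ^ S j) by (apply pow_incr; split; [apply Rabs_pos | exact Hs]).
    eapply Rle_trans; [apply Rmult_le_compat; [apply pow_le, Rabs_pos | apply Cmod_ge_0 | exact Ps | exact P]|].
    replace ((a / 2) ^ S j * (2 * (/ a ^ j * (/ kap ^ 2 * / (INR k + 1) ^ 2))))
      with (/ (INR k + 1) ^ 2 * (/ kap ^ 2 * (2 * a)) * (/ 2) ^ S j).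
    + unfold D. rewrite Rmult_assoc. apply Rmult_le_compat_l; [lra|].
      apply Rmult_le_compat_r; [apply pow_le; lra|]. nra.
    + unfold Rdiv. rewrite Rpow_mult_distr. simpl. field. repeat split; try lra. apply pow_nonzero; lra.
Qed.

Lemma dominate_rows : forall k : nat, ex_series (fun j => / (INR k + 1) ^ 2 * (D * (/ 2) ^ j)).
Proof.
  intros k. apply (ex_series_scal_l (/ (INR k + 1) ^ 2) (fun j => D * (/ 2) ^ j)), (ex_series_scal_l D (fun j => (/ 2) ^ j)), ex_series_geom.
  rewrite Rabs_pos_eq; lra.
Qed.

Lemma dominate_sums : ex_series (fun k => Series (fun j => / (INR k + 1) ^ 2 * (D * (/ 2) ^ j))).
Proof.
  apply (ex_series_ext (fun k => / (INR k + 1) ^ 2 * Series (fun j => D * (/ 2) ^ j))).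
  - intros k. symmetry. apply (Series_scal_l (/ (INR k + 1) ^ 2)).
  - apply ex_series_scal_r, ex_series_inv_sq.
Qed.

Lemma power_pair_summable_scaled (s : R) j : Rabs s <= a / 2 ->
  Csummable (fun k => ((s ^ j)%R * power_pair w j k)%C).
Proof.
  intros Hs. apply (Csummable_col (fun k j => ((s ^ j)%R * power_pair w j k)%C) _
    (fun k j => power_pair_term_bound s j k Hs) dominate_rows dominate_sums).
Qed.

Lemma power_pair_summable j : Csummable (power_pair w j).
Proof.
  assert (Ha : 0 < a) by exact Hw.
  pose proof (power_pair_summable_scaled (a / 2) j) as H.
  rewrite Rabs_pos_eq in H by lra. specialize (H (Rle_refl _)).
  apply (Csummable_scal (/ ((a / 2) ^ j)%R)%C) in H.
  eapply Csummable_ext; [|exact H]. intros k. cbv beta. field.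
  intros E. apply RtoC_inj in E. revert E. apply pow_nonzero. lra.
Qed.

(** The sum of [(w + i m)^(-j-1)] over all integers [m], which is the coefficient of [s^j] in
    [pi_coth (w - s)] read off the partial fractions. *)
Definition lattice_coeff (j : nat) : C := ((/ w) ^ S j + Csum (power_pair w j))%C.

Lemma coth_lattice_expansion (s : R) : Rabs s <= a / 2 ->
  Csummable (fun j => ((s ^ j)%R * lattice_coeff j)%C) /\
  pi_coth (w - s) = Csum (fun j => ((s ^ j)%R * lattice_coeff j)%C).
Proof.
  intros Hs. assert (Ha : 0 < a) by exact Hw.
  destruct (resolvent_expansion w s Hw ltac:(fold a; lra)) as [S0 E0].
  pose proof (Csummable_cols (fun k j => ((s ^ j)%R * power_pair w j k)%C) _
    (fun k j => power_pair_term_bound s j k Hs) dominate_rows dominate_sums) as S1.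
  pose proof (Csum_fubini (fun k j => ((s ^ j)%R * power_pair w j k)%C) _
    (fun k j => power_pair_term_bound s j k Hs) dominate_rows dominate_sums) as F.
  assert (Ej : forall j, ((s ^ j)%R * (/ w) ^ S j + Csum (fun k => ((s ^ j)%R * power_pair w j k)))%C
     = ((s ^ j)%R * lattice_coeff j)%C).
  { intros j. rewrite Csum_scal by apply power_pair_summable. unfold lattice_coeff. ring. }
  split.
  - eapply Csummable_ext; [exact Ej|]. apply Csummable_plus; assumption.
  - rewrite <- (Csum_ext _ _ Ej), Csum_plus, E0, <- F by assumption.
    rewrite coth_partial_fractions.
    + f_equal. apply Csum_ext. intros k. unfold coth_pair.
      destruct (resolvent_expansion (w + INR (S k) * Ci) s) as [Sa Ea]; [rewrite Re_shift; exact Hw | rewrite Re_shift; fold a; lra|].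
      destruct (resolvent_expansion (w + (- INR (S k))%R * Ci) s) as [Sb Eb]; [rewrite Re_shift; exact Hw | rewrite Re_shift; fold a; lra|].
      rewrite (Csum_ext _ (fun j => (s ^ j)%R * (/ (w + INR (S k) * Ci)) ^ S j + (s ^ j)%R * (/ (w + (- INR (S k))%R * Ci)) ^ S j)%C).
      * rewrite Csum_plus, Ea, Eb by assumption. rewrite RtoC_opp. f_equal; f_equal; ring.
      * intros j. unfold power_pair. rewrite RtoC_opp.
        replace (w + - INR (S k) * Ci)%C with (w - INR (S k) * Ci)%C by ring. ring.
    + unfold Cminus. rewrite re_plus, re_opp. simpl (Re (RtoC s)). fold a. pose proof (Rle_abs s). lra.
Qed.

(** The power [q^n] at [tau = i z]. *)
Definition qpow (n : nat) (z : C) : C := Cexp (- (2 * PI * (INR n * z))).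

Lemma qpow_pow n z : qpow n z = (qpow 1 z ^ n)%C.
Proof. unfold qpow. rewrite Cexp_pow. f_equal. simpl. ring. Qed.

Lemma Cmod_qpow n z : Cmod (qpow n z) = exp (- (2 * PI * Re z)) ^ n.
Proof.
  rewrite qpow_pow, Cmod_pow. f_equal. unfold qpow. rewrite Cmod_Cexp. f_equal.
  rewrite re_opp, Re_2PI_mult. simpl. unfold Re. ring.
Qed.

Lemma qpow_1_lt_1 z : 0 < Re z -> exp (- (2 * PI * Re z)) < 1.
Proof. intros H. rewrite <- exp_0. apply exp_increasing. pose proof PI_RGT_0. nra. Qed.

Lemma pi_coth_fourier u : 0 < Re u ->
  pi_coth u = (PI + 2 * PI * Csum (fun n => qpow (S n) u))%C.
Proof.
  intros Hu. assert (Hx : Cmod (qpow 1 u) < 1) by (rewrite Cmod_qpow, pow_1; apply qpow_1_lt_1, Hu).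
  rewrite (Csum_ext _ (fun n => qpow 1 u * qpow 1 u ^ n)%C) by (intros n; rewrite qpow_pow; apply Cpow_S).
  rewrite Csum_scal, Csum_geom by (auto using Csummable_geom).
  unfold pi_coth. pose proof (pi_coth_den u Hu) as Hd. pose proof (Cexp_neq_0 (2 * PI * u)) as E0.
  assert (Q : qpow 1 u = (/ Cexp (2 * PI * u))%C).
  { rewrite <- Cexp_opp. unfold qpow. f_equal. simpl. ring. }
  rewrite Q. field. repeat split; auto.
Qed.

(** [farr s] expands [qpow (S n) (w - s)] in powers of [s]. The dominating array [fdom] corresponds
    to [s = a / 2], where the row sums use up half of the decay of [qpow] and leave
    [exp (- pi a (n + 1))]. *)
Let farr (s : R) (n j : nat) : C := (qpow (S n) w * ((2 * PI * INR (S n) * s)%R ^ j / INR (fact j)))%C.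
Let fdom (n j : nat) : R := exp (- (2 * PI * a)) ^ S n * ((PI * INR (S n) * a) ^ j / INR (fact j)).

Lemma farr_bound (s : R) : Rabs s <= a / 2 -> forall n j, Cmod (farr s n j) <= fdom n j.
Proof.
  intros Hs n j. unfold farr, fdom. rewrite Cmod_mult, Cmod_qpow. fold a.
  apply Rmult_le_compat_l; [apply pow_le, Rlt_le, exp_pos|].
  rewrite Cmod_div by apply INR_fact_C_neq_0. rewrite Cmod_pow, 2!Cmod_R, (Rabs_pos_eq (INR (fact j))) by apply pos_INR.
  apply Rmult_le_compat_r; [apply Rlt_le, Rinv_0_lt_compat, INR_fact_lt_0|].
  apply pow_incr. split; [apply Rabs_pos|]. pose proof (pos_INR (S n)). pose proof PI_RGT_0.
  rewrite Rabs_mult, Rabs_pos_eq by nra. assert (0 <= PI * INR (S n)) by nra. nra.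
Qed.

Lemma fdom_rows n : ex_series (fdom n).
Proof. apply (ex_series_scal_l (exp (- (2 * PI * a)) ^ S n) _ (ex_series_exp (PI * INR (S n) * a))). Qed.

Lemma exp_pow_INR x n : exp x ^ n = exp (INR n * x).
Proof.
  induction n as [|n IH]; [simpl; rewrite Rmult_0_l, exp_0; reflexivity|].
  rewrite S_INR. simpl. rewrite IH, <- exp_plus. f_equal. ring.
Qed.

Lemma fdom_sums : ex_series (fun n => Series (fdom n)).
Proof.
  assert (Ha : 0 < a) by exact Hw.
  apply (ex_series_ext (fun n => exp (- (PI * a)) ^ S n)).
  - intros n. unfold fdom. rewrite Series_scal_l, Series_exp, 2!exp_pow_INR, <- exp_plus. f_equal. ring.
  - apply (ex_series_incr_1 (fun n => exp (- (PI * a)) ^ n)), ex_series_geom.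
    rewrite Rabs_pos_eq by apply Rlt_le, exp_pos. rewrite <- exp_0. apply exp_increasing.
    pose proof PI_RGT_0. nra.
Qed.

Lemma farr_shape (s : R) n j : farr s n j = ((s ^ j)%R * ((2 * PI) ^ j / INR (fact j)) * (INR (S n) ^ j * qpow (S n) w))%C.
Proof.
  unfold farr. rewrite !RtoC_mult, !Cpow_mult_l, RtoC_pow.
  field. apply INR_fact_C_neq_0.
Qed.

Lemma poly_qpow_summable j : Csummable (fun n => (INR (S n) ^ j * qpow (S n) w)%C).
Proof.
  assert (Ha : 0 < a) by exact Hw. assert (Hs : Rabs (a / 2) <= a / 2) by (rewrite Rabs_pos_eq; lra).
  pose proof (Csummable_col (farr (a / 2)) fdom (farr_bound _ Hs) fdom_rows fdom_sums j) as H.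
  set (c := ((((a / 2) ^ j)%R * ((2 * PI) ^ j / INR (fact j))))%C).
  assert (Hc : c <> 0).
  { unfold c, Cdiv. repeat apply Cmult_neq_0.
    - intros E. apply RtoC_inj in E. revert E. apply pow_nonzero. lra.
    - rewrite <- RtoC_mult, <- RtoC_pow. intros E. apply RtoC_inj in E. revert E. apply pow_nonzero.
      pose proof PI_RGT_0. lra.
    - rewrite <- RtoC_inv by apply INR_fact_neq_0. intros E. apply RtoC_inj in E. revert E.
      apply Rinv_neq_0_compat, INR_fact_neq_0. }
  apply (Csummable_scal (/ c)%C) in H. eapply Csummable_ext; [|exact H].
  intros n. cbv beta. rewrite farr_shape. fold c. field. exact Hc.
Qed.

Definition fourier_coeff (j : nat) : C :=
  ((2 * PI) ^ S j / INR (fact j) * Csum (fun n => (INR (S n) ^ j * qpow (S n) w)))%C.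

Definition head_coeff (j : nat) : C := match j with O => RtoC PI | S _ => RtoC 0 end.

Lemma Csum_head (f : nat -> C) : (forall j, f (S j) = 0) -> Csummable f /\ Csum f = f O.
Proof.
  intros H. assert (Sf : Csummable f).
  { apply Csummable_S. apply (ex_series_ext (fun j => 0 * 0 ^ j)).
    - intros j. rewrite H, Cmod_0. apply Rmult_0_l.
    - apply (ex_series_scal_l 0 (fun j => 0 ^ j)), ex_series_geom. rewrite Rabs_R0. lra. }
  split; [exact Sf|]. rewrite (Csum_S _ Sf), (Csum_ext _ (fun _ => RtoC 0)) by exact H.
  rewrite Csum_0. ring.
Qed.

Lemma coth_fourier_expansion (s : R) : Rabs s <= a / 2 ->
  Csummable (fun j => ((s ^ j)%R * (head_coeff j + fourier_coeff j))%C) /\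
  pi_coth (w - s) = Csum (fun j => ((s ^ j)%R * (head_coeff j + fourier_coeff j))%C).
Proof.
  intros Hs. assert (Ha : 0 < a) by exact Hw.
  pose proof (Csummable_cols (farr s) fdom (farr_bound s Hs) fdom_rows fdom_sums) as S1.
  pose proof (Csum_fubini (farr s) fdom (farr_bound s Hs) fdom_rows fdom_sums) as F.
  destruct (Csum_head (fun j => (s ^ j)%R * head_coeff j)%C) as [S0 E0]; [intros; simpl; ring|].
  assert (Ej : forall j, ((s ^ j)%R * head_coeff j + (2 * PI) * Csum (fun n => farr s n j))%C
     = ((s ^ j)%R * (head_coeff j + fourier_coeff j))%C).
  { intros j. rewrite (Csum_ext _ _ (fun n => farr_shape s n j)), Csum_scal by apply poly_qpow_summable.
    unfold fourier_coeff. rewrite Cpow_S. unfold Cdiv. ring. }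
  split.
  - eapply Csummable_ext; [exact Ej|]. apply Csummable_plus; [exact S0 | apply Csummable_scal, S1].
  - rewrite <- (Csum_ext _ _ Ej), Csum_plus, E0, Csum_scal, <- F by (auto; apply Csummable_scal, S1).
    rewrite pi_coth_fourier.
    + simpl (s ^ 0). simpl (head_coeff 0). rewrite Cmult_1_l. do 2 f_equal. apply Csum_ext. intros n.
      unfold farr. rewrite Csum_scal by apply (exp_tail_summable 0).
      change (Csum _) with (exp_tail 0 (2 * PI * INR (S n) * s)%R). rewrite <- Cexp_exp_tail.
      unfold qpow. rewrite <- Cexp_plus. f_equal. rewrite !RtoC_mult. ring.
    + unfold Cminus. rewrite re_plus, re_opp. simpl (Re (RtoC s)). fold a. pose proof (Rle_abs s). lra.
Qed.

(* Both sides are the [j]-th Taylor coefficient at [s = 0] of [pi_coth (w - s)]. *)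
Lemma lipschitz_formula j : (0 < j)%nat -> lattice_coeff j = fourier_coeff j.
Proof.
  intros Hj. assert (Ha : 0 < a) by exact Hw.
  assert (Hs : Rabs (a / 2) <= a / 2) by (rewrite Rabs_pos_eq; lra).
  assert (E : lattice_coeff j = (head_coeff j + fourier_coeff j)%C).
  { apply (Cpower_series_unique lattice_coeff (fun j => head_coeff j + fourier_coeff j)%C (a / 2)).
    - lra.
    - apply (coth_lattice_expansion _ Hs).
    - apply (coth_fourier_expansion _ Hs).
    - intros s Hs'. destruct (coth_lattice_expansion s Hs') as [_ <-].
      destruct (coth_fourier_expansion s Hs') as [_ <-]. reflexivity. }
  rewrite E. destruct j as [|j]; [lia|]. simpl. ring.
Qed.

End Lipschitz.

(** * The values of zeta at 2 and 4 *)

Definition zeta (s : nat) : R := Series (fun k => / INR (S k) ^ s).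

Lemma zeta_summable s : (2 <= s)%nat -> ex_series (fun k => / INR (S k) ^ s).
Proof.
  intros Hs. eapply ex_series_dominated; [|apply ex_series_inv_sq].
  intros n. rewrite S_INR. pose proof (pos_INR n). split.
  - apply Rlt_le, Rinv_0_lt_compat, pow_lt. lra.
  - apply Rinv_le_contravar; [apply pow_lt; lra | apply Rle_pow; [lra | exact Hs]].
Qed.

(** Comparison of orders as [w] tends to 0: division by [w^2] forces [al = 0], after which division
    by [w^4] forces [be = 0]. *)
Lemma quartic_coefficients_vanish (al be K d : R) : 0 < d ->
  (forall w, 0 < w <= d -> Rabs (al * w ^ 2 + be * w ^ 4) <= K * w ^ 6) -> al = 0 /\ be = 0.
Proof.
  intros Hd H.
  assert (small : forall x M, 0 <= M -> (forall w, 0 < w <= d -> Rabs x <= M * w) -> x = 0).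
  { intros x M HM Hx. destruct (Req_dec x 0) as [|E]; [assumption|exfalso].
    pose proof (Rabs_pos_lt x E) as P. set (w := Rmin d (Rabs x / (2 * (M + 1)))).
    assert (Hq : 0 < Rabs x / (2 * (M + 1))) by (apply Rdiv_lt_0_compat; lra).
    assert (Hw : 0 < w <= d) by (split; [apply Rmin_glb_lt; assumption | apply Rmin_l]).
    specialize (Hx w Hw). assert (w <= Rabs x / (2 * (M + 1))) by apply Rmin_r.
    assert (M * w <= M * (Rabs x / (2 * (M + 1)))) by (apply Rmult_le_compat_l; assumption).
    assert (M * (Rabs x / (2 * (M + 1))) < Rabs x); [|lra].
    replace (M * (Rabs x / (2 * (M + 1)))) with (M / (M + 1) * (Rabs x / 2)) by (field; lra).
    assert (M / (M + 1) <= 1).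
    { apply (Rmult_le_reg_r (M + 1)); [lra|]. unfold Rdiv. rewrite Rmult_assoc, Rinv_l by lra. lra. }
    nra. }
  assert (HK : 0 <= K).
  { specialize (H d ltac:(lra)). pose proof (Rabs_pos (al * d ^ 2 + be * d ^ 4)). assert (0 < d ^ 6) by (apply pow_lt; lra). nra. }
  assert (al = 0).
  { apply (small al (Rabs be * d + K * d ^ 3)).
    - pose proof (Rabs_pos be). assert (0 < d ^ 3) by (apply pow_lt; lra). nra.
    - intros w Hw. specialize (H w Hw).
      assert (E : Rabs al * w ^ 2 <= Rabs be * w ^ 4 + K * w ^ 6).
      { replace (Rabs al * w ^ 2) with (Rabs ((al * w ^ 2 + be * w ^ 4) - be * w ^ 4)).
        - eapply Rle_trans; [apply Rabs_triang|]. rewrite Rabs_Ropp, (Rabs_mult be), (Rabs_pos_eq (w ^ 4)) by (apply pow_le; lra). lra.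
        - replace (al * w ^ 2 + be * w ^ 4 - be * w ^ 4) with (al * w ^ 2) by ring.
          rewrite Rabs_mult, (Rabs_pos_eq (w ^ 2)) by (apply pow_le; lra). reflexivity. }
      apply (Rmult_le_reg_r (w ^ 2)); [apply pow_lt; lra|].
      eapply Rle_trans; [exact E|].
      replace ((Rabs be * d + K * d ^ 3) * w * w ^ 2) with (Rabs be * (d * w ^ 3) + K * (d ^ 3 * w ^ 3)) by ring.
      assert (0 < w ^ 3) by (apply pow_lt; lra).
      assert (w ^ 3 <= d ^ 3) by (apply pow_incr; lra).
      pose proof (Rabs_pos be).
      replace (w ^ 4) with (w * w ^ 3) by ring. replace (w ^ 6) with (w ^ 3 * w ^ 3) by ring.
      apply Rplus_le_compat; apply Rmult_le_compat_l; auto; apply Rmult_le_compat_r; lra. }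
  split; [assumption|]. subst al.
  apply (small be (K * d)); [nra|]. intros w Hw. specialize (H w Hw).
  rewrite Rmult_0_l, Rplus_0_l, Rabs_mult, (Rabs_pos_eq (w ^ 4)) in H by (apply pow_le; lra).
  apply (Rmult_le_reg_r (w ^ 4)); [apply pow_lt; lra|]. eapply Rle_trans; [exact H|].
  replace (w ^ 6) with (w * (w * w ^ 4)) by ring. replace (K * d * w * w ^ 4) with (K * (d * (w * w ^ 4))) by ring.
  apply Rmult_le_compat_l; [exact HK|]. apply Rmult_le_compat_r; [|lra].
  apply Rmult_le_pos; [lra | apply pow_le; lra].
Qed.

Lemma exp_expand7 v : 0 < v <= 1 -> exists t, 0 <= t <= 3 /\
  exp v = 1 + v + v ^ 2 / 2 + v ^ 3 / 6 + v ^ 4 / 24 + v ^ 5 / 120 + v ^ 6 / 720 + v ^ 7 * t.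
Proof.
  intros Hv. exists (Series (fun k => v ^ k / INR (fact (7 + k)))).
  assert (B : forall k, 0 <= v ^ k / INR (fact (7 + k)) <= v ^ k / INR (fact k)).
  { intros k. assert (0 <= v ^ k) by (apply pow_le; lra). split.
    - apply Rmult_le_pos; [assumption | apply Rlt_le, Rinv_0_lt_compat, INR_fact_lt_0].
    - apply Rmult_le_compat_l; [assumption | apply fact_shift_le]. }
  assert (Sj : forall j, ex_series (fun k => v ^ k / INR (fact (j + k)))).
  { intros j. eapply ex_series_dominated; [|apply (ex_series_exp v)].
    intros k. assert (0 <= v ^ k) by (apply pow_le; lra). split.
    - apply Rmult_le_pos; [assumption | apply Rlt_le, Rinv_0_lt_compat, INR_fact_lt_0].
    - apply Rmult_le_compat_l; [assumption | apply fact_shift_le]. }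
  assert (E : forall j, Series (fun k => v ^ k / INR (fact (j + k))) =
     / INR (fact j) + v * Series (fun k => v ^ k / INR (fact (S j + k)))).
  { intros j. rewrite (Series_incr_1 _ (Sj j)), <- Series_scal_l. f_equal.
    - rewrite Nat.add_0_r. simpl. field. apply INR_fact_neq_0.
    - apply Series_ext. intros k. replace (j + S k)%nat with (S j + k)%nat by lia. simpl (v ^ S k).
      field. apply INR_fact_neq_0. }
  split.
  - split; [apply Series_nonneg; [intros; apply B | apply (Sj 7%nat)]|].
    apply Rle_trans with (exp v).
    + rewrite <- Series_exp. apply Series_le; [exact B | apply ex_series_exp].
    + apply Rle_trans with (exp 1); [|apply exp_le_3].
      destruct (proj2 Hv) as [H|H]; [apply Rlt_le, exp_increasing, H | rewrite H; lra].
  - rewrite <- Series_exp at 1. change (fun k => v ^ k / INR (fact k)) with (fun k => v ^ k / INR (fact (0 + k))).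
    do 7 rewrite E at 1. simpl fact. simpl INR. field.
Qed.

(** With [v = 2 pi w] this is the Bernoulli expansion of [v / 2 + v / (e^v - 1)]: after
    multiplication by [e^v - 1] all terms below [v^7] cancel. The constant 10 is generous. *)
Lemma coth_quartic_expansion w : 0 < w -> 2 * PI * w <= 1 ->
  Rabs (PI * w + 2 * PI * w / (exp (2 * PI * w) - 1) - (1 + (2 * PI * w) ^ 2 / 12 - (2 * PI * w) ^ 4 / 720))
    <= 10 * (2 * PI * w) ^ 6.
Proof.
  intros Hw Hv. pose proof PI_RGT_0. set (v := 2 * PI * w) in *.
  replace (PI * w) with (v / 2) by (unfold v; field).
  assert (v0 : 0 < v) by (unfold v; nra). clearbody v. clear w Hw.
  destruct (exp_expand7 v) as (t & Ht & E); [lra|].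
  pose proof (exp_ineq1 v) as HP. assert (HP' : v < exp v - 1) by (assert (v <> 0) by lra; specialize (HP H0); lra).
  set (P := exp v - 1) in *.
  assert (EP : P = v + v ^ 2 / 2 + v ^ 3 / 6 + v ^ 4 / 24 + v ^ 5 / 120 + v ^ 6 / 720 + v ^ 7 * t)
    by (unfold P; rewrite E; ring).
  replace (v / 2 + v / P - (1 + v ^ 2 / 12 - v ^ 4 / 720)) with ((v - (1 - v / 2 + v ^ 2 / 12 - v ^ 4 / 720) * P) / P) by (field; lra).
  unfold Rdiv at 1. rewrite Rabs_mult, (Rabs_pos_eq (/ P)) by (apply Rlt_le, Rinv_0_lt_compat; lra).
  apply (Rmult_le_reg_r P); [lra|]. rewrite Rmult_assoc, Rinv_l, Rmult_1_r by lra.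
  apply Rle_trans with (10 * v ^ 6 * v); [|apply Rmult_le_compat_l; [|lra]; apply Rmult_le_pos; [lra | apply pow_le; lra]].
  replace (10 * v ^ 6 * v) with (v ^ 7 * 10) by ring.
  replace (v - (1 - v / 2 + v ^ 2 / 12 - v ^ 4 / 720) * P) with
    (v ^ 7 * (/ 4320 - v / 17280 + v ^ 2 / 86400 + v ^ 3 / 518400 - t * (1 - v / 2 + v ^ 2 / 12 - v ^ 4 / 720)))
    by (rewrite EP; field).
  assert (V2 : 0 <= v ^ 2 <= 1) by (split; [apply pow_le; lra | rewrite <- (pow1 2); apply pow_incr; lra]).
  assert (V3 : 0 <= v ^ 3 <= 1) by (split; [apply pow_le; lra | rewrite <- (pow1 3); apply pow_incr; lra]).
  assert (V4 : 0 <= v ^ 4 <= 1) by (split; [apply pow_le; lra | rewrite <- (pow1 4); apply pow_incr; lra]).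
  rewrite Rabs_mult, Rabs_pos_eq by (apply pow_le; lra).
  apply Rmult_le_compat_l; [apply pow_le; lra|].
  set (c := 1 - v / 2 + v ^ 2 / 12 - v ^ 4 / 720). assert (0 <= c <= 2) by (unfold c; lra).
  apply Rabs_le. split; nra.
Qed.

Lemma Csum_RtoC (a : nat -> R) : Csum (fun n => RtoC (a n)) = RtoC (Series a).
Proof. apply C_eq; simpl; [reflexivity | apply Series_zero]. Qed.

Lemma real_coth_partial_fractions w : 0 < w ->
  PI + 2 * PI / (exp (2 * PI * w) - 1) = / w + Series (fun k => 2 * w / (w ^ 2 + INR (S k) ^ 2)).
Proof.
  intros Hw. apply RtoC_inj. pose proof (coth_partial_fractions w Hw) as E.
  unfold pi_coth in E. rewrite <- 2!RtoC_mult, Cexp_real, <- RtoC_minus in E.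
  assert (D : exp (2 * PI * w) - 1 <> 0).
  { apply Rgt_not_eq. assert (1 < exp (2 * PI * w)); [|lra]. rewrite <- exp_0. apply exp_increasing.
    pose proof PI_RGT_0. nra. }
  rewrite <- RtoC_div, <- RtoC_plus, <- RtoC_inv in E by (auto; lra). rewrite E, RtoC_plus. f_equal.
  rewrite <- Csum_RtoC. apply Csum_ext. intros k. unfold coth_pair.
  pose proof (shift_plus_neq_0 w (INR (S k)) Hw) as N1. pose proof (shift_minus_neq_0 w (INR (S k)) Hw) as N2.
  set (m := INR (S k)) in *. rewrite RtoC_div by nra.
  rewrite RtoC_plus, RtoC_mult, !RtoC_pow.
  assert (CI : (Ci * Ci)%C = (- (1))%C) by (apply C_eq; simpl; ring).
  replace (w ^ 2 + m ^ 2)%C with ((w + m * Ci) * (w - m * Ci))%C.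
  - field. split; assumption.
  - transitivity (w * w - m * m * (Ci * Ci))%C; [ring | rewrite CI; simpl; ring].
Qed.

(** Two expansions of [w pi_coth w] near 0 are compared: the exponential form yields Bernoulli
    numbers, the partial fractions yield zeta values. *)
Lemma zeta_2_4 : zeta 2 = PI ^ 2 / 6 /\ zeta 4 = PI ^ 4 / 90.
Proof.
  pose proof PI_RGT_0 as HP.
  destruct (quartic_coefficients_vanish (2 * zeta 2 - PI ^ 2 / 3) (- (2 * zeta 4) + PI ^ 4 / 45)
    (10 * (2 * PI) ^ 6 + 2 * zeta 6) (/ (2 * PI))) as [H2 H4].
  - apply Rinv_0_lt_compat. lra.
  - intros w [Hw Hw1].
    assert (Hv : 2 * PI * w <= 1).
    { apply (Rmult_le_compat_l (2 * PI)) in Hw1; [|lra]. rewrite Rinv_r in Hw1 by lra. exact Hw1. }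
    pose proof (coth_quartic_expansion w Hw Hv) as B.
    pose proof (real_coth_partial_fractions w Hw) as E.
    (* The remainder of [1 / (w^2 + m^2) = 1 / m^2 - w^2 / m^4 + w^4 / (m^4 (w^2 + m^2))], bounded
       by [zeta 6] uniformly in [w]. *)
    set (T := Series (fun k => / INR (S k) ^ 4 * / (w ^ 2 + INR (S k) ^ 2))).
    assert (Pos : forall k, 0 < INR (S k)) by (intros; apply lt_0_INR; lia).
    assert (Dom : forall k, 0 <= / INR (S k) ^ 4 * / (w ^ 2 + INR (S k) ^ 2) <= / INR (S k) ^ 6).
    { intros k. specialize (Pos k). assert (0 < INR (S k) ^ 4) by (apply pow_lt; lra).
      assert (0 < INR (S k) ^ 2) by (apply pow_lt; lra). assert (0 < w ^ 2) by (apply pow_lt; lra). split.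
      - apply Rmult_le_pos; apply Rlt_le, Rinv_0_lt_compat; lra.
      - replace (INR (S k) ^ 6) with (INR (S k) ^ 4 * INR (S k) ^ 2) by ring. rewrite (Rinv_mult (_ ^ 4)).
        apply Rmult_le_compat_l; [apply Rlt_le, Rinv_0_lt_compat; lra|].
        apply Rinv_le_contravar; lra. }
    assert (ST : ex_series (fun k => / INR (S k) ^ 4 * / (w ^ 2 + INR (S k) ^ 2)))
      by (eapply ex_series_dominated; [apply Dom | apply zeta_summable; lia]).
    assert (BT : 0 <= T <= zeta 6).
    { split; [apply Series_nonneg; [intros; apply Dom | exact ST]|].
      apply Series_le; [apply Dom | apply zeta_summable; lia]. }
    assert (ES : Series (fun k => 2 * w / (w ^ 2 + INR (S k) ^ 2)) =
      2 * w * zeta 2 - 2 * w ^ 3 * zeta 4 + 2 * w ^ 5 * T).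
    { unfold zeta, T. rewrite <- 3!Series_scal_l, <- Series_minus, <- Series_plus.
      - apply Series_ext. intros k. specialize (Pos k). assert (0 < w ^ 2) by (apply pow_lt; lra). field. split; nra.
      - apply (ex_series_minus (fun k => 2 * w * / INR (S k) ^ 2) (fun k => 2 * w ^ 3 * / INR (S k) ^ 4)).
        + apply (ex_series_scal_l (2 * w) (fun k => / INR (S k) ^ 2)), zeta_summable; lia.
        + apply (ex_series_scal_l (2 * w ^ 3) (fun k => / INR (S k) ^ 4)), zeta_summable; lia.
      - apply (ex_series_scal_l (2 * w ^ 5) _ ST).
      - apply (ex_series_scal_l (2 * w) (fun k => / INR (S k) ^ 2)), zeta_summable; lia.
      - apply (ex_series_scal_l (2 * w ^ 3) (fun k => / INR (S k) ^ 4)), zeta_summable; lia. }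
    assert (D : exp (2 * PI * w) - 1 <> 0).
    { apply Rgt_not_eq. assert (1 < exp (2 * PI * w)); [|lra]. rewrite <- exp_0. apply exp_increasing. nra. }
    assert (E2 : PI * w + 2 * PI * w / (exp (2 * PI * w) - 1) =
      1 + 2 * w ^ 2 * zeta 2 - 2 * w ^ 4 * zeta 4 + 2 * w ^ 6 * T).
    { transitivity (w * (PI + 2 * PI / (exp (2 * PI * w) - 1))); [field; exact D|].
      rewrite E, ES. field. lra. }
    rewrite E2 in B.
    replace ((2 * zeta 2 - PI ^ 2 / 3) * w ^ 2 + (- (2 * zeta 4) + PI ^ 4 / 45) * w ^ 4)
      with ((1 + 2 * w ^ 2 * zeta 2 - 2 * w ^ 4 * zeta 4 + 2 * w ^ 6 * T -
       (1 + (2 * PI * w) ^ 2 / 12 - (2 * PI * w) ^ 4 / 720)) - 2 * w ^ 6 * T) by field.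
    eapply Rle_trans; [apply Rabs_triang|]. rewrite Rabs_Ropp.
    assert (0 < w ^ 6) by (apply pow_lt; lra).
    rewrite (Rabs_pos_eq (2 * w ^ 6 * T)) by nra.
    assert (2 * w ^ 6 * T <= 2 * w ^ 6 * zeta 6) by (apply Rmult_le_compat_l; lra).
    replace (10 * (2 * PI * w) ^ 6) with (10 * (2 * PI) ^ 6 * w ^ 6) in B by ring.
    set (Q := 1 + 2 * w ^ 2 * zeta 2 - 2 * w ^ 4 * zeta 4 + 2 * w ^ 6 * T - _) in *. lra.
  - lra.
Qed.

(** * Inversion of the Eisenstein series *)

Lemma product_dominating (C0 : R) (t u : nat -> R) : ex_series t -> ex_series u ->
  (forall l, ex_series (fun m => C0 * (t l * u m))) /\
  ex_series (fun l => Series (fun m => C0 * (t l * u m))).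
Proof.
  intros Ht Hu. split.
  - intros l. apply (ex_series_scal_l C0 (fun m => t l * u m)), (ex_series_scal_l (t l) u Hu).
  - apply (ex_series_ext (fun l => (C0 * Series u) * t l)).
    + intros l. rewrite (Series_scal_l C0 (fun m => t l * u m)), (Series_scal_l (t l) u).
      unfold mult; simpl. lazymatch goal with |- ?a = ?b => change (@eq R a b) end. ring.
    + apply (ex_series_scal_l (C0 * Series u) t Ht).
Qed.

(** [(n + 1)^(-3/2)]. Since [x + y >= sqrt x sqrt y], a lattice term of third order is at most a
    product of two such factors, and the double series is dominated by a product of convergent
    ones. *)
Definition inv_pow32 (n : nat) : R := / (INR n + 1) * / sqrt (INR n + 1).

Lemma ex_series_inv_pow32 : ex_series inv_pow32.
Proof.
  apply (ex_series_bounded _ 3).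
  - intros n. pose proof (pos_INR n). assert (0 < sqrt (INR n + 1)) by (apply sqrt_lt_R0; lra).
    apply Rmult_le_pos; apply Rlt_le, Rinv_0_lt_compat; lra.
  - assert (H : forall n, sum_n inv_pow32 n <= 3 - 2 * / sqrt (INR n + 1)).
    { induction n as [|n IH].
      - rewrite sum_O. unfold inv_pow32. simpl INR. rewrite Rplus_0_l, sqrt_1. lra.
      - rewrite sum_Sn. change (plus (sum_n inv_pow32 n) (inv_pow32 (S n))) with (sum_n inv_pow32 n + inv_pow32 (S n)).
        replace (inv_pow32 (S n)) with (/ (INR n + 1 + 1) * / sqrt (INR n + 1 + 1)) by (unfold inv_pow32; rewrite S_INR; reflexivity).
        rewrite S_INR. pose proof (pos_INR n).
        assert (A0 : 0 < sqrt (INR n + 1)) by (apply sqrt_lt_R0; lra).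
        assert (B0 : 0 < sqrt (INR n + 1 + 1)) by (apply sqrt_lt_R0; lra).
        assert (A2 : sqrt (INR n + 1) * sqrt (INR n + 1) = INR n + 1) by (apply sqrt_sqrt; lra).
        assert (B2 : sqrt (INR n + 1 + 1) * sqrt (INR n + 1 + 1) = INR n + 1 + 1) by (apply sqrt_sqrt; lra).
        assert (AB : sqrt (INR n + 1) <= sqrt (INR n + 1 + 1)) by (apply sqrt_le_1; lra).
        set (a := sqrt (INR n + 1)) in *. set (b := sqrt (INR n + 1 + 1)) in *.
        enough (/ (INR n + 1 + 1) * / b <= 2 * / a - 2 * / b) by lra.
        replace (2 * / a - 2 * / b) with (/ (a * b * ((a + b) / 2))).
        + rewrite <- B2, <- Rinv_mult. apply Rinv_le_contravar; [|nra].
          apply Rmult_lt_0_compat; nra.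
        + replace (2 * / a - 2 * / b) with (2 * (b * b - a * a) / (a * b * (a + b))) by (field; lra).
          rewrite A2, B2. field. lra. }
    intros n. specialize (H n). assert (0 < / sqrt (INR n + 1)); [|lra].
    apply Rinv_0_lt_compat, sqrt_lt_R0. pose proof (pos_INR n). lra.
Qed.

Lemma inv_cube_le (x y : R) : 0 < x -> 0 < y ->
  / (x + y) ^ 3 <= (/ x * / sqrt x) * (/ y * / sqrt y).
Proof.
  intros Hx Hy. pose proof (sqrt_lt_R0 x Hx). pose proof (sqrt_lt_R0 y Hy).
  pose proof (sqrt_sqrt x ltac:(lra)). pose proof (sqrt_sqrt y ltac:(lra)).
  rewrite <- !Rinv_mult. apply Rinv_le_contravar.
  - repeat apply Rmult_lt_0_compat; assumption.
  - set (a := sqrt x) in *. set (b := sqrt y) in *. rewrite <- H1, <- H2.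
    assert (a * b <= a * a + b * b) by nra.
    replace (a * a * a * (b * b * b)) with ((a * b) ^ 3) by ring.
    apply pow_incr. split; nra.
Qed.

Lemma inv_pow_le_inv_pow32 l m j : (3 <= j)%nat ->
  / (INR (S l) + INR (S m)) ^ j <= inv_pow32 l * inv_pow32 m.
Proof.
  intros Hj. unfold inv_pow32. rewrite 2!S_INR. pose proof (pos_INR l). pose proof (pos_INR m).
  eapply Rle_trans; [|apply inv_cube_le; lra].
  apply Rinv_le_contravar; [apply pow_lt; lra | apply Rle_pow; [lra | exact Hj]].
Qed.

Section Lattice.

Variable z : C.
Hypothesis Hz : 0 < Re z.

Lemma Re_scaled l : 0 < Re (INR (S l) * z).
Proof. rewrite re_scal_l. apply Rmult_lt_0_compat; [apply lt_0_INR; lia | exact Hz]. Qed.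

Lemma lattice_inv_bound l m (s : R) : Rabs s = INR (S m) ->
  Cmod (/ (INR (S l) * z + s * Ci)) <= / lattice_const z * / (INR (S l) + INR (S m)).
Proof.
  intros Hs. assert (0 < INR (S l)) by (apply lt_0_INR; lia). assert (0 < INR (S m)) by (apply lt_0_INR; lia).
  pose proof (lattice_const_pos z Hz). rewrite <- Rinv_mult, Cmod_inv.
  - apply Rinv_le_contravar; [nra|]. rewrite <- Hs. apply lattice_lower_bound; lra.
  - apply lattice_neq_0; lra.
Qed.

Lemma lattice_inv_bound_minus l m :
  Cmod (/ (INR (S l) * z - INR (S m) * Ci)) <= / lattice_const z * / (INR (S l) + INR (S m)).
Proof.
  replace (INR (S l) * z - INR (S m) * Ci)%C with (INR (S l) * z + (- INR (S m))%R * Ci)%C by (rewrite RtoC_opp; ring).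
  apply lattice_inv_bound. rewrite Rabs_Ropp. apply Rabs_pos_eq, pos_INR.
Qed.

Lemma lattice_inv_bound_plus l m :
  Cmod (/ (INR (S l) * z + INR (S m) * Ci)) <= / lattice_const z * / (INR (S l) + INR (S m)).
Proof. apply lattice_inv_bound. apply Rabs_pos_eq, pos_INR. Qed.

Lemma power_pair_lattice_bound j l m : (2 <= j)%nat ->
  Cmod (power_pair (INR (S l) * z) j m) <= 2 * / lattice_const z ^ S j * (inv_pow32 l * inv_pow32 m).
Proof.
  intros Hj. unfold power_pair. eapply Rle_trans; [apply Cmod_triangle|]. rewrite 2!Cmod_pow.
  pose proof (lattice_inv_bound_plus l m) as B1. pose proof (lattice_inv_bound_minus l m) as B2.
  set (B := / lattice_const z * / (INR (S l) + INR (S m))) in *.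
  assert (P1 : Cmod (/ (INR (S l) * z + INR (S m) * Ci)) ^ S j <= B ^ S j) by (apply pow_incr; split; [apply Cmod_ge_0 | exact B1]).
  assert (P2 : Cmod (/ (INR (S l) * z - INR (S m) * Ci)) ^ S j <= B ^ S j) by (apply pow_incr; split; [apply Cmod_ge_0 | exact B2]).
  apply Rle_trans with (2 * B ^ S j); [lra|]. unfold B. rewrite Rpow_mult_distr, 2!pow_inv, Rmult_assoc.
  apply Rmult_le_compat_l; [lra|]. apply Rmult_le_compat_l.
  - apply Rlt_le, Rinv_0_lt_compat, pow_lt, lattice_const_pos, Hz.
  - apply inv_pow_le_inv_pow32. lia.
Qed.

Lemma pow_le_fact_exp x j : 0 <= x -> x ^ j <= INR (fact j) * exp x.
Proof.
  intros Hx. pose proof (term_le_Series (fun k => x ^ k / INR (fact k)) j) as H. rewrite Series_exp in H.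
  pose proof (INR_fact_lt_0 j).
  assert (x ^ j / INR (fact j) <= exp x).
  { apply H; [|apply ex_series_exp]. intros n. apply Rmult_le_pos; [apply pow_le, Hx|].
    apply Rlt_le, Rinv_0_lt_compat, INR_fact_lt_0. }
  apply (Rmult_le_compat_l (INR (fact j))) in H1; [|lra].
  replace (INR (fact j) * (x ^ j / INR (fact j))) with (x ^ j) in H1 by (field; lra). exact H1.
Qed.

(** The square root of [|q|]. Half of the decay of [q^N] is kept here, the other half pays for the
    factor [N^j], at the price [lambert_const j] that comes from [x^j <= j! e^x]. *)
Definition nome_bound : R := exp (- (PI * Re z)).
Definition lambert_const (j : nat) : R := INR (fact j) * / (PI * Re z) ^ j.

Lemma nome_bound_range : 0 < nome_bound < 1.
Proof.
  split; [apply exp_pos|]. rewrite <- exp_0. apply exp_increasing. pose proof PI_RGT_0. nra.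
Qed.

Lemma nome_bound_summable : ex_series (fun n => nome_bound ^ n).
Proof. apply ex_series_geom. pose proof nome_bound_range. rewrite Rabs_pos_eq; lra. Qed.

Lemma lambert_bound j l n :
  INR (S l * S n) ^ j * Cmod (qpow (S l * S n) z) <= lambert_const j * (nome_bound ^ l * nome_bound ^ n).
Proof.
  pose proof PI_RGT_0 as HP. pose proof nome_bound_range as [R0 R1].
  assert (Ha : 0 < PI * Re z) by nra. set (N := (S l * S n)%nat).
  rewrite Cmod_qpow, exp_pow_INR. pose proof (pos_INR N) as HN.
  pose proof (pow_le_fact_exp (PI * Re z * INR N) j ltac:(nra)) as B.
  rewrite Rpow_mult_distr in B. assert (Hp : 0 < (PI * Re z) ^ j) by (apply pow_lt, Ha).
  replace (exp (INR N * - (2 * PI * Re z))) with (exp (- (PI * Re z * INR N)) * nome_bound ^ N).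
  2:{ unfold nome_bound. rewrite exp_pow_INR, <- exp_plus. f_equal. ring. }
  assert (B2 : INR N ^ j * exp (- (PI * Re z * INR N)) <= lambert_const j).
  { unfold lambert_const. apply (Rmult_le_reg_l ((PI * Re z) ^ j)); [exact Hp|].
    replace ((PI * Re z) ^ j * (INR (fact j) * / (PI * Re z) ^ j)) with (INR (fact j)) by (field; lra).
    rewrite exp_Ropp. pose proof (exp_pos (PI * Re z * INR N)) as He.
    apply (Rmult_le_reg_r (exp (PI * Re z * INR N))); [exact He|].
    replace ((PI * Re z) ^ j * (INR N ^ j * / exp (PI * Re z * INR N)) * exp (PI * Re z * INR N))
      with ((PI * Re z) ^ j * INR N ^ j) by (field; lra). exact B. }
  (* The product [S l * S n] exceeds [l + n], so decay in the product is geometric decay in both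
     indices. *)
  assert (B3 : nome_bound ^ N <= nome_bound ^ l * nome_bound ^ n).
  { rewrite <- pow_add. unfold N. replace (S l * S n)%nat with (l + n + (1 + l * n))%nat by lia.
    rewrite (pow_add _ (l + n)). rewrite <- (Rmult_1_r (nome_bound ^ (l + n))) at 2.
    apply Rmult_le_compat_l; [apply pow_le; lra|]. rewrite <- (pow1 (1 + l * n)). apply pow_incr. lra. }
  rewrite <- Rmult_assoc. apply Rmult_le_compat; auto.
  - apply Rmult_le_pos; [apply pow_le, HN | apply Rlt_le, exp_pos].
  - apply pow_le. lra.
Qed.

Lemma lambert_dominating (C0 : R) :
  (forall l, ex_series (fun m => C0 * (nome_bound ^ l * nome_bound ^ m))) /\
  ex_series (fun l => Series (fun m => C0 * (nome_bound ^ l * nome_bound ^ m))).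
Proof. apply (product_dominating C0 (pow nome_bound) (pow nome_bound)); apply nome_bound_summable. Qed.

End Lattice.

(** The generating series of [sigma_j], kept as a double sum because its row [l] is the Fourier side
    of the Lipschitz formula at [(l + 1) z]. *)
Definition lambert (j : nat) (z : C) : C :=
  Csum (fun l => Csum (fun n => (INR (S n) ^ j * qpow (S l * S n) z)%C)).

Lemma lambert_term_bound z j l n : 0 < Re z ->
  Cmod (INR (S n) ^ j * qpow (S l * S n) z) <= lambert_const z j * (nome_bound z ^ l * nome_bound z ^ n).
Proof.
  intros Hz. eapply Rle_trans; [|apply lambert_bound, Hz].
  rewrite Cmod_mult, Cmod_pow, Cmod_R, Rabs_pos_eq by apply pos_INR.
  apply Rmult_le_compat_r; [apply Cmod_ge_0|]. apply pow_incr. split; [apply pos_INR|].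
  apply le_INR. lia.
Qed.

Lemma lambert_summable z j : 0 < Re z ->
  Csummable (fun l => Csum (fun n => (INR (S n) ^ j * qpow (S l * S n) z)%C)).
Proof.
  intros Hz. destruct (lambert_dominating z Hz (lambert_const z j)) as [H1 H2].
  apply (Csummable_rows _ _ (fun l n => lambert_term_bound z j l n Hz) H1 H2).
Qed.

Lemma qpow_scaled n l z : qpow n (INR l * z) = qpow (l * n) z.
Proof. unfold qpow. rewrite mult_INR, RtoC_mult. do 2 f_equal. ring. Qed.

Lemma zeta_C_sum s (z : C) : (2 <= s)%nat -> z <> 0 ->
  Csummable (fun l => ((/ (INR (S l) * z)) ^ s)%C) /\
  Csum (fun l => ((/ (INR (S l) * z)) ^ s)%C) = (zeta s * (/ z) ^ s)%C.
Proof.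
  intros Hs z0.
  assert (E : forall l, ((/ z) ^ s * (/ INR (S l) ^ s)%R)%C = ((/ (INR (S l) * z)) ^ s)%C).
  { intros l. assert (N : INR (S l) <> 0) by (apply not_0_INR; lia).
    assert (NC : RtoC (INR (S l)) <> 0) by (intros E; apply RtoC_inj in E; auto).
    rewrite RtoC_inv, RtoC_pow by (apply pow_nonzero, N). rewrite <- Cpow_inv by exact NC.
    rewrite <- Cpow_mult_l. f_equal. field. auto. }
  assert (S0 : Csummable (fun l => RtoC (/ INR (S l) ^ s))).
  { apply (Csummable_le _ (fun l => / INR (S l) ^ s)); [|apply zeta_summable, Hs].
    intros l. rewrite Cmod_R, Rabs_pos_eq; [lra|].
    apply Rlt_le, Rinv_0_lt_compat, pow_lt, lt_0_INR. lia. }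
  split.
  - eapply Csummable_ext; [exact E|]. apply Csummable_scal, S0.
  - rewrite <- (Csum_ext _ _ E), Csum_scal, Csum_RtoC by exact S0. unfold zeta. ring.
Qed.

Lemma lattice_row j z l : (0 < j)%nat -> 0 < Re z ->
  Csum (power_pair (INR (S l) * z) j) =
  ((2 * PI) ^ S j / INR (fact j) * Csum (fun n => INR (S n) ^ j * qpow (S l * S n) z)
    - (/ (INR (S l) * z)) ^ S j)%C.
Proof.
  intros Hj Hz. pose proof (lipschitz_formula (INR (S l) * z) (Re_scaled z Hz l) j Hj) as E.
  unfold lattice_coeff, fourier_coeff in E.
  rewrite (Csum_ext (fun n => INR (S n) ^ j * qpow (S l * S n) z)%C (fun n => INR (S n) ^ j * qpow (S n) (INR (S l) * z))%C)
    by (intros n; rewrite qpow_scaled; reflexivity).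
  rewrite <- E. ring.
Qed.

(** The rows of the lattice sum omit the point [m = 0]; these missing points are what the zeta term
    subtracts. *)
Lemma lattice_lambert j z : (0 < j)%nat -> 0 < Re z ->
  Csummable (fun l => Csum (power_pair (INR (S l) * z) j)) /\
  Csum (fun l => Csum (power_pair (INR (S l) * z) j)) =
  ((2 * PI) ^ S j / INR (fact j) * lambert j z - zeta (S j) * (/ z) ^ S j)%C.
Proof.
  intros Hj Hz. destruct (zeta_C_sum (S j) z ltac:(lia) (Re_pos_neq_0 z Hz)) as [S1 E1].
  pose proof (lambert_summable z j Hz) as S2.
  pose proof (fun l => eq_sym (lattice_row j z l Hj Hz)) as E. split.
  - eapply Csummable_ext; [exact E|]. apply Csummable_minus; [apply Csummable_scal, S2 | exact S1].
  - rewrite <- (Csum_ext _ _ E), Csum_minus, Csum_scal, E1 by (auto; apply Csummable_scal, S2). reflexivity.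
Qed.

Lemma Re_inv_pos z : 0 < Re z -> 0 < Re (/ z).
Proof.
  intros H. unfold Re in *. simpl. apply Rdiv_lt_0_compat; [exact H|]. nra.
Qed.

(** [l / z + i m = (i / z) (m z - i l)], and likewise for the other sign: inversion swaps the two
    lattice coordinates. *)
Lemma power_pair_inversion z l m j : 0 < Re z ->
  power_pair (INR (S l) * / z) j m =
  ((z / Ci) ^ S j * (/ (INR (S m) * z - INR (S l) * Ci)) ^ S j
   + (- z / Ci) ^ S j * (/ (INR (S m) * z + INR (S l) * Ci)) ^ S j)%C.
Proof.
  intros Hz. pose proof (Re_pos_neq_0 z Hz) as z0.
  pose proof (shift_plus_neq_0 _ (INR (S l)) (Re_scaled z Hz m)) as N1.
  pose proof (shift_minus_neq_0 _ (INR (S l)) (Re_scaled z Hz m)) as N2.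
  pose proof (shift_plus_neq_0 _ (INR (S m)) (Re_scaled (/ z) (Re_inv_pos z Hz) l)) as N3.
  pose proof (shift_minus_neq_0 _ (INR (S m)) (Re_scaled (/ z) (Re_inv_pos z Hz) l)) as N4.
  unfold power_pair. rewrite <- 2!Cpow_mult_l.
  assert (CI : (Ci * Ci)%C = (- (1))%C) by (apply C_eq; simpl; ring).
  set (x := RtoC (INR (S l))) in *. set (y := RtoC (INR (S m))) in *.
  assert (A : (x * / z + y * Ci)%C = (Ci * (y * z - x * Ci) / z)%C).
  { replace (Ci * (y * z - x * Ci))%C with (y * z * Ci - x * (Ci * Ci))%C by ring. rewrite CI. field. exact z0. }
  assert (B : (x * / z - y * Ci)%C = (- (Ci * (y * z + x * Ci)) / z)%C).
  { replace (Ci * (y * z + x * Ci))%C with (y * z * Ci + x * (Ci * Ci))%C by ring. rewrite CI. field. exact z0. }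
  pose proof Ci_nz. rewrite A, B. f_equal; f_equal; field; repeat split; auto.
Qed.

Definition E4 (z : C) : C := (1 + 240 * lambert 3 z)%C.

(** In weight 4 the lattice sum converges absolutely, and inversion merely transposes the array and
    multiplies it by [z^4]. The omitted points on the axis contribute [zeta 4], whose value has to
    match the constant term of [E4]. *)
Lemma E4_inversion z : 0 < Re z -> E4 (/ z) = (z ^ 4 * E4 z)%C.
Proof.
  intros Hz. pose proof (Re_inv_pos z Hz) as Hz'. pose proof (Re_pos_neq_0 z Hz) as z0.
  destruct (lattice_lambert 3 z ltac:(lia) Hz) as [S1 E1].
  destruct (lattice_lambert 3 (/ z) ltac:(lia) Hz') as [S2 E2].
  assert (CI : (Ci ^ 4)%C = 1) by (apply C_eq; simpl; ring).
  destruct (product_dominating (2 * / lattice_const z ^ 4) inv_pow32 inv_pow32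
    ex_series_inv_pow32 ex_series_inv_pow32) as [D1 D2].
  assert (B : forall l m, Cmod (power_pair (INR (S l) * z) 3 m) <= 2 * / lattice_const z ^ 4 * (inv_pow32 l * inv_pow32 m))
    by (intros; apply power_pair_lattice_bound; [exact Hz | lia]).
  assert (I : forall l m, power_pair (INR (S l) * / z) 3 m = (z ^ 4 * power_pair (INR (S m) * z) 3 l)%C).
  { intros l m. rewrite power_pair_inversion by exact Hz. unfold power_pair.
    assert (C1 : ((z / Ci) ^ 4)%C = (z ^ 4)%C).
    { unfold Cdiv. rewrite Cpow_mult_l, Cpow_inv, CI by apply Ci_nz. field. }
    assert (C2 : ((- z / Ci) ^ 4)%C = (z ^ 4)%C).
    { rewrite <- C1. unfold Cdiv. ring. }
    rewrite C1, C2. ring. }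
  assert (T : Csum (fun l => Csum (power_pair (INR (S l) * / z) 3)) =
     (z ^ 4 * Csum (fun l => Csum (power_pair (INR (S l) * z) 3)))%C).
  { rewrite (Csum_ext _ (fun l => z ^ 4 * Csum (fun m => power_pair (INR (S m) * z) 3 l))%C).
    - rewrite Csum_scal; [f_equal; symmetry; apply (Csum_fubini _ _ B D1 D2) | apply (Csummable_cols _ _ B D1 D2)].
    - intros l. rewrite <- Csum_scal; [apply Csum_ext, I | apply (Csummable_col _ _ B D1 D2)]. }
  rewrite E1, E2 in T. destruct zeta_2_4 as [_ Z4]. rewrite Z4 in T.
  pose proof PI_RGT_0 as HP.
  assert (P0 : RtoC PI <> 0) by (intros E; apply RtoC_inj in E; lra).
  replace (INR (fact 3)) with 6 in T by (simpl; ring).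
  unfold E4. rewrite RtoC_div, RtoC_pow in T by lra.
  set (A := lambert 3 z) in *. set (A' := lambert 3 (/ z)) in *.
  replace (/ / z)%C with z in T by (field; exact z0).
  assert (N6 : RtoC 6 <> 0) by (intros E; apply RtoC_inj in E; lra).
  assert (N90 : RtoC 90 <> 0) by (intros E; apply RtoC_inj in E; lra).
  (* This factor turns [(2 PI)^4 / 3!] into 240 and [zeta 4] into 1. *)
  apply (f_equal (fun x => 90 / PI ^ 4 * x)%C) in T.
  transitivity (z ^ 4 + 1 + 90 / PI ^ 4 * ((2 * PI) ^ 4 / 6 * A' - PI ^ 4 / 90 * z ^ 4))%C.
  - field. auto.
  - rewrite T. field. auto.
Qed.

(** * The conditionally convergent lattice sum of weight 2 *)

Lemma Csum_telescope (h : nat -> C) (x : C) :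
  Csummable (fun m => (h (S m) - h m)%C) -> Clim h x -> Csum (fun m => (h (S m) - h m)%C) = (x - h O)%C.
Proof.
  intros Hs Hl. apply Csum_unique; [exact Hs|].
  apply (Clim_ext (fun N => h N + - h O)%C).
  - intros N. induction N as [|N IH]; simpl; [ring | rewrite <- IH; ring].
  - apply Clim_plus; [exact Hl | apply Clim_const].
Qed.

Section Eisenstein.

Variable z : C.
Hypothesis Hz : 0 < Re z.

(* Subtracting these telescoping terms makes the weight 2 lattice sum absolutely
   convergent; the two orders of summation then differ by the limit [PI / z] of
   their column sums. *)
Definition lattice_prim (l m : nat) : C :=
  (Ci * (/ (INR (S l) * z + INR m * Ci) - / (INR (S l) * z - INR m * Ci)))%C.

Let A (l m : nat) : C := power_pair (INR (S l) * z) 1 m.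
Let B (l m : nat) : C := (lattice_prim l (S m) - lattice_prim l m)%C.
Let K : R := 4 * / lattice_const z ^ 3.

(** Over the unit step from [m] to [m + 1], [B l m] is a sum of products of neighbouring
    reciprocals. Its difference from the squares in [A l m] therefore has three factors of lattice
    size in the denominator, as [inv_pow32] requires. *)
Lemma weight2_difference_bound l m : Cmod (A l m - B l m) <= K * (inv_pow32 l * inv_pow32 m).
Proof.
  pose proof (lattice_const_pos z Hz) as Kp. pose proof (Re_scaled z Hz l) as HX.
  assert (L1 : 1 <= INR (S l)) by (apply (le_INR 1); lia).
  assert (M1 : 1 <= INR (S m)) by (apply (le_INR 1); lia).
  assert (CI : (Ci * Ci)%C = (- (1))%C) by (apply C_eq; simpl; ring).
  assert (IS : RtoC (INR m) = (INR (S m) - 1)%C) by (rewrite S_INR, RtoC_plus; ring).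
  pose proof (shift_plus_neq_0 _ (INR (S m)) HX) as N1. pose proof (shift_minus_neq_0 _ (INR (S m)) HX) as N2.
  pose proof (shift_plus_neq_0 _ (INR m) HX) as N3. pose proof (shift_minus_neq_0 _ (INR m) HX) as N4.
  pose proof (lattice_inv_bound_plus z Hz l m) as B1. pose proof (lattice_inv_bound_minus z Hz l m) as B2.
  (* Replacing [S m] by [m] costs at most a factor 2, because [S l >= 1]. *)
  assert (B3 : Cmod (/ (INR (S l) * z + INR m * Ci)) <= 2 * (/ lattice_const z * / (INR (S l) + INR (S m)))
             /\ Cmod (/ (INR (S l) * z - INR m * Ci)) <= 2 * (/ lattice_const z * / (INR (S l) + INR (S m)))).
  { assert (G : / (lattice_const z * (INR (S l) + INR m)) <= 2 * (/ lattice_const z * / (INR (S l) + INR (S m)))).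
    { assert (0 <= INR m) by apply pos_INR. rewrite (S_INR m) in *. apply (Rmult_le_reg_l (lattice_const z * (INR (S l) + INR m))); [nra|].
      rewrite Rinv_r by nra.
      replace (lattice_const z * (INR (S l) + INR m) * (2 * (/ lattice_const z * / (INR (S l) + (INR m + 1)))))
        with (2 * (INR (S l) + INR m) * / (INR (S l) + (INR m + 1))) by (field; nra).
      apply (Rmult_le_reg_r (INR (S l) + (INR m + 1))); [nra|]. rewrite Rmult_assoc, Rinv_l; lra. }
    pose proof (pos_INR m). split; (eapply Rle_trans; [|exact G]).
    - rewrite Cmod_inv by exact N3. apply Rinv_le_contravar; [nra|].
      eapply Rle_trans; [|apply lattice_lower_bound; lra]. rewrite Rabs_pos_eq; lra.
    - rewrite Cmod_inv by exact N4. apply Rinv_le_contravar; [nra|].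
      replace (INR (S l) * z - INR m * Ci)%C with (INR (S l) * z + (- INR m)%R * Ci)%C by (rewrite RtoC_opp; ring).
      eapply Rle_trans; [|apply lattice_lower_bound; lra]. rewrite Rabs_Ropp, Rabs_pos_eq; lra. }
  destruct B3 as [B3 B4].
  set (bd := / lattice_const z * / (INR (S l) + INR (S m))) in *.
  assert (E : (A l m - B l m)%C = (Ci * (/ (INR (S l) * z - INR (S m) * Ci)) ^ 2 * / (INR (S l) * z - INR m * Ci)
     - Ci * (/ (INR (S l) * z + INR (S m) * Ci)) ^ 2 * / (INR (S l) * z + INR m * Ci))%C).
  { unfold A, B, power_pair, lattice_prim. rewrite IS in *.
    set (X := (INR (S l) * z)%C) in *. set (y := RtoC (INR (S m))) in *.
    assert (F1 : (Ci * / (X + y * Ci) - Ci * / (X + (y - 1) * Ci))%C = (/ ((X + y * Ci) * (X + (y - 1) * Ci)))%C).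
    { transitivity (- (Ci * Ci) / ((X + y * Ci) * (X + (y - 1) * Ci)))%C; [field; auto | rewrite CI; field; auto]. }
    assert (F2 : (Ci * / (X - (y - 1) * Ci) - Ci * / (X - y * Ci))%C = (/ ((X - y * Ci) * (X - (y - 1) * Ci)))%C).
    { transitivity (- (Ci * Ci) / ((X - y * Ci) * (X - (y - 1) * Ci)))%C; [field; auto | rewrite CI; field; auto]. }
    transitivity ((/ (X + y * Ci)) ^ 2 + (/ (X - y * Ci)) ^ 2 -
      ((Ci * / (X + y * Ci) - Ci * / (X + (y - 1) * Ci)) + (Ci * / (X - (y - 1) * Ci) - Ci * / (X - y * Ci))))%C; [simpl; ring|].
    rewrite F1, F2. simpl. field. auto. }
  rewrite E. eapply Rle_trans; [apply Cmod_triangle_minus|]. rewrite !Cmod_mult, Cmod_Ci, !Cmod_pow.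
  pose proof (Cmod_ge_0 (/ (INR (S l) * z - INR (S m) * Ci))) as P1. pose proof (Cmod_ge_0 (/ (INR (S l) * z + INR (S m) * Ci))) as P2.
  pose proof (Cmod_ge_0 (/ (INR (S l) * z - INR m * Ci))) as P3. pose proof (Cmod_ge_0 (/ (INR (S l) * z + INR m * Ci))) as P4.
  assert (Q1 : Cmod (/ (INR (S l) * z - INR (S m) * Ci)) ^ 2 * Cmod (/ (INR (S l) * z - INR m * Ci)) <= bd ^ 2 * (2 * bd)).
  { apply Rmult_le_compat; auto; [apply pow_le; assumption | apply pow_incr; split; assumption]. }
  assert (Q2 : Cmod (/ (INR (S l) * z + INR (S m) * Ci)) ^ 2 * Cmod (/ (INR (S l) * z + INR m * Ci)) <= bd ^ 2 * (2 * bd)).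
  { apply Rmult_le_compat; auto; [apply pow_le; assumption | apply pow_incr; split; assumption]. }
  apply Rle_trans with (4 * bd ^ 3); [lra|]. unfold K, bd. rewrite Rpow_mult_distr, 2!pow_inv, Rmult_assoc.
  apply Rmult_le_compat_l; [lra|]. apply Rmult_le_compat_l.
  - apply Rlt_le, Rinv_0_lt_compat, pow_lt, Kp.
  - apply inv_pow_le_inv_pow32. lia.
Qed.

Lemma weight2_dominating :
  (forall l, ex_series (fun m => K * (inv_pow32 l * inv_pow32 m))) /\
  ex_series (fun l => Series (fun m => K * (inv_pow32 l * inv_pow32 m))).
Proof. apply product_dominating; apply ex_series_inv_pow32. Qed.

Lemma lattice_prim_0 l : lattice_prim l 0 = 0.
Proof.
  unfold lattice_prim. simpl (INR 0). replace (INR (S l) * z - 0 * Ci)%C with (INR (S l) * z + 0 * Ci)%C by ring. ring.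
Qed.

Lemma is_lim_seq_inv_shift (c : R) : 0 <= c -> is_lim_seq (fun M => / (c + INR (S M))) 0.
Proof.
  intros Hc. apply (is_lim_seq_inv _ p_infty); [|discriminate].
  apply (is_lim_seq_le_p_loc INR); [|apply is_lim_seq_INR].
  exists O. intros n _. rewrite S_INR. lra.
Qed.

Lemma lattice_prim_lim l : Clim (lattice_prim l) 0.
Proof.
  apply (is_lim_seq_incr_1 (fun n => Cmod (lattice_prim l n - 0))).
  apply (Clim_bound (fun n => lattice_prim l (S n)) 0 (fun M => 2 * / lattice_const z * / (INR (S l) + INR (S M)))).
  - intros M. replace (lattice_prim l (S M) - 0)%C with (lattice_prim l (S M)) by ring. unfold lattice_prim.
    rewrite Cmod_mult, Cmod_Ci, Rmult_1_l. eapply Rle_trans; [apply Cmod_triangle_minus|].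
    pose proof (lattice_inv_bound_plus z Hz l M). pose proof (lattice_inv_bound_minus z Hz l M). lra.
  - replace 0 with (2 * / lattice_const z * 0) by ring.
    apply (is_lim_seq_scal_l _ (2 * / lattice_const z) 0), is_lim_seq_inv_shift, pos_INR.
Qed.

(** Along a row the correction telescopes to 0: [lattice_prim l] vanishes at 0 and tends to 0. *)
Lemma weight2_row l : Csum (fun m => (A l m - B l m)%C) = Csum (A l).
Proof.
  destruct weight2_dominating as [D1 D2].
  pose proof (Csummable_row (fun l m => (A l m - B l m)%C) _ weight2_difference_bound D1 l) as S1.
  pose proof (power_pair_summable (INR (S l) * z) (Re_scaled z Hz l) 1) as S2.
  assert (S3 : Csummable (B l)).
  { eapply Csummable_ext; [|apply (Csummable_minus _ _ S2 S1)]. intros m. unfold A. ring. }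
  rewrite Csum_minus by assumption. unfold B at 1.
  rewrite (Csum_telescope (lattice_prim l) 0 S3 (lattice_prim_lim l)), lattice_prim_0. ring.
Qed.

Lemma Re_INR_div m : 0 < Re (INR (S m) / z).
Proof. apply (Re_scaled (/ z) (Re_inv_pos z Hz)). Qed.

(** Read along columns, the correction terms are partial fractions of [pi_coth] at [(m + 1) / z], so
    that the column sums have a closed form. *)
Lemma lattice_prim_coth l m : lattice_prim l (S m) = (/ z * coth_pair (INR (S m) / z) l)%C.
Proof.
  pose proof (Re_pos_neq_0 z Hz) as z0.
  pose proof (shift_plus_neq_0 _ (INR (S m)) (Re_scaled z Hz l)) as N1.
  pose proof (shift_minus_neq_0 _ (INR (S m)) (Re_scaled z Hz l)) as N2.
  unfold lattice_prim, coth_pair.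
  assert (CI : (Ci * Ci)%C = (- (1))%C) by (apply C_eq; simpl; ring). pose proof Ci_nz.
  set (x := RtoC (INR (S l))) in *. set (y := RtoC (INR (S m))) in *.
  assert (E1 : (y / z + x * Ci)%C = (Ci * (x * z - y * Ci) / z)%C).
  { replace (Ci * (x * z - y * Ci))%C with (x * z * Ci - y * (Ci * Ci))%C by ring. rewrite CI. field. exact z0. }
  assert (E2 : (y / z - x * Ci)%C = (- (Ci * (x * z + y * Ci)) / z)%C).
  { replace (Ci * (x * z + y * Ci))%C with (x * z * Ci + y * (Ci * Ci))%C by ring. rewrite CI. field. exact z0. }
  rewrite E1, E2.
  transitivity ((Ci * Ci) * (/ (Ci * (x * z + y * Ci)) - / (Ci * (x * z - y * Ci))))%C.
  - field. auto.
  - rewrite CI. field. auto.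
Qed.

Definition prim_col (m : nat) : C := Csum (fun l => lattice_prim l m).

Lemma prim_col_summable m : Csummable (fun l => lattice_prim l m).
Proof.
  destruct m as [|m].
  - apply (Csummable_ext (fun _ => 0 * 0)%C); [intros; rewrite lattice_prim_0; ring|].
    apply Csummable_scal. apply (proj1 (Csum_head (fun _ => RtoC 0) (fun _ => eq_refl))).
  - eapply Csummable_ext; [intros l; symmetry; apply lattice_prim_coth|].
    apply Csummable_scal, coth_pair_summable, Re_INR_div.
Qed.

Lemma prim_col_0 : prim_col 0 = 0.
Proof. unfold prim_col. rewrite (Csum_ext _ (fun _ => RtoC 0)) by apply lattice_prim_0. apply Csum_0. Qed.

Lemma prim_col_S m : prim_col (S m) = (/ z * pi_coth (INR (S m) / z) - / INR (S m))%C.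
Proof.
  pose proof (Re_pos_neq_0 z Hz) as z0.
  assert (N : RtoC (INR (S m)) <> 0) by (intros E; apply RtoC_inj in E; revert E; apply not_0_INR; lia).
  unfold prim_col. rewrite (Csum_ext _ _ (fun l => lattice_prim_coth l m)).
  rewrite Csum_scal by apply coth_pair_summable, Re_INR_div.
  rewrite (coth_partial_fractions _ (Re_INR_div m)). field. auto.
Qed.

(** [pi_coth] tends to [PI] far to the right. The inequality [e^x - 1 >= x] yields only the rate
    [1 / m], which suffices. *)
Lemma prim_col_lim : Clim prim_col (PI / z).
Proof.
  apply (is_lim_seq_incr_1 (fun n => Cmod (prim_col n - PI / z))).
  pose proof (Re_pos_neq_0 z Hz) as z0. pose proof PI_RGT_0 as HP.
  set (a := Re (/ z)). assert (Ha : 0 < a) by apply (Re_inv_pos z Hz).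
  apply (Clim_bound (fun n => prim_col (S n)) (PI / z) (fun M => (Cmod (/ z) * / a + 1) * / (0 + INR (S M)))).
  - intros M. rewrite prim_col_S. unfold pi_coth. pose proof (pi_coth_den _ (Re_INR_div M)) as Dn.
    assert (HM : 0 < INR (S M)) by (apply lt_0_INR; lia).
    assert (NM : RtoC (INR (S M)) <> 0) by (intros E; apply RtoC_inj in E; lra).
    replace (_ - PI / z)%C with (/ z * (2 * PI / (Cexp (2 * PI * (INR (S M) / z)) - 1)) - / INR (S M))%C
      by (unfold Cdiv; ring).
    eapply Rle_trans; [apply Cmod_triangle_minus|].
    rewrite Cmod_mult, (Cmod_inv (INR _)), Cmod_R, (Rabs_pos_eq (INR _)) by (auto; lra).
    rewrite Cmod_div by exact Dn. rewrite <- RtoC_mult, Cmod_R, Rabs_pos_eq, RtoC_mult by lra.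
    assert (Low : 2 * PI * (INR (S M) * a) <= Cmod (Cexp (2 * PI * (INR (S M) / z)) - 1)).
    { eapply Rle_trans; [|apply Cmod_triangle_rev]. rewrite Cmod_Cexp, Cmod_1.
      rewrite Re_2PI_mult. replace (Re (INR (S M) / z)) with (INR (S M) * a) by (unfold a, Cdiv; rewrite re_scal_l; reflexivity).
      pose proof (exp_ineq1_le (2 * PI * (INR (S M) * a))). lra. }
    assert (0 < 2 * PI * (INR (S M) * a)) by (assert (0 < INR (S M) * a) by (apply Rmult_lt_0_compat; assumption); nra).
    assert (2 * PI / Cmod (Cexp (2 * PI * (INR (S M) / z)) - 1) <= / a * / INR (S M)).
    { apply Rle_trans with (2 * PI / (2 * PI * (INR (S M) * a))); [|apply Req_le; field; repeat split; lra].
      apply Rmult_le_compat_l; [lra|]. apply Rinv_le_contravar; assumption. }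
    pose proof (Cmod_ge_0 (/ z)). rewrite Rplus_0_l.
    replace ((Cmod (/ z) * / a + 1) * / INR (S M)) with (Cmod (/ z) * (/ a * / INR (S M)) + / INR (S M)) by ring.
    apply Rplus_le_compat_r, Rmult_le_compat_l; assumption.
  - replace 0 with ((Cmod (/ z) * / a + 1) * 0) at 1 by ring.
    apply (is_lim_seq_scal_l _ (Cmod (/ z) * / a + 1) 0), is_lim_seq_inv_shift. lra.
Qed.

Lemma weight2_inversion_term l m :
  A l m = (- (/ z) ^ 2 * power_pair (INR (S m) * / z) 1 l)%C.
Proof.
  rewrite power_pair_inversion by exact Hz. pose proof (Re_pos_neq_0 z Hz) as z0.
  unfold A, power_pair.
  assert (CI : (/ Ci * / Ci)%C = (- (1))%C).
  { rewrite Ci_inv. apply C_eq; simpl; ring. }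
  assert (C1 : ((z / Ci) ^ 2)%C = (- z ^ 2)%C).
  { transitivity (z ^ 2 * (/ Ci * / Ci))%C; [unfold Cdiv; simpl; ring | rewrite CI; ring]. }
  assert (C2 : ((- z / Ci) ^ 2)%C = (- z ^ 2)%C).
  { transitivity (z ^ 2 * (/ Ci * / Ci))%C; [unfold Cdiv; simpl; ring | rewrite CI; ring]. }
  rewrite C1, C2.
  transitivity ((/ z * z) ^ 2 * ((/ (INR (S l) * z + INR (S m) * Ci)) ^ 2 + (/ (INR (S l) * z - INR (S m) * Ci)) ^ 2))%C.
  - rewrite Cinv_l by exact z0. simpl. ring.
  - simpl. ring.
Qed.

Lemma weight2_column m : Csum (fun l => (A l m - B l m)%C) =
  (- (/ z) ^ 2 * Csum (power_pair (INR (S m) * / z) 1) - (prim_col (S m) - prim_col m))%C.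
Proof.
  pose proof (power_pair_summable _ (Re_scaled (/ z) (Re_inv_pos z Hz) m) 1) as S1.
  assert (S2 : Csummable (fun l => A l m)).
  { eapply Csummable_ext; [intros l; symmetry; apply weight2_inversion_term|]. apply Csummable_scal, S1. }
  rewrite Csum_minus; [|exact S2|apply Csummable_minus; apply prim_col_summable].
  unfold B. rewrite Csum_minus by apply prim_col_summable. f_equal.
  rewrite (Csum_ext _ _ (fun l => weight2_inversion_term l m)). apply Csum_scal, S1.
Qed.

Lemma weight2_inversion :
  Csum (fun l => Csum (power_pair (INR (S l) * z) 1)) =
  (- (/ z) ^ 2 * Csum (fun m => Csum (power_pair (INR (S m) * / z) 1)) - PI / z)%C.
Proof.
  destruct weight2_dominating as [D1 D2].
  pose proof (Csum_fubini (fun l m => (A l m - B l m)%C) _ weight2_difference_bound D1 D2) as F.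
  pose proof (Csummable_cols (fun l m => (A l m - B l m)%C) _ weight2_difference_bound D1 D2) as SC.
  destruct (lattice_lambert 1 (/ z) ltac:(lia) (Re_inv_pos z Hz)) as [S1 _].
  cbv beta in F, SC. rewrite (Csum_ext _ _ weight2_row) in F.
  change (Csum (fun l => Csum (power_pair (INR (S l) * z) 1))) with (Csum (fun l => Csum (A l))). rewrite F.
  assert (S2 : Csummable (fun m => (prim_col (S m) - prim_col m)%C)).
  { eapply Csummable_ext; [|apply (Csummable_minus _ _ (Csummable_scal (- (/ z) ^ 2)%C _ S1) SC)].
    intros m. cbv beta. rewrite weight2_column. ring. }
  rewrite (Csum_ext _ _ weight2_column), Csum_minus, Csum_scal by (auto; apply Csummable_scal, S1).
  rewrite (Csum_telescope _ _ S2 prim_col_lim), prim_col_0. ring.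
Qed.

End Eisenstein.

Definition E2 (z : C) : C := (1 - 24 * lambert 1 z)%C.

Lemma E2_inversion z : 0 < Re z -> E2 (/ z) = (- z ^ 2 * E2 z + 6 * z / PI)%C.
Proof.
  intros Hz. pose proof (Re_pos_neq_0 z Hz) as z0.
  destruct (lattice_lambert 1 z ltac:(lia) Hz) as [_ U1].
  destruct (lattice_lambert 1 (/ z) ltac:(lia) (Re_inv_pos z Hz)) as [_ U2].
  pose proof (weight2_inversion z Hz) as W. rewrite U1, U2 in W.
  destruct zeta_2_4 as [Z2 _]. rewrite Z2 in W.
  replace (INR (fact 1)) with 1 in W by (simpl; ring).
  pose proof PI_RGT_0 as HP.
  assert (P0 : RtoC PI <> 0) by (intros E; apply RtoC_inj in E; lra).
  assert (N6 : RtoC 6 <> 0) by (intros E; apply RtoC_inj in E; lra).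
  rewrite RtoC_div, RtoC_pow in W by lra.
  unfold E2. set (X := lambert 1 z) in *. set (Y := lambert 1 (/ z)) in *.
  replace (/ / z)%C with z in W by (field; exact z0).
  (* The factor [6 / PI^2] turns [(2 PI)^2] into 24 and [zeta 2] into 1. *)
  apply (f_equal (fun x => 6 * z ^ 2 / PI ^ 2 * x)%C) in W.
  transitivity (1 + 6 * z ^ 2 / PI ^ 2 * (- (/ z) ^ 2 * ((2 * PI) ^ 2 / 1 * Y - PI ^ 2 / 6 * z ^ 2) - PI / z) - z ^ 2 + 6 * z / PI)%C.
  - field. auto.
  - rewrite <- W. field. auto.
Qed.

(** * The discriminant *)

(* The quadratic remainder makes complex differentiability pass through sums of series term by term. *)
Definition hol (f : C -> C) (z d : C) : Prop :=
  exists delta M : R, 0 < delta /\ 0 <= M /\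
    forall h, Cmod h <= delta -> Cmod (f (z + h) - f z - d * h)%C <= M * Cmod h ^ 2.

Lemma hol_ext f g z d : (forall x, f x = g x) -> hol f z d -> hol g z d.
Proof.
  intros E (de & M & H1 & H2 & H3). exists de, M. repeat split; auto.
  intros h Hh. rewrite <- !E. auto.
Qed.

Lemma hol_linear c z : hol (fun x => (c * x)%C) z c.
Proof.
  exists 1, 0. repeat split; try lra. intros h _.
  replace (_ - _ - _)%C with (RtoC 0) by ring. rewrite Cmod_0. lra.
Qed.

Lemma hol_plus f g z d e : hol f z d -> hol g z e -> hol (fun x => (f x + g x)%C) z (d + e).
Proof.
  intros (d1 & M1 & P1 & Q1 & H1) (d2 & M2 & P2 & Q2 & H2).
  exists (Rmin d1 d2), (M1 + M2). split; [apply Rmin_glb_lt; assumption|]. split; [lra|].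
  intros h Hh. pose proof (Rmin_l d1 d2). pose proof (Rmin_r d1 d2).
  specialize (H1 h ltac:(lra)). specialize (H2 h ltac:(lra)).
  replace (f (z + h)%C + g (z + h)%C - (f z + g z) - (d + e) * h)%C
    with ((f (z + h)%C - f z - d * h) + (g (z + h)%C - g z - e * h))%C by ring.
  eapply Rle_trans; [apply Cmod_triangle|]. lra.
Qed.

Lemma hol_mult f g z d e : hol f z d -> hol g z e ->
  hol (fun x => (f x * g x)%C) z (d * g z + f z * e).
Proof.
  intros (d1 & M1 & P1 & Q1 & H1) (d2 & M2 & P2 & Q2 & H2).
  exists (Rmin 1 (Rmin d1 d2)),
    (Cmod d * Cmod e + (Cmod (f z) + Cmod d) * M2 + M1 * (Cmod (g z) + Cmod e) + M1 * M2).
  pose proof (Cmod_ge_0 d). pose proof (Cmod_ge_0 e). pose proof (Cmod_ge_0 (f z)). pose proof (Cmod_ge_0 (g z)).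
  split; [repeat apply Rmin_glb_lt; lra|]. split; [nra|].
  intros h Hh. pose proof (Rmin_l 1 (Rmin d1 d2)). pose proof (Rmin_r 1 (Rmin d1 d2)).
  pose proof (Rmin_l d1 d2). pose proof (Rmin_r d1 d2). pose proof (Cmod_ge_0 h) as Ph.
  specialize (H1 h ltac:(lra)). specialize (H2 h ltac:(lra)).
  set (A := (f (z + h)%C - f z - d * h)%C) in *. set (B := (g (z + h)%C - g z - e * h)%C) in *.
  replace (f (z + h)%C * g (z + h)%C - f z * g z - (d * g z + f z * e) * h)%C
    with (d * e * (h * h) + (f z + d * h) * B + A * (g z + e * h) + A * B)%C by (unfold A, B; ring).
  assert (T1 : Cmod (d * e * (h * h))%C <= Cmod d * Cmod e * Cmod h ^ 2) by (rewrite !Cmod_mult; simpl; lra).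
  assert (T0 : forall x y : C, Cmod (x + y * h) <= Cmod x + Cmod y).
  { intros x y. eapply Rle_trans; [apply Cmod_triangle|]. rewrite Cmod_mult. pose proof (Cmod_ge_0 y). nra. }
  assert (T2 : Cmod ((f z + d * h) * B)%C <= (Cmod (f z) + Cmod d) * (M2 * Cmod h ^ 2)).
  { rewrite Cmod_mult. apply Rmult_le_compat; auto using Cmod_ge_0. }
  assert (T3 : Cmod (A * (g z + e * h))%C <= (M1 * Cmod h ^ 2) * (Cmod (g z) + Cmod e)).
  { rewrite Cmod_mult. apply Rmult_le_compat; auto using Cmod_ge_0. }
  assert (T4 : Cmod (A * B)%C <= M1 * (M2 * Cmod h ^ 2)).
  { rewrite Cmod_mult. apply Rmult_le_compat; auto using Cmod_ge_0.
    eapply Rle_trans; [exact H1|]. assert (Cmod h ^ 2 <= 1) by (simpl; nra). nra. }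
  eapply Rle_trans; [apply Cmod_triangle|]. eapply Rle_trans; [apply Rplus_le_compat_r, Cmod_triangle|].
  eapply Rle_trans; [apply Rplus_le_compat_r, Rplus_le_compat_r, Cmod_triangle|]. nra.
Qed.

Lemma hol_comp f g z d e : hol f (g z) d -> hol g z e -> hol (fun x => f (g x)) z (d * e).
Proof.
  intros (d1 & M1 & P1 & Q1 & H1) (d2 & M2 & P2 & Q2 & H2).
  pose proof (Cmod_ge_0 d). pose proof (Cmod_ge_0 e).
  set (c := Cmod e + M2). assert (Hc : 0 <= c) by (unfold c; lra).
  exists (Rmin (Rmin 1 d2) (d1 / (c + 1))), (M1 * c ^ 2 + Cmod d * M2).
  assert (0 < d1 / (c + 1)) by (apply Rdiv_lt_0_compat; lra).
  split; [repeat apply Rmin_glb_lt; lra|].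
  split; [assert (0 <= c ^ 2) by apply pow2_ge_0; nra|].
  intros h Hh. pose proof (Rmin_l (Rmin 1 d2) (d1 / (c + 1))). pose proof (Rmin_r (Rmin 1 d2) (d1 / (c + 1))).
  pose proof (Rmin_l 1 d2). pose proof (Rmin_r 1 d2). pose proof (Cmod_ge_0 h) as Ph.
  specialize (H2 h ltac:(lra)). set (B := (g (z + h)%C - g z - e * h)%C) in *.
  set (k := (g (z + h)%C - g z)%C).
  assert (Hk : Cmod k <= c * Cmod h).
  { replace k with (e * h + B)%C by (unfold k, B; ring). eapply Rle_trans; [apply Cmod_triangle|].
    rewrite Cmod_mult. unfold c. assert (M2 * Cmod h ^ 2 <= M2 * Cmod h) by (apply Rmult_le_compat_l; simpl; nra). lra. }
  assert (Hk1 : Cmod k <= d1).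
  { eapply Rle_trans; [exact Hk|]. apply Rle_trans with ((c + 1) * (d1 / (c + 1))); [|apply Req_le; field; lra].
    apply Rmult_le_compat; lra. }
  specialize (H1 k Hk1).
  replace (g z + k)%C with (g (z + h)%C) in H1 by (unfold k; ring).
  replace (f (g (z + h)%C) - f (g z) - d * e * h)%C with ((f (g (z + h)%C) - f (g z) - d * k) + d * B)%C by (unfold k, B; ring).
  eapply Rle_trans; [apply Cmod_triangle|]. rewrite Cmod_mult.
  assert (Cmod k ^ 2 <= (c * Cmod h) ^ 2) by (apply pow_incr; split; [apply Cmod_ge_0 | exact Hk]).
  rewrite Rpow_mult_distr in H8.
  assert (M1 * Cmod k ^ 2 <= M1 * (c ^ 2 * Cmod h ^ 2)) by (apply Rmult_le_compat_l; assumption).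
  assert (Cmod d * Cmod B <= Cmod d * (M2 * Cmod h ^ 2)) by (apply Rmult_le_compat_l; assumption).
  lra.
Qed.

Lemma hol_Cexp v : hol Cexp v (Cexp v).
Proof.
  exists 1, (exp (Re v) * exp 1). pose proof (exp_pos (Re v)). pose proof (exp_pos 1).
  split; [lra|]. split; [nra|]. intros h Hh.
  replace (Cexp (v + h) - Cexp v - Cexp v * h)%C with (Cexp v * (Cexp h - 1 - h))%C by (rewrite Cexp_plus; ring).
  rewrite Cmod_mult, Cmod_Cexp. rewrite Rmult_assoc. apply Rmult_le_compat_l; [lra|].
  eapply Rle_trans; [apply Cexp_sub2_bound|]. rewrite Rmult_comm.
  apply Rmult_le_compat_r; [apply pow2_ge_0|].
  destruct Hh as [Hh|Hh]; [apply Rlt_le, exp_increasing, Hh | rewrite Hh; lra].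
Qed.

Lemma hol_inv (z : C) : z <> 0 -> hol Cinv z (- (/ z) ^ 2).
Proof.
  intros Hz. pose proof (proj1 (Cmod_gt_0 z) Hz) as P.
  exists (Cmod z / 2), (2 / Cmod z ^ 3).
  assert (0 < Cmod z ^ 3) by (apply pow_lt, P).
  split; [lra|]. split; [apply Rlt_le, Rdiv_lt_0_compat; lra|].
  intros h Hh.
  assert (Low : Cmod z / 2 <= Cmod (z + h)).
  { pose proof (Cmod_triangle_rev z (- h)). rewrite Cmod_opp in H0.
    replace (z - - h)%C with (z + h)%C in H0 by ring. lra. }
  assert (Hzh : (z + h)%C <> 0) by (apply Cmod_gt_0; lra).
  replace (/ (z + h) - / z - - (/ z) ^ 2 * h)%C with (h ^ 2 / (z ^ 2 * (z + h)))%C by (field; auto).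
  rewrite Cmod_div, Cmod_mult, !Cmod_pow by (apply Cmult_neq_0; [apply Cpow_nz|]; assumption).
  unfold Rdiv. rewrite Rmult_comm. apply Rmult_le_compat_r; [apply pow2_ge_0|].
  apply Rle_trans with (/ (Cmod z ^ 2 * (Cmod z / 2))); [|apply Req_le; field; lra].
  assert (0 < Cmod z ^ 2) by (apply pow_lt, P).
  apply Rinv_le_contravar; [nra|]. apply Rmult_le_compat_l; lra.
Qed.

Lemma hol_pow f z d n : hol f z d -> hol (fun x => (f x ^ S n)%C) z (INR (S n) * f z ^ n * d).
Proof.
  intros H. induction n as [|n IH].
  - simpl. replace (1 * 1 * d)%C with d by ring. apply (hol_ext f); [intros; simpl; ring | exact H].
  - pose proof (hol_mult _ _ z _ _ H IH) as G.
    replace (INR (S (S n)) * f z ^ S n * d)%C with (d * f z ^ S n + f z * (INR (S n) * f z ^ n * d))%C.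
    + apply (hol_ext (fun x => (f x * f x ^ S n)%C)); [intros; symmetry; apply Cpow_S | exact G].
    + rewrite (S_INR (S n)), RtoC_plus, Cpow_S. ring.
Qed.

(** Stated with an explicit radius and constants instead of [hol], so that it can be applied to the
    inner and then to the outer sum of [log_eta]. *)
Lemma hol_Csum (f : nat -> C -> C) (d : nat -> C) z delta (M : nat -> R) :
  (forall i h, Cmod h <= delta -> Cmod (f i (z + h) - f i z - d i * h)%C <= M i * Cmod h ^ 2) ->
  (forall h, Cmod h <= delta -> Csummable (fun i => f i (z + h)%C)) ->
  Csummable d -> ex_series M ->
  forall h, Cmod h <= delta ->
    Cmod (Csum (fun i => f i (z + h)%C) - Csum (fun i => f i z) - Csum d * h)%C <= Series M * Cmod h ^ 2.
Proof.
  intros Hq Hs Hd HM h Hh.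
  assert (S0 : Csummable (fun i => f i z)).
  { assert (H0 : Cmod 0 <= delta) by (rewrite Cmod_0; pose proof (Cmod_ge_0 h); lra).
    eapply Csummable_ext; [|apply (Hs 0 H0)]. intros i. cbv beta. f_equal. ring. }
  pose proof (Hs h Hh) as S1.
  rewrite <- Csum_minus, <- Csum_scal_r, <- Csum_minus by
    (auto using Csummable_minus; try apply (Csummable_ext (fun i => h * d i)%C); try (intros; ring); try apply Csummable_scal; auto).
  eapply Rle_trans; [apply Cmod_Csum_le|].
  - apply (Csummable_le _ (fun i => M i * Cmod h ^ 2)); [intros i; apply Hq, Hh|]. apply ex_series_scal_r, HM.
  - rewrite <- Series_scal_r. apply Series_le; [|apply ex_series_scal_r, HM].
    intros i; split; [apply Cmod_ge_0 | apply Hq, Hh].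
Qed.

Lemma is_derive_quadratic (f : R -> R) t d (delta M : R) : 0 < delta ->
  (forall s, Rabs s <= delta -> Rabs (f (t + s) - f t - d * s) <= M * s ^ 2) -> is_derive f t d.
Proof.
  intros Hd H. apply is_derive_Reals. intros eps Heps.
  set (e := Rmin delta (eps / (2 * (Rabs M + 1)))).
  pose proof (Rabs_pos M) as PM.
  assert (He2 : 0 < eps / (2 * (Rabs M + 1))) by (apply Rdiv_lt_0_compat; lra).
  assert (He : 0 < e) by (apply Rmin_glb_lt; assumption).
  exists (mkposreal e He). intros h h0 Hh. simpl in Hh.
  pose proof (Rmin_l delta (eps / (2 * (Rabs M + 1)))). pose proof (Rmin_r delta (eps / (2 * (Rabs M + 1)))).
  fold e in H0, H1. specialize (H h ltac:(lra)).
  replace ((f (t + h) - f t) / h - d) with ((f (t + h) - f t - d * h) / h) by (field; assumption).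
  unfold Rdiv. rewrite Rabs_mult, Rabs_inv. pose proof (Rabs_pos_lt h h0) as Ph.
  apply (Rmult_lt_reg_r (Rabs h)); [assumption|]. rewrite Rmult_assoc, Rinv_l, Rmult_1_r by lra.
  eapply Rle_lt_trans; [exact H|]. rewrite <- (pow2_abs h).
  assert (M * Rabs h ^ 2 <= Rabs M * Rabs h * Rabs h).
  { replace (Rabs M * Rabs h * Rabs h) with (Rabs M * Rabs h ^ 2) by ring.
    apply Rmult_le_compat_r; [apply pow2_ge_0 | apply Rle_abs]. }
  eapply Rle_lt_trans; [exact H2|]. apply Rmult_lt_compat_r; [assumption|].
  apply Rle_lt_trans with (Rabs M * (eps / (2 * (Rabs M + 1)))); [apply Rmult_le_compat_l; lra|].
  apply Rlt_le_trans with ((Rabs M + 1) * (eps / (2 * (Rabs M + 1)))); [nra|].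
  replace ((Rabs M + 1) * (eps / (2 * (Rabs M + 1)))) with (eps / 2) by (field; lra). lra.
Qed.

(** The half-plane is convex: along the segment from [z1] to [z2] the real and imaginary parts have
    zero derivative. *)
Lemma hol_zero_constant f z1 z2 :
  (forall z, 0 < Re z -> hol f z 0) -> 0 < Re z1 -> 0 < Re z2 -> f z1 = f z2.
Proof.
  intros H H1 H2. set (v := (z2 - z1)%C). set (pt := fun t : R => (z1 + t * v)%C).
  assert (Pt : forall t, 0 <= t <= 1 -> 0 < Re (pt t)).
  { intros t Ht. unfold pt, v. rewrite re_plus, re_scal_l. unfold Cminus. rewrite re_plus, re_opp. nra. }
  assert (D : forall (g : C -> R), (forall x, Rabs (g x) <= Cmod x) -> (forall x y, g (x - y)%C = g x - g y) ->
    forall t, 0 <= t <= 1 -> is_derive (fun t => g (f (pt t))) t 0).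
  { intros g Hg Hl t Ht. destruct (H (pt t) (Pt t Ht)) as (de & M & P & Q & B).
    pose proof (Cmod_ge_0 v) as Pv.
    apply (is_derive_quadratic _ t 0 (de / (Cmod v + 1)) (M * Cmod v ^ 2)); [apply Rdiv_lt_0_compat; lra|].
    intros s Hs. rewrite Rmult_0_l, Rminus_0_r, <- Hl. eapply Rle_trans; [apply Hg|].
    specialize (B (s * v)%C). replace (pt t + s * v)%C with (pt (t + s)%R) in B by (unfold pt; rewrite RtoC_plus; ring).
    replace (f (pt (t + s)%R) - f (pt t) - 0 * (s * v))%C with (f (pt (t + s)%R) - f (pt t))%C in B by ring.
    rewrite Cmod_mult, Cmod_R in B.
    replace (M * Cmod v ^ 2 * s ^ 2) with (M * (Rabs s * Cmod v) ^ 2) by (rewrite Rpow_mult_distr, pow2_abs; ring).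
    apply B. apply Rle_trans with (de / (Cmod v + 1) * (Cmod v + 1)); [|apply Req_le; field; lra].
    apply Rmult_le_compat; auto using Rabs_pos; lra. }
  assert (E0 : pt 0 = z1) by (unfold pt; ring). assert (E1 : pt 1 = z2) by (unfold pt, v; ring).
  rewrite <- E0, <- E1. apply C_eq.
  - apply (eq_is_derive (fun t => Re (f (pt t))) 0 1); [|lra].
    intros t Ht. apply (D Re re_le_Cmod); [intros; unfold Re; simpl; ring | exact Ht].
  - apply (eq_is_derive (fun t => Im (f (pt t))) 0 1); [|lra].
    intros t Ht. apply (D Im im_le_Cmod); [intros; unfold Im; simpl; ring | exact Ht].
Qed.

Lemma qpow_plus n z h : qpow n (z + h) = (qpow n z * qpow n h)%C.
Proof. unfold qpow. rewrite <- Cexp_plus. f_equal. ring. Qed.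

(** The growth [exp (2 pi N |h|)] of the Taylor remainder costs at most a quarter of the decay of
    [qpow N z]; three quarters remain. *)
Lemma qpow_quadratic z N h : 0 < Re z -> Cmod h <= Re z / 4 ->
  Cmod (qpow N (z + h) - qpow N z - - (2 * PI * INR N) * qpow N z * h)%C
    <= (2 * PI) ^ 2 * (INR N ^ 2 * Cmod (qpow N (3 * Re z / 4)%R)) * Cmod h ^ 2.
Proof.
  intros Hz Hh. pose proof PI_RGT_0 as HP. pose proof (pos_INR N) as HN.
  set (v := (- (2 * PI * (INR N * h)))%C).
  assert (Hv : Cmod v = 2 * PI * INR N * Cmod h).
  { unfold v. rewrite Cmod_opp, <- RtoC_mult, !Cmod_mult, !Cmod_R, !Rabs_pos_eq by nra. ring. }
  replace (qpow N (z + h) - qpow N z - - (2 * PI * INR N) * qpow N z * h)%C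
    with (qpow N z * (Cexp v - 1 - v))%C by (rewrite qpow_plus; unfold v, qpow; ring).
  rewrite Cmod_mult. pose proof (Cexp_sub2_bound v) as B. rewrite Hv in B.
  eapply Rle_trans; [apply Rmult_le_compat_l; [apply Cmod_ge_0 | exact B]|].
  replace ((2 * PI) ^ 2 * (INR N ^ 2 * Cmod (qpow N (3 * Re z / 4)%R)) * Cmod h ^ 2)
    with ((2 * PI * INR N * Cmod h) ^ 2 * Cmod (qpow N (3 * Re z / 4)%R)) by ring.
  replace (Cmod (qpow N z) * ((2 * PI * INR N * Cmod h) ^ 2 * exp (2 * PI * INR N * Cmod h)))
    with ((2 * PI * INR N * Cmod h) ^ 2 * (Cmod (qpow N z) * exp (2 * PI * INR N * Cmod h))) by ring.
  apply Rmult_le_compat_l; [apply pow2_ge_0|].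
  rewrite 2!Cmod_qpow, 2!exp_pow_INR, <- exp_plus. simpl (Re _).
  assert (INR N * - (2 * PI * Re z) + 2 * PI * INR N * Cmod h <= INR N * - (2 * PI * (3 * Re z / 4))).
  { assert (2 * PI * INR N * Cmod h <= 2 * PI * INR N * (Re z / 4)) by (apply Rmult_le_compat_l; nra). unfold Re in *. lra. }
  destruct H as [H|H]; [apply Rlt_le, exp_increasing, H | unfold Re in *; rewrite H; lra].
Qed.

(* [log_term u] is [- log (1 - exp (-2 pi u))]. *)
Definition log_term (u : C) : C := Csum (fun k => (/ INR (S k) * qpow (S k) u)%C).

(** Minus the logarithm of the product of [1 - q^n], with the index [l] of the logarithmic series
    outermost, in the order of summation of [lambert]. *)
Definition log_eta (z : C) : C :=
  Csum (fun l => Csum (fun n => (/ INR (S l) * qpow (S l * S n) z)%C)).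

Lemma INR_S_C_neq_0 n : RtoC (INR (S n)) <> 0.
Proof. intros E. apply RtoC_inj in E. revert E. apply not_0_INR. lia. Qed.

Lemma Cmod_inv_INR_S_le n : Cmod (/ INR (S n)) <= 1.
Proof.
  rewrite Cmod_inv, Cmod_R, Rabs_pos_eq by (apply pos_INR || apply INR_S_C_neq_0).
  rewrite <- Rinv_1. apply Rinv_le_contravar; [lra|]. apply (le_INR 1). lia.
Qed.

Lemma Cmod_qpow_lambert z l n : 0 < Re z ->
  Cmod (qpow (S l * S n) z) <= lambert_const z 0 * (nome_bound z ^ l * nome_bound z ^ n).
Proof.
  intros Hz. pose proof (lambert_bound z Hz 0 l n) as B. simpl (_ ^ 0) in B at 1. rewrite Rmult_1_l in B. exact B.
Qed.

Lemma log_eta_term_bound z l n : 0 < Re z ->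
  Cmod (/ INR (S l) * qpow (S l * S n) z) <= lambert_const z 0 * (nome_bound z ^ l * nome_bound z ^ n).
Proof.
  intros Hz. rewrite Cmod_mult. eapply Rle_trans; [|apply Cmod_qpow_lambert, Hz].
  rewrite <- (Rmult_1_l (Cmod (qpow _ _))) at 2.
  apply Rmult_le_compat_r; [apply Cmod_ge_0 | apply Cmod_inv_INR_S_le].
Qed.

Lemma qpow_summable z : 0 < Re z -> Csummable (fun n => qpow (S n) z).
Proof.
  intros Hz. pose proof (poly_qpow_summable z Hz 0) as H.
  eapply Csummable_ext; [|exact H]. intros n. simpl. ring.
Qed.

Lemma log_term_summable u : 0 < Re u -> Csummable (fun k => (/ INR (S k) * qpow (S k) u)%C).
Proof.
  intros Hu. apply (Csummable_le _ (fun n => Cmod (qpow (S n) u))); [|apply qpow_summable, Hu].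
  intros n. rewrite Cmod_mult. rewrite <- (Rmult_1_l (Cmod (qpow _ _))) at 2.
  apply Rmult_le_compat_r; [apply Cmod_ge_0 | apply Cmod_inv_INR_S_le].
Qed.

(** The transposed order has the index of the product outermost. *)
Lemma log_eta_product_form z : 0 < Re z ->
  Csummable (fun n => log_term (INR (S n) * z)) /\ log_eta z = Csum (fun n => log_term (INR (S n) * z)).
Proof.
  intros Hz. destruct (lambert_dominating z Hz (lambert_const z 0)) as [D1 D2].
  pose proof (Csum_fubini _ _ (fun l n => log_eta_term_bound z l n Hz) D1 D2) as F.
  pose proof (Csummable_cols _ _ (fun l n => log_eta_term_bound z l n Hz) D1 D2) as Sc.
  cbv beta in F, Sc.
  assert (E : forall n, Csum (fun l => (/ INR (S l) * qpow (S l * S n) z)%C) = log_term (INR (S n) * z)).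
  { intros n. apply Csum_ext. intros l. rewrite qpow_scaled, (Nat.mul_comm (S n)). reflexivity. }
  split.
  - eapply Csummable_ext; [exact E | exact Sc].
  - unfold log_eta. rewrite F. apply Csum_ext, E.
Qed.

Lemma hol_log_term u : 0 < Re u -> hol log_term u (- (2 * PI) * Csum (fun k => qpow (S k) u))%C.
Proof.
  intros Hu. pose proof PI_RGT_0 as HP.
  set (u0 := RtoC (3 * Re u / 4)). assert (Hu0 : 0 < Re u0) by (unfold u0; simpl; unfold Re in *; lra).
  set (M := fun k : nat => (2 * PI) ^ 2 * (lambert_const u0 2 * (nome_bound u0 ^ k * nome_bound u0 ^ 0))).
  assert (SM : ex_series M).
  { apply (ex_series_ext (fun k => ((2 * PI) ^ 2 * lambert_const u0 2) * nome_bound u0 ^ k)).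
    - intros k. unfold M. simpl (_ ^ 0). lazymatch goal with |- ?a = ?b => change (@eq R a b) end. ring.
    - apply (ex_series_scal_l ((2 * PI) ^ 2 * lambert_const u0 2) (pow (nome_bound u0))), nome_bound_summable, Hu0. }
  rewrite <- Csum_scal by apply qpow_summable, Hu.
  exists (Re u / 4), (Series M). split; [lra|]. split.
  - apply Series_nonneg; [|exact SM]. intros k. unfold M.
    apply Rmult_le_pos; [apply pow2_ge_0|].
    eapply Rle_trans; [|apply (lambert_bound u0 Hu0 2 k 0)]. apply Rmult_le_pos; [apply pow2_ge_0 | apply Cmod_ge_0].
  - intros h Hh. unfold log_term.
    apply (hol_Csum (fun k x => (/ INR (S k) * qpow (S k) x)%C) (fun k => (- (2 * PI) * qpow (S k) u)%C) u (Re u / 4)); auto.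
    + intros k g Hg.
      replace (/ INR (S k) * qpow (S k) (u + g) - / INR (S k) * qpow (S k) u - - (2 * PI) * qpow (S k) u * g)%C
        with (/ INR (S k) * (qpow (S k) (u + g) - qpow (S k) u - - (2 * PI * INR (S k)) * qpow (S k) u * g))%C
        by (field; apply INR_S_C_neq_0).
      rewrite Cmod_mult. eapply Rle_trans; [apply Rmult_le_compat; [apply Cmod_ge_0 | apply Cmod_ge_0 | apply Cmod_inv_INR_S_le | apply qpow_quadratic; assumption]|].
      rewrite Rmult_1_l. apply Rmult_le_compat_r; [apply pow2_ge_0|]. unfold M.
      apply Rmult_le_compat_l; [apply pow2_ge_0|].
      pose proof (lambert_bound u0 Hu0 2 k 0) as B. rewrite Nat.mul_1_r in B. exact B.
    + intros g Hg. apply log_term_summable. rewrite re_plus. pose proof (re_le_Cmod g) as R1.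
      apply Rabs_le_between in R1. lra.
    + apply Csummable_scal, qpow_summable, Hu.
Qed.

(** Termwise, [(1 / l) q^(l n)] has derivative [-2 pi n q^(l n)], the Lambert term of order 1. The
    remainders are dominated at the real point [u0] with three quarters of the real part. *)
Lemma hol_log_eta z : 0 < Re z -> hol log_eta z (- (2 * PI) * lambert 1 z)%C.
Proof.
  intros Hu. pose proof PI_RGT_0 as HP. pose proof (lambert_summable z 1 Hu) as SL.
  set (u0 := RtoC (3 * Re z / 4)). assert (Hu0 : 0 < Re u0) by (unfold u0; simpl; unfold Re in *; lra).
  set (C0 := (2 * PI) ^ 2 * lambert_const u0 2).
  destruct (lambert_dominating u0 Hu0 C0) as [D1 D2].
  set (M := fun l => Series (fun n => C0 * (nome_bound u0 ^ l * nome_bound u0 ^ n))).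
  assert (Pos : forall l n, 0 <= C0 * (nome_bound u0 ^ l * nome_bound u0 ^ n)).
  { intros l n. unfold C0. rewrite Rmult_assoc. apply Rmult_le_pos; [apply pow2_ge_0|].
    eapply Rle_trans; [|apply (lambert_bound u0 Hu0 2 l n)]. apply Rmult_le_pos; [apply pow2_ge_0 | apply Cmod_ge_0]. }
  assert (Rz : forall g, Cmod g <= Re z / 4 -> 0 < Re (z + g)).
  { intros g Hg. rewrite re_plus. pose proof (re_le_Cmod g) as R1. apply Rabs_le_between in R1. lra. }
  unfold lambert. rewrite <- Csum_scal by exact SL.
  exists (Re z / 4), (Series M). split; [lra|]. split.
  - apply Series_nonneg; [|exact D2]. intros l. apply Series_nonneg; [apply Pos | apply D1].
  - intros h Hh. unfold log_eta.
    apply (hol_Csum (fun l x => Csum (fun n => (/ INR (S l) * qpow (S l * S n) x)%C))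
      (fun l => (- (2 * PI) * Csum (fun n => INR (S n) ^ 1 * qpow (S l * S n) z))%C) z (Re z / 4)); auto.
    + intros l g Hg.
      assert (Sl : Csummable (fun n => (INR (S n) ^ 1 * qpow (S l * S n) z)%C)).
      { destruct (lambert_dominating z Hu (lambert_const z 1)) as [E1 E2].
        apply (Csummable_row _ _ (fun l n => lambert_term_bound z 1 l n Hu) E1 l). }
      rewrite <- Csum_scal by exact Sl.
      apply (hol_Csum (fun n x => (/ INR (S l) * qpow (S l * S n) x)%C)
        (fun n => (- (2 * PI) * (INR (S n) ^ 1 * qpow (S l * S n) z))%C) z (Re z / 4)
        (fun n => C0 * (nome_bound u0 ^ l * nome_bound u0 ^ n))); auto.
      * intros n k Hk.
        replace (/ INR (S l) * qpow (S l * S n) (z + k) - / INR (S l) * qpow (S l * S n) z -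
           - (2 * PI) * (INR (S n) ^ 1 * qpow (S l * S n) z) * k)%C
          with (/ INR (S l) * (qpow (S l * S n) (z + k) - qpow (S l * S n) z -
            - (2 * PI * INR (S l * S n)) * qpow (S l * S n) z * k))%C
          by (rewrite mult_INR, RtoC_mult, Cpow_1_r; field; apply INR_S_C_neq_0).
        rewrite Cmod_mult. eapply Rle_trans; [apply Rmult_le_compat; [apply Cmod_ge_0 | apply Cmod_ge_0 | apply Cmod_inv_INR_S_le | apply qpow_quadratic; assumption]|].
        rewrite Rmult_1_l. apply Rmult_le_compat_r; [apply pow2_ge_0|]. unfold C0. rewrite Rmult_assoc.
        apply Rmult_le_compat_l; [apply pow2_ge_0|]. apply (lambert_bound u0 Hu0 2 l n).
      * intros k Hk. destruct (lambert_dominating (z + k) (Rz k Hk) (lambert_const (z + k) 0)) as [E1 E2].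
        apply (Csummable_row _ _ (fun l n => log_eta_term_bound (z + k) l n (Rz k Hk)) E1 l).
      * apply Csummable_scal, Sl.
    + intros g Hg. destruct (lambert_dominating (z + g) (Rz g Hg) (lambert_const (z + g) 0)) as [E1 E2].
      apply (Csummable_rows _ _ (fun l n => log_eta_term_bound (z + g) l n (Rz g Hg)) E1 E2).
    + apply Csummable_scal, SL.
Qed.

Lemma Cmod_qpow_1_lt_1 u : 0 < Re u -> Cmod (qpow 1 u) < 1.
Proof. intros H. rewrite Cmod_qpow, pow_1. apply qpow_1_lt_1, H. Qed.

Lemma qpow_geometric u : 0 < Re u -> Csum (fun k => qpow (S k) u) = (qpow 1 u / (1 - qpow 1 u))%C.
Proof.
  intros Hu. pose proof (Cmod_qpow_1_lt_1 u Hu) as Hx.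
  rewrite (Csum_ext _ (fun n => qpow 1 u * qpow 1 u ^ n)%C) by (intros n; rewrite qpow_pow; apply Cpow_S).
  rewrite Csum_scal, Csum_geom by (auto using Csummable_geom). reflexivity.
Qed.

Lemma one_sub_qpow_neq_0 u : 0 < Re u -> (1 - qpow 1 u)%C <> 0.
Proof.
  intros Hu E. apply Ceq_minus in E. pose proof (Cmod_qpow_1_lt_1 u Hu) as H. rewrite <- E, Cmod_1 in H. lra.
Qed.

Lemma hol_qpow1 u : hol (qpow 1) u (- (2 * PI) * qpow 1 u)%C.
Proof.
  pose proof (hol_comp Cexp (fun x => - (2 * PI) * x)%C u _ _ (hol_Cexp _) (hol_linear (- (2 * PI))%C u)) as H.
  assert (E : forall x, qpow 1 x = Cexp (- (2 * PI) * x)%C) by (intros x; unfold qpow; f_equal; simpl; ring).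
  rewrite E, Cmult_comm. apply (hol_ext (fun x => Cexp (- (2 * PI) * x)%C)); [intros; symmetry; apply E | exact H].
Qed.

(** A complex logarithm is avoided: [f] has derivative 0, hence is constant along [u + N], and it
    tends to 1 there since both [log_term] and [qpow 1] tend to 0. *)
Lemma exp_log_term u : 0 < Re u -> Cexp (- log_term u) = (1 - qpow 1 u)%C.
Proof.
  intros Hu.
  set (f := fun x => (Cexp (log_term x) * (1 - qpow 1 x))%C).
  assert (Hf : forall x, 0 < Re x -> hol f x 0).
  { intros x Hx. pose proof (one_sub_qpow_neq_0 x Hx) as N.
    pose proof (hol_comp Cexp log_term x _ _ (hol_Cexp _) (hol_log_term x Hx)) as G1.
    assert (G2 : hol (fun x => 1 - qpow 1 x)%C x (2 * PI * qpow 1 x)%C).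
    { pose proof (hol_comp (fun y => (-1) * y)%C (qpow 1) x _ _ (hol_linear (-1) _) (hol_qpow1 x)) as K.
      destruct K as (de & M & P & Q & K). exists de, M. repeat split; auto. intros h Hh. specialize (K h Hh).
      match type of K with Cmod ?a <= _ => match goal with |- Cmod ?b <= _ => replace b with a; [exact K|] end end. ring. }
    pose proof (hol_mult _ _ x _ _ G1 G2) as G.
    replace (RtoC 0) with (Cexp (log_term x) * (- (2 * PI) * Csum (fun k => qpow (S k) x)) * (1 - qpow 1 x) +
       Cexp (log_term x) * (2 * PI * qpow 1 x))%C; [exact G|].
    rewrite qpow_geometric by exact Hx. field. exact N. }
  assert (Hc : f u = 1).
  { apply (Clim_unique (fun N => f (u + INR N)%C)).
    - apply (Clim_ext (fun _ => f u)); [|apply Clim_const]. intros N. apply hol_zero_constant; auto.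
      rewrite re_plus. simpl (Re (RtoC _)). pose proof (pos_INR N). lra.
    - set (r := exp (- (2 * PI * Re u))). pose proof (qpow_1_lt_1 u Hu) as Hr. fold r in Hr.
      assert (Hr0 : 0 < r) by apply exp_pos.
      set (s := exp (- (2 * PI))).
      assert (Hs : 0 < s < 1) by (split; [apply exp_pos | unfold s; rewrite <- exp_0; apply exp_increasing; pose proof PI_RGT_0; lra]).
      set (K := / (1 - r)). assert (HK : 0 < K) by (apply Rinv_0_lt_compat; lra).
      assert (Q : forall N, Cmod (qpow 1 (u + INR N)) = r * s ^ N).
      { intros N. rewrite qpow_plus, Cmod_mult, 2!Cmod_qpow, 2!pow_1. fold r. f_equal.
        unfold s. rewrite exp_pow_INR. f_equal. simpl. ring. }
      assert (BL : forall N, Cmod (log_term (u + INR N)) <= K * s ^ N).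
      { intros N. assert (HuN : 0 < Re (u + INR N)) by (rewrite re_plus; simpl (Re (RtoC _)); pose proof (pos_INR N); lra).
        assert (SN : s ^ N <= 1) by (rewrite <- (pow1 N); apply pow_incr; lra).
        assert (SN0 : 0 < s ^ N) by (apply pow_lt; lra).
        eapply Rle_trans; [apply Cmod_Csum_le, log_term_summable, HuN|].
        apply Rle_trans with (Series (fun n => (r * s ^ N) * r ^ n)).
        - apply Series_le.
          + intros n; split; [apply Cmod_ge_0|]. rewrite Cmod_mult, qpow_pow, Cmod_pow, Q.
            apply Rle_trans with (1 * (r * s ^ N) ^ S n).
            * apply Rmult_le_compat_r; [apply pow_le; nra | apply Cmod_inv_INR_S_le].
            * rewrite Rmult_1_l. simpl. apply Rmult_le_compat_l; [nra|]. apply pow_incr. split; nra.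
          + apply (ex_series_scal_l (r * s ^ N) (pow r)), ex_series_geom. rewrite Rabs_pos_eq; lra.
        - rewrite Series_scal_l, Series_geom by (rewrite Rabs_pos_eq; lra). fold K. replace (r * s ^ N * K) with (r * (K * s ^ N)) by ring. assert (0 < K * s ^ N) by nra. nra. }
      apply (Clim_bound _ _ (fun N => (K * exp K * 2 + 1) * s ^ N)).
      + intros N. specialize (BL N). specialize (Q N).
        assert (SN : s ^ N <= 1) by (rewrite <- (pow1 N); apply pow_incr; lra).
        assert (SN0 : 0 < s ^ N) by (apply pow_lt; lra).
        unfold f. set (L := log_term (u + INR N)) in *. set (q := qpow 1 (u + INR N)) in *.
        replace (Cexp L * (1 - q) - 1)%C with ((Cexp L - 1) * (1 - q) - q)%C by ring.
        eapply Rle_trans; [apply Cmod_triangle_minus|]. rewrite Cmod_mult, Q.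
        assert (B1 : Cmod (Cexp L - 1) <= K * s ^ N * exp K).
        { eapply Rle_trans; [apply Cexp_sub1_bound|]. apply Rmult_le_compat; auto using Cmod_ge_0.
          - apply Rlt_le, exp_pos.
          - assert (Cmod L <= K) by nra. destruct H as [H|H]; [apply Rlt_le, exp_increasing, H | rewrite H; lra]. }
        assert (B2 : Cmod (1 - q) <= 2).
        { eapply Rle_trans; [apply Cmod_triangle_minus|]. rewrite Cmod_1, Q. nra. }
        assert (B3 : Cmod (Cexp L - 1) * Cmod (1 - q) <= K * s ^ N * exp K * 2) by (apply Rmult_le_compat; auto using Cmod_ge_0).
        nra.
      + replace 0 with ((K * exp K * 2 + 1) * 0) at 1 by ring.
        apply (is_lim_seq_scal_l _ (K * exp K * 2 + 1) 0), is_lim_seq_geom. rewrite Rabs_pos_eq; lra. }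
  rewrite Cexp_opp. unfold f in Hc. pose proof (Cexp_neq_0 (log_term u)).
  replace (1 - qpow 1 u)%C with (Cexp (log_term u) * (1 - qpow 1 u) / Cexp (log_term u))%C by (field; assumption).
  rewrite Hc. field. assumption.
Qed.

(** The product of [q] with all [(1 - q^n)^24], defined as an exponential so that it cannot vanish
    and its logarithmic derivative is [- 2 pi E2]. *)
Definition discr (z : C) : C := Cexp (- 24 * log_eta z - 2 * PI * z).

(** Here [f x] is [discr (1 / x) / (x^12 discr x)]. [E2_inversion] says that its derivative
    vanishes, and the fixed point [x = 1] gives the constant. *)
Lemma discr_inversion z : 0 < Re z -> discr (/ z) = (z ^ 12 * discr z)%C.
Proof.
  intros Hz. pose proof PI_RGT_0 as HP.
  assert (P0 : RtoC PI <> 0) by (intros E; apply RtoC_inj in E; lra).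
  set (g := fun x => (- 24 * log_eta (/ x) + (- (2 * PI)) * / x + (24 * log_eta x + 2 * PI * x))%C).
  set (f := fun x => (Cexp (g x) * (/ x) ^ 12)%C).
  assert (Hg : forall x, 0 < Re x -> hol g x (12 * / x)%C).
  { intros x Hx. pose proof (Re_pos_neq_0 x Hx) as x0. pose proof (Re_inv_pos x Hx) as Hx'.
    pose proof (hol_inv x x0) as Hi.
    pose proof (hol_comp log_eta Cinv x _ _ (hol_log_eta _ Hx') Hi) as G1.
    pose proof (hol_comp (fun y => - 24 * y)%C _ x _ _ (hol_linear (- 24)%C _) G1) as G2.
    pose proof (hol_comp (fun y => - (2 * PI) * y)%C _ x _ _ (hol_linear (- (2 * PI))%C _) Hi) as G3.
    pose proof (hol_comp (fun y => 24 * y)%C _ x _ _ (hol_linear 24 _) (hol_log_eta x Hx)) as G4.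
    pose proof (hol_plus _ _ x _ _ (hol_plus _ _ x _ _ G2 G3) (hol_plus _ _ x _ _ G4 (hol_linear (2 * PI)%C x))) as G.
    pose proof (E2_inversion x Hx) as E. unfold E2 in E.
    set (A := lambert 1 x) in *. set (B := lambert 1 (/ x)) in *.
    replace (12 * / x)%C with (- 24 * (- (2 * PI) * B * - (/ x) ^ 2) + - (2 * PI) * - (/ x) ^ 2 + (24 * (- (2 * PI) * A) + 2 * PI))%C; [exact G|].
    transitivity (2 * PI * (/ x) ^ 2 * (1 - 24 * B) + 2 * PI * (1 - 24 * A))%C; [ring|]. rewrite E. field. auto. }
  assert (Hf : forall x, 0 < Re x -> hol f x 0).
  { intros x Hx. pose proof (Re_pos_neq_0 x Hx) as x0.
    pose proof (hol_comp Cexp g x _ _ (hol_Cexp _) (Hg x Hx)) as G1.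
    pose proof (hol_pow Cinv x _ 11 (hol_inv x x0)) as G2.
    pose proof (hol_mult _ _ x _ _ G1 G2) as G.
    replace (RtoC 0) with (Cexp (g x) * (12 * / x) * (/ x) ^ 12 + Cexp (g x) * (INR 12 * (/ x) ^ 11 * - (/ x) ^ 2))%C; [exact G|].
    replace (INR 12) with 12 by (simpl; ring). ring. }
  assert (E : f z = f 1) by (apply hol_zero_constant; auto; simpl; lra).
  assert (E1 : f 1 = 1).
  { unfold f, g. replace (/ 1)%C with (RtoC 1) by field.
    replace (- 24 * log_eta 1 + - (2 * PI) * 1 + (24 * log_eta 1 + 2 * PI * 1))%C with (RtoC 0) by ring.
    rewrite Cexp_0. ring. }
  rewrite E1 in E. unfold f in E. pose proof (Re_pos_neq_0 z Hz) as z0.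
  assert (E3 : Cexp (g z) = (discr (/ z) / discr z)%C).
  { unfold discr. rewrite <- Cexp_minus. f_equal. unfold g. ring. }
  rewrite E3 in E. assert (D0 : discr z <> 0) by apply Cexp_neq_0.
  transitivity (z ^ 12 * discr z * (discr (/ z) / discr z * (/ z) ^ 12))%C.
  - field. auto.
  - rewrite E. ring.
Qed.

(** * The modular invariant on the right half-plane *)

Lemma is_lim_seq_component (f : C -> R) (u : nat -> C) x :
  (forall z, Rabs (f z) <= Cmod z) -> (forall a b, f (a - b)%C = f a - f b) ->
  Clim u x -> is_lim_seq (fun n => f (u n)) (f x).
Proof.
  intros Hf Hl H.
  apply (is_lim_seq_le_le (fun n => f x - Cmod (u n - x)) _ (fun n => f x + Cmod (u n - x))).
  - intros n. pose proof (Hf (u n - x)%C) as B. rewrite Hl in B. apply Rabs_le_between in B. lra.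
  - replace (Finite (f x)) with (Finite (f x - 0)) by (f_equal; ring).
    apply is_lim_seq_minus'; [apply is_lim_seq_const | exact H].
  - replace (Finite (f x)) with (Finite (f x + 0)) by (f_equal; ring).
    apply is_lim_seq_plus'; [apply is_lim_seq_const | exact H].
Qed.

Lemma Clim_CLim_seq u x : Clim u x -> CLim_seq u = x.
Proof.
  intros H. unfold CLim_seq. apply C_eq.
  - change (real (Lim_seq (fun n => Re (u n))) = Re x).
    rewrite (is_lim_seq_unique _ _ (is_lim_seq_component Re u x re_le_Cmod ltac:(intros; unfold Re; simpl; ring) H)). reflexivity.
  - change (real (Lim_seq (fun n => Im (u n))) = Im x).
    rewrite (is_lim_seq_unique _ _ (is_lim_seq_component Im u x im_le_Cmod ltac:(intros; unfold Im; simpl; ring) H)). reflexivity.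
Qed.

Lemma sum_n_Cpsum (a : nat -> C) n : sum_n a n = Cpsum a (S n).
Proof.
  induction n as [|n IH].
  - rewrite sum_O. simpl. ring.
  - rewrite sum_Sn, IH. reflexivity.
Qed.

Lemma CSeries_Csum a : Csummable a -> CSeries a = Csum a.
Proof.
  intros Ha. apply Clim_CLim_seq. apply (Clim_ext (fun n => Cpsum a (S n))).
  - intros n. symmetry. apply sum_n_Cpsum.
  - apply Clim_shift, Clim_Cpsum, Ha.
Qed.

Lemma Csum_finite (a : nat -> C) M : (forall n, (M <= n)%nat -> a n = 0) -> Csum a = Cpsum a M.
Proof.
  revert a. induction M as [|M IH]; intros a H.
  - simpl. rewrite (Csum_ext _ (fun _ => RtoC 0)) by (intros n; apply H; lia). apply Csum_0.
  - assert (Sa : Csummable a).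
    { apply (proj2 (ex_series_incr_n (fun n => Cmod (a n)) (S M))).
      apply (ex_series_ext (fun _ => 0 * 0)).
      - intros n. rewrite H by lia. rewrite Cmod_0. apply Rmult_0_l.
      - apply (ex_series_ext (fun n => 0 * (0 ^ n))); [intros; lazymatch goal with |- ?a = ?b => change (@eq R a b) end; ring|].
        apply (ex_series_scal_l 0 (pow 0)), ex_series_geom. rewrite Rabs_R0. lra. }
    rewrite (Csum_S _ Sa), IH by (intros; apply H; lia).
    change (S M) with (1 + M)%nat. rewrite Cpsum_app. simpl. ring.
Qed.

(** Index [N] stands for the integer [N + 1], so the multiples of [d] occupy the last place in each
    block of length [d]. *)
Lemma Csum_multiples (d : nat) (c f : nat -> C) : (0 < d)%nat -> Csummable c -> Csummable f ->
  (forall l, c (l * d + (d - 1))%nat = f l) ->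
  (forall N, (S N mod d <> 0)%nat -> c N = 0) -> Csum c = Csum f.
Proof.
  intros Hd Sc Sf H1 H2.
  assert (Block : forall l k, (k < d)%nat -> Cpsum (fun i => c (l * d + i)%nat) k = 0).
  { intros l k. induction k as [|k IH]; intros Hk; [reflexivity|]. simpl. rewrite IH by lia.
    rewrite H2; [ring|]. replace (S (l * d + k)) with (S k + l * d)%nat by lia.
    rewrite Nat.Div0.mod_add, Nat.mod_small; lia. }
  assert (P : forall M, Cpsum c (M * d) = Cpsum f M).
  { induction M as [|M IH]; [reflexivity|].
    replace (S M * d)%nat with (M * d + ((d - 1) + 1))%nat by lia.
    rewrite Cpsum_app, IH, (Cpsum_app _ (d - 1) 1), Block by lia. simpl. rewrite Nat.add_0_r, H1. ring. }
  apply (Clim_unique (Cpsum f)).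
  - apply (Clim_ext (fun M => Cpsum c (M * d))); [exact P|].
    pose proof (Clim_Cpsum c Sc) as L. unfold Clim in L |- *.
    apply (is_lim_seq_subseq _ _ (fun M => (M * d)%nat)) in L; [exact L|].
    apply eventually_subseq. intros n. nia.
  - apply Clim_Cpsum, Sf.
Qed.

(** The Lambert series regrouped by the exponent [S N]: row [n] is a sum over the multiples of
    [S n], padded with zeros, and column [N] is the divisor sum of [S N]. *)
Definition divisor_term (k : nat) (z : C) (n N : nat) : C :=
  if (S N mod S n =? 0)%nat then (INR (S n) ^ k * qpow (S N) z)%C else RtoC 0.

(** The square root of [nome_bound]: the terms decay in [N] only, and this decay is shared between
    [N] and the smaller index [n <= N]. *)
Definition nome_sqrt (z : C) : R := exp (- (PI * Re z / 2)).

Lemma divisor_term_bound k z n N : 0 < Re z ->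
  Cmod (divisor_term k z n N) <= lambert_const z k * (nome_sqrt z ^ n * nome_sqrt z ^ N).
Proof.
  intros Hz. pose proof PI_RGT_0 as HP. pose proof (nome_bound_range z Hz) as [R0 R1].
  assert (E : nome_bound z = nome_sqrt z * nome_sqrt z).
  { unfold nome_bound, nome_sqrt. rewrite <- exp_plus. f_equal. field. }
  assert (S1 : 0 < nome_sqrt z < 1).
  { split; [apply exp_pos|]. unfold nome_sqrt. rewrite <- exp_0. apply exp_increasing. nra. }
  assert (C0 : 0 <= lambert_const z k).
  { unfold lambert_const. apply Rmult_le_pos; [apply pos_INR|]. apply Rlt_le, Rinv_0_lt_compat, pow_lt. nra. }
  unfold divisor_term. destruct (Nat.eqb_spec (S N mod S n) 0) as [D|D].
  - assert (Hn : (n <= N)%nat).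
    { apply Nat.Div0.mod_divides in D. destruct D as [q Hq]. destruct q; lia. }
    rewrite Cmod_mult, Cmod_pow, Cmod_R, Rabs_pos_eq by apply pos_INR.
    pose proof (lambert_bound z Hz k 0 N) as B. rewrite Nat.mul_1_l in B.
    simpl (nome_bound z ^ 0) in B. rewrite Rmult_1_l in B.
    eapply Rle_trans; [|eapply Rle_trans; [exact B|]].
    + apply Rmult_le_compat_r; [apply Cmod_ge_0|]. apply pow_incr. split; [apply pos_INR | apply le_INR; lia].
    + apply Rmult_le_compat_l; [exact C0|]. rewrite E, Rpow_mult_distr.
      apply Rmult_le_compat_r; [apply pow_le; lra|].
      replace N with (n + (N - n))%nat by lia. rewrite pow_add.
      rewrite <- (Rmult_1_r (nome_sqrt z ^ n)) at 2. apply Rmult_le_compat_l; [apply pow_le; lra|].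
      rewrite <- (pow1 (N - n)). apply pow_incr. lra.
  - rewrite Cmod_0. apply Rmult_le_pos; [exact C0|]. apply Rmult_le_pos; apply pow_le; lra.
Qed.

Lemma nome_sqrt_dominating k z : 0 < Re z ->
  (forall n, ex_series (fun N => lambert_const z k * (nome_sqrt z ^ n * nome_sqrt z ^ N))) /\
  ex_series (fun n => Series (fun N => lambert_const z k * (nome_sqrt z ^ n * nome_sqrt z ^ N))).
Proof.
  intros Hz. assert (G : ex_series (pow (nome_sqrt z))).
  { apply ex_series_geom. rewrite Rabs_pos_eq by apply Rlt_le, exp_pos. unfold nome_sqrt. rewrite <- exp_0.
    apply exp_increasing. pose proof PI_RGT_0. nra. }
  apply (product_dominating _ (pow (nome_sqrt z)) (pow (nome_sqrt z)) G G).
Qed.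

Lemma list_sum_filter_Cpsum (p : nat -> bool) (f : nat -> nat) M :
  RtoC (INR (list_sum (map f (filter p (seq 1 M))))) =
  Cpsum (fun n => if p (S n) then RtoC (INR (f (S n))) else RtoC 0) M.
Proof.
  induction M as [|M IH]; [reflexivity|].
  rewrite seq_S, filter_app, map_app, list_sum_app, plus_INR, RtoC_plus, IH. simpl Cpsum. f_equal.
  simpl. destruct (p (S M)); simpl; [|reflexivity]. rewrite Nat.add_0_r. reflexivity.
Qed.

Lemma lambert_divisor_sum k z : 0 < Re z ->
  Csummable (fun N => (INR (divisor_sum k (S N)) * qpow (S N) z)%C) /\
  lambert k z = Csum (fun N => (INR (divisor_sum k (S N)) * qpow (S N) z)%C).
Proof.
  intros Hz. destruct (nome_sqrt_dominating k z Hz) as [D1 D2].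
  assert (B : forall n N, Cmod (divisor_term k z n N) <= lambert_const z k * (nome_sqrt z ^ n * nome_sqrt z ^ N))
    by (intros; apply divisor_term_bound, Hz).
  pose proof (Csum_fubini _ _ B D1 D2) as F. pose proof (Csummable_cols _ _ B D1 D2) as Sc.
  assert (Col : forall N, Csum (fun n => divisor_term k z n N) = (INR (divisor_sum k (S N)) * qpow (S N) z)%C).
  { intros N. rewrite (Csum_finite _ (S N)).
    - unfold divisor_sum. rewrite list_sum_filter_Cpsum, Cmult_comm, <- Cpsum_scal.
      apply Cpsum_ext. intros n _. unfold divisor_term. destruct (S N mod S n =? 0)%nat; [|ring].
      rewrite pow_INR, RtoC_pow. ring.
    - intros n Hn. unfold divisor_term. rewrite Nat.mod_small by lia. reflexivity. }
  destruct (lambert_dominating z Hz (lambert_const z k)) as [E1 E2].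
  pose proof (Csum_fubini _ _ (fun l n => lambert_term_bound z k l n Hz) E1 E2) as F2.
  assert (Row : forall n, Csum (divisor_term k z n) = Csum (fun l => (INR (S n) ^ k * qpow (S l * S n) z)%C)).
  { intros n. apply (Csum_multiples (S n)); [lia | | | |].
    - apply (Csummable_row _ _ B D1 n).
    - apply (Csummable_col _ _ (fun l n => lambert_term_bound z k l n Hz) E1 E2 n).
    - intros l. unfold divisor_term. replace (S (l * S n + (S n - 1))) with (S l * S n)%nat by lia.
      rewrite Nat.Div0.mod_mul. reflexivity.
    - intros N HN. unfold divisor_term. destruct (Nat.eqb_spec (S N mod S n) 0); [contradiction|reflexivity]. }
  split.
  - eapply Csummable_ext; [exact Col | exact Sc].
  - unfold lambert. cbv beta in F2. rewrite F2, <- (Csum_ext _ _ Row), F. apply Csum_ext, Col.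
Qed.

Definition J (z : C) : C := j_invariant (Ci * z).

Lemma q_of_qpow z : q_of (Ci * z) = qpow 1 z.
Proof.
  unfold q_of, qpow. f_equal.
  assert (CI : (Ci * Ci)%C = (- (1))%C) by (apply C_eq; simpl; ring).
  transitivity (2 * PI * (Ci * Ci) * z)%C; [ring | rewrite CI; simpl; ring].
Qed.

Lemma Cprod_exp z N : 0 < Re z ->
  Cprod (fun n => (1 - qpow 1 z ^ S n) ^ 24)%C N = Cexp (- 24 * Cpsum (fun n => log_term (INR (S n) * z)) N).
Proof.
  intros Hz. induction N as [|N IH].
  - simpl. replace (- 24 * 0)%C with (RtoC 0) by ring. symmetry. apply Cexp_0.
  - cbn [Cprod Cpsum]. rewrite IH, <- qpow_pow.
    replace (qpow (S N) z) with (qpow 1 (INR (S N) * z)) by (rewrite qpow_scaled, Nat.mul_1_r; reflexivity).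
    rewrite <- exp_log_term by apply (Re_scaled z Hz). rewrite Cexp_pow, <- Cexp_plus. f_equal.
    replace (INR 24) with 24 by (simpl; ring). ring.
Qed.

Lemma Clim_Cexp u x : Clim u x -> Clim (fun n => Cexp (u n)) (Cexp x).
Proof.
  intros H. destruct (proj1 (is_lim_seq_Reals _ _) H 1 ltac:(lra)) as [N HN].
  apply (Clim_bound_eventually _ _ (fun n => exp (Re x) * exp 1 * Cmod (u n - x)) N).
  - intros n Hn. specialize (HN n Hn). unfold Rdist in HN. rewrite Rminus_0_r, Rabs_pos_eq in HN by apply Cmod_ge_0.
    replace (Cexp (u n)) with (Cexp x * Cexp (u n - x))%C by (rewrite <- Cexp_plus; f_equal; ring).
    replace (Cexp x * Cexp (u n - x) - Cexp x)%C with (Cexp x * (Cexp (u n - x) - 1))%C by ring.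
    rewrite Cmod_mult, Cmod_Cexp, Rmult_assoc. apply Rmult_le_compat_l; [apply Rlt_le, exp_pos|].
    eapply Rle_trans; [apply Cexp_sub1_bound|]. rewrite Rmult_comm.
    apply Rmult_le_compat_r; [apply Cmod_ge_0 | apply Rlt_le, exp_increasing, HN].
  - replace 0 with (exp (Re x) * exp 1 * 0) by ring. apply (is_lim_seq_scal_l _ (exp (Re x) * exp 1) 0 H).
Qed.

Lemma Cprod_lim z : 0 < Re z ->
  Clim (Cprod (fun n => (1 - qpow 1 z ^ S n) ^ 24)%C) (Cexp (- 24 * log_eta z)).
Proof.
  intros Hz. destruct (log_eta_product_form z Hz) as [S1 E1].
  eapply Clim_ext; [intros N; symmetry; apply Cprod_exp, Hz|].
  apply Clim_Cexp, Clim_scal. rewrite E1. apply Clim_Cpsum, S1.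
Qed.

Lemma J_quotient z : 0 < Re z -> J z = (E4 z ^ 3 / discr z)%C.
Proof.
  intros Hz. unfold J, j_invariant. rewrite q_of_qpow.
  destruct (lambert_divisor_sum 3 z Hz) as [S1 E1].
  assert (E : forall N, (INR (divisor_sum 3 (S N)) * qpow (S N) z)%C = (INR (divisor_sum 3 (S N)) * qpow 1 z ^ S N)%C)
    by (intros N; rewrite qpow_pow; reflexivity).
  rewrite CSeries_Csum by (eapply Csummable_ext; [exact E | exact S1]).
  rewrite <- (Csum_ext _ _ E), <- E1. fold (E4 z). f_equal.
  unfold CProduct. rewrite (Clim_CLim_seq _ _ (Cprod_lim z Hz)).
  unfold discr. rewrite Cexp_minus. unfold qpow. simpl (INR 1).
  replace (- (2 * PI * (1 * z)))%C with (- (2 * PI * z))%C by ring. rewrite Cexp_opp. unfold Cdiv. ring.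
Qed.

Lemma J_inversion z : 0 < Re z -> J (/ z) = J z.
Proof.
  intros Hz. rewrite 2!J_quotient, E4_inversion, discr_inversion by (auto; apply Re_inv_pos, Hz).
  pose proof (Re_pos_neq_0 z Hz). assert (discr z <> 0) by apply Cexp_neq_0. field. auto.
Qed.

Lemma Cexp_2PI_Z (m : Z) : Cexp (IZR m * (2 * PI * Ci)) = 1.
Proof.
  assert (P : forall n : nat, Cexp (INR n * (2 * PI * Ci)) = 1).
  { intros n. rewrite <- Cexp_pow, Cexp_2PI_i. apply Cpow_1_l. }
  destruct (Z.le_gt_cases 0 m) as [H|H].
  - rewrite <- (Z2Nat.id m H), <- INR_IZR_INZ. apply P.
  - replace (IZR m * (2 * PI * Ci))%C with (- (INR (Z.to_nat (- m)) * (2 * PI * Ci)))%C.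
    + rewrite Cexp_opp, P. field.
    + rewrite INR_IZR_INZ, Z2Nat.id, opp_IZR, RtoC_opp by lia. ring.
Qed.

Lemma qpow_1_translate z (m : Z) : qpow 1 (z + IZR m * Ci) = qpow 1 z.
Proof.
  rewrite qpow_plus. replace (qpow 1 (IZR m * Ci)) with (RtoC 1); [ring|].
  rewrite <- (Cexp_2PI_Z (- m)). unfold qpow. f_equal. rewrite opp_IZR, RtoC_opp. simpl. ring.
Qed.

Lemma J_translate z (m : Z) : J (z + IZR m * Ci) = J z.
Proof. unfold J, j_invariant. rewrite 2!q_of_qpow, qpow_1_translate. reflexivity. Qed.

(** * Exact coefficients *)

Fixpoint peval (l : list Z) (q : R) : R :=
  match l with [] => 0 | a :: l' => IZR a + q * peval l' q end.

Fixpoint padd (l m : list Z) : list Z :=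
  match l, m with
  | [], _ => m
  | _, [] => l
  | a :: l', b :: m' => (a + b)%Z :: padd l' m'
  end.

Fixpoint pmul (l m : list Z) : list Z :=
  match l with [] => [] | a :: l' => padd (map (Z.mul a) m) (0%Z :: pmul l' m) end.

Lemma peval_padd l m q : peval (padd l m) q = peval l q + peval m q.
Proof.
  revert m. induction l as [|a l IH]; intros [|b m]; simpl; try ring.
  rewrite IH, plus_IZR. ring.
Qed.

Lemma peval_scale a m q : peval (map (Z.mul a) m) q = IZR a * peval m q.
Proof. induction m as [|b m IH]; simpl; [ring|]. rewrite IH, mult_IZR. ring. Qed.

Lemma peval_pmul l m q : peval (pmul l m) q = peval l q * peval m q.
Proof.
  induction l as [|a l IH]; simpl; [ring|]. rewrite peval_padd, peval_scale. simpl. rewrite IH. ring.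
Qed.

Lemma peval_firstn N l q : peval l q = peval (firstn N l) q + q ^ N * peval (skipn N l) q.
Proof.
  revert l. induction N as [|N IH]; intros [|a l]; simpl; try ring.
  rewrite (IH l) at 1. ring.
Qed.

Lemma peval_app l m q : peval (l ++ m) q = peval l q + q ^ length l * peval m q.
Proof. induction l as [|a l IH]; simpl; [ring|]. rewrite IH. ring. Qed.

Lemma peval_bound l : exists B, 0 <= B /\ forall q, 0 < q <= 1 / 4 -> Rabs (peval l q) <= B.
Proof.
  induction l as [|a l [B [HB IH]]]; simpl.
  - exists 0. split; [lra|]. intros; rewrite Rabs_R0; lra.
  - exists (Rabs (IZR a) + B). split; [pose proof (Rabs_pos (IZR a)); lra|]. intros q Hq.
    eapply Rle_trans; [apply Rabs_triang|]. rewrite Rabs_mult, (Rabs_pos_eq q) by lra.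
    specialize (IH q Hq). pose proof (Rabs_pos (peval l q)). nra.
Qed.

(** Agreement with an integer polynomial up to [O (q^N)] at small real nomes. It plays the part of
    formal power series: it is stable under products and truncation, and it determines the first [N]
    coefficients. *)
Definition jet (N : nat) (f : R -> R) (l : list Z) : Prop :=
  exists K, 0 <= K /\ forall q, 0 < q <= 1 / 4 -> Rabs (f q - peval l q) <= K * q ^ N.

Lemma jet_mult N f g l m : jet N f l -> jet N g m -> jet N (fun q => f q * g q) (pmul l m).
Proof.
  intros (K1 & P1 & H1) (K2 & P2 & H2).
  destruct (peval_bound l) as (B1 & Q1 & B1'). destruct (peval_bound m) as (B2 & Q2 & B2').
  exists (K1 * (B2 + K2) + B1 * K2). split; [nra|]. intros q Hq.
  specialize (H1 q Hq). specialize (H2 q Hq). specialize (B1' q Hq). specialize (B2' q Hq).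
  rewrite peval_pmul. assert (QN : 0 <= q ^ N <= 1).
  { split; [apply pow_le; lra | rewrite <- (pow1 N); apply pow_incr; lra]. }
  replace (f q * g q - peval l q * peval m q) with ((f q - peval l q) * (peval m q + (g q - peval m q)) + peval l q * (g q - peval m q)) by ring.
  eapply Rle_trans; [apply Rabs_triang|]. rewrite 2!Rabs_mult.
  assert (T : Rabs (peval m q + (g q - peval m q)) <= B2 + K2) by (eapply Rle_trans; [apply Rabs_triang|]; nra).
  assert (Rabs (f q - peval l q) * Rabs (peval m q + (g q - peval m q)) <= (K1 * q ^ N) * (B2 + K2)) by (apply Rmult_le_compat; auto using Rabs_pos).
  assert (Rabs (peval l q) * Rabs (g q - peval m q) <= B1 * (K2 * q ^ N)) by (apply Rmult_le_compat; auto using Rabs_pos).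
  lra.
Qed.

Lemma jet_trunc N f l : jet N f l -> jet N f (firstn N l).
Proof.
  intros (K & P & H). destruct (peval_bound (skipn N l)) as (B & Q & B').
  exists (K + B). split; [lra|]. intros q Hq. specialize (H q Hq). specialize (B' q Hq).
  replace (f q - peval (firstn N l) q) with ((f q - peval l q) + q ^ N * peval (skipn N l) q)
    by (rewrite (peval_firstn N l) at 1; ring).
  assert (QN : 0 <= q ^ N) by (apply pow_le; lra).
  eapply Rle_trans; [apply Rabs_triang|]. rewrite Rabs_mult, (Rabs_pos_eq (q ^ N)) by assumption. nra.
Qed.

Lemma jet_ext N f g l : (forall q, 0 < q <= 1 / 4 -> f q = g q) -> jet N f l -> jet N g l.
Proof. intros E (K & P & H). exists K. split; [exact P|]. intros q Hq. rewrite <- E by exact Hq. auto. Qed.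

(** Distinct integers are at least 1 apart, while the estimates bring the two constant terms
    arbitrarily close as [q] tends to 0. Once they agree, division by [q] continues the
    induction. *)
Lemma jet_unique N f l m : jet N f l -> jet N f m -> forall k, (k < N)%nat -> nth k l 0%Z = nth k m 0%Z.
Proof.
  intros (K1 & P1 & H1) (K2 & P2 & H2).
  assert (H : exists K, 0 <= K /\ forall q, 0 < q <= 1 / 4 -> Rabs (peval l q - peval m q) <= K * q ^ N).
  { exists (K1 + K2). split; [lra|]. intros q Hq. specialize (H1 q Hq). specialize (H2 q Hq).
    rewrite Rabs_minus_sym in H1. pose proof (Rabs_triang (peval l q - f q) (f q - peval m q)) as T.
    replace (peval l q - f q + (f q - peval m q)) with (peval l q - peval m q) in T by ring. lra. }
  clear f K1 P1 H1 K2 P2 H2. revert l m H. induction N as [|N IH]; intros l m (K & PK & H) k Hk; [lia|].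
  set (a := hd 0%Z l). set (b := hd 0%Z m).
  assert (El : forall q, peval l q = IZR a + q * peval (tl l) q) by (intros; destruct l; simpl; unfold a; simpl; ring).
  assert (Em : forall q, peval m q = IZR b + q * peval (tl m) q) by (intros; destruct m; simpl; unfold b; simpl; ring).
  assert (Hab : a = b).
  { destruct (peval_bound (tl l)) as (B1 & Q1 & B1'). destruct (peval_bound (tl m)) as (B2 & Q2 & B2').
    destruct (Z.eq_dec a b) as [|Hn]; [assumption|exfalso].
    assert (1 <= Rabs (IZR a - IZR b)).
    { rewrite <- minus_IZR, Rabs_Zabs. apply IZR_le. lia. }
    (* Small enough that [K q^(N+1) + q (B1 + B2)] is below 1. *)
    set (q := / (4 * (K + B1 + B2 + 1))).
    assert (Hq : 0 < q <= 1 / 4).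
    { split; [apply Rinv_0_lt_compat; lra|]. unfold q. replace (1 / 4) with (/ 4) by field.
      apply Rinv_le_contravar; lra. }
    specialize (H q Hq). specialize (B1' q Hq). specialize (B2' q Hq). rewrite El, Em in H.
    assert (T : Rabs (IZR a - IZR b) <= K * q ^ S N + q * (B1 + B2)).
    { replace (IZR a - IZR b) with ((IZR a + q * peval (tl l) q - (IZR b + q * peval (tl m) q)) + q * (peval (tl m) q - peval (tl l) q)) by ring.
      eapply Rle_trans; [apply Rabs_triang|]. rewrite (Rabs_mult q), (Rabs_pos_eq q) by lra.
      assert (Rabs (peval (tl m) q - peval (tl l) q) <= B1 + B2).
      { unfold Rminus. eapply Rle_trans; [apply Rabs_triang|]. rewrite Rabs_Ropp. lra. }
      apply Rplus_le_compat; [exact H | apply Rmult_le_compat_l; lra]. }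
    assert (QN : 0 <= q ^ N <= 1).
    { split; [apply pow_le; lra | rewrite <- (pow1 N); apply pow_incr; lra]. }
    assert (K * q ^ S N <= K * q * 1).
    { replace (K * q ^ S N) with (K * q * q ^ N) by (simpl; ring). apply Rmult_le_compat_l; [apply Rmult_le_pos; lra | lra]. }
    assert (Eq : q * (K + B1 + B2 + 1) = / 4) by (unfold q; field; lra). nra. }
  destruct k as [|k].
  - destruct l, m; simpl in *; unfold a, b in Hab; simpl in Hab; congruence.
  - specialize (IH (tl l) (tl m)). assert (E : nth k (tl l) 0%Z = nth k (tl m) 0%Z).
    { apply IH; [|lia]. exists K. split; [exact PK|]. intros q Hq. specialize (H q Hq).
      rewrite El, Em, Hab in H.
      replace (IZR b + q * peval (tl l) q - (IZR b + q * peval (tl m) q)) with (q * (peval (tl l) q - peval (tl m) q)) in H by ring.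
      rewrite Rabs_mult, (Rabs_pos_eq q) in H by lra. simpl in H. apply (Rmult_le_reg_l q); lra. }
    destruct l, m; simpl in *; try exact E; destruct k; exact E.
Qed.

Lemma peval_map_seq (a : nat -> Z) N q : peval (map a (seq 0 N)) q = sum_f_R0 (fun n => IZR (a n) * q ^ n) N - IZR (a N) * q ^ N.
Proof.
  induction N as [|N IH]; [simpl; ring|].
  rewrite seq_S, map_app, peval_app, IH, length_map, length_seq. simpl. ring.
Qed.

Lemma jet_series (a : nat -> Z) N :
  ex_series (fun n => Rabs (IZR (a n)) * (1 / 4) ^ n) ->
  jet N (fun q => Series (fun n => IZR (a n) * q ^ n)) (map a (seq 0 N)).
Proof.
  intros Ha.
  assert (Ht : ex_series (fun n => Rabs (IZR (a (N + n)%nat)) * (1 / 4) ^ n)).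
  { apply (ex_series_incr_n _ N) in Ha.
    apply (ex_series_ext (fun n => 4 ^ N * (Rabs (IZR (a (N + n)%nat)) * (1 / 4) ^ (N + n)))).
    - intros n. rewrite pow_add. lazymatch goal with |- ?a = ?b => change (@eq R a b) end.
      assert (E : 4 ^ N * (1 / 4) ^ N = 1) by (rewrite <- Rpow_mult_distr; replace (4 * (1 / 4)) with 1 by field; apply pow1).
      transitivity (4 ^ N * (1 / 4) ^ N * (Rabs (IZR (a (N + n)%nat)) * (1 / 4) ^ n)); [ring | rewrite E; ring].
    - apply (ex_series_scal_l (4 ^ N) _ Ha). }
  exists (Series (fun n => Rabs (IZR (a (N + n)%nat)) * (1 / 4) ^ n)). split.
  - apply Series_nonneg; [|exact Ht]. intros n. apply Rmult_le_pos; [apply Rabs_pos | apply pow_le; lra].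
  - intros q Hq.
    assert (Sq : ex_series (fun n => IZR (a n) * q ^ n)).
    { apply ex_series_Rabs. eapply ex_series_dominated; [|exact Ha]. intros n. split; [apply Rabs_pos|].
      rewrite Rabs_mult, (Rabs_pos_eq (q ^ n)) by (apply pow_le; lra).
      apply Rmult_le_compat_l; [apply Rabs_pos | apply pow_incr; lra]. }
    assert (St : ex_series (fun n => Rabs (IZR (a (N + n)%nat)) * q ^ n)).
    { eapply ex_series_dominated; [|exact Ht]. intros n. split; [apply Rmult_le_pos; [apply Rabs_pos | apply pow_le; lra]|].
      apply Rmult_le_compat_l; [apply Rabs_pos | apply pow_incr; lra]. }
    assert (E : Series (fun n => IZR (a n) * q ^ n) - peval (map a (seq 0 N)) q = q ^ N * Series (fun n => IZR (a (N + n)%nat) * q ^ n)).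
    { rewrite <- Series_scal_l.
      rewrite (Series_ext (fun n => q ^ N * (IZR (a (N + n)%nat) * q ^ n)) (fun n => IZR (a (N + n)%nat) * q ^ (N + n)))
        by (intros n; rewrite pow_add; ring).
      rewrite peval_map_seq. destruct N as [|N].
      - simpl. ring.
      - rewrite (Series_incr_n _ (S N)) by (auto; lia). cbn [sum_f_R0 Init.Nat.pred]. ring. }
    rewrite E, Rabs_mult, Rabs_pos_eq, Rmult_comm by (apply pow_le; lra).
    apply Rmult_le_compat_r; [apply pow_le; lra|].
    assert (ER : forall n, Rabs (IZR (a (N + n)%nat) * q ^ n) = Rabs (IZR (a (N + n)%nat)) * q ^ n).
    { intros n. rewrite Rabs_mult, (Rabs_pos_eq (q ^ n)) by (apply pow_le; lra). reflexivity. }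
    eapply Rle_trans; [apply Series_Rabs|].
    + eapply ex_series_ext; [intros n; symmetry; apply ER | exact St].
    + apply Series_le; [|exact Ht]. intros n. rewrite ER. split; [apply Rmult_le_pos; [apply Rabs_pos | apply pow_le; lra]|].
      apply Rmult_le_compat_l; [apply Rabs_pos | apply pow_incr; lra].
Qed.

(** * The expansion of j at real nomes *)

Lemma is_series_C_Clim (a : nat -> C) (l : C) :
  is_series (V := C_NormedModule) a l -> Clim (fun n => Cpsum a (S n)) l.
Proof.
  intros H. apply is_lim_seq_spec. intros eps.
  pose proof (proj1 (filterlim_locally_ball_norm _ _) H eps) as [N HN].
  exists N. intros n Hn. specialize (HN n Hn). rewrite Rminus_0_r, Rabs_pos_eq by apply Cmod_ge_0.
  unfold ball_norm in HN. rewrite <- sum_n_Cpsum. exact HN.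
Qed.

(** The real point of the half-plane whose nome is [q]. *)
Definition tq (q : R) : R := - ln q / (2 * PI).

Lemma tq_pos q : 0 < q < 1 -> 0 < tq q.
Proof.
  intros Hq. pose proof PI_RGT_0. unfold tq. apply Rdiv_lt_0_compat; [|lra].
  assert (ln q < ln 1) by (apply ln_increasing; lra). rewrite ln_1 in H0. lra.
Qed.

Lemma qpow_tq n q : 0 < q < 1 -> qpow n (tq q) = RtoC (q ^ n).
Proof.
  intros Hq. rewrite qpow_pow, RtoC_pow. f_equal. unfold qpow.
  replace (- (2 * PI * (INR 1 * tq q)))%C with (RtoC (ln q)).
  - rewrite Cexp_real, exp_ln by lra. reflexivity.
  - simpl (INR 1). rewrite <- !RtoC_mult, <- RtoC_opp. f_equal. unfold tq. field. apply PI_neq0.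
Qed.

Section Coefficients.

Variable c : nat -> Z.
Hypothesis hc : j_fourier_coefficients c.

Lemma hc_J z : 0 < Re z -> Clim (fun n => Cpsum (fun n => IZR (c n) * qpow n z)%C (S n)) (J z - / qpow 1 z).
Proof.
  intros Hz. specialize (hc (Ci * z)%C). rewrite q_of_qpow in hc.
  assert (Hi : 0 < Im (Ci * z)) by (unfold Im; simpl; unfold Re in Hz; lra).
  apply is_series_C_Clim in hc; [|exact Hi].
  eapply Clim_ext; [|exact hc]. intros n. apply Cpsum_ext. intros k _. rewrite <- qpow_pow. reflexivity.
Qed.

(** Plain convergence at the larger nome [r'] makes the terms tend to 0 there, which puts [r] inside
    the disk of absolute convergence. *)
Lemma coefficients_disk r : 0 <= r < 1 -> ex_series (fun n => Rabs (IZR (c n)) * r ^ n).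
Proof.
  intros Hr. set (r' := (1 + r) / 2). assert (Hr' : 0 < r' < 1) by (unfold r'; lra).
  pose proof (hc_J (tq r') (tq_pos r' Hr')) as H.
  apply (is_lim_seq_component Re) in H; [|apply re_le_Cmod | intros; unfold Re; simpl; ring].
  set (b := fun n => IZR (c n) * r' ^ n).
  assert (E : forall n, Re (Cpsum (fun n => IZR (c n) * qpow n (tq r'))%C (S n)) = sum_n b n).
  { intros n. induction n as [|n IH].
    - rewrite sum_O. cbn [Cpsum]. rewrite qpow_tq by exact Hr'. unfold b, Re; simpl. ring.
    - rewrite sum_Sn, <- IH. change (plus ?x ?y) with (x + y). cbn [Cpsum]. rewrite re_plus at 1. f_equal.
      rewrite qpow_tq by exact Hr'. unfold b, Re; simpl. ring. }
  assert (Hb : ex_series b) by (exists (Re (J (tq r') - / qpow 1 (tq r'))); exact (is_lim_seq_ext _ _ _ E H)).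
  apply ex_series_lim_0 in Hb.
  assert (Hc : Rbar_lt (Rabs r) (CV_radius (fun n => IZR (c n)))).
  { apply Rbar_lt_le_trans with r'; [simpl; rewrite Rabs_pos_eq by lra; unfold r'; lra|].
    apply Rbar_not_lt_le. intros Hlt. apply (CV_disk_outside (fun n => IZR (c n)) r'); [rewrite Rabs_pos_eq by lra; exact Hlt | exact Hb]. }
  apply CV_disk_inside in Hc. eapply ex_series_ext; [|exact Hc].
  intros n. simpl. rewrite Rabs_mult, (Rabs_pos_eq (r ^ n)) by (apply pow_le; lra). reflexivity.
Qed.

Lemma coefficients_summable z : 0 < Re z -> Csummable (fun n => (IZR (c n) * qpow n z)%C).
Proof.
  intros Hz. apply (ex_series_ext (fun n => Rabs (IZR (c n)) * exp (- (2 * PI * Re z)) ^ n)).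
  - intros n. rewrite Cmod_mult, Cmod_R, Cmod_qpow. reflexivity.
  - apply coefficients_disk. split; [apply Rlt_le, exp_pos | apply qpow_1_lt_1, Hz].
Qed.

Lemma J_expansion z : 0 < Re z -> J z = (/ qpow 1 z + Csum (fun n => IZR (c n) * qpow n z))%C.
Proof.
  intros Hz.
  pose proof (Clim_unique _ _ _ (hc_J z Hz) (Clim_shift _ _ (Clim_Cpsum _ (coefficients_summable z Hz)))) as E.
  rewrite <- E. ring.
Qed.

(** The coefficients of [q j], which has no pole; this causes the shift from [n] to [S n] in all
    computed lists. *)
Definition shifted_coeff (n : nat) : Z := match n with O => 1%Z | S n' => c n' end.

Definition e4_coeff (n : nat) : Z :=
  match n with O => 1%Z | S _ => (240 * Z.of_nat (divisor_sum 3 n))%Z end.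

Definition qj (q : R) : R := Series (fun n => IZR (shifted_coeff n) * q ^ n).
Definition e4_real (q : R) : R := Series (fun n => IZR (e4_coeff n) * q ^ n).
(** The infinite product of [1 - q^n] at a real nome, taken as the real part of the exponential
    already studied; [eta_real_spec] shows that the imaginary part is 0 and recovers the product. *)
Definition eta_real (q : R) : R := Re (Cexp (- log_eta (tq q))).
Fixpoint rprod (q : R) (N : nat) : R := match N with O => 1 | S N' => rprod q N' * (1 - q ^ S N') end.

Lemma shifted_disk r : 0 <= r < 1 -> ex_series (fun n => Rabs (IZR (shifted_coeff n)) * r ^ n).
Proof.
  intros Hr. apply (ex_series_incr_1 (fun n => Rabs (IZR (shifted_coeff n)) * r ^ n)).
  apply (ex_series_ext (fun n => r * (Rabs (IZR (c n)) * r ^ n))).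
  - intros n. simpl. lazymatch goal with |- ?a = ?b => change (@eq R a b) end. ring.
  - apply (ex_series_scal_l r _ (coefficients_disk r Hr)).
Qed.

Lemma e4_disk r : 0 < r < 1 -> ex_series (fun n => Rabs (IZR (e4_coeff n)) * r ^ n).
Proof.
  intros Hr. apply (ex_series_incr_1 (fun n => Rabs (IZR (e4_coeff n)) * r ^ n)).
  destruct (lambert_divisor_sum 3 (tq r) (tq_pos r Hr)) as [S1 _].
  apply (ex_series_ext (fun n => 240 * Cmod (INR (divisor_sum 3 (S n)) * qpow (S n) (tq r))%C)).
  - intros n. rewrite qpow_tq, Cmod_mult, 2!Cmod_R by exact Hr. unfold e4_coeff.
    rewrite mult_IZR, <- INR_IZR_INZ, Rabs_mult, (Rabs_pos_eq 240), (Rabs_pos_eq (r ^ S n)) by (try lra; apply pow_le; lra).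
    lazymatch goal with |- ?a = ?b => change (@eq R a b) end. ring.
  - apply (ex_series_scal_l 240 _ S1).
Qed.

Lemma ex_series_of_disk (a : nat -> Z) r : 0 <= r ->
  ex_series (fun n => Rabs (IZR (a n)) * r ^ n) -> ex_series (fun n => IZR (a n) * r ^ n).
Proof.
  intros Hr H. apply ex_series_Rabs. eapply ex_series_ext; [|exact H].
  intros n. cbv beta. rewrite Rabs_mult, (Rabs_pos_eq (r ^ n)) by (apply pow_le; lra). reflexivity.
Qed.

Lemma qj_J q : 0 < q < 1 -> RtoC (qj q) = (q * J (tq q))%C.
Proof.
  intros Hq. pose proof (tq_pos q Hq) as Ht. rewrite J_expansion by exact Ht.
  rewrite qpow_tq, pow_1 by exact Hq. unfold qj.
  rewrite Series_incr_1 by (apply ex_series_of_disk; [lra | apply shifted_disk; lra]).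
  rewrite (Csum_ext _ (fun n => RtoC (IZR (c n) * q ^ n))) by (intros n; rewrite qpow_tq, RtoC_mult by exact Hq; reflexivity).
  rewrite Csum_RtoC. simpl (shifted_coeff 0).
  rewrite (Series_ext _ (fun n => q * (IZR (c n) * q ^ n))) by (intros n; simpl; ring).
  replace (1 * q ^ 0) with 1 by (simpl; ring).
  rewrite Series_scal_l, RtoC_plus, RtoC_mult. field. intros E. apply RtoC_inj in E. lra.
Qed.

Lemma e4_real_E4 q : 0 < q < 1 -> RtoC (e4_real q) = E4 (tq q).
Proof.
  intros Hq. pose proof (tq_pos q Hq) as Ht. unfold E4.
  destruct (lambert_divisor_sum 3 (tq q) Ht) as [_ ->].
  rewrite (Csum_ext _ (fun n => RtoC (INR (divisor_sum 3 (S n)) * q ^ S n))) by (intros n; rewrite qpow_tq, RtoC_mult by exact Hq; reflexivity).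
  rewrite Csum_RtoC. unfold e4_real. rewrite Series_incr_1 by (apply ex_series_of_disk; [lra | apply e4_disk; lra]).
  rewrite <- RtoC_mult, <- RtoC_plus. f_equal. simpl (e4_coeff 0). rewrite <- Series_scal_l. f_equal; [simpl; ring|].
  apply Series_ext. intros n. unfold e4_coeff. rewrite mult_IZR, <- INR_IZR_INZ. ring.
Qed.

Lemma rprod_lim q : 0 < q < 1 -> Clim (fun N => RtoC (rprod q N)) (Cexp (- log_eta (tq q))).
Proof.
  intros Hq. pose proof (tq_pos q Hq) as Ht. destruct (log_eta_product_form (tq q) Ht) as [S1 E1].
  apply (Clim_ext (fun N => Cexp (-1 * Cpsum (fun n => log_term (INR (S n) * tq q)) N)%C)).
  - intros N. induction N as [|N IH].
    + simpl. replace (-1 * 0)%C with (RtoC 0) by ring. apply Cexp_0.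
    + cbn [Cpsum rprod]. rewrite RtoC_mult, <- IH.
      replace (-1 * (Cpsum (fun n => log_term (INR (S n) * tq q)) N + log_term (INR (S N) * tq q)))%C
        with (-1 * Cpsum (fun n => log_term (INR (S n) * tq q)) N + - log_term (INR (S N) * tq q))%C by ring.
      rewrite Cexp_plus, exp_log_term by apply (Re_scaled (tq q) Ht). f_equal.
      rewrite qpow_scaled, Nat.mul_1_r, qpow_tq, RtoC_minus by exact Hq. reflexivity.
  - replace (- log_eta (tq q))%C with (-1 * log_eta (tq q))%C by ring. rewrite E1.
    apply Clim_Cexp, Clim_scal, Clim_Cpsum, S1.
Qed.

Lemma eta_real_spec q : 0 < q < 1 ->
  RtoC (eta_real q) = Cexp (- log_eta (tq q)) /\ is_lim_seq (rprod q) (eta_real q).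
Proof.
  intros Hq. pose proof (rprod_lim q Hq) as L.
  pose proof (is_lim_seq_component Re _ _ re_le_Cmod ltac:(intros; unfold Re; simpl; ring) L) as LR.
  pose proof (is_lim_seq_component Im _ _ im_le_Cmod ltac:(intros; unfold Im; simpl; ring) L) as LI.
  simpl in LR, LI. split; [|exact LR].
  apply C_eq; [reflexivity|]. simpl.
  pose proof (is_lim_seq_unique _ _ LI) as U. rewrite Lim_seq_const in U. congruence.
Qed.

Lemma qj_factorisation q : 0 < q < 1 -> qj q = e4_real q ^ 3 * (/ eta_real q) ^ 24.
Proof.
  intros Hq. pose proof (tq_pos q Hq) as Ht. apply RtoC_inj.
  destruct (eta_real_spec q Hq) as [E _].
  assert (N0 : eta_real q <> 0).
  { intros H. rewrite H in E. apply (Cexp_neq_0 (- log_eta (tq q))). symmetry. exact E. }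
  rewrite qj_J, J_quotient by assumption. rewrite RtoC_mult, !RtoC_pow, RtoC_inv, E, e4_real_E4 by assumption.
  rewrite <- Cexp_opp, Cexp_pow. unfold discr. replace (INR 24) with 24 by (simpl; ring).
  assert (Q : RtoC q = Cexp (- (2 * PI * tq q))).
  { pose proof (qpow_tq 1 q Hq) as X. rewrite pow_1 in X. transitivity (qpow 1 (tq q)); [symmetry; exact X|].
    unfold qpow. f_equal. simpl. ring. }
  rewrite Q at 1. rewrite Cexp_minus, Cexp_opp.
  replace (24 * - - log_eta (tq q))%C with (- (- 24 * log_eta (tq q)))%C by ring. rewrite Cexp_opp.
  pose proof (Cexp_neq_0 (2 * PI * tq q)). pose proof (Cexp_neq_0 (- 24 * log_eta (tq q))). field. auto.
Qed.

(** The term [2 q ^ S (N + j)] strengthens the claim so that the induction closes: with [p] this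
    power, a further factor [1 - p] costs at most [p], and [2 p - p >= 2 q p]. *)
Lemma rprod_range q N : 0 < q <= 1 / 4 -> 0 < rprod q N /\
  forall j, rprod q N * (1 - 2 * q ^ S N + 2 * q ^ S (N + j)) <= rprod q (N + j) <= rprod q N.
Proof.
  intros Hq.
  assert (P : forall n, 0 < q ^ S n <= 1 / 4).
  { intros n. split; [apply pow_lt; lra|]. simpl. assert (q ^ n <= 1) by (rewrite <- (pow1 n); apply pow_incr; lra).
    assert (0 <= q ^ n) by (apply pow_le; lra). nra. }
  assert (Pos : forall n, 0 < rprod q n).
  { induction n as [|n IH]; [simpl; lra|]. cbn [rprod]. specialize (P n). nra. }
  split; [apply Pos|]. intros j. induction j as [|j [IH1 IH2]].
  - rewrite Nat.add_0_r. lra.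
  - replace (N + S j)%nat with (S (N + j)) by lia. cbn [rprod].
    pose proof (P (N + j)%nat) as Pp. pose proof (P N) as Px. pose proof (Pos (N + j)%nat). pose proof (Pos N).
    assert (Hpx : q ^ S (N + j) <= q ^ S N).
    { replace (S (N + j)) with (S N + j)%nat by lia. rewrite pow_add.
      assert (q ^ j <= 1) by (rewrite <- (pow1 j); apply pow_incr; lra). nra. }
    replace (q ^ S (S (N + j))) with (q * q ^ S (N + j)) by reflexivity.
    set (p := q ^ S (N + j)) in *. set (x := q ^ S N) in *. split; [|nra].
    apply Rle_trans with (rprod q N * (1 - 2 * x + 2 * p) * (1 - p)).
    + rewrite Rmult_assoc. apply Rmult_le_compat_l; [lra|]. nra.
    + apply Rmult_le_compat_r; lra.
Qed.

Lemma eta_real_range q N : 0 < q <= 1 / 4 -> rprod q N * (1 - 2 * q ^ S N) <= eta_real q <= rprod q N.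
Proof.
  intros Hq. destruct (rprod_range q N Hq) as [P H]. destruct (eta_real_spec q ltac:(lra)) as [_ L].
  apply (is_lim_seq_incr_n _ N) in L.
  split.
  - apply (is_lim_seq_le (fun _ => rprod q N * (1 - 2 * q ^ S N)) (fun n => rprod q (n + N)) (rprod q N * (1 - 2 * q ^ S N)) (eta_real q)); [|apply is_lim_seq_const | exact L].
    intros n. rewrite Nat.add_comm. destruct (H n) as [H1 _]. eapply Rle_trans; [|exact H1].
    assert (0 < q ^ S (N + n)) by (apply pow_lt; lra). nra.
  - apply (is_lim_seq_le (fun n => rprod q (n + N)) (fun _ => rprod q N) (eta_real q) (rprod q N)); [|exact L | apply is_lim_seq_const].
    intros n. rewrite Nat.add_comm. apply H.
Qed.

(** For [q <= 1 / 4] the products stay above 1/2, so the relative error [2 q^(N+1)] of cutting the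
    product off passes to the reciprocals. *)
Lemma inv_eta_approx q N : 0 < q <= 1 / 4 -> Rabs (/ eta_real q - / rprod q N) <= 8 * q ^ N.
Proof.
  intros Hq. destruct (eta_real_range q N Hq) as [H1 H2]. destruct (eta_real_range q 0 Hq) as [H3 _].
  destruct (rprod_range q N Hq) as [P _]. destruct (rprod_range q 0 Hq) as [_ P0].
  specialize (P0 N). destruct P0 as [P0 _]. simpl in H3, P0.
  assert (0 < q ^ S N) by (apply pow_lt; lra).
  assert (QN : 0 < q ^ N) by (apply pow_lt; lra).
  assert (x4 : q ^ S N <= q ^ N / 4) by (simpl; nra).
  assert (QN1 : q ^ N <= 1) by (rewrite <- (pow1 N); apply pow_incr; lra).
  assert (R2 : 1 / 2 <= rprod q N).
  { assert (0 < q * q ^ N) by nra. nra. }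
  assert (E2 : 1 / 2 <= eta_real q) by nra.
  rewrite Rabs_pos_eq.
  - replace (/ eta_real q - / rprod q N) with ((rprod q N - eta_real q) / (eta_real q * rprod q N)) by (field; lra).
    apply (Rmult_le_reg_r (eta_real q * rprod q N)); [nra|].
    unfold Rdiv. rewrite Rmult_assoc, Rinv_l, Rmult_1_r by nra.
    assert (rprod q N - eta_real q <= rprod q N * (2 * q ^ S N)) by nra.
    assert (rprod q N * (2 * q ^ S N) <= rprod q N * (q ^ N / 2)) by (apply Rmult_le_compat_l; lra).
    assert (rprod q N * (q ^ N / 2) <= 8 * q ^ N * (eta_real q * rprod q N)); [|lra].
    replace (8 * q ^ N * (eta_real q * rprod q N)) with (rprod q N * (8 * q ^ N * eta_real q)) by ring.
    apply Rmult_le_compat_l; nra.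
  - assert (/ rprod q N <= / eta_real q) by (apply Rinv_le_contravar; lra). lra.
Qed.

(** The first [N] terms of the geometric series for [1 / (1 - q^(m+1))], as blocks of length
    [m + 1]. *)
Definition geo (m N : nat) : list Z := concat (repeat (1%Z :: repeat 0%Z m) N).

Lemma peval_zeros m q : peval (repeat 0%Z m) q = 0.
Proof. induction m as [|m IH]; simpl; [reflexivity | rewrite IH; ring]. Qed.

Lemma peval_geo m N q : peval (geo m N) q * (1 - q ^ S m) = 1 - (q ^ S m) ^ N.
Proof.
  unfold geo. induction N as [|N IH]; [simpl; ring|].
  cbn [repeat concat]. rewrite peval_app. cbn [length]. rewrite repeat_length.
  cbn [peval]. rewrite peval_zeros. set (G := peval (concat _) q) in *.
  transitivity ((1 - q ^ S m) + q ^ S m * (G * (1 - q ^ S m))); [ring|]. rewrite IH.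
  change ((q ^ S m) ^ S N) with (q ^ S m * (q ^ S m) ^ N). set (x := q ^ S m). ring.
Qed.

Lemma jet_geo m N : jet N (fun q => / (1 - q ^ S m)) (geo m N).
Proof.
  exists 2. split; [lra|]. intros q Hq.
  assert (X : 0 < q ^ S m <= q).
  { split; [apply pow_lt; lra|]. simpl. assert (q ^ m <= 1) by (rewrite <- (pow1 m); apply pow_incr; lra). nra. }
  pose proof (peval_geo m N q) as E. set (x := q ^ S m) in *.
  replace (/ (1 - x) - peval (geo m N) q) with (x ^ N / (1 - x)).
  - rewrite Rabs_pos_eq by (apply Rmult_le_pos; [apply pow_le; lra | apply Rlt_le, Rinv_0_lt_compat; lra]).
    apply (Rmult_le_reg_r (1 - x)); [lra|]. unfold Rdiv. rewrite Rmult_assoc, Rinv_l, Rmult_1_r by lra.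
    assert (x ^ N <= q ^ N) by (apply pow_incr; lra). assert (0 <= q ^ N) by (apply pow_le; lra). nra.
  - apply (Rmult_eq_reg_r (1 - x)); [|lra]. rewrite Rmult_minus_distr_r, E. field. lra.
Qed.

(** Cutting to [N] entries after every product keeps the lists short for the later evaluation. *)
Fixpoint inv_prod_list (N M : nat) : list Z :=
  match M with O => [1%Z] | S M' => firstn N (pmul (firstn N (geo M' N)) (inv_prod_list N M')) end.

Fixpoint ppow (N : nat) (l : list Z) (n : nat) : list Z :=
  match n with O => [1%Z] | S n' => firstn N (pmul l (ppow N l n')) end.

Lemma jet_one N : jet N (fun _ => 1) [1%Z].
Proof.
  exists 0. split; [lra|]. intros q _. simpl. rewrite Rmult_0_r, Rplus_0_r, Rminus_diag, Rabs_R0. lra.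
Qed.

Lemma jet_inv_prod N M : jet N (fun q => / rprod q M) (inv_prod_list N M).
Proof.
  induction M as [|M IH].
  - simpl. apply (jet_ext _ (fun _ => 1)); [intros; simpl; field | apply jet_one].
  - cbn [inv_prod_list]. apply jet_trunc.
    apply (jet_ext _ (fun q => / (1 - q ^ S M) * / rprod q M)).
    + intros q _. cbn [rprod]. rewrite Rinv_mult. apply Rmult_comm.
    + apply jet_mult; [apply jet_trunc, jet_geo | exact IH].
Qed.

Lemma jet_ppow N f l n : jet N f l -> jet N (fun q => f q ^ n) (ppow N l n).
Proof.
  intros H. induction n as [|n IH]; [apply jet_one|]. cbn [ppow]. apply jet_trunc.
  apply (jet_ext _ (fun q => f q * f q ^ n)); [reflexivity | apply jet_mult; assumption].
Qed.

Lemma jet_inv_eta N : jet N (fun q => / eta_real q) (inv_prod_list N N).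
Proof.
  destruct (jet_inv_prod N N) as (K & P & H). exists (K + 8). split; [lra|]. intros q Hq.
  specialize (H q Hq). pose proof (inv_eta_approx q N Hq).
  replace (/ eta_real q - peval (inv_prod_list N N) q) with ((/ eta_real q - / rprod q N) + (/ rprod q N - peval (inv_prod_list N N) q)) by ring.
  eapply Rle_trans; [apply Rabs_triang|]. lra.
Qed.

(** The cube of [E4] times the 24th power of the inverse product, obtained by three squarings and a
    cube. Inverting the factors before multiplying keeps every list nonnegative. *)
Definition qj_list (N : nat) : list Z :=
  pmul (ppow N (map e4_coeff (seq 0 N)) 3)
    (ppow N (ppow N (ppow N (ppow N (inv_prod_list N N) 2) 2) 2) 3).

Lemma jet_qj N : jet N qj (qj_list N).
Proof.
  apply (jet_ext _ (fun q => e4_real q ^ 3 * (/ eta_real q) ^ 24)).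
  - intros q Hq. symmetry. apply qj_factorisation. lra.
  - apply jet_mult.
    + apply jet_ppow, (jet_series e4_coeff), e4_disk. lra.
    + apply (jet_ext _ (fun q => ((((/ eta_real q) ^ 2) ^ 2) ^ 2) ^ 3)); [intros; ring|].
      apply (jet_ppow N (fun q => (((/ eta_real q) ^ 2) ^ 2) ^ 2)), (jet_ppow N (fun q => ((/ eta_real q) ^ 2) ^ 2)),
        (jet_ppow N (fun q => (/ eta_real q) ^ 2)), (jet_ppow N (fun q => / eta_real q)), jet_inv_eta.
Qed.

(** The power series of [qj] and the computation are two jets of the same function. *)
Lemma coefficient_from_list N n : (S n < N)%nat -> c n = nth (S n) (qj_list N) 0%Z.
Proof.
  intros Hn. rewrite <- (jet_unique N qj (map shifted_coeff (seq 0 N)) (qj_list N)); [| |apply jet_qj|exact Hn].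
  - rewrite (nth_indep _ 0%Z (shifted_coeff 0)) by (rewrite length_map, length_seq; exact Hn).
    rewrite map_nth, seq_nth by exact Hn. reflexivity.
  - apply (jet_series shifted_coeff). apply shifted_disk. lra.
Qed.

(** * Nonnegativity of the coefficients *)

Definition nonneg_list (l : list Z) : Prop := List.Forall (fun x => (0 <= x)%Z) l.

Lemma nonneg_padd l m : nonneg_list l -> nonneg_list m -> nonneg_list (padd l m).
Proof.
  intros Hl. revert m. induction Hl as [|a l Ha Hl IH]; intros m Hm; [exact Hm|].
  destruct Hm as [|b m Hb Hm]; [constructor; assumption|]. simpl. constructor; [lia | apply IH, Hm].
Qed.

Lemma nonneg_pmul l m : nonneg_list l -> nonneg_list m -> nonneg_list (pmul l m).
Proof.
  intros Hl Hm. induction Hl as [|a l Ha Hl IH]; [constructor|]. simpl. apply nonneg_padd.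
  - clear IH. induction Hm; simpl; constructor; [nia | assumption].
  - constructor; [lia | exact IH].
Qed.

Lemma nonneg_firstn N l : nonneg_list l -> nonneg_list (firstn N l).
Proof. intros H. revert N. induction H; intros [|N]; simpl; constructor; auto. apply IHForall. Qed.

Lemma nonneg_ppow N l n : nonneg_list l -> nonneg_list (ppow N l n).
Proof.
  intros H. induction n; simpl; [constructor; [lia|constructor]|].
  apply nonneg_firstn, nonneg_pmul; assumption.
Qed.

Lemma nonneg_geo m N : nonneg_list (geo m N).
Proof.
  unfold geo. induction N as [|N IH]; [constructor|]. cbn [repeat concat]. apply List.Forall_app. split; [|exact IH].
  constructor; [lia|]. apply List.Forall_forall. intros x Hx. apply repeat_spec in Hx. lia.
Qed.

(** Inherited from the factors in [qj_list]. It makes sums of absolute values equal to values of the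
    series at real nomes. *)
Lemma coefficients_nonneg n : (0 <= c n)%Z.
Proof.
  rewrite (coefficient_from_list (S (S n)) n) by lia.
  assert (H : nonneg_list (qj_list (S (S n)))).
  { apply nonneg_pmul; repeat apply nonneg_ppow.
    - apply List.Forall_forall. intros x Hx. apply in_map_iff in Hx. destruct Hx as (k & <- & _).
      unfold e4_coeff. destruct k; lia.
    - generalize (S (S n)) at 2 as M. induction M; [constructor; [lia|constructor]|].
      cbn [inv_prod_list]. apply nonneg_firstn, nonneg_pmul; [apply nonneg_firstn, nonneg_geo | assumption]. }
  destruct (nth_in_or_default (S n) (qj_list (S (S n))) 0%Z) as [I|E]; [|rewrite E; lia].
  apply (proj1 (List.Forall_forall _ _) H), I.
Qed.

End Coefficients.

(** * A Poincare series for the Bessel coefficients *)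

(* [bessel x] is [2 pi / sqrt x * I_1 (4 pi sqrt x)], the leading term of the Rademacher formula for [c(n)]. *)
Definition bessel_coeff (k : nat) : R := (4 * PI ^ 2) ^ S k / (INR (fact (S k)) * INR (fact k)).
Definition bessel (x : R) : R := Series (fun k => bessel_coeff k * x ^ k).

(** Two Taylor terms are removed so that the translates [z + i m] contribute [O (1 / m^2)] and can
    be summed absolutely. *)
Definition exp_rem2 (u : C) : C := (Cexp (2 * PI / u) - 1 - 2 * PI / u)%C.

Lemma bessel_coeff_pos k : 0 < bessel_coeff k.
Proof.
  pose proof PI_RGT_0. unfold bessel_coeff. apply Rdiv_lt_0_compat.
  - apply pow_lt. assert (0 < PI ^ 2) by (apply pow_lt; lra). lra.
  - apply Rmult_lt_0_compat; apply INR_fact_lt_0.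
Qed.

(* Splitting [A ^ k N ^ k / k! ^ 2] as [(A / e) ^ k / k! * ((e N) ^ k / k!)] and bounding the second factor by [exp (e N)]. *)
Lemma bessel_term_bound k (N e : R) : 0 <= N -> 0 < e ->
  bessel_coeff k * N ^ k <= (4 * PI ^ 2) * ((4 * PI ^ 2 / e) ^ k / INR (fact k)) * exp (e * N).
Proof.
  intros HN He. pose proof PI_RGT_0. assert (HA : 0 < 4 * PI ^ 2) by (assert (0 < PI ^ 2) by (apply pow_lt; lra); lra).
  set (A := 4 * PI ^ 2) in *. pose proof (INR_fact_lt_0 k) as F. pose proof (INR_fact_lt_0 (S k)) as F'.
  assert (B : (e * N) ^ k / INR (fact k) <= exp (e * N)).
  { rewrite <- Series_exp. apply (term_le_Series (fun k => (e * N) ^ k / INR (fact k))); [|apply ex_series_exp].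
    intros n. apply Rmult_le_pos; [apply pow_le; nra | apply Rlt_le, Rinv_0_lt_compat, INR_fact_lt_0]. }
  assert (P : 0 <= A * ((A / e) ^ k / INR (fact k))).
  { apply Rmult_le_pos; [lra|]. apply Rmult_le_pos; [apply pow_le, Rlt_le, Rdiv_lt_0_compat; lra | apply Rlt_le, Rinv_0_lt_compat, F]. }
  eapply Rle_trans; [|apply Rmult_le_compat_l; [exact P | exact B]].
  unfold bessel_coeff. fold A. replace (A ^ S k / (INR (fact (S k)) * INR (fact k)) * N ^ k)
    with (A ^ S k * N ^ k / INR (fact k) * / INR (fact (S k))) by (field; lra).
  replace (A * ((A / e) ^ k / INR (fact k)) * ((e * N) ^ k / INR (fact k)))
    with (A ^ S k * N ^ k / INR (fact k) * / INR (fact k)).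
  - apply Rmult_le_compat_l; [|apply (fact_shift_le 1 k)].
    apply Rmult_le_pos; [apply Rmult_le_pos; apply pow_le; lra | apply Rlt_le, Rinv_0_lt_compat, F].
  - unfold Rdiv. rewrite !Rpow_mult_distr, pow_inv. simpl (A ^ S k). field. repeat split; try lra; apply pow_nonzero; lra.
Qed.

Lemma bessel_ex_series x : 0 <= x -> ex_series (fun k => bessel_coeff k * x ^ k).
Proof.
  intros Hx. pose proof (fun k => bessel_term_bound k x 1 Hx ltac:(lra)) as B.
  eapply ex_series_dominated; [intros k; split; [|apply B]|].
  - apply Rmult_le_pos; [apply Rlt_le, bessel_coeff_pos | apply pow_le, Hx].
  - apply ex_series_scal_r. apply (ex_series_scal_l (4 * PI ^ 2) _ (ex_series_exp (4 * PI ^ 2 / 1))).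
Qed.

Section Comparison.

Variable z : C.
Hypothesis Hz : 0 < Re z.

(** [lat_arr] and [four_arr] share the column index [j], the Taylor index of [exp_rem2]. Row sums
    give the two sides of the Poincare identity, and the columns are matched by the Lipschitz
    formula. *)
Let lat_arr (k j : nat) : C := ((2 * PI) ^ S (S j) / INR (fact (S (S j))) * power_pair z (S j) k)%C.
Let lat_const : R := 2 * ((2 * PI) ^ 2 * / lattice_const z ^ 2).
Let lat_row (j : nat) : R := (2 * PI / Re z) ^ j / INR (fact j).

Lemma lat_arr_bound k j : Cmod (lat_arr k j) <= lat_const * (/ (INR k + 1) ^ 2 * lat_row j).
Proof.
  pose proof PI_RGT_0. unfold lat_arr, lat_row, lat_const. rewrite Cmod_mult, Cmod_div, Cmod_pow by apply INR_fact_C_neq_0.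
  rewrite <- RtoC_mult, 2!Cmod_R, 2!Rabs_pos_eq by (lra || apply pos_INR).
  assert (P : Cmod (power_pair z (S j) k) <= 2 * (/ Re z ^ j * (/ lattice_const z ^ 2 * / (INR k + 1) ^ 2))).
  { unfold power_pair. eapply Rle_trans; [apply Cmod_triangle|].
    pose proof (power_bound z Hz (INR (S k)) k j (Rabs_pos_eq _ (pos_INR _))) as Q1.
    pose proof (power_bound z Hz (- INR (S k)) k j) as Q2. rewrite Rabs_Ropp in Q2.
    specialize (Q2 (Rabs_pos_eq _ (pos_INR _))).
    replace (z + (- INR (S k))%R * Ci)%C with (z - INR (S k) * Ci)%C in Q2 by (rewrite RtoC_opp; ring). lra. }
  pose proof (INR_fact_lt_0 j) as F0. pose proof (fact_shift_le 2 j) as F2. change (2 + j)%nat with (S (S j)) in F2.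
  assert (F : (2 * PI) ^ S (S j) / INR (fact (S (S j))) <= (2 * PI) ^ S (S j) * / INR (fact j)).
  { apply Rmult_le_compat_l; [apply pow_le; lra | exact F2]. }
  eapply Rle_trans; [apply Rmult_le_compat; [apply Rmult_le_pos; [apply pow_le; lra | apply Rlt_le, Rinv_0_lt_compat, INR_fact_lt_0] | apply Cmod_ge_0 | exact F | exact P]|].
  apply Req_le. unfold Rdiv. rewrite (Rpow_mult_distr (2 * PI) (/ Re z)), pow_inv. simpl ((2 * PI) ^ S (S j)).
  unfold Rdiv. ring.
Qed.

Lemma lat_dominating :
  (forall k, ex_series (fun j => lat_const * (/ (INR k + 1) ^ 2 * lat_row j))) /\
  ex_series (fun k => Series (fun j => lat_const * (/ (INR k + 1) ^ 2 * lat_row j))).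
Proof.
  apply (product_dominating lat_const (fun k => / (INR k + 1) ^ 2) lat_row); [apply ex_series_inv_sq | apply ex_series_exp].
Qed.

Lemma exp_rem2_series (u : C) : u <> 0 ->
  Csummable (fun j => ((2 * PI) ^ S (S j) / INR (fact (S (S j))) * (/ u) ^ S (S j))%C) /\
  exp_rem2 u = Csum (fun j => ((2 * PI) ^ S (S j) / INR (fact (S (S j))) * (/ u) ^ S (S j))%C).
Proof.
  intros Hu. set (v := (2 * PI / u)%C).
  assert (E : forall j, (v * v * (v ^ j / INR (fact (2 + j))))%C = ((2 * PI) ^ S (S j) / INR (fact (S (S j))) * (/ u) ^ S (S j))%C).
  { intros j. change (2 + j)%nat with (S (S j)).
    replace (v * v * (v ^ j / INR (fact (S (S j)))))%C with (v ^ S (S j) / INR (fact (S (S j))))%C by (rewrite !Cpow_S; unfold Cdiv; ring).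
    unfold v, Cdiv. rewrite Cpow_mult_l. ring. }
  pose proof (exp_tail_summable 2 v) as Sv. split.
  - eapply Csummable_ext; [exact E|]. apply Csummable_scal, Sv.
  - rewrite <- (Csum_ext _ _ E), Csum_scal by exact Sv. unfold exp_rem2. fold v. rewrite Cexp_expand2.
    unfold exp_tail. ring.
Qed.

Lemma exp_rem2_pair_series k :
  Csum (lat_arr k) = (exp_rem2 (z + INR (S k) * Ci) + exp_rem2 (z - INR (S k) * Ci))%C.
Proof.
  destruct (exp_rem2_series _ (shift_plus_neq_0 z (INR (S k)) Hz)) as [S1 E1].
  destruct (exp_rem2_series _ (shift_minus_neq_0 z (INR (S k)) Hz)) as [S2 E2].
  rewrite E1, E2, <- Csum_plus by assumption. apply Csum_ext. intros j. unfold lat_arr, power_pair. ring.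
Qed.

Let four_arr (n j : nat) : C := ((bessel_coeff (S j) * INR (S n) ^ S j)%R * qpow (S n) z)%C.
Let four_row (j : nat) : R := (4 * PI / Re z) ^ S j / INR (fact (S j)).

(** [bessel_term_bound] with [e = PI * Re z] spends half of the decay of [qpow]; the other half is
    [nome_bound]. *)
Lemma four_arr_bound n j : Cmod (four_arr n j) <= 4 * PI ^ 2 * (nome_bound z ^ S n * four_row j).
Proof.
  pose proof PI_RGT_0 as HP. unfold four_arr, four_row.
  assert (He : 0 < PI * Re z) by nra.
  pose proof (bessel_term_bound (S j) (INR (S n)) (PI * Re z) (pos_INR _) He) as B.
  rewrite Cmod_mult, Cmod_R, Rabs_pos_eq, Cmod_qpow.
  2:{ apply Rmult_le_pos; [apply Rlt_le, bessel_coeff_pos | apply pow_le, pos_INR]. }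
  eapply Rle_trans; [apply Rmult_le_compat_r; [apply pow_le, Rlt_le, exp_pos | exact B]|].
  replace (4 * PI ^ 2 / (PI * Re z)) with (4 * PI / Re z) by (field; lra).
  apply Req_le. unfold nome_bound. rewrite !exp_pow_INR.
  replace (exp (INR (S n) * - (PI * Re z))) with (exp (PI * Re z * INR (S n)) * exp (INR (S n) * - (2 * PI * Re z))).
  - ring.
  - rewrite <- exp_plus. f_equal. ring.
Qed.

Lemma four_dominating :
  (forall n, ex_series (fun j => 4 * PI ^ 2 * (nome_bound z ^ S n * four_row j))) /\
  ex_series (fun n => Series (fun j => 4 * PI ^ 2 * (nome_bound z ^ S n * four_row j))).
Proof.
  apply (product_dominating (4 * PI ^ 2) (fun n => nome_bound z ^ S n) four_row).
  - apply (ex_series_incr_1 (fun n => nome_bound z ^ n)), nome_bound_summable, Hz.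
  - apply (ex_series_incr_1 (fun j => (4 * PI / Re z) ^ j / INR (fact j))), ex_series_exp.
Qed.

(** The subtracted [4 * PI ^ 2] is the term [k = 0] of the Bessel series; it corresponds to the part
    [2 pi / u] left out of [exp_rem2]. *)
Lemma bessel_tail_row n : Csum (four_arr n) = ((bessel (INR (S n)) - 4 * PI ^ 2)%R * qpow (S n) z)%C.
Proof.
  destruct four_dominating as [D1 D2].
  pose proof (bessel_ex_series (INR (S n)) (pos_INR _)) as Sb.
  unfold four_arr. rewrite Csum_scal_r.
  - f_equal. rewrite Csum_RtoC. f_equal. unfold bessel. rewrite (Series_incr_1 _ Sb).
    unfold bessel_coeff at 2. simpl fact. simpl INR. simpl (_ ^ 0). simpl (_ ^ 1). field.
  - apply (Csummable_le _ (fun j => bessel_coeff (S j) * INR (S n) ^ S j)).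
    + intros j. rewrite Cmod_R, Rabs_pos_eq; [lra|].
      apply Rmult_le_pos; [apply Rlt_le, bessel_coeff_pos | apply pow_le, pos_INR].
    + apply (ex_series_incr_1 (fun j => bessel_coeff j * INR (S n) ^ j)), Sb.
Qed.

(** The Lipschitz factor [(2 pi)^(j+2) / (j+1)!] and the Taylor coefficient [(2 pi)^(j+2) / (j+2)!]
    multiply to [bessel_coeff (S j)]. *)
Lemma comparison_column j :
  Csum (fun n => four_arr n j) =
  ((2 * PI) ^ S (S j) / INR (fact (S (S j))) * (/ z) ^ S (S j) + Csum (fun k => lat_arr k j))%C.
Proof.
  pose proof (lipschitz_formula z Hz (S j) ltac:(lia)) as L. unfold lattice_coeff, fourier_coeff in L.
  unfold lat_arr. rewrite Csum_scal by apply power_pair_summable, Hz.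
  rewrite <- Cmult_plus_distr_l, L.
  pose proof (poly_qpow_summable z Hz (S j)) as Sq. rewrite Cmult_assoc, <- Csum_scal by exact Sq.
  apply Csum_ext. intros n. unfold four_arr, bessel_coeff.
  pose proof (INR_fact_C_neq_0 (S (S j))). pose proof (INR_fact_C_neq_0 (S j)).
  pose proof (INR_fact_neq_0 (S (S j))). pose proof (INR_fact_neq_0 (S j)).
  rewrite RtoC_mult, RtoC_div, RtoC_mult, !RtoC_pow, !RtoC_mult, RtoC_pow by nra.
  replace ((4 * PI ^ 2) ^ S (S j))%C with ((2 * PI) ^ S (S j) * (2 * PI) ^ S (S j))%C.
  - field. auto.
  - rewrite <- Cpow_mult_l. f_equal. simpl. ring.
Qed.

Lemma bessel_tail_summable : Csummable (fun n => ((bessel (INR (S n)) - 4 * PI ^ 2)%R * qpow (S n) z)%C).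
Proof.
  destruct four_dominating as [D1 D2]. eapply Csummable_ext; [exact bessel_tail_row|].
  apply (Csummable_rows _ _ four_arr_bound D1 D2).
Qed.

Lemma exp_rem2_pair_summable : Csummable (fun k => (exp_rem2 (z + INR (S k) * Ci) + exp_rem2 (z - INR (S k) * Ci))%C).
Proof.
  destruct lat_dominating as [D1 D2]. eapply Csummable_ext; [exact exp_rem2_pair_series|].
  apply (Csummable_rows _ _ lat_arr_bound D1 D2).
Qed.

Lemma bessel_poincare_series :
  Csum (fun n => ((bessel (INR (S n)) - 4 * PI ^ 2)%R * qpow (S n) z)%C) =
  (exp_rem2 z + Csum (fun k => exp_rem2 (z + INR (S k) * Ci) + exp_rem2 (z - INR (S k) * Ci)))%C.
Proof.
  destruct four_dominating as [D1 D2]. destruct lat_dominating as [D3 D4].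
  destruct (exp_rem2_series z (Re_pos_neq_0 z Hz)) as [S0 E0].
  rewrite <- (Csum_ext _ _ bessel_tail_row), <- (Csum_ext _ _ exp_rem2_pair_series).
  pose proof (Csum_fubini _ _ four_arr_bound D1 D2) as F1. pose proof (Csum_fubini _ _ lat_arr_bound D3 D4) as F2.
  cbv beta in F1, F2. rewrite F1, F2, E0, <- Csum_plus.
  - apply Csum_ext, comparison_column.
  - exact S0.
  - apply (Csummable_cols _ _ lat_arr_bound D3 D4).
Qed.

End Comparison.

(** * The coefficients of j and the Bessel function *)

Definition root_unity (N : nat) (d : Z) : C := Cexp (IZR d / INR N * (2 * PI * Ci)).

Lemma root_unity_neq_1 N d : (0 < Z.abs d < Z.of_nat N)%Z -> root_unity N d <> 1.
Proof.
  intros Hd E. pose proof PI_RGT_0 as HP.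
  assert (HN : 0 < INR N) by (apply lt_0_INR; lia).
  assert (NC : RtoC (INR N) <> 0) by (intros H; apply RtoC_inj in H; lra).
  set (t := PI * (IZR d / INR N)).
  assert (E2 : root_unity N d = Cexp (2 * t * Ci)).
  { unfold root_unity, t. f_equal. rewrite RtoC_mult, RtoC_div by lra. ring. }
  rewrite E2 in E. apply (f_equal Re) in E.
  assert (E3 : Re (Cexp (2 * t * Ci)) = cos (2 * t)).
  { unfold Cexp. simpl. replace ((2 * t - 0 * 0) * 0 - (2 * 0 + 0 * t) * 1) with 0 by ring.
    rewrite exp_0, Rmult_1_l. f_equal. ring. }
  rewrite E3, cos_2a_sin in E. simpl in E.
  assert (S0 : sin t = 0) by nra.
  assert (Pos : forall x, 0 < x < PI -> sin x <> 0) by (intros x Hx; apply Rgt_not_eq, sin_gt_0; lra).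
  assert (HdR : 0 < IZR (Z.abs d) < INR N).
  { rewrite INR_IZR_INZ. split; apply IZR_lt; lia. }
  assert (Hq : 0 < IZR (Z.abs d) / INR N < 1).
  { split; [apply Rdiv_lt_0_compat; lra|]. apply (Rmult_lt_reg_r (INR N)); [lra|]. unfold Rdiv. rewrite Rmult_assoc, Rinv_l; lra. }
  destruct (Z.abs_spec d) as [[_ Ha]|[_ Ha]]; rewrite Ha in Hq.
  - apply (Pos t); [unfold t; nra | exact S0].
  - apply (Pos (- t)).
    + rewrite opp_IZR in Hq. unfold Rdiv in *. unfold t. nra.
    + rewrite sin_neg, S0. ring.
Qed.

Lemma root_unity_sum N d : (0 < Z.abs d < Z.of_nat N)%Z -> Cpsum (fun k => root_unity N d ^ k)%C N = 0.
Proof.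
  intros Hd. pose proof (root_unity_neq_1 N d Hd) as H1.
  assert (HN : INR N <> 0) by (apply not_0_INR; lia).
  assert (G : forall n, ((root_unity N d - 1) * Cpsum (fun k => root_unity N d ^ k) n)%C = (root_unity N d ^ n - 1)%C).
  { induction n as [|n IH]; [simpl; ring|]. cbn [Cpsum]. rewrite Cmult_plus_distr_l, IH, Cpow_S. ring. }
  specialize (G N).
  assert (P : (root_unity N d ^ N)%C = 1).
  { unfold root_unity. rewrite Cexp_pow. rewrite <- (Cexp_2PI_Z d). f_equal. field.
    intros H; apply RtoC_inj in H; auto. }
  rewrite P in G. replace (1 - 1)%C with (RtoC 0) in G by ring.
  destruct (Ceq_dec (Cpsum (fun k => root_unity N d ^ k)%C N) 0) as [|Hn]; [assumption|].
  exfalso. revert G. apply Cmult_neq_0; [|exact Hn]. intros H. apply H1, Ceq_minus, H.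
Qed.

Lemma Cpsum_swap (a : nat -> nat -> C) N M :
  Cpsum (fun i => Cpsum (a i) M) N = Cpsum (fun j => Cpsum (fun i => a i j) N) M.
Proof.
  induction N as [|N IH]; cbn [Cpsum].
  - induction M as [|M IHM]; [reflexivity|]. cbn [Cpsum]. rewrite <- IHM. ring.
  - rewrite IH, <- Cpsum_plus. reflexivity.
Qed.

Lemma Cpsum_single (a : nat -> C) N n : (n < N)%nat -> (forall k, (k < N)%nat -> k <> n -> a k = 0) -> Cpsum a N = a n.
Proof.
  revert n. induction N as [|N IH]; intros n Hn H; [lia|]. cbn [Cpsum].
  destruct (Nat.eq_dec n N) as [->|D].
  - replace (Cpsum a N) with (Cpsum (fun _ => 0 * 0)%C N).
    + rewrite (Cpsum_scal 0 (fun _ => RtoC 0)). ring.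
    + apply Cpsum_ext. intros k Hk. rewrite H by lia. ring.
  - rewrite (IH n), (H N) by (auto; lia). ring.
Qed.

(** * Cauchy's estimate without integrals *)

Section Cauchy.

Variables (r : nat -> C) (y M : R).
Hypothesis Hy : 0 < y.
Hypothesis Hs : Csummable (fun n => (r n * qpow (S n) y)%C).
Hypothesis HM : forall x : R, Rabs x <= 1 / 2 -> Cmod (Csum (fun n => r n * qpow (S n) (y + x * Ci))%C) <= M.

Lemma Cmod_qpow_vertical n (x : R) : Cmod (qpow n (y + x * Ci)) = Cmod (qpow n y).
Proof. rewrite 2!Cmod_qpow. do 3 f_equal. rewrite re_plus, re_mult_Ci. simpl. ring. Qed.

Lemma vertical_summable (x : R) : Csummable (fun n => (r n * qpow (S n) (y + x * Ci))%C).
Proof.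
  eapply Csummable_le; [|exact Hs]. intros n. rewrite 2!Cmod_mult, Cmod_qpow_vertical. lra.
Qed.

(* The contour integral is replaced by an average over [N]-th roots of unity,
   which isolates the coefficient up to the tail of the series. *)
Lemma cauchy_estimate n : Cmod (r n) * exp (- (2 * PI * y)) ^ S n <= M.
Proof.
  assert (HP := PI_RGT_0).
  replace (exp (- (2 * PI * y)) ^ S n) with (Cmod (qpow (S n) y)) by (rewrite Cmod_qpow; reflexivity).
  rewrite <- Cmod_mult. set (b := fun k => (r k * qpow (S k) y)%C) in *. change (r n * qpow (S n) y)%C with (b n).
  set (tau := fun N => Series (fun k => Cmod (b (N + k)%nat))).
  assert (Main : forall N, (n < N)%nat -> Cmod (b n) <= M + tau N).
  { intros N HnN. assert (HN : 0 < INR N) by (apply lt_0_INR; lia).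
    assert (NC : RtoC (INR N) <> 0) by (intros H; apply RtoC_inj in H; lra).
    (* Equally spaced points of one period, placed where [HM] applies; [ph] cancels the phase of the
       term with index [n]. *)
    set (x := fun k : nat => INR k / INR N - 1 / 2).
    set (ph := fun k : nat => Cexp (2 * PI * (INR (S n) * (x k * Ci)))).
    set (T := fun k : nat => (ph k * Cpsum (fun m => r m * qpow (S m) (y + x k * Ci)) N)%C).
    assert (Hx : forall k, (k < N)%nat -> Rabs (x k) <= 1 / 2).
    { intros k Hk. unfold x. apply lt_INR in Hk. pose proof (pos_INR k).
      assert (0 <= INR k / INR N <= 1).
      { split; [apply Rmult_le_pos; [lra | apply Rlt_le, Rinv_0_lt_compat, HN]|].
        apply (Rmult_le_reg_r (INR N)); [lra|]. unfold Rdiv. rewrite Rmult_assoc, Rinv_l; lra. }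
      apply Rabs_le. lra. }
    assert (BT : Cmod (Cpsum T N) <= INR N * (M + tau N)).
    { apply Cmod_Cpsum_le. intros k Hk. unfold T. rewrite Cmod_mult.
      replace (Cmod (ph k)) with 1.
      2:{ unfold ph. rewrite Cmod_Cexp, <- exp_0. f_equal. rewrite Re_2PI_mult. unfold Re; simpl; ring. }
      rewrite Rmult_1_l. pose proof (Csum_split _ N (vertical_summable (x k))) as E.
      set (Full := Csum (fun m => r m * qpow (S m) (y + x k * Ci))%C) in E.
      set (Tail := Csum (fun m => r (N + m)%nat * qpow (S (N + m)) (y + x k * Ci))%C) in E.
      replace (Cpsum (fun m => r m * qpow (S m) (y + x k * Ci))%C N) with (Full - Tail)%C by (rewrite E; ring).
      eapply Rle_trans; [apply Cmod_triangle_minus|]. apply Rplus_le_compat; [apply HM, Hx, Hk|].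
      eapply Rle_trans; [apply Cmod_Csum_le, (Csummable_shift _ N (vertical_summable (x k)))|].
      apply Req_le. unfold tau. apply Series_ext. intros m. unfold b. rewrite 2!Cmod_mult, Cmod_qpow_vertical. reflexivity. }
    assert (ET : Cpsum T N = (INR N * b n)%C).
    { unfold T. rewrite (Cpsum_ext _ (fun k => Cpsum (fun m => b m * (Cexp (- (IZR (Z.of_nat n - Z.of_nat m) * (PI * Ci))) * root_unity N (Z.of_nat n - Z.of_nat m) ^ k)) N)%C).
      - rewrite Cpsum_swap, (Cpsum_single _ N n HnN).
        + rewrite (Cpsum_ext _ (fun _ => b n * 1)%C).
          * rewrite (Cpsum_scal (b n) (fun _ => RtoC 1)).
            replace (Cpsum (fun _ => RtoC 1) N) with (RtoC (INR N)); [ring|].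
            clear. induction N as [|N IH]; [reflexivity|]. rewrite S_INR, RtoC_plus, IH. reflexivity.
          * intros k _. rewrite Z.sub_diag. unfold root_unity.
            replace (- (0 * (PI * Ci)))%C with (RtoC 0) by ring.
            replace (0 / INR N * (2 * PI * Ci))%C with (RtoC 0) by (field; exact NC).
            rewrite Cexp_0, Cpow_1_l. ring.
        + intros m Hm D. rewrite Cpsum_scal, Cpsum_scal, root_unity_sum by lia. ring.
      - intros k _. rewrite <- Cpsum_scal. apply Cpsum_ext. intros m _. unfold b, ph, root_unity.
        rewrite qpow_plus, Cexp_pow. unfold qpow at 2.
        replace (Cexp (2 * PI * (INR (S n) * (x k * Ci))) * (r m * (qpow (S m) y * Cexp (- (2 * PI * (INR (S m) * (x k * Ci)))))))%C
          with (r m * qpow (S m) y * (Cexp (2 * PI * (INR (S n) * (x k * Ci))) * Cexp (- (2 * PI * (INR (S m) * (x k * Ci))))))%C by ring.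
        rewrite <- 2!Cexp_plus. do 2 f_equal. unfold x.
        rewrite RtoC_minus, 2!RtoC_div, minus_IZR, RtoC_minus, <- 2!INR_IZR_INZ, !S_INR, !RtoC_plus by lra. field. exact NC. }
    rewrite ET, Cmod_mult, Cmod_R, Rabs_pos_eq in BT by lra. apply (Rmult_le_reg_l (INR N)); lra. }
  assert (L : is_lim_seq (fun N => M + tau N) (M + 0)).
  { apply is_lim_seq_plus'; [apply is_lim_seq_const | apply (Series_tail_lim (fun k => Cmod (b k)) Hs)]. }
  rewrite Rplus_0_r in L.
  apply (is_lim_seq_le_loc (fun _ => Cmod (b n)) (fun N => M + tau N) (Cmod (b n)) M); [|apply is_lim_seq_const | exact L].
  exists (S n). intros N HN. apply Main. lia.
Qed.

End Cauchy.

(** * Explicit bounds for j *)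

Lemma exp_le (x y : R) : x <= y -> exp x <= exp y.
Proof. intros [H|H]; [apply Rlt_le, exp_increasing, H | rewrite H; lra]. Qed.

(** The true value is close to 1; the loss comes from the general bound [lambert_term_bound], which
    gives [1 + 240 (1/41) (7/6)^2 < 9]. *)
Lemma Cmod_E4_2_le : Cmod (E4 2) <= 9.
Proof.
  assert (H2 : 0 < Re 2) by (simpl; lra). pose proof PI_bounds as HP.
  destruct (lambert_dominating 2 H2 (lambert_const 2 3)) as [D1 D2].
  pose proof (lambert_term_bound 2 3) as B.
  set (rho := nome_bound 2). pose proof (nome_bound_range 2 H2) as Hr. fold rho in Hr.
  assert (Hrho : rho <= 1 / 7).
  { unfold rho, nome_bound. simpl (Re _). rewrite exp_Ropp. replace (1 / 7) with (/ 7) by field.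
    apply Rinv_le_contravar; [lra|]. pose proof (exp_ineq1_le (PI * 2)). lra. }
  assert (HC : 0 <= lambert_const 2 3 <= 1 / 41).
  { unfold lambert_const. simpl (Re _). simpl (INR (fact 3)).
    assert (H41 : 246 <= (PI * 2) ^ 3).
    { apply Rle_trans with (6.283 ^ 3); [lra | apply pow_incr; lra]. }
    split; [apply Rmult_le_pos; [lra | apply Rlt_le, Rinv_0_lt_compat; lra]|].
    apply (Rmult_le_reg_r ((PI * 2) ^ 3)); [lra|]. rewrite Rmult_assoc, Rinv_l by lra. lra. }
  set (K := lambert_const 2 3) in *.
  assert (G : forall t, Series (fun n => t * rho ^ n) = t * / (1 - rho)).
  { intros t. rewrite Series_scal_l, Series_geom; [reflexivity | rewrite Rabs_pos_eq; lra]. }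
  assert (Hinv : / (1 - rho) <= 7 / 6).
  { replace (7 / 6) with (/ (6 / 7)) by field. apply Rinv_le_contravar; lra. }
  assert (Hinv0 : 0 < / (1 - rho)) by (apply Rinv_0_lt_compat; lra).
  assert (BL : Cmod (lambert 3 2) <= K * / (1 - rho) * / (1 - rho)).
  { unfold lambert. eapply Rle_trans; [apply Cmod_Csum_le, lambert_summable, H2|].
    rewrite <- G. apply Series_le.
    - intros l. split; [apply Cmod_ge_0|].
      eapply Rle_trans; [apply Cmod_Csum_le, (Csummable_row _ _ (fun l n => B l n H2) D1 l)|].
      apply Rle_trans with (Series (fun n => (K * rho ^ l) * rho ^ n)).
      + apply Series_le.
        * intros n. split; [apply Cmod_ge_0|]. eapply Rle_trans; [apply B, H2|]. unfold K, rho. apply Req_le. ring.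
        * apply (ex_series_scal_l (K * rho ^ l) (pow rho)), nome_bound_summable, H2.
      + rewrite G. apply Req_le. ring.
    - apply (ex_series_scal_l (K * / (1 - rho)) (pow rho)), nome_bound_summable, H2. }
  unfold E4. eapply Rle_trans; [apply Cmod_triangle|]. rewrite Cmod_mult, Cmod_1, Cmod_R, Rabs_pos_eq by lra.
  assert (K * / (1 - rho) <= 1 / 41 * (7 / 6)) by (apply Rmult_le_compat; lra).
  assert (0 <= K * / (1 - rho)) by nra.
  assert (K * / (1 - rho) * / (1 - rho) <= 1 / 41 * (7 / 6) * (7 / 6)) by (apply Rmult_le_compat; lra).
  lra.
Qed.

Section Bounds.

Variable c : nat -> Z.
Hypothesis hc : j_fourier_coefficients c.

(** The nome at 2 is at most 1/49, so the infinite product is at least 47/49, and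
    [9^3 (49/47)^24 < 2000]. *)
Lemma Cmod_J_2_le : Cmod (J 2) <= 2000 * exp (4 * PI).
Proof.
  pose proof PI_bounds as HP. set (q := exp (- (4 * PI))).
  assert (Hq : 0 < q <= 1 / 49).
  { split; [apply exp_pos|]. unfold q. replace (- (4 * PI)) with (- (2 * PI) + - (2 * PI)) by ring.
    rewrite exp_plus, exp_Ropp.
    assert (/ exp (2 * PI) <= / 7) by (apply Rinv_le_contravar; [lra | pose proof (exp_ineq1_le (2 * PI)); lra]).
    assert (0 < / exp (2 * PI)) by apply Rinv_0_lt_compat, exp_pos. nra. }
  assert (Ht : tq q = 2) by (unfold tq, q; rewrite ln_exp; field; apply PI_neq0).
  pose proof (qj_J c hc q ltac:(lra)) as E. rewrite Ht in E.
  pose proof (qj_factorisation c hc q ltac:(lra)) as F.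
  pose proof (e4_real_E4 q ltac:(lra)) as E4q. rewrite Ht in E4q.
  pose proof Cmod_E4_2_le as B4. rewrite <- E4q, Cmod_R in B4.
  destruct (eta_real_range q 0 ltac:(lra)) as [L _]. simpl in L.
  assert (L1 : 47 / 49 <= eta_real q) by lra.
  assert (Q : Cmod (J 2) = Rabs (qj c q) * exp (4 * PI)).
  { rewrite <- Cmod_R, E, Cmod_mult, Cmod_R, Rabs_pos_eq by lra.
    assert (q * exp (4 * PI) = 1) by (unfold q; rewrite <- exp_plus, <- exp_0; f_equal; ring).
    replace (q * Cmod (J 2) * exp (4 * PI)) with (q * exp (4 * PI) * Cmod (J 2)) by ring. rewrite H. ring. }
  rewrite Q. apply Rmult_le_compat_r; [apply Rlt_le, exp_pos|]. rewrite F, Rabs_mult, <- 2!RPow_abs.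
  apply Rle_trans with (9 ^ 3 * (49 / 47) ^ 24).
  - apply Rmult_le_compat; try (apply pow_le, Rabs_pos).
    + apply pow_incr. split; [apply Rabs_pos | exact B4].
    + apply pow_incr. split; [apply Rabs_pos|]. rewrite Rabs_pos_eq by (apply Rlt_le, Rinv_0_lt_compat; lra).
      replace (49 / 47) with (/ (47 / 49)) by field. apply Rinv_le_contravar; lra.
  - lra.
Qed.

(** The value of [J - 1/q] at [z = 1 / 2], where the nome is [exp (- PI)]. As the coefficients are
    nonnegative, it bounds this difference on the whole of [Re z >= 1 / 2]. *)
Definition tail_const : R := Series (fun n => IZR (c n) * exp (- PI) ^ n).

Lemma coefficient_IZR_nonneg n : 0 <= IZR (c n).
Proof. apply IZR_le, coefficients_nonneg, hc. Qed.

Lemma tail_const_ex_series : ex_series (fun n => IZR (c n) * exp (- PI) ^ n).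
Proof.
  apply ex_series_of_disk; [apply Rlt_le, exp_pos|]. apply coefficients_disk; [exact hc|].
  split; [apply Rlt_le, exp_pos|]. rewrite <- exp_0. apply exp_increasing. pose proof PI_RGT_0. lra.
Qed.

(** [J (1/2) = J 2], and by nonnegativity both [c 0] and the omitted [1/q] only help. *)
Lemma tail_const_bound : 0 <= IZR (c 0) <= tail_const /\ tail_const <= 2000 * exp (4 * PI).
Proof.
  assert (Pos : forall n, 0 <= IZR (c n) * exp (- PI) ^ n).
  { intros n. apply Rmult_le_pos; [apply coefficient_IZR_nonneg | apply pow_le, Rlt_le, exp_pos]. }
  split; [split; [apply coefficient_IZR_nonneg|]|].
  - pose proof (term_le_Series _ 0 Pos tail_const_ex_series) as T. simpl in T. unfold tail_const. lra.
  - eapply Rle_trans; [|apply Cmod_J_2_le].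
    assert (H2 : 0 < Re 2) by (simpl; lra).
    rewrite <- J_inversion by exact H2. rewrite <- RtoC_inv by lra.
    assert (Hh : 0 < Re (/ 2)%R) by (simpl; lra).
    rewrite (J_expansion c hc _ Hh).
    assert (Q1 : forall n, qpow n (/ 2)%R = RtoC (exp (- PI) ^ n)).
    { intros n. rewrite qpow_pow, RtoC_pow. f_equal. unfold qpow. rewrite <- Cexp_real. f_equal.
      simpl (INR 1). rewrite <- !RtoC_mult, <- RtoC_opp. f_equal. field. }
    rewrite Q1, pow_1, <- RtoC_inv by (apply Rgt_not_eq, exp_pos).
    rewrite (Csum_ext _ (fun n => RtoC (IZR (c n) * exp (- PI) ^ n))) by (intros n; rewrite Q1, RtoC_mult; reflexivity).
    rewrite Csum_RtoC, <- RtoC_plus, Cmod_R. eapply Rle_trans; [|apply Rle_abs]. fold tail_const.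
    assert (0 < / exp (- PI)) by apply Rinv_0_lt_compat, exp_pos. lra.
Qed.

Lemma tail_bound z : 1 / 2 <= Re z -> Cmod (Csum (fun n => IZR (c n) * qpow n z)%C) <= tail_const.
Proof.
  intros Hz. assert (Hz0 : 0 < Re z) by lra.
  eapply Rle_trans; [apply Cmod_Csum_le, coefficients_summable; assumption|].
  apply Series_le; [|apply tail_const_ex_series]. intros n. split; [apply Cmod_ge_0|].
  rewrite Cmod_mult, Cmod_R, Rabs_pos_eq, Cmod_qpow by apply coefficient_IZR_nonneg.
  apply Rmult_le_compat_l; [apply coefficient_IZR_nonneg|]. apply pow_incr.
  split; [apply Rlt_le, exp_pos|]. apply exp_le. pose proof PI_RGT_0. nra.
Qed.

Lemma inv_qpow_1 z : (/ qpow 1 z)%C = Cexp (2 * PI * z).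
Proof. unfold qpow. rewrite <- Cexp_opp. f_equal. simpl. ring. Qed.

Lemma J_near_cusp z : 1 / 2 <= Re z -> Cmod (J z - Cexp (2 * PI * z)) <= tail_const.
Proof.
  intros Hz. rewrite (J_expansion c hc z) by lra. rewrite inv_qpow_1.
  replace (_ - _)%C with (Csum (fun n => IZR (c n) * qpow n z)%C) by ring. apply tail_bound, Hz.
Qed.

Lemma J_bound_near_cusp z : 1 / 2 <= Re z -> Cmod (J z) <= exp (2 * PI * Re z) + tail_const.
Proof.
  intros Hz. pose proof (J_near_cusp z Hz) as B.
  replace (J z) with (Cexp (2 * PI * z) + (J z - Cexp (2 * PI * z)))%C by ring.
  eapply Rle_trans; [apply Cmod_triangle|]. rewrite Cmod_Cexp, Re_2PI_mult. lra.
Qed.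

Lemma nearest_integer x : exists m : Z, Rabs (x - IZR m) <= 1 / 2.
Proof.
  exists (up (x - 1 / 2)). pose proof (archimed (x - 1 / 2)) as [H1 H2]. apply Rabs_le. lra.
Qed.

(* Each step [z -> 1 / (z - i m)] at least doubles [Re z] as long as [Re z < 1/2]. *)
Lemma J_reduction k : forall z, 0 < Re z -> 1 <= 2 ^ S k * Re z ->
  exists p q : Z, (p, q) <> (0%Z, 0%Z) /\
    1 / 2 <= Re z / Cmod (IZR p * z + IZR q * Ci) ^ 2 /\
    Cmod (J z) <= exp (2 * PI * (Re z / Cmod (IZR p * z + IZR q * Ci) ^ 2)) + tail_const.
Proof.
  induction k as [|k IH]; intros z Hz Hk.
  - exists 0%Z, 1%Z. split; [discriminate|].
    replace (IZR 0 * z + IZR 1 * Ci)%C with Ci by ring. rewrite Cmod_Ci.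
    replace (Re z / 1 ^ 2) with (Re z) by field. simpl in Hk. split; [lra | apply J_bound_near_cusp; lra].
  - destruct (Rle_dec (1 / 2) (Re z)) as [Hc|Hc].
    + exists 0%Z, 1%Z. split; [discriminate|].
      replace (IZR 0 * z + IZR 1 * Ci)%C with Ci by ring. rewrite Cmod_Ci.
      replace (Re z / 1 ^ 2) with (Re z) by field. split; [lra | apply J_bound_near_cusp; lra].
    + destruct (nearest_integer (Im z)) as [m Hm].
      set (z0 := (z + IZR (- m) * Ci)%C).
      assert (R0 : Re z0 = Re z) by apply Re_shift.
      assert (I0 : Im z0 = Im z - IZR m) by (unfold z0, Im; rewrite opp_IZR; simpl; ring).
      assert (Hz0 : 0 < Re z0) by lra. pose proof (Re_pos_neq_0 z0 Hz0) as z00.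
      pose proof (Cmod2_alt z0) as N0. rewrite R0, I0 in N0.
      apply Rabs_le_between in Hm.
      assert (Np : 0 < Cmod z0 ^ 2) by (apply pow_lt, Cmod_gt_0, z00).
      assert (N1 : Cmod z0 ^ 2 <= 1 / 2) by (rewrite N0; nra).
      assert (R1 : Re (/ z0) = Re z / Cmod z0 ^ 2).
      { rewrite <- R0, Cmod2_alt. unfold Re, Im. simpl. reflexivity. }
      assert (R2 : 2 * Re z <= Re (/ z0)).
      { rewrite R1. apply (Rmult_le_reg_r (Cmod z0 ^ 2)); [exact Np|]. replace (Re z / Cmod z0 ^ 2 * Cmod z0 ^ 2) with (Re z) by (field; apply Rgt_not_eq, Cmod_gt_0, z00). nra. }
      assert (P2 : 0 < 2 ^ S k) by (apply pow_lt; lra).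
      destruct (IH (/ z0)%C) as (p & q & Hpq & Hv & HJ).
      * lra.
      * change (2 ^ S (S k)) with (2 * 2 ^ S k) in Hk.
        pose proof (Rmult_le_compat_l _ _ _ (Rlt_le _ _ P2) R2). lra.
      (* From [p / z0 + i q = (i / z0) (q z0 - i p)] with [z0 = z - i m]. *)
      * exists q, (- (q * m + p))%Z.
        assert (EV : Re (/ z0) / Cmod (IZR p * / z0 + IZR q * Ci) ^ 2 =
           Re z / Cmod (IZR q * z + IZR (- (q * m + p)) * Ci) ^ 2).
        { assert (CI : (Ci * Ci)%C = (- (1))%C) by (apply C_eq; simpl; ring).
          assert (EE : (IZR p * / z0 + IZR q * Ci)%C = (Ci * (IZR q * z + IZR (- (q * m + p)) * Ci) / z0)%C).
          { rewrite opp_IZR, plus_IZR, mult_IZR, RtoC_opp, RtoC_plus, RtoC_mult.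
            replace (IZR q * z + - (IZR q * IZR m + IZR p) * Ci)%C with (IZR q * z0 - IZR p * Ci)%C
              by (unfold z0; rewrite opp_IZR, RtoC_opp; ring).
            replace (Ci * (IZR q * z0 - IZR p * Ci))%C with (IZR q * z0 * Ci - IZR p * (Ci * Ci))%C by ring.
            rewrite CI. field. exact z00. }
          rewrite EE, Cmod_div, Cmod_mult, Cmod_Ci, Rmult_1_l, R1 by exact z00.
          set (X := Cmod (IZR q * z + IZR (- (q * m + p)) * Ci)).
          assert (HX : X <> 0).
          (* If the lattice vector vanished, the convention [/ 0 = 0] would make the real part of
             the image 0, against the bound 1/2. *)
          { intros HX. apply Cmod_eq_0 in HX. rewrite EE, HX in Hv.
            replace (Ci * 0 / z0)%C with (RtoC 0) in Hv by (field; exact z00).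
            rewrite Cmod_0 in Hv. unfold Rdiv in Hv. replace (0 ^ 2) with 0 in Hv by ring. rewrite Rinv_0 in Hv. lra. }
          assert (Cmod z0 <> 0) by (apply Rgt_not_eq, Cmod_gt_0, z00). field. auto. }
        rewrite <- EV. split; [|split; [exact Hv|]].
        -- intros H. apply Hpq. injection H as Hq Hp. subst q. f_equal. lia.
        -- rewrite J_inversion in HJ by exact Hz0. unfold z0 in HJ. rewrite J_translate in HJ. exact HJ.
Qed.

(** If [Re (1 / z) >= 1 / 2], the main term is the polar part of [J (1 / z) = J z]. Otherwise the
    main term is at most [exp PI], and the reducing pair is neither [(1, 0)] nor [(-1, 0)], as these
    would lead to [Re (1 / z)] itself. For every other pair [|p z + i q|^2 >= 4 (Re z)^2], so the
    image has real part at most [1 / (4 Re z)]. *)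
Lemma J_minus_main_bound z : 0 < Re z <= 1 / 4 -> Rabs (Im z) <= 1 / 2 ->
  Cmod (J z - Cexp (2 * PI / z)) <= exp (PI / (2 * Re z)) + tail_const + exp PI.
Proof.
  intros Hz Hx. pose proof (Re_pos_neq_0 z (proj1 Hz)) as z0. pose proof PI_RGT_0 as HP.
  pose proof (exp_pos (PI / (2 * Re z))). pose proof (exp_pos PI).
  destruct (Rle_dec (1 / 2) (Re (/ z))) as [Hc|Hc].
  - rewrite <- J_inversion by lra. pose proof (J_near_cusp (/ z) Hc) as B.
    unfold Cdiv in *. lra.
  - eapply Rle_trans; [apply Cmod_triangle_minus|]. rewrite Cmod_Cexp.
    assert (E1 : exp (Re (2 * PI / z)) <= exp PI).
    { apply exp_le. unfold Cdiv. rewrite Re_2PI_mult. nra. }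
    destruct (INR_unbounded (/ Re z)) as [k Hk].
    assert (Hk2 : 1 <= 2 ^ S k * Re z).
    { assert (INR k <= 2 ^ S k).
      { clear. induction k as [|k IH]; [simpl; lra|]. rewrite S_INR. assert (1 <= 2 ^ S k) by (apply pow_R1_Rle; lra). simpl in *. lra. }
      apply Rle_trans with (/ Re z * Re z); [rewrite Rinv_l by lra; lra|]. apply Rmult_le_compat_r; lra. }
    destruct (J_reduction k z (proj1 Hz) Hk2) as (p & q & Hpq & Hv & HJ).
    set (v := Re z / Cmod (IZR p * z + IZR q * Ci) ^ 2) in *.
    assert (EN : Cmod (IZR p * z + IZR q * Ci) ^ 2 = (IZR p * Re z) ^ 2 + (IZR p * Im z + IZR q) ^ 2).
    { rewrite Cmod2_alt. unfold Re, Im. simpl. ring. }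
    apply Rabs_le_between in Hx.
    assert (Big : forall D, 0 < D -> D <= Cmod (IZR p * z + IZR q * Ci) ^ 2 -> v <= Re z / D).
    { intros D HD HDle. unfold v. apply Rmult_le_compat_l; [lra|]. apply Rinv_le_contravar; assumption. }
    assert (V : v <= / (4 * Re z)).
    { assert (IN : forall a b : Z, (a <= b)%Z -> IZR a <= IZR b) by (intros; apply IZR_le; assumption).
      destruct (Z.eq_dec p 0) as [->|Hp].
      - assert (Hq : q <> 0%Z) by congruence.
        assert (v <= Re z / 1).
        { apply Big; [lra|]. rewrite EN.
          assert (1 <= IZR q ^ 2); [|nra].
          replace (IZR q ^ 2) with (IZR (q * q)) by (rewrite mult_IZR; ring). apply IN. nia. }
        apply Rle_trans with (Re z / 1); [assumption|].
        apply (Rmult_le_reg_r (4 * Re z)); [lra|]. rewrite Rinv_l by lra. nra.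
      - destruct (Z_le_gt_dec 2 (Z.abs p)) as [Hp2|Hp2].
        + assert (v <= Re z / (4 * Re z ^ 2)).
          { apply Big; [nra|]. rewrite EN.
            assert (4 <= IZR p ^ 2) by (replace (IZR p ^ 2) with (IZR (p * p)) by (rewrite mult_IZR; ring); apply IN; nia).
            rewrite Rpow_mult_distr. pose proof (pow2_ge_0 (IZR p * Im z + IZR q)). nra. }
          replace (/ (4 * Re z)) with (Re z / (4 * Re z ^ 2)) by (field; lra). assumption.
        + assert (Hp1 : (p = 1 \/ p = -1)%Z) by lia.
          destruct (Z.eq_dec q 0) as [->|Hq].
          * exfalso. apply Hc. assert (v = Re (/ z)); [|lra].
            unfold v. rewrite EN. unfold Re, Im. simpl. f_equal. destruct Hp1 as [-> | ->]; f_equal; ring.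
          * assert (v <= Re z / (1 / 4)).
            { apply Big; [lra|]. rewrite EN. pose proof (pow2_ge_0 (IZR p * Re z)).
              assert (1 / 4 <= (IZR p * Im z + IZR q) ^ 2); [|lra].
              assert (Hq1 : (1 <= q \/ q <= -1)%Z) by lia.
              destruct Hp1 as [-> | ->]; destruct Hq1 as [Hq1|Hq1]; apply IN in Hq1; nra. }
            apply Rle_trans with (Re z / (1 / 4)); [assumption|].
            apply (Rmult_le_reg_r (4 * Re z)); [lra|]. rewrite Rinv_l by lra. nra. }
    assert (E2 : exp (2 * PI * v) <= exp (PI / (2 * Re z))).
    { apply exp_le. replace (PI / (2 * Re z)) with (2 * PI * / (4 * Re z)) by (field; lra).
      apply Rmult_le_compat_l; lra. }
    lra.
Qed.

End Bounds.

(** * The two series on the line Re z = 1 / sqrt n *)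

Lemma exp_rem2_far_bound (u : C) k : u <> 0 -> (INR k + 1) / 2 <= Cmod u ->
  Cmod (exp_rem2 u) <= (16 * PI ^ 2 * exp (4 * PI)) * / (INR k + 1) ^ 2.
Proof.
  intros u0 Hu. pose proof PI_RGT_0 as HP. pose proof (pos_INR k).
  unfold exp_rem2. eapply Rle_trans; [apply Cexp_sub2_bound|].
  assert (V : Cmod (2 * PI / u) <= 4 * PI * / (INR k + 1)).
  { rewrite Cmod_div, <- RtoC_mult, Cmod_R, Rabs_pos_eq by (auto; lra).
    replace (4 * PI * / (INR k + 1)) with (2 * PI * / ((INR k + 1) / 2)) by (field; lra).
    apply Rmult_le_compat_l; [lra|]. apply Rinv_le_contravar; lra. }
  assert (V2 : Cmod (2 * PI / u) <= 4 * PI).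
  { eapply Rle_trans; [exact V|]. rewrite <- (Rmult_1_r (4 * PI)) at 2. apply Rmult_le_compat_l; [lra|].
    rewrite <- Rinv_1. apply Rinv_le_contravar; lra. }
  pose proof (Cmod_ge_0 (2 * PI / u)).
  apply Rle_trans with ((4 * PI * / (INR k + 1)) ^ 2 * exp (4 * PI)).
  - apply Rmult_le_compat; [apply pow2_ge_0 | apply Rlt_le, exp_pos | apply pow_incr; lra | apply exp_le, V2].
  - apply Req_le. rewrite Rpow_mult_distr, pow_inv. ring.
Qed.

Lemma vertical_distance (z : C) (t : R) : Rabs (Im z) <= 1 / 2 -> 1 <= Rabs t ->
  Rabs t / 2 <= Cmod (z + t * Ci).
Proof.
  intros Hx Ht. eapply Rle_trans; [|apply im_le_Cmod].
  replace (Im (z + t * Ci)) with (Im z + t) by (unfold Im; simpl; ring).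
  pose proof (Rabs_triang (Im z + t) (- Im z)) as T. rewrite Rabs_Ropp in T.
  replace (Im z + t + - Im z) with t in T by ring. lra.
Qed.

Section Difference.

Variable c : nat -> Z.
Hypothesis hc : j_fourier_coefficients c.

Definition coeff_error (n : nat) : C := RtoC (IZR (c (S n)) - bessel (INR (S n))).

Lemma coeff_error_series z : 0 < Re z ->
  Csummable (fun n => (coeff_error n * qpow (S n) z)%C) /\
  Csum (fun n => (coeff_error n * qpow (S n) z)%C) =
  (J z - Cexp (2 * PI * z) - IZR (c 0) - ((4 * PI ^ 2)%R * Csum (fun n => qpow (S n) z) + exp_rem2 z
    + Csum (fun k => exp_rem2 (z + INR (S k) * Ci) + exp_rem2 (z - INR (S k) * Ci))))%C.
Proof.
  intros Hz.
  pose proof (coefficients_summable c hc z Hz) as Sc.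
  pose proof (proj1 (Csummable_S _) Sc) as Sc1.
  pose proof (bessel_tail_summable z Hz) as Sb. pose proof (qpow_summable z Hz) as Sq.
  assert (E : forall n, ((IZR (c (S n)) * qpow (S n) z) - ((4 * PI ^ 2)%R * qpow (S n) z + (bessel (INR (S n)) - 4 * PI ^ 2)%R * qpow (S n) z))%C
    = (coeff_error n * qpow (S n) z)%C).
  { intros n. unfold coeff_error. rewrite !RtoC_minus. ring. }
  pose proof (Csummable_scal (4 * PI ^ 2)%R _ Sq) as Sq4.
  split.
  - eapply Csummable_ext; [exact E|]. apply Csummable_minus; [exact Sc1|]. apply Csummable_plus; assumption.
  - rewrite <- (Csum_ext _ _ E), Csum_minus, Csum_plus, Csum_scal by (auto using Csummable_plus).
    rewrite (bessel_poincare_series z Hz), (J_expansion c hc z Hz), (Csum_S _ Sc), inv_qpow_1.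
    assert (Q0 : qpow 0 z = 1) by (rewrite qpow_pow; reflexivity). rewrite Q0. ring.
Qed.

Lemma PI_sq_le_10 : PI ^ 2 <= 10.
Proof. pose proof PI_bounds. simpl. nra. Qed.

Lemma exp_PI_le : exp PI <= 81.
Proof.
  pose proof PI_bounds. apply Rle_trans with (exp (1 + 1 + 1 + 1)); [apply exp_le; lra|].
  rewrite !exp_plus. pose proof exp_le_3. pose proof (exp_pos 1).
  assert (exp 1 * exp 1 <= 9) by nra. assert (0 < exp 1 * exp 1) by nra. nra.
Qed.

(** For [s >= 6], [exp (4 PI) <= 81 exp (PI s / 2)]. In units of [exp (PI s / 2)], [tail_const] and
    [c 0] cost 2000 times 81 each, the shifted Poincare terms 640 times 81, together 375840; the
    lower order terms fit into the rest of 400000. *)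
Lemma coeff_error_sup (s x : R) : 6 <= s -> Rabs x <= 1 / 2 ->
  Cmod (Csum (fun n => (coeff_error n * qpow (S n) (RtoC (/ s) + x * Ci))%C)) <= 400000 * exp (PI * s / 2).
Proof.
  intros Hs Hx. pose proof PI_bounds as HP. set (z := (RtoC (/ s) + x * Ci)%C). set (y := / s).
  assert (Hy : 0 < y <= 1 / 6).
  { unfold y. split; [apply Rinv_0_lt_compat; lra|]. replace (1 / 6) with (/ 6) by field. apply Rinv_le_contravar; lra. }
  assert (Rz : Re z = y) by (unfold z; rewrite Re_shift; reflexivity).
  assert (Iz : Im z = x) by (unfold z, Im; simpl; ring).
  assert (Hz : 0 < Re z) by lra. pose proof (Re_pos_neq_0 z Hz) as z0.
  destruct (coeff_error_series z Hz) as [_ ->].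
  pose proof (J_minus_main_bound c hc z ltac:(lra) ltac:(rewrite Iz; exact Hx)) as B1.
  rewrite Rz in B1. replace (PI / (2 * y)) with (PI * s / 2) in B1 by (unfold y; field; lra).
  destruct (tail_const_bound c hc) as [[C0 C1] C2].
  set (X := exp (PI * s / 2)) in *. set (T := tail_const c) in *.
  pose proof exp_PI_le as E81. pose proof (exp_pos PI) as Ep.
  assert (E4 : exp (4 * PI) <= 81 * X).
  { unfold X. apply Rle_trans with (exp PI * exp (PI * s / 2)).
    - rewrite <- exp_plus. apply exp_le. nra.
    - apply Rmult_le_compat_r; [apply Rlt_le, exp_pos | exact E81]. }
  assert (X1 : PI * s / 2 + 1 <= X) by (pose proof (exp_ineq1_le (PI * s / 2)); unfold X; lra).
  assert (B2 : Cmod (2 * PI / z) <= 2 * PI * s).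
  { rewrite Cmod_div, <- RtoC_mult, Cmod_R, Rabs_pos_eq by (auto; lra).
    apply Rmult_le_compat_l; [lra|]. rewrite <- (Rinv_inv s). fold y.
    apply Rinv_le_contravar; [lra|]. rewrite <- Rz. apply Re_le_Cmod. }
  assert (B3 : Cmod (Cexp (2 * PI * z)) <= 81).
  { rewrite Cmod_Cexp, Re_2PI_mult, Rz. eapply Rle_trans; [|exact E81]. apply exp_le. nra. }
  assert (B4 : Cmod ((4 * PI ^ 2)%R * Csum (fun n => qpow (S n) z))%C <= 2 * PI * s).
  { assert (P2 : 0 < PI ^ 2) by (apply pow_lt; lra).
    rewrite qpow_geometric, Cmod_mult, Cmod_R, Rabs_pos_eq by (auto; lra).
    rewrite Cmod_div by (apply one_sub_qpow_neq_0, Hz).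
    pose proof (Cmod_qpow 1 z) as Q. rewrite pow_1, Rz in Q. set (e := exp (- (2 * PI * y))) in *.
    assert (He : 0 < e) by apply exp_pos.
    assert (He1 : e * (1 + 2 * PI * y) <= 1).
    { unfold e. rewrite exp_Ropp. pose proof (exp_ineq1_le (2 * PI * y)). pose proof (exp_pos (2 * PI * y)).
      apply (Rmult_le_reg_l (exp (2 * PI * y))); [assumption|]. rewrite <- Rmult_assoc, Rinv_r by lra. lra. }
    assert (D : e * (2 * PI * y) <= Cmod (1 - qpow 1 z)).
    { eapply Rle_trans; [|apply Cmod_triangle_rev]. rewrite Cmod_1, Q. lra. }
    assert (0 < e * (2 * PI * y)) by (apply Rmult_lt_0_compat; nra).
    rewrite Q. apply Rle_trans with (4 * PI ^ 2 * (e / (e * (2 * PI * y)))).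
    - apply Rmult_le_compat_l; [lra|]. apply Rmult_le_compat_l; [lra|]. apply Rinv_le_contravar; assumption.
    - apply Req_le. unfold y. field. split; lra. }
  assert (B5 : Cmod (Csum (fun k => exp_rem2 (z + INR (S k) * Ci) + exp_rem2 (z - INR (S k) * Ci))%C) <= 640 * exp (4 * PI)).
  { set (K := 16 * PI ^ 2 * exp (4 * PI)).
    assert (Bk : forall k, Cmod (exp_rem2 (z + INR (S k) * Ci) + exp_rem2 (z - INR (S k) * Ci))%C <= 2 * K * / (INR k + 1) ^ 2).
    { intros k. eapply Rle_trans; [apply Cmod_triangle|].
      assert (K1 : 1 <= Rabs (INR (S k))) by (rewrite Rabs_pos_eq by apply pos_INR; apply (le_INR 1); lia).
      pose proof (vertical_distance z (INR (S k)) ltac:(rewrite Iz; exact Hx) K1) as V1.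
      pose proof (vertical_distance z (- INR (S k)) ltac:(rewrite Iz; exact Hx) ltac:(rewrite Rabs_Ropp; exact K1)) as V2.
      rewrite Rabs_Ropp in V2. rewrite Rabs_pos_eq, S_INR in V1, V2 by apply pos_INR.
      replace (z + (- (INR k + 1))%R * Ci)%C with (z - (INR k + 1)%R * Ci)%C in V2 by (rewrite RtoC_opp; ring).
      rewrite <- S_INR in V1 at 2. rewrite <- S_INR in V2 at 2.
      pose proof (exp_rem2_far_bound _ k (shift_plus_neq_0 z _ Hz) V1).
      pose proof (exp_rem2_far_bound _ k (shift_minus_neq_0 z _ Hz) V2). fold K in H, H0. lra. }
    eapply Rle_trans; [apply Cmod_Csum_le, exp_rem2_pair_summable, Hz|].
    apply Rle_trans with (Series (fun k => 2 * K * / (INR k + 1) ^ 2)).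
    - apply Series_le; [|apply (ex_series_scal_l (2 * K) _ ex_series_inv_sq)].
      intros k; split; [apply Cmod_ge_0 | apply Bk].
    - rewrite Series_scal_l. pose proof Series_inv_sq_le as S2. pose proof (exp_pos (4 * PI)) as E0.
      pose proof PI_sq_le_10 as P10. assert (0 < PI ^ 2) by (apply pow_lt; lra).
      assert (K0 : 0 <= K) by (unfold K; nra).
      apply Rle_trans with (2 * K * 2); [apply Rmult_le_compat_l; lra|]. unfold K. nra. }
  (* Regrouped so that [exp (2 pi / z)], present in the unshifted [exp_rem2 z], cancels the main
     part of [J z]. *)
  replace (J z - Cexp (2 * PI * z) - IZR (c 0) - ((4 * PI ^ 2)%R * Csum (fun n => qpow (S n) z) + exp_rem2 z
    + Csum (fun k => exp_rem2 (z + INR (S k) * Ci) + exp_rem2 (z - INR (S k) * Ci))))%C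
    with (((J z - Cexp (2 * PI / z)) + 1 + 2 * PI / z - Cexp (2 * PI * z) - IZR (c 0))
     - (4 * PI ^ 2)%R * Csum (fun n => qpow (S n) z) - Csum (fun k => exp_rem2 (z + INR (S k) * Ci) + exp_rem2 (z - INR (S k) * Ci)))%C
    by (unfold exp_rem2 at 3; ring).
  eapply Rle_trans; [apply Cmod_triangle_minus|]. eapply Rle_trans; [apply Rplus_le_compat_r, Cmod_triangle_minus|].
  eapply Rle_trans; [apply Rplus_le_compat_r, Rplus_le_compat_r, Cmod_triangle_minus|].
  eapply Rle_trans; [apply Rplus_le_compat_r, Rplus_le_compat_r, Rplus_le_compat_r, Cmod_triangle_minus|].
  eapply Rle_trans; [apply Rplus_le_compat_r, Rplus_le_compat_r, Rplus_le_compat_r, Rplus_le_compat_r, Cmod_triangle|].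
  eapply Rle_trans; [apply Rplus_le_compat_r, Rplus_le_compat_r, Rplus_le_compat_r, Rplus_le_compat_r, Rplus_le_compat_r, Cmod_triangle|].
  rewrite Cmod_1, Cmod_R, Rabs_pos_eq by exact C0. nra.
Qed.

(** With [s = sqrt n], the line [Re z = 1 / s] costs the Cauchy factor
    [exp (2 pi n / s) = exp (2 pi s)]; the condition [36 <= n] is [6 <= s]. *)
Lemma coefficient_bessel_bound n : (36 <= n)%nat ->
  Rabs (IZR (c n) - bessel (INR n)) <= 400000 * exp (5 * PI * sqrt (INR n) / 2).
Proof.
  intros Hn. destruct n as [|n]; [lia|]. set (s := sqrt (INR (S n))).
  assert (HN : 36 <= INR (S n)) by (replace 36 with (INR 36) by (simpl; ring); apply le_INR, Hn).
  assert (Hs2 : s * s = INR (S n)) by (apply sqrt_sqrt; lra).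
  assert (Hs : 6 <= s).
  { replace 6 with (sqrt (6 * 6)) by (apply sqrt_square; lra). apply sqrt_le_1; lra. }
  assert (Hy : 0 < / s) by (apply Rinv_0_lt_compat; lra).
  pose proof (cauchy_estimate coeff_error (/ s) (400000 * exp (PI * s / 2))
    (proj1 (coeff_error_series (RtoC (/ s)) Hy)) (fun x Hx => coeff_error_sup s x Hs Hx) n) as B.
  unfold coeff_error in B. rewrite Cmod_R in B. rewrite exp_pow_INR, <- Hs2 in B.
  replace (s * s * - (2 * PI * / s)) with (- (2 * PI * s)) in B by (field; lra).
  rewrite Hs2 in B.
  replace (5 * PI * s / 2) with (PI * s / 2 + 2 * PI * s) by field. rewrite exp_plus.
  apply (Rmult_le_reg_r (exp (- (2 * PI * s)))); [apply exp_pos|].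
  eapply Rle_trans; [exact B|]. apply Req_le.
  rewrite (exp_Ropp (2 * PI * s)). field. apply Rgt_not_eq, exp_pos.
Qed.

End Difference.

(** * Third differences for the Bessel function *)

(** The coefficients of the hypergeometric series 0F1(; 2; t), whose sum [Hs t] is
    [I_1 (2 sqrt t) / sqrt t]. *)
Definition hyp_coeff (k : nat) : R := / (INR (fact (S k)) * INR (fact k)).

Lemma hyp_coeff_pos k : 0 < hyp_coeff k.
Proof. apply Rinv_0_lt_compat, Rmult_lt_0_compat; apply INR_fact_lt_0. Qed.

Lemma hyp_radius : CV_radius hyp_coeff = p_infty.
Proof.
  apply CV_radius_infinite. intros r Hr.
  apply (ex_series_dominated _ (fun k => r ^ k / INR (fact k))); [|apply ex_series_exp].
  intros k. split; [apply Rabs_pos|].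
  assert (0 <= r ^ k) by (apply pow_le, Hr). pose proof (hyp_coeff_pos k).
  rewrite Rabs_pos_eq by nra. rewrite Rmult_comm. apply Rmult_le_compat_l; [assumption|].
  unfold hyp_coeff. apply Rinv_le_contravar; [apply INR_fact_lt_0|].
  assert (1 <= INR (fact (S k))) by (apply (le_INR 1), lt_O_fact). pose proof (INR_fact_lt_0 k). nra.
Qed.

Definition Hs (t : R) : R := PSeries hyp_coeff t.
Definition Hs1 (t : R) : R := PSeries (PS_derive hyp_coeff) t.
Definition Hs2 (t : R) : R := PSeries (PS_derive (PS_derive hyp_coeff)) t.

Lemma Hs_derive t : is_derive Hs t (Hs1 t).
Proof. apply is_derive_PSeries. rewrite hyp_radius. exact I. Qed.

Lemma Hs1_derive t : is_derive Hs1 t (Hs2 t).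
Proof. apply is_derive_PSeries. rewrite CV_radius_derive, hyp_radius. exact I. Qed.

Lemma hyp_ex_pseries t : ex_pseries hyp_coeff t.
Proof. apply CV_radius_inside. rewrite hyp_radius. exact I. Qed.

Lemma hyp1_ex_pseries t : ex_pseries (PS_derive hyp_coeff) t.
Proof. apply CV_radius_inside. rewrite CV_radius_derive, hyp_radius. exact I. Qed.

Lemma hyp2_ex_pseries t : ex_pseries (PS_derive (PS_derive hyp_coeff)) t.
Proof. apply CV_radius_inside. rewrite !CV_radius_derive, hyp_radius. exact I. Qed.

Lemma hyp_coeff_S k : INR (S k) * INR (S (S k)) * hyp_coeff (S k) = hyp_coeff k.
Proof.
  unfold hyp_coeff. rewrite (fact_simpl (S k)), (fact_simpl k), !mult_INR.
  pose proof (INR_fact_neq_0 k). assert (INR (S k) <> 0) by (apply not_0_INR; lia).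
  assert (INR (S (S k)) <> 0) by (apply not_0_INR; lia). field. auto.
Qed.

Lemma Hs_ode t : t * Hs2 t + 2 * Hs1 t = Hs t.
Proof.
  unfold Hs, Hs1, Hs2. rewrite <- PSeries_incr_1, <- PSeries_scal, <- PSeries_plus.
  - apply PSeries_ext. intros k. rewrite <- hyp_coeff_S.
    unfold PS_plus, PS_incr_1, PS_scal, PS_derive. unfold plus, scal; simpl; unfold mult; simpl.
    destruct k as [|k].
    + unfold zero; simpl. ring.
    + change (match k with O => 1 | S _ => INR k + 1 end) with (INR (S k)).
      change (match S k with O => 1 | S _ => INR (S k) + 1 end) with (INR (S (S k))).
      change (match S (S k) with O => 1 | S _ => INR (S (S k)) + 1 end) with (INR (S (S (S k)))).
      rewrite !S_INR. ring.
  - apply ex_pseries_incr_1, hyp2_ex_pseries.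
  - apply ex_pseries_scal; [apply Rmult_comm | apply hyp1_ex_pseries].
Qed.

Lemma Hs_ge_1 t : 0 <= t -> 1 <= Hs t.
Proof.
  intros Ht. unfold Hs. pose proof (proj1 (ex_pseries_R _ _) (hyp_ex_pseries t)) as S0.
  assert (Pos : forall n, 0 <= hyp_coeff n * t ^ n) by (intros n; pose proof (hyp_coeff_pos n); pose proof (pow_le t n Ht); nra).
  pose proof (term_le_Series _ 0 Pos S0) as T. unfold PSeries.
  unfold hyp_coeff in T at 1. simpl in T. lra.
Qed.

(** Termwise from [hyp_coeff_S]; this supplies the initial inequalities of the barriers at
    [r = 1 / 2]. *)
Lemma Hs1_range t : 0 <= t -> 0 <= Hs1 t <= Hs t / 2.
Proof.
  intros Ht. unfold Hs, Hs1, PSeries.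
  pose proof (proj1 (ex_pseries_R _ _) (hyp_ex_pseries t)) as S0.
  pose proof (proj1 (ex_pseries_R _ _) (hyp1_ex_pseries t)) as S1.
  assert (B : forall n, 0 <= PS_derive hyp_coeff n * t ^ n <= / 2 * (hyp_coeff n * t ^ n)).
  { intros n. pose proof (pow_le t n Ht). unfold PS_derive. rewrite <- (hyp_coeff_S n).
    pose proof (hyp_coeff_pos (S n)). rewrite !S_INR. pose proof (pos_INR n). split.
    - apply Rmult_le_pos; [apply Rmult_le_pos|]; lra.
    - rewrite <- Rmult_assoc. apply Rmult_le_compat_r; [assumption|].
      assert (0 <= (INR n + 1) * hyp_coeff (S n)) by (apply Rmult_le_pos; lra). nra. }
  split.
  - apply Series_nonneg; [intros; apply B | exact S1].
  - replace (Series (fun k => hyp_coeff k * t ^ k) / 2) with (/ 2 * Series (fun k => hyp_coeff k * t ^ k)) by field.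
    rewrite <- Series_scal_l. apply Series_le; [exact B | apply (ex_series_scal_l (/ 2) _ S0)].
Qed.

Lemma bessel_Hs x : bessel x = 4 * PI ^ 2 * Hs (4 * PI ^ 2 * x).
Proof.
  unfold bessel, Hs, PSeries. rewrite <- Series_scal_l. apply Series_ext. intros k.
  unfold bessel_coeff, hyp_coeff. set (A := 4 * PI ^ 2). rewrite Rpow_mult_distr, <- tech_pow_Rmult. unfold Rdiv. ring.
Qed.

Lemma monotone_of_derive (f f' : R -> R) a b : a <= b ->
  (forall x, a <= x <= b -> is_derive f x (f' x)) -> (forall x, a <= x <= b -> 0 <= f' x) -> f a <= f b.
Proof.
  intros Hab Hd Hp.
  destruct (MVT_gen f a b f') as (xi & Hxi & E).
  - intros x Hx. rewrite Rmin_left, Rmax_right in Hx by exact Hab. apply Hd. lra.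
  - intros x Hx. rewrite Rmin_left, Rmax_right in Hx by exact Hab.
    apply continuity_pt_filterlim. apply (ex_derive_continuous f). eexists; apply Hd; exact Hx.
  - rewrite Rmin_left, Rmax_right in Hxi by exact Hab. specialize (Hp xi Hxi). nra.
Qed.

Section Barrier.

(** In the variable [r = sqrt t], [h] is [I_1 (2 r) / r] and [k] its derivative, with
    [h'' = 4 h - 3 h' / r]. *)
Let h (r : R) : R := Hs (r * r).
Let k (r : R) : R := 2 * r * Hs1 (r * r).

Lemma h_derive r : is_derive h r (k r).
Proof.
  unfold h, k. pose proof (Hs_derive (r * r)) as D.
  evar_last; [apply (is_derive_comp Hs (fun r => r * r) r (Hs1 (r * r)) (2 * r) D); auto_derive; [exact I | ring]|].
  unfold scal; simpl; unfold mult; simpl. ring.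
Qed.

Lemma k_derive r : 0 < r -> is_derive k r (4 * h r - 3 * k r / r).
Proof.
  intros Hr. unfold h, k. pose proof (Hs1_derive (r * r)) as D. pose proof (Hs_ode (r * r)) as O.
  assert (D2 : is_derive (fun r => Hs1 (r * r)) r (2 * r * Hs2 (r * r))).
  { evar_last; [apply (is_derive_comp Hs1 (fun r => r * r) r (Hs2 (r * r)) (2 * r) D); auto_derive; [exact I | ring]|].
    unfold scal; simpl; unfold mult; simpl. ring. }
  evar_last; [apply (is_derive_mult (fun r => 2 * r) (fun r => Hs1 (r * r)) r 2 (2 * r * Hs2 (r * r))); [auto_derive; [exact I | ring] | exact D2 | intros; apply Rmult_comm]|].
  unfold plus, mult; simpl. rewrite <- O. field. lra.
Qed.

Lemma h_pos r : 1 <= h r.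
Proof. apply Hs_ge_1. nra. Qed.

Lemma k_range r : 0 <= r -> 0 <= k r <= r * h r.
Proof. intros Hr. unfold k, h. pose proof (Hs1_range (r * r) ltac:(nra)). split; nra. Qed.

(* [k / h] solves the Riccati equation of the Bessel function; the weight
   [exp (2 r) * sqrt r] makes the gap to the barrier monotone. *)
Lemma barrier_lower r : 1 / 2 <= r -> 0 <= r * k r - (2 * r - 3 / 2) * h r.
Proof.
  intros Hr.
  set (F := fun r => (r * k r - (2 * r - 3 / 2) * h r) * exp (2 * r) * sqrt r).
  assert (HF : F (1 / 2) <= F r).
  { apply (monotone_of_derive F (fun r => 3 / 4 * h r / r * exp (2 * r) * sqrt r)); [exact Hr | |].
    - intros x Hx. unfold F. pose proof (h_derive x) as Dh. pose proof (k_derive x ltac:(lra)) as Dk.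
      assert (Sx : 0 < sqrt x) by (apply sqrt_lt_R0; lra).
      evar_last; [auto_derive; [repeat split; try (eexists; eassumption); lra | reflexivity]|].
      rewrite (is_derive_unique (fun x : R => k x) x _ Dk), (is_derive_unique (fun x : R => h x) x _ Dh).
      pose proof (sqrt_sqrt x ltac:(lra)) as SS. set (sx := sqrt x) in *. rewrite <- SS. field. lra.
    - intros x Hx. pose proof (h_pos x). pose proof (exp_pos (2 * x)). pose proof (sqrt_pos x).
      repeat apply Rmult_le_pos; try lra. apply Rlt_le, Rinv_0_lt_compat. lra. }
  assert (HF0 : 0 <= F (1 / 2)).
  { unfold F. pose proof (h_pos (1 / 2)). pose proof (k_range (1 / 2) ltac:(lra)).
    pose proof (exp_pos (2 * (1 / 2))). pose proof (sqrt_pos (1 / 2)).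
    apply Rmult_le_pos; [|assumption]. apply Rmult_le_pos; [|lra]. lra. }
  unfold F in HF at 2. pose proof (exp_pos (2 * r)). assert (0 < sqrt r) by (apply sqrt_lt_R0; lra).
  assert (0 < exp (2 * r) * sqrt r) by (apply Rmult_lt_0_compat; assumption).
  rewrite Rmult_assoc in HF. apply (Rmult_le_reg_r (exp (2 * r) * sqrt r)); lra.
Qed.

(** The expansion of [r h' / h] is [2 r - 3/2 + 3 / (16 r) + ...]; the larger term [1 / (2 r)] makes
    the derivative of [F] a sum of squares times positive factors. The weight [w] is the integrating
    factor: [r w' / w = b + 2] for the barrier [b]. *)
Lemma barrier_upper r : 1 / 2 <= r -> 0 <= (2 * r - 3 / 2 + / (2 * r)) * h r - r * k r.
Proof.
  intros Hr.
  set (F := fun r => ((2 * r - 3 / 2 + / (2 * r)) * h r - r * k r) * exp (2 * r - / (2 * r)) * sqrt r).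
  assert (HF : F (1 / 2) <= F r).
  { apply (monotone_of_derive F (fun r => (1 / 4 + (1 - / (2 * r)) ^ 2) * h r / r * exp (2 * r - / (2 * r)) * sqrt r)); [exact Hr | |].
    - intros x Hx. unfold F. pose proof (h_derive x) as Dh. pose proof (k_derive x ltac:(lra)) as Dk.
      assert (Sx : 0 < sqrt x) by (apply sqrt_lt_R0; lra).
      evar_last; [auto_derive; [repeat split; try (eexists; eassumption); lra | reflexivity]|].
      rewrite (is_derive_unique (fun x : R => k x) x _ Dk), (is_derive_unique (fun x : R => h x) x _ Dh).
      pose proof (sqrt_sqrt x ltac:(lra)) as SS. set (E := exp _). set (sx := sqrt x) in *.
      replace (exp (2 * x - / (2 * x))) with E by (unfold E; f_equal; ring). rewrite <- SS. field. nra.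
    - intros x Hx. pose proof (h_pos x). pose proof (exp_pos (2 * x - / (2 * x))). pose proof (sqrt_pos x).
      pose proof (pow2_ge_0 (1 - / (2 * x))).
      repeat apply Rmult_le_pos; try lra. apply Rlt_le, Rinv_0_lt_compat. lra. }
  assert (HF0 : 0 <= F (1 / 2)).
  { unfold F. pose proof (h_pos (1 / 2)). pose proof (k_range (1 / 2) ltac:(lra)).
    pose proof (exp_pos (2 * (1 / 2) - / (2 * (1 / 2)))). pose proof (sqrt_pos (1 / 2)).
    apply Rmult_le_pos; [|assumption]. apply Rmult_le_pos; [|lra].
    replace (/ (2 * (1 / 2))) with 1 by field. lra. }
  unfold F in HF at 2. pose proof (exp_pos (2 * r - / (2 * r))). assert (0 < sqrt r) by (apply sqrt_lt_R0; lra).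
  assert (0 < exp (2 * r - / (2 * r)) * sqrt r) by (apply Rmult_lt_0_compat; assumption).
  rewrite Rmult_assoc in HF. apply (Rmult_le_reg_r (exp (2 * r - / (2 * r)) * sqrt r)); lra.
Qed.

End Barrier.

(** Half of [r h' / h] at [r = sqrt t], so the barriers bracket it directly. *)
Definition log_der (t : R) : R := t * Hs1 t / Hs t.

Lemma log_der_bounds t : 1 / 4 <= t ->
  sqrt t - 3 / 4 <= log_der t <= sqrt t - 3 / 4 + / (4 * sqrt t).
Proof.
  intros Ht. set (r := sqrt t). assert (Hr : 1 / 2 <= r).
  { unfold r. replace (1 / 2) with (sqrt (1 / 4)); [apply sqrt_le_1; lra|].
    replace (1 / 4) with ((1 / 2) * (1 / 2)) by field. apply sqrt_square. lra. }
  assert (E : r * r = t) by (apply sqrt_sqrt; lra).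
  pose proof (barrier_lower r Hr) as L. pose proof (barrier_upper r Hr) as U. cbv beta zeta in L, U. rewrite E in L, U.
  pose proof (Hs_ge_1 t ltac:(lra)) as P.
  assert (EQ : log_der t * Hs t = t * Hs1 t) by (unfold log_der; field; lra).
  assert (EK : r * (2 * r * Hs1 t) = 2 * (log_der t * Hs t)) by (rewrite EQ, <- E; ring).
  rewrite EK in L, U. split.
  - apply (Rmult_le_reg_r (Hs t)); lra.
  - apply (Rmult_le_reg_r (Hs t)); [lra|].
    replace (/ (4 * r)) with (/ 2 * / (2 * r)) by (field; lra). lra.
Qed.

Lemma log_der_derive t : 0 < t -> is_derive log_der t ((t - log_der t - log_der t ^ 2) / t).
Proof.
  intros Ht. pose proof (Hs_derive t) as D0. pose proof (Hs1_derive t) as D1. pose proof (Hs_ode t) as O.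
  pose proof (Hs_ge_1 t ltac:(lra)) as P. unfold log_der.
  evar_last; [auto_derive; [repeat split; try (eexists; eassumption); lra | reflexivity]|].
  rewrite (is_derive_unique (fun x : R => Hs x) t _ D0), (is_derive_unique (fun x : R => Hs1 x) t _ D1).
  replace (Hs2 t) with ((Hs t - 2 * Hs1 t) / t) by (rewrite <- O; field; lra). field. lra.
Qed.

Lemma shift_derive (f : R -> R) (c x d : R) : is_derive f (x + c) d -> is_derive (fun x => f (x + c)) x d.
Proof.
  intros H. evar_last; [apply (is_derive_comp f (fun x => x + c) x d 1 H); auto_derive; [exact I | ring]|].
  unfold scal; simpl; unfold mult; simpl. ring.
Qed.

(** The differences are taken one at a time: a function whose derivative is at most [-K] drops by at
    least [K] over a unit step. *)
Lemma third_difference_le (f f1 f2 f3 : R -> R) (a K : R) :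
  (forall x, a <= x <= a + 3 -> is_derive f x (f1 x)) ->
  (forall x, a <= x <= a + 3 -> is_derive f1 x (f2 x)) ->
  (forall x, a <= x <= a + 3 -> is_derive f2 x (f3 x)) ->
  (forall x, a <= x <= a + 3 -> f3 x <= - K) ->
  f (a + 3) - 3 * f (a + 2) + 3 * f (a + 1) - f a <= - K.
Proof.
  intros D1 D2 D3 B.
  assert (S1 : forall x, a <= x <= a + 2 -> f2 (x + 1) - f2 x <= - K).
  { intros x Hx.
    assert (M : - f2 x - K * x <= - f2 (x + 1) - K * (x + 1)); [|lra].
    apply (monotone_of_derive (fun y => - f2 y - K * y) (fun y => - f3 y - K)); [lra | |].
    - intros y Hy. apply (is_derive_minus (fun y => - f2 y) (fun y => K * y) y (- f3 y) K).
      + apply (is_derive_opp f2). apply D3. lra.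
      + auto_derive; [exact I | ring].
    - intros y Hy. specialize (B y). lra. }
  assert (S2 : forall x, a <= x <= a + 1 -> f1 (x + 2) - 2 * f1 (x + 1) + f1 x <= - K).
  { intros x Hx.
    assert (M : - (f1 (x + 1) - f1 x) - K * x <= - (f1 (x + 1 + 1) - f1 (x + 1)) - K * (x + 1)).
    { apply (monotone_of_derive (fun y => - (f1 (y + 1) - f1 y) - K * y) (fun y => - (f2 (y + 1) - f2 y) - K)); [lra | |].
      - intros y Hy. apply (is_derive_minus (fun y => - (f1 (y + 1) - f1 y)) (fun y => K * y) y (- (f2 (y + 1) - f2 y)) K).
        + apply (is_derive_opp (fun y => f1 (y + 1) - f1 y)).
          apply (is_derive_minus (fun y => f1 (y + 1)) f1 y (f2 (y + 1)) (f2 y)); [apply shift_derive|]; apply D2; lra.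
        + auto_derive; [exact I | ring].
      - intros y Hy. specialize (S1 y). lra. }
    replace (x + 1 + 1) with (x + 2) in M by ring. lra. }
  set (g := fun y => f (y + 2) - 2 * f (y + 1) + f y).
  assert (M : - g a - K * a <= - g (a + 1) - K * (a + 1)).
  { apply (monotone_of_derive (fun y => - g y - K * y) (fun y => - (f1 (y + 2) - 2 * f1 (y + 1) + f1 y) - K)); [lra | |].
    - intros y Hy. apply (is_derive_minus (fun y => - g y) (fun y => K * y) y (- (f1 (y + 2) - 2 * f1 (y + 1) + f1 y)) K).
      + apply (is_derive_opp g). unfold g.
        apply (is_derive_plus (fun y => f (y + 2) - 2 * f (y + 1)) f y (f1 (y + 2) - 2 * f1 (y + 1)) (f1 y)).
        * apply (is_derive_minus (fun y => f (y + 2)) (fun y => 2 * f (y + 1)) y (f1 (y + 2)) (2 * f1 (y + 1))).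
          -- apply shift_derive, D1. lra.
          -- apply (is_derive_scal (fun y => f (y + 1)) y 2 (f1 (y + 1))). apply shift_derive, D1. lra.
        * apply D1. lra.
      + auto_derive; [exact I | ring].
    - intros y Hy. specialize (S2 y). lra. }
  unfold g in M. replace (a + 1 + 2) with (a + 3) in M by ring. replace (a + 1 + 1) with (a + 2) in M by ring. lra.
Qed.

Section LogBessel.

Let A : R := 4 * PI ^ 2.

Lemma four_PI_sq_bounds : 39 < 4 * PI ^ 2 < 40.
Proof. pose proof PI_bounds. simpl. nra. Qed.

Definition lb (x : R) : R := ln (bessel x).
(** With [D = x d/dx], [U = D lb], [V = D U] and [W = D V]; the Riccati equation makes [V] and [W]
    polynomials in [x] and [U]. The third derivative of [lb x / x] is [x^(-4)] times
    [(D - 1) (D - 2) (D - 3) lb], which explains the coefficients in [L3]. *)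
Let U (x : R) : R := log_der (A * x).
Let V (x : R) : R := A * x - U x - U x ^ 2.
Let W (x : R) : R := A * x - V x * (1 + 2 * U x).

Lemma bessel_pos x : 0 <= x -> 0 < bessel x.
Proof.
  intros Hx. rewrite bessel_Hs. pose proof four_PI_sq_bounds. pose proof (Hs_ge_1 (4 * PI ^ 2 * x) ltac:(nra)). nra.
Qed.

Lemma lb_derive x : 0 < x -> is_derive lb x (U x / x).
Proof.
  intros Hx. pose proof four_PI_sq_bounds as HA. fold A in HA. unfold lb.
  assert (D : is_derive bessel x (A * (A * Hs1 (A * x)))).
  { apply (is_derive_ext (fun x => A * Hs (A * x))); [intros t; symmetry; apply bessel_Hs|].
    apply (is_derive_scal (fun x => Hs (A * x)) x A).
    evar_last; [apply (is_derive_comp Hs (fun x => A * x) x (Hs1 (A * x)) A (Hs_derive _)); auto_derive; [exact I | ring]|].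
    unfold scal; simpl; unfold mult; simpl. reflexivity. }
  pose proof (Hs_ge_1 (A * x) ltac:(nra)) as P. pose proof (bessel_pos x ltac:(lra)) as Pb.
  evar_last; [apply (is_derive_comp ln bessel x (/ bessel x) _ (is_derive_ln _ Pb) D)|].
  unfold scal; simpl; unfold mult; simpl. rewrite bessel_Hs. fold A. unfold U, log_der. field. lra.
Qed.

Lemma U_derive x : 0 < x -> is_derive U x (V x / x).
Proof.
  intros Hx. pose proof four_PI_sq_bounds as HA. fold A in HA. unfold U.
  evar_last; [apply (is_derive_comp log_der (fun x => A * x) x _ A (log_der_derive (A * x) ltac:(nra))); auto_derive; [exact I | ring]|].
  unfold scal; simpl; unfold mult; simpl. unfold V, U. field. lra.
Qed.

Lemma V_derive x : 0 < x -> is_derive V x (W x / x).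
Proof.
  intros Hx. pose proof (U_derive x Hx) as D. unfold V at 1.
  evar_last; [auto_derive; [repeat split; eexists; eassumption | reflexivity]|].
  rewrite (is_derive_unique (fun x : R => U x) x _ D). unfold W. field. lra.
Qed.

Let L0 (x : R) : R := lb x / x.
Let L1 (x : R) : R := (U x - lb x) / x ^ 2.
Let L2 (x : R) : R := (V x - 3 * U x + 2 * lb x) / x ^ 3.
Let L3 (x : R) : R := (W x - 6 * V x + 11 * U x - 6 * lb x) / x ^ 4.

Lemma L0_derive x : 0 < x -> is_derive L0 x (L1 x).
Proof.
  intros Hx. pose proof (lb_derive x Hx) as D. unfold L0.
  evar_last; [auto_derive; [repeat split; try (eexists; eassumption); lra | reflexivity]|].
  rewrite (is_derive_unique (fun x : R => lb x) x _ D). unfold L1. field. lra.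
Qed.

Lemma L1_derive x : 0 < x -> is_derive L1 x (L2 x).
Proof.
  intros Hx. pose proof (lb_derive x Hx) as D. pose proof (U_derive x Hx) as DU. unfold L1.
  evar_last; [auto_derive; [repeat split; try (eexists; eassumption); nra | reflexivity]|].
  rewrite (is_derive_unique (fun x : R => lb x) x _ D), (is_derive_unique (fun x : R => U x) x _ DU).
  unfold L2. field. lra.
Qed.

Lemma L2_derive x : 0 < x -> is_derive L2 x (L3 x).
Proof.
  intros Hx. pose proof (lb_derive x Hx) as D. pose proof (U_derive x Hx) as DU. pose proof (V_derive x Hx) as DV.
  assert (0 < x * (x * (x * 1))) by (assert (0 < x * x) by nra; nra). unfold L2.
  evar_last; [auto_derive; [repeat split; try (eexists; eassumption); lra | reflexivity]|].
  rewrite (is_derive_unique (fun x : R => lb x) x _ D), (is_derive_unique (fun x : R => U x) x _ DU), (is_derive_unique (fun x : R => V x) x _ DV).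
  unfold L3. field. lra.
Qed.

(** Integration of the lower bound for [log_der] from [t = 1], where [Hs 1 >= 1]; [ln A >= 3] leaves
    the constant [3 - 2 = 1]. *)
Lemma lb_lower x : 1 <= A * x -> 2 * sqrt (A * x) - 3 / 2 * ln (sqrt (A * x)) + 1 <= lb x.
Proof.
  intros Hx. pose proof four_PI_sq_bounds as HA. fold A in HA. set (t := A * x) in *.
  assert (E : lb x = ln A + ln (Hs t)).
  { unfold lb. rewrite bessel_Hs. fold A t. pose proof (Hs_ge_1 t ltac:(lra)). apply ln_mult; lra. }
  set (G := fun t => ln (Hs t) - 2 * sqrt t + 3 / 2 * ln (sqrt t)).
  assert (M : G 1 <= G t).
  { apply (monotone_of_derive G (fun t => (log_der t - (sqrt t - 3 / 4)) / t)); [exact Hx | |].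
    - intros y Hy. pose proof (Hs_derive y) as D. pose proof (Hs_ge_1 y ltac:(lra)) as P. unfold G.
      assert (Sy : 0 < sqrt y) by (apply sqrt_lt_R0; lra).
      evar_last; [auto_derive; [repeat split; try (eexists; eassumption); lra | reflexivity]|].
      rewrite (is_derive_unique (fun x : R => Hs x) y _ D). unfold log_der.
      pose proof (sqrt_sqrt y ltac:(lra)) as SS. set (sy := sqrt y) in *. rewrite <- SS. field.
      rewrite SS. lra.
    - intros y Hy. pose proof (log_der_bounds y ltac:(lra)) as B. apply Rmult_le_pos; [lra|].
      apply Rlt_le, Rinv_0_lt_compat. lra. }
  unfold G in M. rewrite sqrt_1, ln_1 in M.
  assert (L1' : 0 <= ln (Hs 1)).
  { rewrite <- ln_1. pose proof (Hs_ge_1 1 ltac:(lra)) as [P|P]; [apply Rlt_le, ln_increasing; lra | rewrite <- P; lra]. }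
  assert (LA : 3 <= ln A).
  { rewrite <- (ln_exp 3). apply Rlt_le, ln_increasing; [apply exp_pos|].
    replace 3 with (1 + 1 + 1) by ring. rewrite !exp_plus. pose proof exp_le_3. pose proof (exp_pos 1).
    assert (exp 1 * exp 1 <= 9) by nra. nra. }
  rewrite E. lra.
Qed.

(** The tangent to [ln] at [exp 2.7], with [exp 0.9 >= 1.9]. The factor 9 is six times the [3/2] of
    [lb_lower]. *)
Lemma ln_linear_bound r : 0 < r -> 9 * ln r <= 1.32 * r + 15.3.
Proof.
  intros Hr. set (e := exp (27 / 10)).
  assert (He : 6.859 <= e).
  { unfold e. replace (27 / 10) with (9 / 10 + 9 / 10 + 9 / 10) by field. rewrite !exp_plus.
    pose proof (exp_ineq1_le (9 / 10)). set (u := exp (9 / 10)) in *. assert (1.9 * 1.9 <= u * u) by nra. nra. }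
  assert (E : ln r = ln (r / e) + 27 / 10).
  { unfold Rdiv at 1. rewrite ln_mult, ln_Rinv by (try apply Rinv_0_lt_compat; unfold e in *; try apply exp_pos; lra).
    unfold e. rewrite ln_exp. ring. }
  assert (B : ln (r / e) <= r / e - 1).
  { assert (P : 0 < r / e) by (apply Rdiv_lt_0_compat; lra).
    pose proof (exp_ineq1_le (ln (r / e))) as I. rewrite exp_ln in I by exact P. lra. }
  assert (r / e <= r / 6.859) by (apply Rmult_le_compat_l; [lra | apply Rinv_le_contravar; lra]).
  unfold Rdiv in *. lra.
Qed.

(** To leading order [W <= 7/8 r], [V >= r / 2], [U] is about [r] and [lb >= 2 r], so the
    coefficient of [r] is [7/8 - 3 + 11 - 12 = -25/8]. After the logarithm takes 1.32 of it, more
    than 1.65 is left for the constants to be absorbed. *)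
Lemma L3_upper x : 30 <= sqrt (A * x) -> 0 < x -> L3 x <= - (1.65 * sqrt (A * x)) / x ^ 4.
Proof.
  intros Hr Hx. pose proof four_PI_sq_bounds as HA. fold A in HA.
  assert (Ht : 0 < A * x) by nra. pose proof (sqrt_sqrt (A * x) ltac:(lra)) as E.
  set (r := sqrt (A * x)) in *.
  pose proof (log_der_bounds (A * x) ltac:(nra)) as B. fold r in B. fold (U x) in B.
  pose proof (lb_lower x ltac:(nra)) as F. fold r in F.
  pose proof (ln_linear_bound r ltac:(lra)) as Ln.
  unfold L3. apply Rmult_le_compat_r; [apply Rlt_le, Rinv_0_lt_compat, pow_lt, Hx|].
  assert (EV : V x = r * r - U x - U x ^ 2) by (unfold V; rewrite E; reflexivity).
  assert (EW : W x = r * r - V x * (1 + 2 * U x)) by (unfold W; rewrite E; reflexivity).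
  set (d := U x - (r - 3 / 4)) in *.
  assert (Hd : 0 <= d <= / (4 * r)) by (unfold d; lra).
  assert (Hdr : d * (4 * r) <= 1).
  { apply Rle_trans with (/ (4 * r) * (4 * r)); [apply Rmult_le_compat_r; lra | rewrite Rinv_l; lra]. }
  assert (Hd1 : d <= / 120) by (eapply Rle_trans; [apply Hd | apply Rinv_le_contravar; lra]).
  assert (EU : U x = r - 3 / 4 + d) by (unfold d; ring).
  assert (VL : r / 2 - 5 / 16 <= V x) by (assert (d * d <= / 120 * d) by (apply Rmult_le_compat_r; lra); rewrite EV, EU; simpl; lra).
  assert (WU : W x <= 7 / 8 * r - 5 / 32).
  { rewrite EW. assert ((r / 2 - 5 / 16) * (2 * r - 1 / 2) <= V x * (1 + 2 * U x)); [|lra].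
    apply Rmult_le_compat; lra. }
  lra.
Qed.

Lemma log_bessel_third_difference n : (64 <= n)%nat ->
  lb (INR n + 3) / (INR n + 3) - 3 * (lb (INR n + 2) / (INR n + 2)) + 3 * (lb (INR n + 1) / (INR n + 1)) - lb (INR n) / INR n
    <= - (80 / (INR n + 3) ^ 4).
Proof.
  intros Hn. assert (HN : 64 <= INR n) by (replace 64 with (INR 64) by (simpl; ring); apply le_INR, Hn).
  pose proof four_PI_sq_bounds as HA. fold A in HA. pose proof PI_bounds as HP.
  apply (third_difference_le L0 L1 L2 L3 (INR n) (80 / (INR n + 3) ^ 4)).
  - intros x Hx. apply L0_derive. lra.
  - intros x Hx. apply L1_derive. lra.
  - intros x Hx. apply L2_derive. lra.
  - intros x Hx.
    (* [49^2 = 2401] is below [39 * 64], and [1.65 * 49] exceeds 80. *)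
    assert (Sr : 49 <= sqrt (A * x)).
    { replace 49 with (sqrt (49 * 49)) by (apply sqrt_square; lra). apply sqrt_le_1; nra. }
    eapply Rle_trans; [apply L3_upper; lra|]. unfold Rdiv. rewrite <- Ropp_mult_distr_l.
    apply Ropp_le_contravar. apply Rmult_le_compat; try lra.
    + apply Rlt_le, Rinv_0_lt_compat, pow_lt. lra.
    + apply Rinv_le_contravar; [apply pow_lt; lra | apply pow_incr; lra].
Qed.

End LogBessel.

(** * Large indices *)

(** [ln u - ln v <= (u - v) / v] is used in both directions; [x >= b / 2] accounts for the factor
    2. *)
Lemma ln_perturbation (b x e : R) : 0 < b -> e <= 1 / 2 -> Rabs (x - b) <= e * b ->
  0 < x /\ Rabs (ln x - ln b) <= 2 * e.
Proof.
  intros Hb He H. apply Rabs_le_between in H.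
  assert (Hx : 0 < x) by nra. split; [exact Hx|].
  assert (He0 : 0 <= e) by nra. assert (Hxb : b / 2 <= x) by nra.
  assert (L : forall u v, 0 < u -> 0 < v -> ln u - ln v <= (u - v) / v).
  { intros u v Hu Hv. assert (P : 0 < u / v) by (apply Rdiv_lt_0_compat; lra).
    pose proof (exp_ineq1_le (ln (u / v))) as I. rewrite exp_ln in I by exact P.
    assert (E : ln (u / v) = ln u - ln v) by (unfold Rdiv; rewrite ln_mult, ln_Rinv; [ring | lra | lra | apply Rinv_0_lt_compat; lra]).
    rewrite E in I. replace ((u - v) / v) with (u / v - 1) by (field; lra). lra. }
  pose proof (L x b Hx Hb) as L1. pose proof (L b x Hb Hx) as L2.
  assert (B1 : (x - b) / b <= e).
  { apply (Rmult_le_reg_r b); [exact Hb|]. unfold Rdiv. rewrite Rmult_assoc, Rinv_l; lra. }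
  assert (B2 : (b - x) / x <= 2 * e).
  { apply (Rmult_le_reg_r x); [exact Hx|]. unfold Rdiv. rewrite Rmult_assoc, Rinv_l by lra.
    assert (e * b <= e * (2 * x)) by (apply Rmult_le_compat_l; lra). lra. }
  apply Rabs_le. lra.
Qed.

Lemma exp_1_ge : 2.7 <= exp 1.
Proof. destruct (exp_expand7 1 ltac:(lra)) as (t & Ht & E). rewrite E. lra. Qed.

(** [3 PI s / 2] is the gap between the exponents [4 PI s] and [5 PI s / 2]. Everything is
    normalised at [s = 8]: [s^2 + 3 <= 67 (s / 8)^2], [s / 8 <= exp (s / 8 - 1)], and
    [37 + 10 (s / 8 - 1) <= 3 PI s / 2]. *)
Lemma exp_dominates s : 8 <= s -> 3200000 * (s * s + 3) ^ 5 <= exp (3 * PI * s / 2).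
Proof.
  intros Hs. pose proof PI_bounds as HP.
  assert (P : (s * s + 3) <= 67 * (s / 8) ^ 2) by (simpl; nra).
  assert (E1 : s / 8 <= exp (s / 8 - 1)) by (pose proof (exp_ineq1_le (s / 8 - 1)); lra).
  assert (E2 : (s * s + 3) ^ 5 <= 67 ^ 5 * exp (10 * (s / 8 - 1))).
  { apply Rle_trans with ((67 * (s / 8) ^ 2) ^ 5); [apply pow_incr; split; [nra | exact P]|].
    rewrite Rpow_mult_distr, <- pow_mult. apply Rmult_le_compat_l; [lra|].
    replace (10 * (s / 8 - 1)) with (INR 10 * (s / 8 - 1)) by (simpl; ring). rewrite <- exp_pow_INR.
    apply pow_incr. split; [lra | exact E1]. }
  assert (E3 : 3200000 * 67 ^ 5 <= exp 37).
  { replace 37 with (INR 37 * 1) by (simpl; ring). rewrite <- exp_pow_INR.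
    apply Rle_trans with (2.7 ^ 37); [lra | apply pow_incr; split; [lra | apply exp_1_ge]]. }
  apply Rle_trans with (exp 37 * exp (10 * (s / 8 - 1))).
  - pose proof (exp_pos (10 * (s / 8 - 1))).
    apply Rle_trans with (3200000 * (67 ^ 5 * exp (10 * (s / 8 - 1)))); [apply Rmult_le_compat_l; lra|].
    rewrite <- Rmult_assoc. apply Rmult_le_compat_r; lra.
  - rewrite <- exp_plus. apply exp_le. nra.
Qed.

Section LargeIndex.

Variable c : nat -> Z.
Hypothesis hc : j_fourier_coefficients c.

(** The tolerance is dictated by the third difference: passing to logarithms doubles 5 to 10, and
    the weights [1 + 3 + 3 + 1 = 8] give the 80 of [log_bessel_third_difference]. *)
Lemma relative_error m : (64 <= m)%nat ->
  Rabs (IZR (c m) - bessel (INR m)) <= 5 / (INR m + 3) ^ 4 * bessel (INR m).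
Proof.
  intros Hm. assert (HM : 64 <= INR m) by (replace 64 with (INR 64) by (simpl; ring); apply le_INR, Hm).
  pose proof (coefficient_bessel_bound c hc m ltac:(lia)) as B.
  pose proof PI_bounds as HP. pose proof four_PI_sq_bounds as HA.
  set (s := sqrt (INR m)) in *.
  assert (Ess : s * s = INR m) by (apply sqrt_sqrt; lra).
  assert (Hs : 8 <= s).
  { unfold s. replace 8 with (sqrt (8 * 8)) by (apply sqrt_square; lra). apply sqrt_le_1; lra. }
  assert (Er : sqrt (4 * PI ^ 2 * INR m) = 2 * PI * s).
  { rewrite <- Ess. replace (4 * PI ^ 2 * (s * s)) with ((2 * PI * s) * (2 * PI * s)) by ring. apply sqrt_square. nra. }
  pose proof (lb_lower (INR m) ltac:(nra)) as L. rewrite Er in L. set (r := 2 * PI * s) in *.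
  assert (Hr : 1 <= r) by (unfold r; nra).
  assert (Lr : 0 <= ln r).
  { rewrite <- ln_1. destruct Hr as [Hr|Hr]; [apply Rlt_le, ln_increasing; lra | rewrite <- Hr; lra]. }
  pose proof (bessel_pos (INR m) ltac:(lra)) as Pb.
  (* Weakening [3/2 ln r] to [2 ln r] in [lb_lower] leaves the integral power
     [r^2 = 4 PI^2 m <= 40 m]. *)
  assert (Low : exp (2 * r) / (40 * INR m) <= bessel (INR m)).
  { rewrite <- (exp_ln (bessel (INR m))) by exact Pb. fold (lb (INR m)).
    apply Rle_trans with (exp (2 * r - 2 * ln r)); [|apply exp_le; lra].
    unfold Rminus. rewrite exp_plus, exp_Ropp. replace (2 * ln r) with (ln r + ln r) by ring.
    rewrite exp_plus, exp_ln by lra. apply Rmult_le_compat_l; [apply Rlt_le, exp_pos|].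
    apply Rinv_le_contravar; [nra|]. unfold r. replace (2 * PI * s * (2 * PI * s)) with (4 * PI ^ 2 * (s * s)) by ring.
    rewrite Ess. nra. }
  pose proof (exp_dominates s Hs) as D. rewrite Ess in D.
  eapply Rle_trans; [exact B|].
  assert (P4 : 0 < (INR m + 3) ^ 4) by (apply pow_lt; lra).
  apply Rle_trans with (5 / (INR m + 3) ^ 4 * (exp (2 * r) / (40 * INR m))).
  - replace (2 * r) with (5 * PI * s / 2 + 3 * PI * s / 2) by (unfold r; field). rewrite exp_plus.
    set (X := exp (5 * PI * s / 2)). set (Y := exp (3 * PI * s / 2)) in *. assert (0 < X) by apply exp_pos.
    replace (5 / (INR m + 3) ^ 4 * (X * Y / (40 * INR m))) with (X * (Y / (8 * INR m * (INR m + 3) ^ 4))) by (field; lra).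
    rewrite (Rmult_comm 400000). apply Rmult_le_compat_l; [lra|].
    assert (0 < 8 * INR m * (INR m + 3) ^ 4) by (apply Rmult_lt_0_compat; lra).
    apply (Rmult_le_reg_r (8 * INR m * (INR m + 3) ^ 4)); [assumption|].
    unfold Rdiv. rewrite (Rmult_assoc Y), Rinv_l, Rmult_1_r by lra.
    eapply Rle_trans; [|exact D].
    replace (3200000 * (INR m + 3) ^ 5) with (3200000 * (INR m + 3) * (INR m + 3) ^ 4) by ring.
    replace (400000 * (8 * INR m * (INR m + 3) ^ 4)) with (3200000 * INR m * (INR m + 3) ^ 4) by ring.
    apply Rmult_le_compat_r; lra.
  - apply Rmult_le_compat_l; [|exact Low]. apply Rlt_le, Rdiv_lt_0_compat; lra.
Qed.

Lemma log_coefficient_close n m : (64 <= n)%nat -> (n <= m)%nat ->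
  0 < IZR (c m) /\ Rabs (ln (IZR (c m)) / INR m - lb (INR m) / INR m) <= 10 / (INR n + 3) ^ 4.
Proof.
  intros Hn Hm. assert (HN : 64 <= INR n) by (replace 64 with (INR 64) by (simpl; ring); apply le_INR, Hn).
  apply le_INR in Hm as HM.
  pose proof (relative_error m ltac:(lia)) as B.
  assert (P4 : 0 < (INR n + 3) ^ 4) by (apply pow_lt; lra).
  assert (E4 : 5 / (INR m + 3) ^ 4 <= 5 / (INR n + 3) ^ 4).
  { apply Rmult_le_compat_l; [lra|]. apply Rinv_le_contravar; [exact P4|]. apply pow_incr. lra. }
  assert (Small : 5 / (INR n + 3) ^ 4 <= 1 / 2).
  { apply (Rmult_le_reg_r ((INR n + 3) ^ 4)); [exact P4|]. unfold Rdiv. rewrite Rmult_assoc, Rinv_l by lra.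
    assert (1 <= INR n + 3) by lra. pose proof (pow_R1_Rle (INR n + 3) 3 H).
    replace ((INR n + 3) ^ 4) with ((INR n + 3) * (INR n + 3) ^ 3) by ring. nra. }
  destruct (ln_perturbation _ _ _ (bessel_pos (INR m) ltac:(lra)) (Rle_trans _ _ _ E4 Small) B) as [P Q].
  split; [exact P|]. fold (lb (INR m)) in Q.
  replace (ln (IZR (c m)) / INR m - lb (INR m) / INR m) with ((ln (IZR (c m)) - lb (INR m)) * / INR m) by (field; lra).
  rewrite Rabs_mult, (Rabs_pos_eq (/ INR m)) by (apply Rlt_le, Rinv_0_lt_compat; lra).
  assert (I1 : / INR m <= 1) by (rewrite <- Rinv_1; apply Rinv_le_contravar; lra).
  assert (I0 : 0 < / INR m) by (apply Rinv_0_lt_compat; lra).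
  pose proof (Rabs_pos (ln (IZR (c m)) - lb (INR m))). unfold Rdiv in *. nra.
Qed.

Lemma third_difference_large n : (64 <= n)%nat ->
  (forall k, (k < 4)%nat -> 0 < IZR (c (n + k))) /\
  ln (IZR (c (n + 3))) / INR (n + 3) - 3 * (ln (IZR (c (n + 2))) / INR (n + 2))
   + 3 * (ln (IZR (c (n + 1))) / INR (n + 1)) - ln (IZR (c n)) / INR n <= 0.
Proof.
  intros Hn. split; [intros k Hk; apply (log_coefficient_close n (n + k)); lia|].
  pose proof (log_bessel_third_difference n Hn) as D.
  destruct (log_coefficient_close n n Hn ltac:(lia)) as [_ B0].
  destruct (log_coefficient_close n (n + 1) Hn ltac:(lia)) as [_ B1].
  destruct (log_coefficient_close n (n + 2) Hn ltac:(lia)) as [_ B2].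
  destruct (log_coefficient_close n (n + 3) Hn ltac:(lia)) as [_ B3].
  rewrite (plus_INR n 1) in *. rewrite (plus_INR n 2) in *. rewrite (plus_INR n 3) in *.
  replace (INR 1) with 1 in * by reflexivity. replace (INR 2) with 2 in * by (simpl; ring). replace (INR 3) with 3 in * by (simpl; ring).
  apply Rabs_le_between in B0, B1, B2, B3.
  replace (80 / (INR n + 3) ^ 4) with (8 * (10 / (INR n + 3) ^ 4)) in D by (unfold Rdiv; ring). lra.
Qed.

End LargeIndex.

(** * Small indices and the theorem *)

(* These bound [2 ^ p * (log2 m + e)] by [p] squarings of the mantissa, cut back
   to about 41 bits each time. *)
Fixpoint log2_lower (p : nat) (m e : Z) : Z :=
  match p with
  | O => (Z.log2 m + e)%Z
  | S p' => let k := Z.max 0 (Z.log2 (m * m) - 40) in log2_lower p' (Z.shiftr (m * m) k) (2 * e + k)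
  end.

Fixpoint log2_upper (p : nat) (m e : Z) : Z :=
  match p with
  | O => (Z.log2 m + 1 + e)%Z
  | S p' => let k := Z.max 0 (Z.log2 (m * m) - 40) in log2_upper p' (Z.shiftr (m * m) k + 1) (2 * e + k)
  end.

Lemma ln_2_pow k : (0 <= k)%Z -> ln (IZR (2 ^ k)) = IZR k * ln 2.
Proof.
  intros Hk. rewrite <- (Z2Nat.id k Hk), <- pow_IZR, ln_pow, <- INR_IZR_INZ by lra. reflexivity.
Qed.

Lemma ln_square m : (0 < m)%Z -> ln (IZR (m * m)) = 2 * ln (IZR m).
Proof. intros Hm. assert (0 < IZR m) by (apply IZR_lt; lia). rewrite mult_IZR, ln_mult by assumption. ring. Qed.

Lemma ln_IZR_le a b : (0 < a <= b)%Z -> ln (IZR a) <= ln (IZR b).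
Proof.
  intros H. assert (0 < IZR a) by (apply IZR_lt; lia). assert (IZR a <= IZR b) by (apply IZR_le; lia).
  destruct (Rle_lt_or_eq_dec _ _ H1) as [L|E]; [apply Rlt_le, ln_increasing; assumption | rewrite E; lra].
Qed.

Lemma ln_scaled a k : (0 < a)%Z -> (0 <= k)%Z -> ln (IZR (a * 2 ^ k)) = ln (IZR a) + IZR k * ln 2.
Proof.
  intros Ha Hk. rewrite mult_IZR, ln_mult, ln_2_pow; auto; apply IZR_lt; lia.
Qed.

Lemma log2_shift_nonneg m (k := Z.max 0 (Z.log2 (m * m) - 40)) : (0 < m)%Z -> (0 <= k)%Z /\ (2 ^ k <= m * m)%Z.
Proof.
  intros Hm. unfold k. split; [lia|].
  pose proof (Z.log2_spec (m * m) ltac:(nia)) as [H _]. pose proof (Z.log2_nonneg (m * m)).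
  eapply Z.le_trans; [|exact H]. apply Z.pow_le_mono_r; lia.
Qed.

Lemma log2_lower_spec p m e : (0 < m)%Z ->
  IZR (log2_lower p m e) * ln 2 <= 2 ^ p * (ln (IZR m) + IZR e * ln 2).
Proof.
  revert m e. induction p as [|p IH]; intros m e Hm; cbn [log2_lower].
  - pose proof (Z.log2_spec m Hm) as [H _]. pose proof (ln_IZR_le (2 ^ Z.log2 m) m) as L.
    rewrite ln_2_pow in L by apply Z.log2_nonneg. rewrite plus_IZR. simpl.
    assert (0 < 2 ^ Z.log2 m)%Z by (apply Z.pow_pos_nonneg; [lia | apply Z.log2_nonneg]). specialize (L ltac:(lia)). lra.
  - destruct (log2_shift_nonneg m Hm) as [K1 K2]. set (k := Z.max _ _) in *. cbv zeta.
    rewrite Z.shiftr_div_pow2 by exact K1. assert (0 < 2 ^ k)%Z by lia.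
    set (a := (m * m / 2 ^ k)%Z). assert (Ha : (0 < a)%Z) by (apply Z.div_str_pos; lia).
    assert (La : (a * 2 ^ k <= m * m)%Z) by (rewrite Z.mul_comm; apply Z.mul_div_le; lia).
    eapply Rle_trans; [apply IH, Ha|]. simpl (2 ^ S p).
    pose proof (ln_IZR_le (a * 2 ^ k) (m * m) ltac:(nia)) as L. rewrite ln_scaled, ln_square in L by assumption.
    rewrite plus_IZR, mult_IZR.
    replace (2 * 2 ^ p * (ln (IZR m) + IZR e * ln 2)) with (2 ^ p * (2 * ln (IZR m) + 2 * (IZR e * ln 2))) by ring.
    apply Rmult_le_compat_l; [apply pow_le; lra|]. lra.
Qed.

(** The [+ 1] after the shift makes the cut mantissa an upper bound, and [k] in the exponent
    compensates the dropped bits. *)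
Lemma log2_upper_spec p m e : (0 < m)%Z ->
  2 ^ p * (ln (IZR m) + IZR e * ln 2) <= IZR (log2_upper p m e) * ln 2.
Proof.
  revert m e. induction p as [|p IH]; intros m e Hm; cbn [log2_upper].
  - pose proof (Z.log2_spec m Hm) as [_ H]. pose proof (ln_IZR_le m (2 ^ (Z.log2 m + 1))) as L.
    rewrite ln_2_pow in L by (pose proof (Z.log2_nonneg m); lia). rewrite 2!plus_IZR. rewrite plus_IZR in L. simpl.
    unfold Z.succ in H. specialize (L ltac:(lia)). lra.
  - destruct (log2_shift_nonneg m Hm) as [K1 K2]. set (k := Z.max _ _) in *. cbv zeta.
    rewrite Z.shiftr_div_pow2 by exact K1. assert (0 < 2 ^ k)%Z by lia.
    set (a := (m * m / 2 ^ k)%Z). assert (Ha : (0 < a)%Z) by (apply Z.div_str_pos; lia).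
    assert (La : (m * m <= (a + 1) * 2 ^ k)%Z) by (pose proof (Z.mul_succ_div_gt (m * m) (2 ^ k) ltac:(lia)); unfold a; nia).
    eapply Rle_trans; [|apply IH; lia]. simpl (2 ^ S p).
    pose proof (ln_IZR_le (m * m) ((a + 1) * 2 ^ k) ltac:(nia)) as L. rewrite ln_scaled, ln_square in L by (assumption || lia).
    rewrite (plus_IZR (2 * e)), mult_IZR.
    replace (2 * 2 ^ p * (ln (IZR m) + IZR e * ln 2)) with (2 ^ p * (2 * ln (IZR m) + 2 * (IZR e * ln 2))) by ring.
    apply Rmult_le_compat_l; [apply pow_le; lra|]. lra.
Qed.

(** Logarithms with positive weight are rounded up, the others down, over the common denominator
    [n (n + 1) (n + 2) (n + 3)]; 18 squarings scale them by [2^18] first. The entry [S (n + k)] is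
    [c (n + k)], since entry 0 belongs to the pole. *)
Definition third_difference_check (l : list Z) (n : nat) : bool :=
  let a := fun k => nth (S (n + k)) l 0%Z in
  let N := Z.of_nat n in
  ((0 <? a 0%nat) && (0 <? a 1%nat) && (0 <? a 2%nat) && (0 <? a 3%nat) &&
  (log2_upper 18 (a 3%nat) 0 * (N * (N + 1) * (N + 2)) - 3 * log2_lower 18 (a 2%nat) 0 * (N * (N + 1) * (N + 3))
   + 3 * log2_upper 18 (a 1%nat) 0 * (N * (N + 2) * (N + 3)) - log2_lower 18 (a 0%nat) 0 * ((N + 1) * (N + 2) * (N + 3)) <=? 0))%Z%bool.

(** The last index [n = 63] reads entry [S (63 + 3) = 67], hence the length 68. The [let] shares one
    computation of the list among all indices. *)
Lemma third_difference_checked :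
  (let l := qj_list 68 in forallb (third_difference_check l) (seq 1 63)) = true.
Proof. vm_compute. reflexivity. Qed.

Lemma third_difference_check_sound (a : nat -> Z) l n : (1 <= n)%nat ->
  (forall k, (k < 4)%nat -> nth (S (n + k)) l 0%Z = a (n + k)%nat) -> third_difference_check l n = true ->
  (forall k, (k < 4)%nat -> 0 < IZR (a (n + k)%nat)) /\
  ln (IZR (a (n + 3)%nat)) / INR (n + 3) - 3 * (ln (IZR (a (n + 2)%nat)) / INR (n + 2))
    + 3 * (ln (IZR (a (n + 1)%nat)) / INR (n + 1)) - ln (IZR (a n)) / INR n <= 0.
Proof.
  intros Hn E H. unfold third_difference_check in H. cbv zeta beta in H.
  rewrite !E, Nat.add_0_r in H by lia. rewrite !Bool.andb_true_iff in H.
  destruct H as [[[[P0 P1] P2] P3] H]. apply Z.ltb_lt in P0, P1, P2, P3. apply Z.leb_le, IZR_le in H.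
  split.
  { intros k Hk. apply IZR_lt. destruct k as [|[|[|[|k]]]]; [rewrite Nat.add_0_r| | | |lia]; assumption. }
  pose proof (log2_lower_spec 18 _ 0 P0) as L0. pose proof (log2_upper_spec 18 _ 0 P1) as U1.
  pose proof (log2_lower_spec 18 _ 0 P2) as L2. pose proof (log2_upper_spec 18 _ 0 P3) as U3.
  set (l0 := log2_lower 18 (a n) 0) in *. set (u1 := log2_upper 18 (a (n + 1)%nat) 0) in *.
  set (l2 := log2_lower 18 (a (n + 2)%nat) 0) in *. set (u3 := log2_upper 18 (a (n + 3)%nat) 0) in *.
  clearbody l0 u1 l2 u3.
  rewrite Rmult_0_l, Rplus_0_r in L0, U1, L2, U3.
  rewrite minus_IZR, plus_IZR, minus_IZR, !mult_IZR, !plus_IZR, <- INR_IZR_INZ in H.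
  rewrite !plus_INR. replace (INR 1) with 1 by reflexivity. replace (INR 2) with 2 by reflexivity. replace (INR 3) with 3 by (simpl; ring).
  assert (HN : 1 <= INR n) by (change 1 with (INR 1); apply le_INR, Hn). set (N := INR n) in *.
  set (x0 := ln (IZR (a n))) in *. set (x1 := ln (IZR (a (n + 1)%nat))) in *.
  set (x2 := ln (IZR (a (n + 2)%nat))) in *. set (x3 := ln (IZR (a (n + 3)%nat))) in *.
  set (w := 2 ^ 18) in *. assert (Hw : 0 < w) by (apply pow_lt; lra). clearbody w N x0 x1 x2 x3.
  assert (L : 0 < ln 2) by (pose proof (ln_increasing 1 2); rewrite ln_1 in *; lra).
  assert (D : 0 < N * (N + 1) * (N + 2) * (N + 3)) by (repeat apply Rmult_lt_0_compat; lra).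
  (* After multiplication by [2^18] and the common denominator, the four logarithms are replaced by
     their integer bounds times [ln 2], which factors out. *)
  apply (Rmult_le_reg_r (w * (N * (N + 1) * (N + 2) * (N + 3)))); [nra|]. rewrite Rmult_0_l.
  replace ((x3 / (N + 3) - 3 * (x2 / (N + 2)) + 3 * (x1 / (N + 1)) - x0 / N) * (w * (N * (N + 1) * (N + 2) * (N + 3))))
    with (w * x3 * (N * (N + 1) * (N + 2)) - 3 * (w * x2) * (N * (N + 1) * (N + 3))
      + 3 * (w * x1) * (N * (N + 2) * (N + 3)) - w * x0 * ((N + 1) * (N + 2) * (N + 3))) by (field; lra).
  assert (0 <= N * (N + 1) * (N + 2)) by (repeat apply Rmult_le_pos; lra).
  assert (0 <= N * (N + 1) * (N + 3)) by (repeat apply Rmult_le_pos; lra).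
  assert (0 <= N * (N + 2) * (N + 3)) by (repeat apply Rmult_le_pos; lra).
  assert (0 <= (N + 1) * (N + 2) * (N + 3)) by (repeat apply Rmult_le_pos; lra).
  apply (Rmult_le_compat_r (ln 2)) in H; [|lra]. rewrite Rmult_0_l in H.
  apply (Rmult_le_compat_r ((N + 1) * (N + 2) * (N + 3))) in L0; [|assumption].
  apply (Rmult_le_compat_r (N * (N + 2) * (N + 3))) in U1; [|assumption].
  apply (Rmult_le_compat_r (N * (N + 1) * (N + 3))) in L2; [|assumption].
  apply (Rmult_le_compat_r (N * (N + 1) * (N + 2))) in U3; [|assumption].
  lra.
Qed.

Lemma third_difference c (hc : j_fourier_coefficients c) n : (1 <= n)%nat ->
  (forall k, (k < 4)%nat -> 0 < IZR (c (n + k)%nat)) /\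
  ln (IZR (c (n + 3)%nat)) / INR (n + 3) - 3 * (ln (IZR (c (n + 2)%nat)) / INR (n + 2))
    + 3 * (ln (IZR (c (n + 1)%nat)) / INR (n + 1)) - ln (IZR (c n)) / INR n <= 0.
Proof.
  intros Hn. destruct (le_lt_dec 64 n) as [Hl|Hl]; [apply (third_difference_large c hc n Hl)|].
  apply (third_difference_check_sound c (qj_list 68) n Hn).
  - intros k Hk. symmetry. apply (coefficient_from_list c hc). lia.
  - apply (proj1 (forallb_forall _ _) third_difference_checked), in_seq. lia.
Qed.

(** The logarithm of the ratio at [n] is [f (n + 1) - f n], and its second difference is the third
    difference of [f]. *)
Lemma ratio_log_concave_exp (f : nat -> R) n0 :
  (forall n, (n0 <= n)%nat -> f (n + 3)%nat - 3 * f (n + 2)%nat + 3 * f (n + 1)%nat - f n <= 0) ->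
  ratio_log_concave n0 (fun n => exp (f n)).
Proof.
  intros H n Hn. specialize (H n Hn).
  replace (n + 2 + 1)%nat with (n + 3)%nat by lia. replace (n + 1 + 1)%nat with (n + 2)%nat by lia.
  unfold Rdiv. rewrite <- !exp_Ropp, <- !exp_plus, exp_pow_INR.
  apply Rle_minus, exp_le. simpl. lra.
Qed.

Theorem theorem3p5 (c : nat -> Z) (hc : j_fourier_coefficients c) :
  ratio_log_concave 1 (fun n : nat => nth_root n (IZR (c n))).
Proof.
  (* [Rpower] unfolds to this exponential, so the roots have the required form by conversion. *)
  apply (ratio_log_concave_exp (fun n => / INR n * ln (IZR (c n)))).
  intros n Hn. destruct (third_difference c hc n Hn) as [_ H]. unfold Rdiv in H. lra.
Qed.
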